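(* For each $j=1,\dots,M$, let $\omega_j$ and $\omega_j^*$ be truncated concentric cubes (concentric cubes intersected with $\Omega$) with side lengths $H_j$ and $H_j^*$, respectively, where $\delta_j^*:=H_j^*-H_j>0$, and let $\lambda_{j,1}\ge\lambda_{j,2}\ge\dots$ be the eigenvalues of the local generalized eigenvalue problem on $H_B(\omega_j^* )$. Then there are constants $C_j,c_j>0$ and $N_j\in\mathbb{N}$ such that $$\sqrt{\lambda_{j,N}}\le C_j\,e^{-c_jN^{1/d}}\qquad\text{for all } N>N_j.$$
   Context: Setting. Let $\Omega\subset\mathbb{R}^d$, $d\in\{2,3\}$, be a bounded domain with Lipschitz boundary $\partial\Omega = \overline{\Gamma_D}\cup\overline{\Gamma_O}$, $\Gamma_D\cap\Gamma_O=\emptyset$, with unit outer normal $\boldsymbol{\nu}$. Let $\mathbf{b}\in W^{1,\infty}(\Omega;\mathbb{R}^d)$ with $\Gamma_O\subseteq\{\mathbf{b}\cdot\boldsymbol{\nu}\ge 0\}$, and let $A\in L^\infty(\Omega;\mathbb{R}^{d\times d})$ be pointwise symmetric with $a_{\min}|\boldsymbol{\xi}|^2\le A(\mathbf{x})\boldsymbol{\xi}\cdot\boldsymbol{\xi}\le a_{\max}|\boldsymbol{\xi}|^2$ for all $\mathbf{x}\in\Omega$, $\boldsymbol{\xi}\in\mathbb{R}^d$, for some $a_{\min},a_{\max}>0$. Forms and spaces. For a subdomain $\omega\subseteq\Omega$ define $$B_\omega(u,v) := \int_\omega A\nabla u\cdot\nabla v\,d\mathbf{x} - \int_\omega u\,\mathbf{b}\cdot\nabla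 v\,d\mathbf{x} + \int_{\Gamma_O\cap\partial\omega} uv\,\mathbf{b}\cdot\boldsymbol{\nu}\,ds,\qquad a_\omega(u,v) := \int_\omega A\nabla u\cdot\nabla v\,d\mathbf{x},$$ $$H^1_D(\omega) := \{v\in H^1(\omega): v=0\text{ on }\Gamma_D\cap\partial\omega\},$$ $$H^1_{D,0}(\omega) := \{v\in H^1(\omega): v=0 \text{ on } (\partial\omega\cap\Gamma_D)\cup(\partial\omega\cap\Omega)\},$$ $$H_B(\omega) := \{u\in H^1_D(\omega): B_\omega(u,v)=0\ \ \forall v\in H^1_{D,0}(\omega)\}.$$ It is assumed throughout that the global problem (find $u\in H^1_D(\Omega)$ with $B_\Omega(u,v)=F(v)$ for all $v\in H^1_D(\Omega)$) and all occurring subdomain problems (the analogous problems for $B_{\omega_j^*}$ on $H^1_{D,0}(\omega_j^* )$) are well-posed. Decomposition. $\{\omega_j\}_{j=1}^M$ are overlapping subdomains with $\bigcup_j\omega_j=\Omega$, and $\{\omega_j^*\}_{j=1}^M$ are oversampling domains with $\omega_j\subset\omega_j^*\subset\Omega$. $\{\chi_j\}_{j=1}^M$ is a partition of unity with $\operatorname{supp}\chi_j\subseteq\overline{\omega_j}$, $0\le\chi_j\le1$, $\sum_j\chi_j=1$, $\chi_j\in W^{1,\infty}(\Omega)$, $|\nabla\chi_j|\le C_\chi/\operatorname{diam}(\omega_j)$ for some $C_\chi>0$. Local eigenproblem. Find $\lambda\in[0,+\infty]$, $\varphi\in H_B(\omega_j^* )$ such that $$a_{\omega_j^*}(\chi_j\varphi,\chi_j\psi)=\lambda\,a_{\omega_j^*}(\varphi,\psi)\quad\text{for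 all }\psi\in H_B(\omega_j^* ),$$ where $\lambda=+\infty$ corresponds to the existence of $\varphi\in H_B(\omega_j^* )$ with $a_{\omega_j^*}(\varphi,\psi)=0$ for all $\psi\in H_B(\omega_j^* )$ but $a_{\omega_j}(\chi_j\varphi,\chi_j\widehat\psi)\ne0$ for some $\widehat\psi\in H_B(\omega_j^* )$. The eigenpairs are denoted $(\lambda_{j,k},\varphi_{j,k})$, numbered so that $\lambda_{j,1}\ge\lambda_{j,2}\ge\dots$. *)

(* Defs.v *)
From HB Require Import structures.
From mathcomp Require Import all_boot all_order all_algebra.
From mathcomp Require Import all_classical all_reals all_analysis.

Set Implicit Arguments.
Unset Strict Implicit.
Unset Printing Implicit Defensive.

Import Order.TTheory GRing.Theory Num.Theory.
Import numFieldNormedType.Exports.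

Local Open Scope classical_set_scope.
Local Open Scope ring_scope.

(* The library norm on ['rV[R]_d] is the sup norm.  It induces the right
   topology, but metric notions below use [enorm]. *)

Section Euclidean.
Context {R : realType} {d : nat}.
Implicit Types (x y : 'rV[R]_d) (A : set 'rV[R]_d).

Definition dot x y : R := \sum_(i < d) x 0 i * y 0 i.
Definition enorm x : R := Num.sqrt (dot x x).
Definition eball x (r : R) : set 'rV[R]_d := [set y | enorm (y - x) < r].
Definition ediam A : \bar R :=
  ereal_sup ([set 0%E] `|` [set (enorm (x - y))%:E | x in A & y in A]).
Definition bnd A : set 'rV[R]_d := closure A `\` interior A.

(* [xi |-> M xi] for row vectors *)
Definition app (M : 'M[R]_d) x : 'rV[R]_d := x *m M^T.

End Euclidean.

(* The Lebesgue and surface measures below are Caratheodory measures of outer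
   measures given by countable covers.  [mu_ext] is used over the semiring of
   all subsets; the weight [+oo] excludes a set from the admissible covers. *)

Section Cover.
Context {R : realType} (T : pointedType).

Definition all_subsets := g_sigma_algebraType [set: set T].

Definition cover_outer (w : set T -> \bar R) (X : set T) : \bar R :=
  @mu_ext _ all_subsets R w X.

End Cover.

Section Lebesgue.
Context (R : realType) (d : nat).
Local Open Scope ereal_scope.

Definition box (a b : 'rV[R]_d) : set 'rV[R]_d :=
  [set x | forall i, (a 0 i < x 0 i < b 0 i)%R].

Definition box_vol (A : set 'rV[R]_d) : \bar R :=
  ereal_inf [set v | (A = set0 /\ v = 0) \/
    exists a b : 'rV[R]_d, [/\ forall i, (a 0 i < b 0 i)%R, A = box a b &
      v = (\prod_(i < d) (b 0 i - a 0 i))%R%:E]].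

Definition leb_outer : set 'rV[R]_d -> \bar R := cover_outer box_vol.

Lemma box_vol_ge0 A : 0 <= box_vol A.
Proof.
apply: le_ereal_inf_tmp => _ [[_ ->]//|[a [b [ab _ ->]]]].
by rewrite lee_fin; apply: prodr_ge0 => i _; rewrite subr_ge0 ltW.
Qed.

Lemma box_vol0 : box_vol set0 = 0.
Proof.
apply/eqP; rewrite eq_le box_vol_ge0 andbT.
by apply: ereal_inf_lbound; left.
Qed.

HB.instance Definition _ := isOuterMeasure.Build R 'rV[R]_d leb_outer
  (@mu_ext0 _ (all_subsets 'rV[R]_d) R _ box_vol0 box_vol_ge0)
  (@mu_ext_ge0 _ (all_subsets 'rV[R]_d) R _ box_vol_ge0)
  (@le_mu_ext _ (all_subsets 'rV[R]_d) R _)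
  (@mu_ext_sigma_subadditive _ (all_subsets 'rV[R]_d) R _ box_vol_ge0).

Definition leb_space := caratheodory_type leb_outer.
HB.instance Definition _ := Measurable.on leb_space.
Definition leb : set leb_space -> \bar R := leb_outer.
HB.instance Definition _ := isMeasure.Build _ _ _ leb
  (@caratheodory_measure0 _ _ leb_outer) (@caratheodory_measure_ge0 _ _ leb_outer)
  (@caratheodory_measure_sigma_additive _ _ leb_outer).

End Lebesgue.

Section Hausdorff.
Context (R : realType) (d : nat) (s : nat).
Local Open Scope ereal_scope.

(* |B(0,1)| / 2^s for the unit ball of R^s: the normalization for which the
   s-dimensional Hausdorff measure is the surface measure of s-dimensional
   Lipschitz surfaces *)
Definition hcst : \bar R := leb_outer (@eball R s 0 1) * (2 ^- s)%R%:E.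

Definition hweight (delta : R) (A : set 'rV[R]_d) : \bar R :=
  if A == set0 then 0
  else if ediam A <= delta%:E then hcst * ediam A ^+ s else +oo.

Definition hausdorff_outer (X : set 'rV[R]_d) : \bar R :=
  ereal_sup [set cover_outer (hweight delta) X | delta in [set r : R | (0 < r)%R]].

Lemma hcst_ge0 : 0 <= hcst.
Proof. by rewrite mule_ge0// ?outer_measure_ge0// lee_fin invr_ge0 exprn_ge0. Qed.

Lemma hweight_ge0 delta A : 0 <= hweight delta A.
Proof.
rewrite /hweight; case: ifP => // _; case: ifP => _; last exact: leey.
by rewrite mule_ge0 ?hcst_ge0// expe_ge0// ereal_sup_ubound//; left.
Qed.

Lemma hweight0 delta : hweight delta set0 = 0.
Proof. by rewrite /hweight eqxx. Qed.

Let H delta := @cover_outer R 'rV[R]_d (hweight delta).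

Let H_ge0 delta X : 0 <= H delta X.
Proof. exact: (@mu_ext_ge0 _ (all_subsets _) R _ (hweight_ge0 delta)). Qed.

Lemma hausdorff_outer0 : hausdorff_outer set0 = 0.
Proof.
have H0 delta : H delta set0 = 0.
  exact: (@mu_ext0 _ (all_subsets _) R _ (hweight0 delta) (hweight_ge0 delta)).
apply/eqP; rewrite eq_le; apply/andP; split.
  by apply: ge_ereal_sup => _ [delta _ <-]; rewrite -/(H delta) H0.
by apply: ereal_sup_ubound; exists 1%R => //=; exact: H0.
Qed.

Lemma hausdorff_outer_ge0 X : 0 <= hausdorff_outer X.
Proof.
apply: (le_trans (H_ge0 1%R X)).
by apply: ereal_sup_ubound; exists 1%R => //=.
Qed.

Lemma le_hausdorff_outer :
  {homo hausdorff_outer : A B / A `<=` B >-> A <= B}.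
Proof.
move=> A B AB; apply: ge_ereal_sup => _ [delta d0 <-].
apply: (@le_trans _ _ (H delta B)).
  exact: (@le_mu_ext _ (all_subsets _) R _ A B AB).
by apply: ereal_sup_ubound; exists delta.
Qed.

Lemma hausdorff_outer_sigma_subadditive : sigma_subadditive hausdorff_outer.
Proof.
move=> F; apply: ge_ereal_sup => _ [delta d0 <-].
apply: (le_trans (@mu_ext_sigma_subadditive _ (all_subsets _) R _
  (hweight_ge0 delta) F)).
apply: lee_nneseries => [i _ _|i _]; first exact: H_ge0.
by apply: ereal_sup_ubound; exists delta.
Qed.

HB.instance Definition _ := isOuterMeasure.Build R 'rV[R]_d hausdorff_outer
  hausdorff_outer0 hausdorff_outer_ge0 le_hausdorff_outer
  hausdorff_outer_sigma_subadditive.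

Definition hausdorff_space := caratheodory_type hausdorff_outer.
HB.instance Definition _ := Measurable.on hausdorff_space.
Definition hausdorff : set hausdorff_space -> \bar R := hausdorff_outer.
HB.instance Definition _ := isMeasure.Build _ _ _ hausdorff
  (@caratheodory_measure0 _ _ hausdorff_outer) (@caratheodory_measure_ge0 _ _ hausdorff_outer)
  (@caratheodory_measure_sigma_additive _ _ hausdorff_outer).

End Hausdorff.

Arguments leb R d : clear implicits.
Arguments hausdorff R d s : clear implicits.

Section Domains.
Context {R : realType} {d : nat}.
Implicit Types (x y e : 'rV[R]_d) (Omega : set 'rV[R]_d).

Definition lipschitz_on_space (f : 'rV[R]_d -> R) : Prop :=
  exists L : R, forall x y, `|f x - f y| <= L * enorm (x - y).

(* Near each boundary point, Omega is the strict epigraph, in the direction of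
   the unit vector [e], of a Lipschitz function of the component orthogonal
   to [e]. *)
Definition lipschitz_boundary Omega : Prop :=
  forall x0, bnd Omega x0 ->
  exists (r : R) (e : 'rV[R]_d) (gamma : 'rV[R]_d -> R),
    [/\ 0 < r, enorm e = 1, lipschitz_on_space gamma,
        forall y t, gamma (y + t *: e) = gamma y
      & forall y, eball x0 r y -> (Omega y <-> gamma y < dot y e)].

Definition bounded_lipschitz_domain Omega : Prop :=
  [/\ open Omega, connected Omega, Omega !=set0, bounded_set Omega
    & lipschitz_boundary Omega].

(* Near [x], Omega contains every cone around [- nu], and its complement every
   cone around [nu], of half-angle less than a right angle.  For a Lipschitz
   graph this is differentiability of the graph, so the normal exists at
   almost every boundary point. *)
Definition is_outer_normal Omega x (nu : 'rV[R]_d) : Prop :=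
  enorm nu = 1 /\
  forall eps : R, 0 < eps -> \forall y \near x,
    (eps * enorm (y - x) < dot (y - x) nu -> ~ Omega y) /\
    (dot (y - x) nu < - (eps * enorm (y - x)) -> Omega y).

Definition outer_normal Omega x : 'rV[R]_d :=
  xget 0 [set nu | is_outer_normal Omega x nu].

(* open cube with centre [c], side length [h] and edges along the columns of
   the orthogonal matrix [Q] *)
Definition cube (Q : 'M[R]_d) c (h : R) : set 'rV[R]_d :=
  [set x | forall i, `|((x - c) *m Q) 0 i| < h / 2].

End Domains.

Section Sobolev.
Context {R : realType} {d : nat}.
Implicit Types (w S : set 'rV[R]_d) (u v : 'rV[R]_d -> R)
  (g : 'rV[R]_d -> 'rV[R]_d).
Let mu := leb R d.
Let space := leb_space R d.

Definition L2 w u : Prop :=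
  measurable_fun (w : set space) (u : space -> R) /\
  (\int[mu]_(x in w) (u x ^+ 2)%:E < +oo)%E.

Definition Loo w u : Prop :=
  measurable_fun (w : set space) (u : space -> R) /\
  exists M : R, \forall x \ae mu, w x -> `|u x| <= M.

Definition L1loc w u : Prop :=
  forall K : set 'rV[R]_d, compact K -> K `<=` w ->
    mu.-integrable (K : set space) (fun x : space => (u x)%:E).

Definition partial (i : 'I_d) u : 'rV[R]_d -> R :=
  fun x => 'D_(delta_mx 0 i : 'rV[R]_d) u x.

Definition smooth u : Prop :=
  forall (s : seq 'I_d) x, differentiable (foldr partial u s) x.

Definition test_function w (eta : 'rV[R]_d -> R) : Prop :=
  smooth eta /\ exists K : set 'rV[R]_d,
    [/\ compact K, K `<=` w & forall x, ~ K x -> eta x = 0].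

Definition is_weak_grad w u g : Prop :=
  forall i, L1loc w (fun x => g x 0 i) /\
    forall eta, test_function w eta ->
      \int[mu]_(x in w) (u x * partial i eta x) =
      - \int[mu]_(x in w) (g x 0 i * eta x).

(* determined up to a null set of [w] *)
Definition grad w u : 'rV[R]_d -> 'rV[R]_d :=
  xget (fun=> 0) [set g | is_weak_grad w u g].

Definition H1 w u : Prop :=
  L2 w u /\ exists g, is_weak_grad w u g /\ forall i, L2 w (fun x => g x 0 i).

Definition W1oo w u : Prop :=
  Loo w u /\ exists g, is_weak_grad w u g /\ forall i, Loo w (fun x => g x 0 i).

Definition H1norm w u : R :=
  Num.sqrt (\int[mu]_(x in w) (u x ^+ 2) +
            \int[mu]_(x in w) dot (grad w u x) (grad w u x)).

(* Mean value of [u] over the part of [w] at distance less than [r] from [x].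
   On a Lipschitz part of the boundary of [w] the limit of these mean values
   as [r] tends to 0 exists H^(d-1)-almost everywhere for [u] in H^1(w), and
   is the trace of [u]; in this form the trace makes sense on parts of the
   boundary, and is continuous extension for Lipschitz [u]. *)
Definition mean w u (x : 'rV[R]_d) (r : R) : R :=
  (\int[mu]_(y in eball x r `&` w) u y) / fine (mu (eball x r `&` w)).

Definition trace w u (x : 'rV[R]_d) : R := lim (mean w u x @ 0^'+).

(* [u = 0] on [S] in the sense of traces taken from [w] *)
Definition vanishes_on w S u : Prop :=
  \forall x \ae hausdorff R d d.-1, S x -> mean w u x @ 0^'+ --> (0 : R).

End Sobolev.

Record pde_data (R : realType) (d : nat) := PdeData {
  Omega : set 'rV[R]_d;
  GammaD : set 'rV[R]_d;
  GammaO : set 'rV[R]_d;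
  bvec : 'rV[R]_d -> 'rV[R]_d;
  Amat : 'rV[R]_d -> 'M[R]_d }.

Section Forms.
Context {R : realType} {d : nat} (P : pde_data R d).
Implicit Types (w : set 'rV[R]_d) (u v : 'rV[R]_d -> R).
Let mu := leb R d.

Definition b_dot_nu (x : 'rV[R]_d) : R :=
  dot (\row_i trace (Omega P) (fun y => bvec P y 0 i) x)
      (outer_normal (Omega P) x).

(* The boundary part is Hausdorff-measurable in order that boundary integrals
   over it make sense. *)
Definition admissible_data (amin amax : R) : Prop :=
  [/\ bounded_lipschitz_domain (Omega P),
      [/\ bnd (Omega P) = closure (GammaD P) `|` closure (GammaO P),
          GammaD P `&` GammaO P = set0,
          measurable (GammaD P : set (hausdorff_space R d d.-1))
        & measurable (GammaO P : set (hausdorff_space R d d.-1))],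
      (forall i, W1oo (Omega P) (fun x => bvec P x 0 i)) /\
        (\forall x \ae hausdorff R d d.-1, GammaO P x -> 0 <= b_dot_nu x)
    & [/\ 0 < amin, 0 < amax,
          forall i j, Loo (Omega P) (fun x => Amat P x i j),
          forall x, Omega P x -> (Amat P x)^T = Amat P x
        & forall x xi, Omega P x ->
            amin * enorm xi ^+ 2 <= dot (app (Amat P x) xi) xi
              <= amax * enorm xi ^+ 2]].

Definition a_form w u v : R :=
  \int[mu]_(x in w) dot (app (Amat P x) (grad w u x)) (grad w v x).

Definition B_form w u v : R :=
  a_form w u v
  - \int[mu]_(x in w) (u x * dot (bvec P x) (grad w v x))
  + \int[hausdorff R d d.-1]_(x in GammaO P `&` bnd w)
      (trace w u x * trace w v x * b_dot_nu x).

Definition H1D w v : Prop := H1 w v /\ vanishes_on w (GammaD P `&` bnd w) v.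

Definition H1D0 w v : Prop :=
  H1 w v /\
  vanishes_on w ((bnd w `&` GammaD P) `|` (bnd w `&` Omega P)) v.

Definition HB w u : Prop :=
  H1D w u /\ forall v, H1D0 w v -> B_form w u v = 0.

(* Hadamard well-posedness of: find [u] in [V] with [B_w(u,v) = F(v)] for all
   [v] in [V], for the bounded linear functionals [F] on [V] *)
Definition well_posed w (V : set ('rV[R]_d -> R)) : Prop :=
  exists C : R, forall (F : ('rV[R]_d -> R) -> R) (K : R),
    (forall (c : R) v1 v2, V v1 -> V v2 ->
       F (fun x => c * v1 x + v2 x) = c * F v1 + F v2) ->
    0 <= K -> (forall v, V v -> `|F v| <= K * H1norm w v) ->
    exists u, [/\ V u, forall v, V v -> B_form w u v = F v,
      H1norm w u <= C * K
    & forall u', V u' -> (forall v, V v -> B_form w u' v = F v) ->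
        \forall x \ae mu, w x -> u' x = u x].

End Forms.

Section Eigenproblem.
Context {R : realType} {d : nat} (P : pde_data R d).
Variables (w ws : set 'rV[R]_d) (chi : 'rV[R]_d -> R).
Implicit Types (phi psi : 'rV[R]_d -> R).

Let cut phi : 'rV[R]_d -> R := fun x => chi x * phi x.

Definition eigenpair (lambda : \bar R) phi : Prop :=
  HB P ws phi /\
  match lambda with
  | r%:E => 0 <= r /\ forall psi, HB P ws psi ->
      a_form P ws (cut phi) (cut psi) = r * a_form P ws phi psi
  | +oo%E => (forall psi, HB P ws psi -> a_form P ws phi psi = 0) /\
      exists2 psi, HB P ws psi & a_form P w (cut phi) (cut psi) <> 0
  | -oo%E => False
  end.

(* Both forms vanish at [phi], so that the eigenvalue equation holds for every
   [lambda]: such [phi] count as zero. *)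
Definition degenerate phi : Prop :=
  forall psi, HB P ws psi ->
    a_form P ws phi psi = 0 /\ a_form P ws (cut phi) (cut psi) = 0.

(* [(lam k, phi k)], k = 1, 2, ..., is a finite ([I] is an initial segment) or
   infinite numbering of eigenpairs in nonincreasing order of the eigenvalues,
   counted with multiplicity: an eigenvalue is repeated once per linearly
   independent eigenfunction.  A numbering need not exhaust all eigenpairs;
   omitting some of them only lowers the N-th eigenvalue. *)
Definition eigen_numbering (I : set nat) (lam : nat -> \bar R)
    (phi : nat -> 'rV[R]_d -> R) : Prop :=
  [/\ forall k, I k -> (0 < k)%N /\ forall m, (0 < m <= k)%N -> I m,
      forall k, I k -> eigenpair (lam k) (phi k),
      forall k m, I k -> I m -> (k <= m)%N -> (lam m <= lam k)%E
    & forall (N : nat) (c : nat -> R), I N ->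
        degenerate (fun x => \sum_(1 <= k < N.+1) c k * phi k x) ->
        forall k, (1 <= k <= N)%N -> c k = 0].

End Eigenproblem.

Section Decomposition.
Context {R : realType} {d : nat} (Om : set 'rV[R]_d) {M : nat}.

Definition decomposition (w ws : 'I_M -> set 'rV[R]_d) : Prop :=
  \bigcup_j w j = Om /\ forall j, w j `<=` ws j /\ ws j `<=` Om.

Definition partition_of_unity (w : 'I_M -> set 'rV[R]_d)
    (chi : 'I_M -> 'rV[R]_d -> R) (Cchi : R) : Prop :=
  0 < Cchi /\
  (forall x, Om x -> \sum_(j < M) chi j x = 1) /\
  forall j,
    [/\ closure [set x | Om x /\ chi j x != 0] `<=` closure (w j),
        forall x, Om x -> 0 <= chi j x <= 1,
        W1oo Om (chi j)
      & \forall x \ae leb R d, Om x ->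
          enorm (grad Om (chi j) x) <= Cchi / fine (ediam (w j))].

Definition truncated_concentric_cubes (w ws : set 'rV[R]_d) (h hs : R) : Prop :=
  exists (Q : 'M[R]_d) (c : 'rV[R]_d),
    [/\ Q *m Q^T = 1%:M, w = cube Q c h `&` Om & ws = cube Q c hs `&` Om].

End Decomposition.

(* Main.v *)
(* A function in the kernel of the form B on a truncated cube is controlled on a smaller one by
   two estimates. Caccioppoli: testing the equation with eta^2 phi bounds the energy on a cube
   by C / tau^2 times the L2 norm on a cube larger by tau; the boundary term on the outflow part
   has a good sign. Poincare: if the mean values of phi over a grid of balls of size rho vanish,
   the L2 norm is at most C rho^2 times the energy on a slightly larger cube. The balls are moved
   into Omega along the cones given by the Lipschitz boundary, and the grid does not depend on
   the cube. With rho a small multiple of tau, each of m + 1 layers of width tau between the two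
   cubes gains a factor e^-2 in the energy, at the cost of about (C (m + 1))^d linear
   functionals altogether. If N exceeds this number, a nontrivial combination phi of the first
   N eigenfunctions annihilates the functionals, and
     lambda_N a(phi, phi) <= a(chi phi, chi phi) <= C e^(-2m) a(phi, phi).

   The boundary term needs traces defined by limits of mean values: cutting off commutes with
   taking such traces outside an H^(d-1)-null set, the traces are square integrable on compact
   pieces of the boundary (by a Poincare estimate in a collar), and the normal component of b,
   which need not be measurable, is replaced by its largest measurable minorant. *)

From HB Require Import structures.
Require Import Defs.
From mathcomp Require Import all_boot all_order all_algebra.
From mathcomp Require Import all_classical all_reals all_analysis.
From mathcomp Require Import measurable_realfun.
From mathcomp Require Import ring lra zify.

Set Implicit Arguments.
Unset Strict Implicit.
Unset Printing Implicit Defensive.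

Import Order.TTheory GRing.Theory Num.Theory.
Import numFieldNormedType.Exports.

Local Open Scope classical_set_scope.
Local Open Scope ring_scope.

(** * Lebesgue measure *)

(** Sobolev functions are never approximated by smooth ones in $H^1$: a weak gradient is accessible
    only through its pairings with test functions. The substitute is a translation estimate. Moving
    the shift onto the test function makes $t \mapsto \int u(x+tz)\,\psi(x)\,dx$ differentiable, and
    a duality bound then controls $u(\cdot+z)-u$ in $L^2$ by $z\cdot\nabla u$. This one estimate
    gives the product rule, the Poincare inequality (boxes are bisected, so the constant is
    explicit) and the bounds in a boundary collar. With a nonmeasurable weight, boundary integrals
    are not visibly additive, and [HB] is not visibly a linear space. Hence the energy estimates are
    stated for finite combinations of members of [HB], expanded into double sums. Eigenfunctions may
    be far from orthogonal and eigenvalues may be infinite. What enters is the ordering, the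
    eigenvalue equations tested with the eigenfunctions themselves, and that no nontrivial
    combination of the first $N$ functions is degenerate. *)

Section BorelRow.
Context {R : realType} {d : nat}.
Variable nu : {outer_measure set 'rV[R]_d -> \bar R}.
Hypothesis halfspace : forall i c,
  nu.-cara.-measurable [set x : 'rV[R]_d | x 0 i < c].

Let halfspace_gt i c : nu.-cara.-measurable [set x : 'rV[R]_d | c < x 0 i].
Proof.
rewrite (_ : [set _ | _] = \bigcup_(n : nat) ~` [set x : 'rV[R]_d | x 0 i < c + n.+1%:R^-1]).
  by apply: bigcup_measurable => n _; apply: measurableC; exact: halfspace.
apply/seteqP; split=> x /=.
  move=> cx; have xc : 0 < x 0 i - c by rewrite subr_gt0.
  have [n Hn] : exists n : nat, n.+1%:R^-1 < x 0 i - c.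
    by exists (Num.truncn (x 0 i - c)^-1); rewrite invf_plt ?posrE// truncnS_gt.
  by exists n => //=; apply/negP; rewrite -leNgt -lerBrDl ltW.
move=> [n _ /= /negP]; rewrite -leNgt; apply: lt_le_trans.
by rewrite ltrDl invr_gt0.
Qed.

Lemma box_cara_measurable (a b : 'rV[R]_d) : nu.-cara.-measurable (box a b).
Proof.
rewrite (_ : box a b = \big[setI/setT]_(i < d)
   ([set x : 'rV[R]_d | a 0 i < x 0 i] `&` [set x : 'rV[R]_d | x 0 i < b 0 i])).
  apply: bigsetI_measurable => i _.
  by apply: measurableI; [exact: halfspace_gt|exact: halfspace].
apply/seteqP; split => x H.
- elim/big_ind: _ => // i _; split=> /=; by have /andP[] := H i.
- move=> i; move: H; rewrite (bigD1 i)//= => -[[/= a1 a2] _].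
  by rewrite a1 a2.
Qed.

(** An open set is the countable union of the rational boxes inside it. Half-spaces are the only
    input, so the Lebesgue and the Hausdorff outer measures are served at once. *)
Lemma open_cara_measurable (U : set 'rV[R]_d) : open U -> nu.-cara.-measurable U.
Proof.
move=> oU.
pose q2r (a : 'rV[rat]_d) : 'rV[R]_d := \row_i ratr (a 0 i).
pose F (ab : 'rV[rat]_d * 'rV[rat]_d) := [set x | box (q2r ab.1) (q2r ab.2) x /\
  box (q2r ab.1) (q2r ab.2) `<=` U].
rewrite (_ : U = \bigcup_ab F ab).
  apply: countable_bigcupT_measurable; first exact: countableP.
  move=> ab; have [sU|nsU] := pselect (box (q2r ab.1) (q2r ab.2) `<=` U).
    rewrite (_ : F ab = box (q2r ab.1) (q2r ab.2)); first exact: box_cara_measurable.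
    by apply/seteqP; split=> [x []//|x bx]; split.
  rewrite (_ : F ab = set0); first exact: measurable0.
  by apply/seteqP; split=> [x []//|//].
apply/seteqP; split=> [x Ux|x [ab _ [/[swap] /[apply]]]//].
move: oU; rewrite openE => /(_ x Ux); rewrite /interior /= nbhs_ballP => -[e /= e0 be].
have Q (i : 'I_d) : exists ab : rat * rat,
    x 0 i - e < ratr ab.1 < x 0 i /\ x 0 i < ratr ab.2 < x 0 i + e.
  have [a /andP[a1 a2]] : exists a : rat, x 0 i - e < ratr a < x 0 i.
    have /rat_in_itvoo[q] : x 0 i - e < x 0 i by rewrite ltrBlDr ltrDl.
    by rewrite in_itv /= => ?; exists q.
  have [b /andP[b1 b2]] : exists a : rat, x 0 i < ratr a < x 0 i + e.
    have /rat_in_itvoo[q] : x 0 i < x 0 i + e by rewrite ltrDl.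
    by rewrite in_itv /= => ?; exists q.
  by exists (a, b); rewrite a1 a2 b1 b2.
have {Q}[f Hf] := choice Q.
exists (\row_i (f i).1, \row_i (f i).2) => //; split => /=.
  by move=> i; rewrite !mxE; have [/andP[_ ->] /andP[->]] := Hf i.
move=> y By; apply: be; rewrite -ball_normE /= [ltLHS]/Num.norm /= mx_normrE.
apply/bigmax_ltP; split=> // -[i0 i] _ /=; rewrite !mxE ord1.
have := By i; rewrite !mxE => /andP[y1 y2].
have [/andP[a1 a2] /andP[b1 b2]] := Hf i.
by rewrite ltr_norml; apply/andP; split; lra.
Qed.

Lemma continuous_cara_measurable (f : 'rV[R]_d -> R) : continuous f ->
  measurable_fun [set: caratheodory_type nu] (f : caratheodory_type nu -> R).
Proof.
move=> cf; apply: (measurability _ (RGenOpens.measurableE R)) => _ [_ [a [b ->]] <-].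
rewrite setTI; apply: open_cara_measurable; apply: open_comp => // x _; exact: cf.
Qed.

End BorelRow.

(** * Lebesgue outer measure of half-spaces and affine images *)

Section LebesgueOuter.
Context {R : realType} {d : nat}.
Implicit Types (a b x : 'rV[R]_d) (X A : set 'rV[R]_d).
Local Open Scope ereal_scope.

Lemma leb_outer_le (F : nat -> set 'rV[R]_d) X : X `<=` \bigcup_k F k ->
  leb_outer X <= \sum_(k <oo) box_vol (F k).
Proof. by move=> XF; apply: ereal_inf_lbound; exists F => //; split=> // k; exact: sub_sigma_algebra. Qed.

Lemma leb_outer_ge c X :
  (forall F : nat -> set 'rV[R]_d, X `<=` \bigcup_k F k -> c <= \sum_(k <oo) box_vol (F k)) ->
  c <= leb_outer X.
Proof. by move=> H; apply: le_ereal_inf_tmp => _ [F [_ XF] <-]; exact: H. Qed.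

Definition vol a b : R := (\prod_(i < d) (b 0 i - a 0 i))%R.

Lemma leb_box_le a b X : (forall i, (a 0 i < b 0 i)%R) -> X `<=` box a b ->
  leb_outer X <= (vol a b)%:E.
Proof.
move=> ab XB.
apply: (@le_trans _ _ (\sum_(k <oo) box_vol (if k == 0%N then box a b else set0))).
  by apply: leb_outer_le => x /XB Bx; exists 0%N.
rewrite (@nneseries_recl R xpredT _ (fun k _ => box_vol_ge0 _) isT).
rewrite eseries0 ?adde0; last by move=> [|k]//= _ _; exact: box_vol0.
by apply: ereal_inf_lbound; right; exists a, b; split.
Qed.

Lemma leb_halfspace (i : 'I_d) (c : R) :
  (@leb_outer R d).-cara.-measurable [set x : 'rV[R]_d | (x 0 i < c)%R].
Proof.
apply: le_caratheodory_measurable => X; apply: leb_outer_ge => F XF.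
set A := [set x | _].
have one B : leb_outer (B `&` A) + leb_outer (B `&` ~` A) <= box_vol B.
  apply: le_ereal_inf_tmp => _ [[-> ->]|[a [b [ab -> ->]]]].
    by rewrite !set0I !outer_measure0 adde0.
  have [ca|ac] := leP c (a 0%R i).
    rewrite (_ : box a b `&` A = set0) ?outer_measure0 ?add0e.
      by apply: leb_box_le => // x [].
    apply/seteqP; split=> // x [/(_ i) /andP[ax _] /=] xc.
    by have := lt_trans xc (le_lt_trans ca ax); rewrite ltxx.
  have [bc|cb] := leP (b 0%R i) c.
    rewrite (_ : box a b `&` ~` A = set0) ?outer_measure0 ?adde0.
      by apply: leb_box_le => // x [].
    apply/seteqP; split=> // x [/(_ i) /andP[_ xb] /=] /negP; rewrite -leNgt => cx.
    by have := lt_le_trans xb (le_trans bc cx); rewrite ltxx.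
  pose p := (\prod_(j < d | j != i) (b 0 j - a 0 j))%R.
  have p0 : (0 <= p)%R by apply: prodr_ge0 => j _; rewrite subr_ge0 ltW.
  apply/lee_addgt0Pr => e e0.
  (* Covers consist of open boxes, while the upper piece contains its face on the hyperplane: its
     box starts at [c - t], at an extra volume [t * p <= e]. *)
  pose t := (Num.min (c - a 0 i) (e / (p + 1)))%R.
  have t0 : (0 < t)%R by rewrite lt_min subr_gt0 ac divr_gt0// ltr_wpDl.
  pose b' := (\row_j if j == i then c else b 0 j)%R : 'rV[R]_d.
  pose a' := (\row_j if j == i then c - t else a 0 j)%R : 'rV[R]_d.
  have v1 : vol a b' = ((c - a 0 i) * p)%R.
    rewrite /vol (bigD1 i)//= !mxE eqxx; congr (_ * _)%R; apply: eq_bigr => j /negbTE ji.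
    by rewrite !mxE ji.
  have v2 : vol a' b = ((b 0 i - (c - t)) * p)%R.
    rewrite /vol (bigD1 i)//= !mxE eqxx; congr (_ * _)%R; apply: eq_bigr => j /negbTE ji.
    by rewrite !mxE ji.
  have v3 : vol a b = ((b 0 i - a 0 i) * p)%R by rewrite /vol (bigD1 i).
  have h1 : leb_outer (box a b `&` A) <= (vol a b')%:E.
    apply: leb_box_le => [j|x [Bx /= xc] j].
      by rewrite mxE; case: eqP => [->//|_].
    by rewrite mxE; case: eqP => [->|_]; [rewrite xc; have /andP[->] := Bx i|].
  have h2 : leb_outer (box a b `&` ~` A) <= (vol a' b)%:E.
    apply: leb_box_le => [j|x [Bx /= /negP]].
      rewrite mxE; case: eqP => [->|_//]; apply: lt_trans cb.
      by rewrite ltrBlDr ltrDl.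
    rewrite -leNgt => cx j; rewrite mxE; case: eqP => [->|_//].
    have /andP[_ ->] := Bx i; rewrite andbT (lt_le_trans _ cx)//.
    by rewrite ltrBlDr ltrDl.
  apply: (le_trans (leeD h1 h2)); rewrite -/(vol a b) v1 v2 v3 -!EFinD lee_fin.
  have tp : (t * p <= e)%R.
    have : (t <= e / (p + 1))%R by rewrite ge_min lexx orbT.
    rewrite ler_pdivlMr ?ltr_wpDl// mulrDr mulr1 => h.
    by apply: le_trans h; rewrite lerDl ltW.
  by lra.
apply: (@le_trans _ _ (\sum_(k <oo) (leb_outer (F k `&` A) + leb_outer (F k `&` ~` A)))).
  rewrite nneseriesD; [|by move=> *; exact: outer_measure_ge0..].
  have sub (C : set 'rV[R]_d) : leb_outer (X `&` C) <= \sum_(k <oo) leb_outer (F k `&` C).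
    apply: le_trans (outer_measure_sigma_subadditive (@leb_outer R d) (fun k => F k `&` C)).
    apply: le_outer_measure => x [/XF[k _ Fx] Cx]; by exists k.
  by apply: leeD; exact: sub.
apply: lee_nneseries => // k _ _; by rewrite adde_ge0// outer_measure_ge0.
Qed.

Lemma box_vol_affine (l : R) z A : (0 < l)%R ->
  box_vol [set x | A (l *: x + z)%R] <= (l ^- d)%:E * box_vol A.
Proof.
move=> l0; rewrite -lee_pdivrMl ?invr_gt0 ?exprn_gt0//.
apply: le_ereal_inf_tmp => _ [[-> ->]|[a [b [ab -> ->]]]].
  by rewrite (_ : [set _ | _] = set0) ?box_vol0 ?mule0//.
rewrite lee_pdivrMl ?invr_gt0 ?exprn_gt0//; apply: ereal_inf_lbound; right.
exists (l^-1 *: (a - z))%R, (l^-1 *: (b - z))%R; split.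
- by move=> i; rewrite !mxE ltr_pM2l ?invr_gt0// ltrD2r.
- apply/seteqP; split=> x H i; have := H i; rewrite !mxE => /andP[h1 h2]; apply/andP; split;
  first [by rewrite ltr_pdivrMl// ltrBlDr | by rewrite ltr_pdivlMl// ltrBrDr |
         by rewrite -ltrBlDr -ltr_pdivrMl| by rewrite -ltrBrDr -ltr_pdivlMl].
- rewrite -EFinM -exprVn -[in X in (X * _)%R](card_ord d) -prodr_const -big_split/=.
  by congr EFin; apply: eq_bigr => i _; rewrite !mxE; ring.
Qed.

Lemma leb_outer_affine (l : R) z A : (0 < l)%R ->
  leb_outer [set x | A (l *: x + z)%R] <= (l ^- d)%:E * leb_outer A.
Proof.
move=> l0; rewrite -lee_pdivrMl ?invr_gt0 ?exprn_gt0//.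
apply: leb_outer_ge => F AF; rewrite lee_pdivrMl ?invr_gt0 ?exprn_gt0//.
apply: (@le_trans _ _ (\sum_(k <oo) box_vol [set x | F k (l *: x + z)%R])).
  by apply: leb_outer_le => x /AF [k _ Fk]; exists k.
rewrite -nneseriesZl; last by move=> *; exact: (@box_vol_ge0 R d).
apply: lee_nneseries => k *; first exact: (@box_vol_ge0 R d).
exact: box_vol_affine.
Qed.

Lemma leb_outer_shift z A : leb_outer [set x | A (x + z)%R] = leb_outer A.
Proof.
have H (y : 'rV[R]_d) (B : set 'rV[R]_d) : leb_outer [set x | B (x + y)%R] <= leb_outer B.
  have := @leb_outer_affine 1%R y B ltr01; rewrite expr1n invr1 mul1e; congr (leb_outer _ <= _).
  by apply/funext => x /=; rewrite scale1r.
apply/eqP; rewrite eq_le H/=.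
apply: le_trans (H (- z)%R _); rewrite le_eqVlt; apply/orP; left; apply/eqP.
by congr leb_outer; apply/funext => x /=; rewrite subrK.
Qed.

(** The bound on the coordinates confines the set to a box of width [2 * t] and volume [e]. Later
    this discards the cut left by a bisection. *)
Lemma leb_hyperplane (i : 'I_d) (c r : R) :
  leb_outer [set x : 'rV[R]_d | x 0%R i = c /\ forall j, (`|x 0 j| < r)%R] = 0.
Proof.
apply/eqP; rewrite eq_le outer_measure_ge0 andbT.
have [r0|r0] := leP r 0%R.
  rewrite (_ : [set _ | _] = set0) ?outer_measure0//.
  apply/seteqP; split=> // x [_ /(_ i)]; rewrite ltNge => /negP[].
  exact: le_trans r0 (normr_ge0 _).
apply/lee_addgt0Pr => e e0; rewrite add0e.
pose p : R := ((r + r) ^+ d.-1)%R.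
have p0 : (0 < p)%R by rewrite exprn_gt0// addr_gt0.
pose t := (e / (p + p))%R.
have t0 : (0 < t)%R by rewrite divr_gt0// addr_gt0.
pose a := (\row_j if j == i then c - t else - r)%R : 'rV[R]_d.
pose b := (\row_j if j == i then c + t else r)%R : 'rV[R]_d.
apply: le_trans (@leb_box_le a b _ _ _) _.
- by move=> j; rewrite !mxE; case: ifP => _; lra.
- move=> x [xc xr] j; rewrite !mxE; case: eqP => [->|_]; first by rewrite xc; apply/andP; split; lra.
  by have := xr j; rewrite ltr_norml.
- rewrite lee_fin /vol (bigD1 i)//= !mxE eqxx (eq_bigr (fun=> (r + r)%R)); last first.
    by move=> j /negbTE ji; rewrite !mxE ji opprK.
  rewrite prodr_const -/p.
  rewrite (_ : #|_| = d.-1) -/p; last by rewrite cardC1 card_ord.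
  have : (t * (p + p) = e)%R by rewrite divfK// gt_eqF// addr_gt0.
  by move=> <-; lra.
Qed.

End LebesgueOuter.

(** * Borel sets and translations under Lebesgue measure *)

Section LebesgueMeasure.
Context {R : realType} {d : nat}.
Implicit Types (x z : 'rV[R]_d) (A U W : set 'rV[R]_d).
Local Notation lmeas A := (measurable (A : set (leb_space R d))).
Local Notation lmfun W f := (measurable_fun (W : set (leb_space R d)) (f : leb_space R d -> _)).

Lemma leb_open U : open U -> lmeas U.
Proof. exact: (open_cara_measurable leb_halfspace). Qed.

Lemma leb_closed A : closed A -> lmeas A.
Proof. by move=> cA; rewrite -(setCK A); apply: measurableC; apply: leb_open; exact: closed_openC. Qed.

Lemma leb_compact A : compact A -> lmeas A.
Proof. by move=> cA; apply: leb_closed; apply: compact_closed => //; exact: norm_hausdorff. Qed.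

Lemma leb_continuous (f : 'rV[R]_d -> R) A : continuous f -> lmfun A f.
Proof.
move=> cf; apply: measurable_funTS; exact: (continuous_cara_measurable leb_halfspace).
Qed.

Lemma leb_bounded A : bounded_set A -> (leb R d A < +oo)%E.
Proof.
case=> M [Mreal AM].
pose r := `|M| + 1; have r0 : 0 < r by rewrite ltr_wpDl.
have M1 : forall x, A x -> `|x| < r + 1.
  move=> x Ax; apply: (@le_lt_trans _ _ r); last by rewrite ltrDl.
  by apply: (AM r) => //; rewrite (le_lt_trans (ler_norm _))// ltrDl.
apply: le_lt_trans (@leb_box_le _ _ (const_mx (- (r + 1))) (const_mx (r + 1)) A _ _) (ltry _).
- by move=> i; rewrite !mxE; lra.
- move=> x /M1 xr i; rewrite !mxE -ltr_norml; apply: le_lt_trans xr.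
  by rewrite [leRHS]/Num.norm /= mx_normrE (le_bigmax _ _ (ord0, i)).
Qed.

Let cara_shift z A : (@leb_outer R d).-caratheodory A ->
  (@leb_outer R d).-caratheodory [set x | A (x + z)].
Proof.
move=> mA X.
have E Y : leb_outer Y = leb_outer [set x : 'rV[R]_d | Y (x - z)].
  by rewrite leb_outer_shift.
have := mA [set x | X (x - z)]; rewrite /= -E => ->.
rewrite [in RHS](E (X `&` _)) [in RHS](E (X `&` ~` _)).
congr (_ + _)%E; congr leb_outer; apply/funext => x /=;
  by rewrite /setI /setC /= subrK.
Qed.

Definition shift z : leb_space R d -> leb_space R d := fun x : 'rV[R]_d => x + z.

Lemma measurable_shift z : measurable_fun setT (shift z).
Proof. by move=> _ A mA; rewrite setTI; exact: cara_shift. Qed.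

Lemma measurable_shift_set z W : lmeas W -> lmeas [set x | W (x + z)].
Proof. exact: cara_shift. Qed.

Lemma measurable_fun_shift z W d' (T : measurableType d') (f : 'rV[R]_d -> T) :
  lmeas W -> lmfun W f -> lmfun [set x | W (x + z)] (fun x : 'rV[R]_d => f (x + z)).
Proof.
move=> mW mf _ Y mY; rewrite (_ : _ `&` _ = [set x | (W `&` f @^-1` Y) (x + z)])//.
by apply: measurable_shift_set; exact: mf.
Qed.

Lemma leb_integral_shift z W (f : 'rV[R]_d -> \bar R) :
  lmeas W -> lmfun W f ->
  (\int[leb R d]_(x in W) f x = \int[leb R d]_(x in [set x | W (x + z)%R]) f (x + z)%R)%E.
Proof.
move=> mW mf.
have ge0 (g : 'rV[R]_d -> \bar R) : lmfun W g -> (forall x, 0 <= g x)%E ->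
  (\int[leb R d]_(x in W) g x = \int[leb R d]_(x in [set x | W (x + z)%R]) g (x + z)%R)%E.
  move=> mg g0.
  apply: etrans (@ge0_integral_pushforward _ _ _ _ R _ (measurable_shift z) (leb R d) W g mW mg
    (fun y _ => g0 y)).
  apply: (eq_measure_integral (measure_function_pushforward__canonical__measure_function_Measure
    (leb R d) (measurable_shift z))) => A mA _.
  by apply/esym; exact: leb_outer_shift.
rewrite integralE [RHS]integralE; congr (_ - _)%E; rewrite ge0//.
- by apply: eq_integral => x _; rewrite !funeposE.
- exact: measurable_funepos.
- by apply: eq_integral => x _; rewrite !funenegE.
- exact: measurable_funeneg.
Qed.

End LebesgueMeasure.

(** * Smooth test functions *)

Section Flat.
Context {R : realType}.
Implicit Types t : R.

(* the derivatives of [exp (- 1 / t)] are combinations of the functions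
   [t ^ -n exp (- 1 / t)], all flat at 0 *)
Definition flat (n : nat) t : R := if 0 < t then t^-1 ^+ n * expR (- t^-1) else 0.

Lemma flat_ge0 n t : 0 <= flat n t.
Proof.
rewrite /flat; case: ifP => // t0.
by rewrite mulr_ge0 ?exprn_ge0 ?invr_ge0 ?expR_ge0// ltW.
Qed.

(** From $e^y \ge y^{n+k+1}/(n+k+1)!$ at $y = 1/t$: every [flat n] vanishes at 0 faster than any
    power. *)
Lemma flat_le n k t : flat n t <= (n + k).+1`!%:R * `|t| ^+ k.+1.
Proof.
rewrite /flat; case: ifPn => [t0|_]; last by rewrite mulr_ge0// exprn_ge0.
have y0 : 0 < t^-1 by rewrite invr_gt0.
rewrite (ger0_norm (ltW t0)) expRN ler_pdivrMr ?expR_gt0//.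
have := expR_ge1Dxn (n + k) (ltW y0).
move: (expR t^-1) => E h.
have {}h : t^-1 ^+ (n + k).+1 <= (n + k).+1`!%:R * E.
  rewrite -ler_pdivrMl ?ltr0n ?fact_gt0// mulrC; apply: le_trans h; by rewrite lerDr.
have -> : t^-1 ^+ n = t^-1 ^+ (n + k).+1 * t ^+ k.+1.
  by rewrite -addnS exprD -mulrA -exprMn mulVf ?gt_eqF// expr1n mulr1.
by rewrite mulrAC ler_wpM2r// exprn_ge0// ltW.
Qed.

Let flat_pos_derive n t : 0 < t ->
  is_derive t 1 (fun t : R => t^-1 ^+ n * expR (- t^-1))
    (flat n.+2 t - n%:R * flat n.+1 t).
Proof.
move=> t0; have tn0 : t != 0 by rewrite gt_eqF.
have dV : is_derive t 1 (fun t : R => t^-1) (- (t^-1) ^+ 2).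
  by apply: is_derive_eq; [exact: is_deriveV|rewrite exprVn /GRing.scale/= mulr1].
have dX : is_derive t 1 (fun s : R => s^-1 ^+ n) (n%:R * t^-1 ^+ n.-1 * (- (t^-1) ^+ 2)).
  rewrite (_ : (fun s => _) = (fun s : R => s^-1) ^+ n); last first.
    by apply/funext => s; rewrite exprfctE.
  exact: (@is_deriveX _ _ (fun s : R => s^-1) n t 1 _ dV).
have dN : is_derive t 1 (fun s : R => - s^-1) (t^-1 ^+ 2).
  by have := is_deriveN dV; rewrite opprK.
have dE : is_derive t 1 (fun s : R => expR (- s^-1)) (expR (- t^-1) * t^-1 ^+ 2).
  exact: (@is_derive1_comp _ expR (fun s : R => - s^-1) t _ _ (is_derive_expR _) dN).
have dM := is_deriveM dX dE.
apply: (@is_derive_eq _ _ _ _ _ _ _ _ dM) => {dM}.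
rewrite /flat t0 /GRing.scale /=.
case: n {dX} => [|n]; first by rewrite !expr0; ring.
by rewrite !exprS /=; ring.
Qed.

Lemma is_derive_flat n t : is_derive t 1 (flat n) (flat n.+2 t - n%:R * flat n.+1 t).
Proof.
have [t0|t0|t0] := ltgtP t 0; last rewrite {t}t0.
- rewrite /flat ltNge (ltW t0) /= mulr0 subr0.
  have nf : \near t, cst 0 t = (if 0 < t then t^-1 ^+ n * expR (- t^-1) else 0).
    near=> s; rewrite /= ifF//; apply/negbTE; rewrite -leNgt ltW//.
    by near: s; exact: lt_nbhsl.
  exact: (near_eq_is_derive nf (is_derive_cst _ _ _)).
- have nf : \near t, t^-1 ^+ n * expR (- t^-1) = flat n t.
    near=> s; rewrite /flat ifT//.
    rewrite -oppr_lt0; near: s; apply: Nlt_nbhsl; by rewrite oppr_lt0.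
  exact: (near_eq_is_derive nf (flat_pos_derive n t0)).
- rewrite /flat ltxx mulr0 subr0.
  have cv : h^-1 *: (flat n (h *: 1 + 0) - flat n 0) @[h --> 0^'] --> (0 : R).
    apply/cvgr0Pnorm_le => e e0.
    pose C : R := (n + 1).+1`!%:R + 1.
    have C0 : 0 < C by rewrite ltr_wpDl.
    near=> h.
    rewrite scaler1 addr0 [flat n 0]/flat ltxx subr0 normrM normfV.
    have h0 : h != 0 by near: h; exact: nbhs_dnbhs_neq.
    have hp : 0 < `|h| by rewrite normr_gt0.
    rewrite ler_pdivrMl// ger0_norm ?flat_ge0//.
    apply: le_trans (flat_le n 1 h) _; rewrite exprS expr1 mulrCA ler_wpM2l//.
    apply: (@le_trans _ _ (C * `|h|)); first by rewrite ler_wpM2r// lerDl.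
    rewrite -ler_pdivlMl//.
    near: h; apply: dnbhs0_le; by rewrite mulr_gt0 ?invr_gt0.
  apply: DeriveDef; first by apply/cvg_ex; exists 0.
  exact/cvg_lim.
Unshelve. all: by end_near. Qed.

End Flat.

(** * Calculus of smooth functions *)

Section Smooth.
Context {R : realType} {d : nat}.
Implicit Types (f g : 'rV[R]_d -> R) (x z : 'rV[R]_d).

(** All partial derivatives up to order [k] are differentiable, by recursion on the order, so that
    sums and products can be treated by induction. The innermost derivative is peeled off first,
    hence the [rcons] in the comparison with [smooth]. *)
Fixpoint smoothN (k : nat) f : Prop :=
  (forall x, differentiable f x) /\
  if k is k'.+1 then forall i, smoothN k' (partial i f) else True.

Lemma smoothNP f : smooth f <-> forall k, smoothN k f.
Proof.
split=> [sf k|H s x].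
  elim: k f sf => [|k IH] f sf /=; split=> //; [exact: (sf [::])|exact: (sf [::])|].
  move=> i; apply: IH => s x; have := sf (rcons s i) x.
  by rewrite foldr_rcons.
elim/last_ind: s f H => [|s i IH] f H; first by have [] := H 0%N.
by rewrite foldr_rcons; apply: IH => k; have [_ /(_ i)] := H k.+1.
Qed.

Lemma smooth_differentiable f x : smooth f -> differentiable f x.
Proof. by move=> sf; exact: (sf [::]). Qed.

Lemma smooth_derivable f x z : smooth f -> derivable f x z.
Proof. by move=> sf; apply: diff_derivable; exact: smooth_differentiable. Qed.

Lemma smooth_continuous f : smooth f -> continuous f.
Proof. by move=> sf x; apply: differentiable_continuous; exact: smooth_differentiable. Qed.

Lemma smooth_partial i f : smooth f -> smooth (partial i f).
Proof. by move=> sf s x; have := sf (rcons s i) x; rewrite foldr_rcons. Qed.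

Lemma smooth_cst (c : R) : smooth (fun _ : 'rV[R]_d => c).
Proof.
apply/smoothNP => k; elim: k c => [|k IH] c /=; split=> //.
move=> i; rewrite (_ : partial i _ = fun=> 0); first exact: IH.
by apply/funext => x; exact: derive_cst.
Qed.

Lemma smoothN_S k f : smoothN k.+1 f -> smoothN k f.
Proof.
elim: k f => [|k IH] f; first by move=> [].
by move=> [df H]; split=> // i; apply: IH; exact: H.
Qed.

Lemma partialD i f g : (forall x, differentiable f x) -> (forall x, differentiable g x) ->
  partial i (fun x => f x + g x) = fun x => partial i f x + partial i g x.
Proof.
by move=> df dg; apply/funext => x; rewrite /partial -deriveD//; exact: diff_derivable.
Qed.

Lemma partialM i f g : (forall x, differentiable f x) -> (forall x, differentiable g x) ->
  partial i (fun x => f x * g x) = fun x => f x * partial i g x + g x * partial i f x.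
Proof.
by move=> df dg; apply/funext => x; rewrite /partial [LHS]deriveM//; exact: diff_derivable.
Qed.

Lemma smoothND k f g : smoothN k f -> smoothN k g -> smoothN k (fun x => f x + g x).
Proof.
elim: k f g => [|k IH] f g /= [df Hf] [dg Hg]; split=> //;
  try by move=> x; exact: differentiableD.
by move=> i; rewrite partialD//; exact: IH.
Qed.

Lemma smoothNM k f g : smoothN k f -> smoothN k g -> smoothN k (fun x => f x * g x).
Proof.
elim: k f g => [|k IH] f g sf sg.
  by case: sf sg => [df _] [dg _]; split=> // x; exact: differentiableM.
have [df Hf] := sf; have [dg Hg] := sg.
split; first by move=> x; exact: differentiableM.
move=> i; rewrite partialM//; apply: smoothND; apply: IH.
- exact: smoothN_S.
- exact: Hg.
- exact: smoothN_S.
- exact: Hf.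
Qed.

Lemma smoothD f g : smooth f -> smooth g -> smooth (fun x => f x + g x).
Proof. by move=> /smoothNP sf /smoothNP sg; apply/smoothNP => k; exact: smoothND. Qed.

Lemma smoothM f g : smooth f -> smooth g -> smooth (fun x => f x * g x).
Proof. by move=> /smoothNP sf /smoothNP sg; apply/smoothNP => k; exact: smoothNM. Qed.

Lemma smoothZ (c : R) f : smooth f -> smooth (fun x => c * f x).
Proof. by apply: smoothM; exact: smooth_cst. Qed.

Lemma smoothB f g : smooth f -> smooth g -> smooth (fun x => f x - g x).
Proof.
move=> sf sg; rewrite (_ : (fun _ => _) = fun x => f x + -1 * g x).
  by apply: smoothD => //; exact: smoothZ.
by apply/funext => x; rewrite mulN1r.
Qed.

Lemma smoothX n f : smooth f -> smooth (fun x => f x ^+ n).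
Proof.
move=> sf; elim: n => [|n IH]; first exact: smooth_cst.
rewrite (_ : (fun _ => _) = fun x => f x * f x ^+ n); first exact: smoothM.
by apply/funext => x; rewrite exprS.
Qed.

Lemma smooth_prod I (s : seq I) (P : pred I) (F : I -> 'rV[R]_d -> R) :
  (forall i, smooth (F i)) -> smooth (fun x => \prod_(i <- s | P i) F i x).
Proof.
move=> sF; elim: s => [|i s IH].
  by rewrite (_ : (fun _ => _) = fun=> 1); [exact: smooth_cst|apply/funext => x; rewrite big_nil].
rewrite (_ : (fun _ => _) = fun x => (if P i then F i x else 1) * \prod_(i <- s | P i) F i x).
  by apply: smoothM => //; case: (P i) => //; exact: smooth_cst.
by apply/funext => x; rewrite big_cons; case: ifP => // _; rewrite mul1r.
Qed.

Definition affine (a : 'rV[R]_d) (b : R) x : R := dot a x + b.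

Lemma affine_line a b x z t : affine a b (t *: z + x) = t * dot a z + affine a b x.
Proof.
rewrite /affine /dot addrA mulr_sumr -big_split /=; congr (_ + _).
by apply: eq_bigr => i _; rewrite !mxE mulrDr mulrCA.
Qed.

Lemma differentiable_affine a b x : differentiable (affine a b) x.
Proof.
have -> : affine a b = (\sum_(i < d) (fun x => a 0 i * x 0 i)) + cst b.
  apply/funext => y; rewrite /affine /dot fctE /=; congr (_ + _).
  by elim/big_ind2: _ => // f1 f2 g1 g2 -> ->.
apply: differentiableD => //; apply: differentiable_sum => i.
by apply: differentiableZ; exact: differentiable_coord.
Qed.

Lemma derive_comp_affine (g : R -> R) a b z x :
  'D_z (fun y => g (affine a b y)) x = 'D_(dot a z) g (affine a b x).
Proof.
have E : (fun h : R => h^-1 *: (g (affine a b (h *: z + x)) - g (affine a b x))) =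
    (fun h => h^-1 *: (g (h *: dot a z + affine a b x) - g (affine a b x))).
  by apply/funext => t; rewrite affine_line.
exact: (congr1 (fun F => lim (F @ 0^')) E).
Qed.

Lemma smooth_flat n a b : smooth (fun x => flat n (affine a b x)).
Proof.
apply/smoothNP => k; elim: k n => [|k IH] n.
  split=> // x; apply: differentiable_comp; first exact: differentiable_affine.
  by apply/derivable1_diffP; have [] := is_derive_flat n (affine a b x).
split=> [x|i].
  apply: differentiable_comp; first exact: differentiable_affine.
  by apply/derivable1_diffP; have [] := is_derive_flat n (affine a b x).
rewrite (_ : partial i _ = fun x => a 0 i *
    (flat n.+2 (affine a b x) + (- n%:R) * flat n.+1 (affine a b x))).
  apply: smoothNM; first by have /smoothNP := smooth_cst (a 0 i); apply.
  apply: smoothND => //; apply: smoothNM => //.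
  by have /smoothNP := smooth_cst (- n%:R); apply.
apply/funext => x; rewrite /partial derive_comp_affine.
have -> : dot a (delta_mx 0 i) = a 0 i.
  rewrite /dot (bigD1 i)//= mxE !eqxx mulr1 big1 ?addr0// => j /negbTE ji.
  by rewrite mxE ji andbF mulr0.
have [df de] := is_derive_flat n (affine a b x).
rewrite deriveE; last exact/derivable1_diffP.
by rewrite deriv1E// derive1E de /GRing.scale/= mulNr.
Qed.

Lemma partial_shift i f z : partial i (fun x => f (x + z)) = fun x => partial i f (x + z).
Proof.
apply/funext => x.
have E : (fun h : R => h^-1 *: (f (h *: delta_mx 0 i + x + z) - f (x + z))) =
    (fun h => h^-1 *: (f (h *: delta_mx 0 i + (x + z)) - f (x + z))).
  by apply/funext => t; rewrite addrA.
exact: (congr1 (fun F => lim (F @ 0^')) E).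
Qed.

Lemma smooth_shift f z : smooth f -> smooth (fun x => f (x + z)).
Proof.
move=> /smoothNP sf; apply/smoothNP => k; elim: k f sf => [|k IH] f sf.
  by split=> // x; apply: differentiable_comp => //; have [] := sf 0%N.
split; first by move=> x; apply: differentiable_comp => //; have [] := sf 0%N.
by move=> i; rewrite partial_shift; apply: IH => m; have [_ /(_ i)] := sf m.+1.
Qed.

Lemma derive_partial f x z : smooth f -> 'D_z f x = \sum_(i < d) z 0 i * partial i f x.
Proof.
move=> sf; rewrite deriveE; last exact: smooth_differentiable.
rewrite [in LHS](row_sum_delta z) linear_sum; apply: eq_bigr => i _.
by rewrite linearZ /= /partial deriveE//; exact: smooth_differentiable.
Qed.

End Smooth.

Lemma MVT_between {R : realType} (F F' : R -> R) (a b : R) :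
  (forall t : R, is_derive t 1 F (F' t)) ->
  exists c, `|c - a| <= `|b - a| /\ F b - F a = F' c * (b - a).
Proof.
move=> dF.
have cF : continuous F.
  by move=> t; apply: differentiable_continuous; apply/derivable1_diffP; have [] := dF t.
have cW (A : set R) : {within A, continuous F}.
  by apply: continuous_subspaceT.
have [ab|ba|<-] := ltgtP a b.
- have [c] := MVT ab (fun x _ => dF x) (cW _).
  rewrite in_itv /= => /andP[ac cb] ->; exists c; split=> //.
  by rewrite gtr0_norm ?subr_gt0// gtr0_norm ?subr_gt0//; lra.
- have [c] := MVT ba (fun x _ => dF x) (cW _).
  rewrite in_itv /= => /andP[ac cb] E; exists c; split.
    by rewrite ltr0_norm ?subr_lt0// ltr0_norm ?subr_lt0//; lra.
  by rewrite -opprB E -mulrN opprB.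
- by exists a; split; rewrite ?subrr ?mulr0.
Qed.

(** * Test functions and their Taylor expansion *)

Section TestFunctions.
Context {R : realType} {d : nat}.
Implicit Types (psi f : 'rV[R]_d -> R) (x z : 'rV[R]_d) (W : set 'rV[R]_d).

Lemma test_functionS W W' psi : W `<=` W' -> test_function W psi -> test_function W' psi.
Proof. by move=> WW' [spsi [K [cK KW K0]]]; split=> //; exists K; split=> // x /KW /WW'. Qed.

Lemma test_functionM W f psi : smooth f -> test_function W psi ->
  test_function W (fun x => f x * psi x).
Proof.
move=> sf [sp [K [cK KW K0]]]; split; first exact: smoothM.
by exists K; split=> // x Kx; rewrite K0// mulr0.
Qed.

Lemma test_functionZ W (c : R) psi : test_function W psi ->
  test_function W (fun x => c * psi x).
Proof. by apply: test_functionM; exact: smooth_cst. Qed.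

Lemma test_function0 W : test_function W (fun=> 0).
Proof. by split; [exact: smooth_cst|exists set0; split=> //; exact: compact0]. Qed.

Lemma test_functionD W psi1 psi2 : test_function W psi1 -> test_function W psi2 ->
  test_function W (fun x => psi1 x + psi2 x).
Proof.
move=> [sp [K [cK KW K0]]] [sp' [K' [cK' KW' K0']]]; split; first exact: smoothD.
exists (K `|` K'); split; first exact: compactU.
- by move=> x [/KW|/KW'].
- by move=> x /not_orP[Kx K'x]; rewrite K0// K0'// addr0.
Qed.

Lemma test_function_sum W I (s : seq I) (psi : I -> 'rV[R]_d -> R) :
  (forall i, test_function W (psi i)) -> test_function W (fun x => \sum_(i <- s) psi i x).
Proof.
move=> H; elim: s => [|i s IH].
  rewrite (_ : (fun _ => _) = fun=> 0); first exact: test_function0.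
  by apply/funext => x; rewrite big_nil.
rewrite (_ : (fun _ => _) = fun x => psi i x + \sum_(i <- s) psi i x).
  exact: test_functionD.
by apply/funext => x; rewrite big_cons.
Qed.

Lemma compact_closed_row (K : set 'rV[R]_d) : compact K -> closed K.
Proof. by apply: compact_closed; exact: norm_hausdorff. Qed.

Lemma test_function_partial W i psi : test_function W psi -> test_function W (partial i psi).
Proof.
move=> [sp [K [cK KW K0]]]; split; first exact: smooth_partial.
exists K; split=> // x Kx; rewrite /partial.
have nK : \near x, cst 0 x = psi x.
  have oK : open (~` K) by apply: closed_openC; exact: compact_closed_row.
  by apply: filterS (open_nbhs_nbhs (conj oK Kx)) => y Ky; rewrite K0.
by rewrite -(near_eq_derive _ nK) derive_cst.
Qed.

Lemma test_function_shift W z psi : test_function W psi ->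
  test_function [set x | W (x + z)] (fun x => psi (x + z)).
Proof.
move=> [sp [K [cK KW K0]]]; split; first exact: smooth_shift.
exists [set x | K (x + z)]; split.
- rewrite (_ : [set _ | _] = (fun y => y - z) @` K).
    apply: continuous_compact => //; apply: continuous_subspaceT => x.
    by apply: differentiable_continuous.
  by apply/seteqP; split=> [x /= Kx|_ [y Ky <-] /=]; [exists (x + z); rewrite ?addrK|rewrite subrK].
- by move=> x /= /KW.
- by move=> x /= /K0.
Qed.

Lemma test_function_bounded W psi : test_function W psi ->
  exists2 M : R, 0 <= M & forall x, `|psi x| <= M.
Proof.
move=> [sp [K [cK KW K0]]].
have : compact (psi @` K).
  by apply: continuous_compact => //; apply: continuous_subspaceT; exact: smooth_continuous.
move=> /compact_bounded[M [Mr HM]].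
exists (`|M| + 1); first by rewrite addr_ge0.
move=> x; have [Kx|Kx] := pselect (K x); last by rewrite K0// normr0 addr_ge0.
by apply: (HM (`|M| + 1)); [rewrite (le_lt_trans (ler_norm _))// ltrDl|exists x].
Qed.

Definition dirder z psi x : R := \sum_(i < d) z 0 i * partial i psi x.

Lemma test_function_dirder W z psi : test_function W psi -> test_function W (dirder z psi).
Proof.
move=> tp; apply: test_function_sum => i; apply: test_functionZ.
exact: test_function_partial.
Qed.

Lemma is_derive_line psi x z (t : R) : smooth psi ->
  is_derive t 1 (fun t : R => psi (x + t *: z)) (dirder z psi (x + t *: z)).
Proof.
move=> sp.
have E : (fun h : R => h^-1 *: (psi (h *: z + (x + t *: z)) - psi (x + t *: z))) =
  (fun h : R => h^-1 *: (psi (x + (h *: 1 + t) *: z) - psi (x + t *: z))).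
  by apply/funext => h; rewrite scaler1 scalerDl addrCA addrA.
have dp := @smooth_derivable _ _ psi (x + t *: z) z sp.
apply: DeriveDef.
  by move: dp; rewrite /derivable /= E.
rewrite /dirder -derive_partial// /derive /=.
by rewrite E.
Qed.

(** Two applications of the mean value theorem. The constant is uniform in [x], so the remainder can
    be integrated against any integrable function. *)
Lemma test_function_taylor W z psi : test_function W psi ->
  exists2 C : R, 0 <= C & forall x h,
    `|psi (x + h *: z) - psi x - h * dirder z psi x| <= C * h ^+ 2.
Proof.
move=> tp; have tp1 := test_function_dirder z tp; have tp2 := test_function_dirder z tp1.
have [C C0 HC] := test_function_bounded tp2.
exists C => // x h.
have [c [ch Ec]] := MVT_between 0 h (fun t => is_derive_line x z t tp.1).
have [c' [cc' Ec']] := MVT_between 0 c (fun t => is_derive_line x z t tp1.1).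
move: Ec Ec'; rewrite !scale0r !addr0 !subr0 => -> Ec'.
rewrite [h * _]mulrC -mulrBl Ec' normrM normrM.
rewrite !subr0 in ch cc'.
rewrite -[h ^+ 2]real_normK ?num_real// expr2 mulrA ler_wpM2r//.
by apply: ler_pM.
Qed.

End TestFunctions.

Lemma sqrD_le {R : realDomainType} (a b : R) : (a + b) ^+ 2 <= 2 * a ^+ 2 + 2 * b ^+ 2.
Proof. by have := sqr_ge0 (a - b); rewrite !expr2; lra. Qed.

(** * Real-valued integrals *)

Section RealIntegrable.
Context {dsp : measure_display} {T : measurableType dsp} {R : realType}.
Variable mu : {measure set T -> \bar R}.
Implicit Types (D E : set T) (f g h : T -> R).

Definition rint D f := mu.-integrable D (EFin \o f).

Lemma rint_measurable D f : rint D f -> measurable_fun D f.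
Proof. by move=> /measurable_int /measurable_EFinP. Qed.

Lemma measurableM D f g : measurable_fun D f -> measurable_fun D g ->
  measurable_fun D (fun x => f x * g x).
Proof. exact: measurable_funM. Qed.

Lemma measurable_sqr D f : measurable_fun D f -> measurable_fun D (fun x => f x ^+ 2).
Proof. by move=> mf; exact: measurableM. Qed.

Lemma rintD D f g : measurable D -> rint D f -> rint D g -> rint D (fun x => f x + g x).
Proof. by move=> mD rf rg; have := integrableD mD rf rg; apply: eq_integrable. Qed.

Lemma rintB D f g : measurable D -> rint D f -> rint D g -> rint D (fun x => f x - g x).
Proof. by move=> mD rf rg; have := integrableB mD rf rg; apply: eq_integrable. Qed.

Lemma rintZ D c f : measurable D -> rint D f -> rint D (fun x => c * f x).
Proof. by move=> mD rf; have := integrableZl mD c rf; apply: eq_integrable. Qed.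

Lemma rint0 D : measurable D -> rint D (fun=> 0).
Proof. by move=> mD; have := integrable0 mu D; apply: eq_integrable. Qed.

Lemma rint_sum D I (s : seq I) (F : I -> T -> R) : measurable D ->
  (forall i, rint D (F i)) -> rint D (fun x => \sum_(i <- s) F i x).
Proof.
move=> mD rF; have := @integrable_sum _ _ _ mu D mD _ s xpredT (fun i => EFin \o F i) (fun i _ => rF i).
by apply: eq_integrable => // x _; rewrite /= sumEFin.
Qed.

Lemma rint_le D f g : measurable D -> measurable_fun D f ->
  (forall x, D x -> `|f x| <= g x) -> rint D g -> rint D f.
Proof.
move=> mD mf fg; apply: le_integrable => //; first exact/measurable_EFinP.
by move=> x Dx; rewrite /= lee_fin (le_trans (fg x Dx))// ler_norm.
Qed.

Lemma rint_cst D (c : R) : measurable D -> (mu D < +oo)%E -> rint D (cst c).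
Proof.
move=> mD fD; apply/integrableP; split; first exact/measurable_EFinP/measurable_cst.
by rewrite /= integral_cst// lte_mul_pinfty.
Qed.

Lemma rint_bounded D f (M : R) : measurable D -> measurable_fun D f -> (mu D < +oo)%E ->
  (forall x, D x -> `|f x| <= M) -> rint D f.
Proof.
move=> mD mf fD fM; apply: (@rint_le _ _ (cst M)) => //.
exact: rint_cst.
Qed.

Lemma rint_mul_bounded D f h M : measurable D -> rint D f -> measurable_fun D h ->
  (forall x, D x -> `|h x| <= M) -> rint D (fun x => h x * f x).
Proof.
move=> mD rf mh hM.
have rn : rint D (fun x => `|M| * `|f x|).
  by apply: rintZ => //; exact: integrable_norm.
apply: rint_le rn => //.
  by apply: measurable_funM => //; exact: rint_measurable.
move=> x Dx; rewrite normrM ler_wpM2r//.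
exact: le_trans (hM x Dx) (ler_norm _).
Qed.

Lemma rintS D E f : measurable D -> measurable E -> D `<=` E -> rint E f -> rint D f.
Proof. by move=> mD mE DE; exact: integrableS. Qed.

Lemma Rintegral_sum D I (s : seq I) (F : I -> T -> R) : measurable D ->
  (forall i, rint D (F i)) ->
  \int[mu]_(x in D) (\sum_(i <- s) F i x) = \sum_(i <- s) \int[mu]_(x in D) F i x.
Proof.
move=> mD rF; elim: s => [|i s IH].
  rewrite big_nil -[RHS](mul0r (fine (mu D))) -Rintegral_cst//.
  by apply: eq_Rintegral => x _; rewrite big_nil.
rewrite big_cons -IH -RintegralD//; [|exact: rF|exact: rint_sum].
by apply: eq_Rintegral => x _; rewrite big_cons.
Qed.

Lemma ae_eq_Rintegral D f g : measurable D -> measurable_fun D f -> measurable_fun D g ->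
  {ae mu, forall x, D x -> f x = g x} ->
  \int[mu]_(x in D) f x = \int[mu]_(x in D) g x.
Proof.
move=> mD mf mg fg; congr fine; apply: ae_eq_integral => //; try exact/measurable_EFinP.
by apply: filterS fg => x H Dx; rewrite H.
Qed.

Lemma ae_eq_rint D f g : measurable D -> measurable_fun D g ->
  {ae mu, forall x, D x -> f x = g x} -> rint D f -> rint D g.
Proof.
move=> mD mg fg rf.
have mf := rint_measurable rf.
apply/integrableP; split; first exact/measurable_EFinP.
have /integrableP[_] := rf; rewrite (@ae_eq_integral _ _ _ mu D (abse \o (EFin \o g)))//.
- by apply: measurableT_comp => //; exact/measurable_EFinP.
- by apply: measurableT_comp => //; exact/measurable_EFinP.
- by apply: filterS fg => x H Dx; rewrite /= H.
Qed.

(** Monotonicity of the integral asks for a pointwise inequality, so [g] is replaced by $\max(f,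
    g)$, which agrees with it almost everywhere. *)
Lemma ae_le_Rintegral D f g : measurable D -> rint D f -> rint D g ->
  {ae mu, forall x, D x -> f x <= g x} ->
  \int[mu]_(x in D) f x <= \int[mu]_(x in D) g x.
Proof.
move=> mD rf rg fg.
have mf := rint_measurable rf; have mg := rint_measurable rg.
pose h x := Num.max (f x) (g x).
have mh : measurable_fun D h by exact: measurable_maxr.
have hg : {ae mu, forall x, D x -> g x = h x}.
  by apply: filterS fg => x H Dx; rewrite /h max_r// H.
rewrite (ae_eq_Rintegral mD mg mh hg); apply: le_Rintegral => //.
  exact: ae_eq_rint hg rg.
by move=> x _; rewrite /h le_max lexx.
Qed.

Lemma Rintegral_dominated D (F : nat -> T -> R) f g : measurable D ->
  (forall n, measurable_fun D (F n)) ->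
  measurable_fun D f ->
  (forall x, D x -> F ^~ x @ \oo --> f x) -> rint D g ->
  (forall n x, D x -> `|F n x| <= g x) ->
  rint D f /\ \int[mu]_(x in D) F n x @[n --> \oo] --> \int[mu]_(x in D) f x.
Proof.
move=> mD mF mf cF rg Fg.
have [|||||rf _ cv] := @dominated_convergence _ _ _ mu D mD (fun n => EFin \o F n)
  (EFin \o f) (EFin \o g) => //.
- by move=> n; exact/measurable_EFinP.
- exact/measurable_EFinP.
- by apply: aeW => x Dx; apply: cvg_EFin; [exact: nearW|exact: cF].
- by apply: aeW => x n Dx; rewrite lee_fin Fg.
split=> //; apply: fine_cvg; rewrite fineK; last exact: integrable_fin_num.
exact: cv.
Qed.

Lemma Rintegral_ae0 D f : measurable D -> rint D f -> (forall x, D x -> 0 <= f x) ->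
  \int[mu]_(x in D) f x <= 0 -> {ae mu, forall x, D x -> f x = 0}.
Proof.
move=> mD rf f0 I0.
have /ae_eq_integral_abs : (\int[mu]_(x in D) `|(f x)%:E| = 0)%E.
  rewrite (eq_integral (EFin \o f)); last first.
    by move=> x /set_mem Dx; rewrite /= ger0_norm// f0.
  rewrite -(fineK (integrable_fin_num mD rf)); congr EFin.
  by apply/eqP; rewrite eq_le I0 Rintegral_ge0.
move=> /(_ mD) H; have {H} := H (measurable_int mu rf).
by apply: filterS => x H Dx; have := H Dx => -[].
Qed.

Lemma subset_Rintegral D E f : measurable D -> measurable E -> D `<=` E -> rint E f ->
  (forall x, E x -> 0 <= f x) ->
  \int[mu]_(x in D) f x <= \int[mu]_(x in E) f x.
Proof.
move=> mD mE DE rf f0; apply: fine_le.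
- by apply: integrable_fin_num => //; exact: rintS rf.
- exact: integrable_fin_num.
- apply: ge0_subset_integral => //.
  by apply/measurable_EFinP; exact: rint_measurable rf.
Qed.

Lemma Rintegral_indic D E f : measurable D -> measurable E ->
  \int[mu]_(x in D) (\1_E x * f x) = \int[mu]_(x in D `&` E) f x.
Proof.
move=> mD mE; rewrite Rintegral_mkcondr; apply: eq_Rintegral => x _.
by rewrite /patch indicE; case: ifP => xE; rewrite ?mul1r ?mul0r.
Qed.

End RealIntegrable.

(* locked, since [done] would otherwise unfold it into the costly measurability
   hints of the library *)
HB.lock Definition sqint {dsp : measure_display} {T : measurableType dsp} {R : realType}
  (mu : {measure set T -> \bar R}) (D : set T) (f : T -> R) : Prop :=
  measurable_fun D f /\ rint mu D (fun x => f x ^+ 2).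

Section SquareIntegrable.
Context {dsp : measure_display} {T : measurableType dsp} {R : realType}.
Variable mu : {measure set T -> \bar R}.
Implicit Types (D E : set T) (f g h : T -> R).
Local Notation rint := (rint mu).
Local Notation sqint := (sqint mu).

Lemma Sqint D f : measurable_fun D f -> rint D (fun x => f x ^+ 2) -> sqint D f.
Proof. by rewrite sqint.unlock. Qed.

Lemma sqintE D f : sqint D f -> measurable_fun D f /\ rint D (fun x => f x ^+ 2).
Proof. by rewrite sqint.unlock. Qed.

Lemma sqint_measurable D f : sqint D f -> measurable_fun D f.
Proof. by move=> /sqintE[]. Qed.

Lemma sqint_sq D f : sqint D f -> rint D (fun x => f x ^+ 2).
Proof. by move=> /sqintE[]. Qed.

Lemma sqint_rint D f g : measurable D -> sqint D f -> sqint D g ->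
  rint D (fun x => f x * g x).
Proof.
move=> mD /sqintE[mf rf] /sqintE[mg rg].
apply: (@rint_le _ _ _ mu _ _ (fun x => f x ^+ 2 + g x ^+ 2)) => //.
- exact: measurable_funM.
- move=> x _; rewrite normrM -[X in _ <= X + _]real_normK ?num_real//.
  by rewrite -[X in _ <= _ + X]real_normK ?num_real//; nra.
- exact: rintD.
Qed.

Lemma sqintD D f g : measurable D -> sqint D f -> sqint D g -> sqint D (fun x => f x + g x).
Proof.
move=> mD sf sg; have [mf rf] := sqintE sf; have [mg rg] := sqintE sg.
apply: Sqint; first exact: measurable_funD.
rewrite (_ : (fun _ => _) = fun x => f x ^+ 2 + g x ^+ 2 + 2 * (f x * g x)).
  by apply: rintD => //; [exact: rintD|apply: rintZ => //; exact: sqint_rint].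
by apply/funext => x; ring.
Qed.

Lemma sqintZ D c f : measurable D -> sqint D f -> sqint D (fun x => c * f x).
Proof.
move=> mD /sqintE[mf rf]; apply: Sqint; first exact: measurable_funM.
rewrite (_ : (fun _ => _) = fun x => c ^+ 2 * f x ^+ 2); first exact: rintZ.
by apply/funext => x; rewrite exprMn.
Qed.

Lemma sqintB D f g : measurable D -> sqint D f -> sqint D g -> sqint D (fun x => f x - g x).
Proof.
move=> mD sf sg; rewrite (_ : (fun _ => _) = fun x => f x + -1 * g x).
  by apply: sqintD => //; exact: sqintZ.
by apply/funext => x; rewrite mulN1r.
Qed.

Lemma sqint0 D : measurable D -> sqint D (fun=> 0).
Proof.
move=> mD; apply: Sqint; first exact: measurable_cst.
by rewrite expr0n; exact: rint0.
Qed.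

Lemma sqint_sum D I (s : seq I) (F : I -> T -> R) : measurable D ->
  (forall i, sqint D (F i)) -> sqint D (fun x => \sum_(i <- s) F i x).
Proof.
move=> mD sF; elim: s => [|i s IH].
  rewrite (_ : (fun _ => _) = fun=> 0); first exact: sqint0.
  by apply/funext => x; rewrite big_nil.
rewrite (_ : (fun _ => _) = fun x => F i x + \sum_(i <- s) F i x); first exact: sqintD.
by apply/funext => x; rewrite big_cons.
Qed.

Lemma sqint_le D f g : measurable D -> measurable_fun D f ->
  (forall x, D x -> `|f x| <= `|g x|) -> sqint D g -> sqint D f.
Proof.
move=> mD mf fg /sqintE[mg rg]; apply: Sqint => //; apply: rint_le rg => //.
  by rewrite (_ : (fun _ => _) = fun x => f x * f x)//; exact: measurable_funM.
move=> x Dx; rewrite normrX -[X in _ <= X]real_normK ?num_real//.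
by rewrite lerXn2r ?nnegrE// fg.
Qed.

Lemma sqint_mul_bounded D f h M : measurable D -> sqint D f -> measurable_fun D h ->
  (forall x, D x -> `|h x| <= M) -> sqint D (fun x => h x * f x).
Proof.
move=> mD sf mh hM; apply: (@sqint_le _ _ (fun x => `|M| * f x)) => //.
- by apply: measurable_funM => //; exact: sqint_measurable sf.
- by move=> x Dx; rewrite !normrM normr_id ler_wpM2r// (le_trans (hM x Dx))// ler_norm.
- exact: sqintZ.
Qed.

Lemma sqintS D E f : measurable D -> measurable E -> D `<=` E -> sqint E f -> sqint D f.
Proof.
move=> mD mE DE /sqintE[mf rf]; apply: Sqint; first exact: measurable_funS mf.
exact: rintS rf.
Qed.

Lemma sqint_rint_finite D f : measurable D -> (mu D < +oo)%E -> sqint D f -> rint D f.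
Proof.
move=> mD fD sf.
have : sqint D (cst 1).
  by apply: Sqint; [exact: measurable_cst|exact: (rint_cst (1 ^+ 2))].
move=> /(sqint_rint mD sf); rewrite /=; under eq_fun do rewrite mulr1.
by [].
Qed.

Lemma ae_eq_sqint D f g : measurable D -> measurable_fun D g ->
  {ae mu, forall x, D x -> f x = g x} -> sqint D f -> sqint D g.
Proof.
move=> mD mg fg /sqintE[mf rf]; apply: Sqint => //; apply: ae_eq_rint rf => //.
  by rewrite (_ : (fun _ => _) = fun x => g x * g x)//; exact: measurable_funM.
by apply: filterS fg => x H Dx; rewrite H.
Qed.

End SquareIntegrable.

(** * Density of test functions *)

Section Bump.
Context {R : realType} {d : nat}.
Implicit Types (psi f : 'rV[R]_d -> R) (x z a b : 'rV[R]_d) (K W U : set 'rV[R]_d).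

Lemma dot_delta i x : dot (delta_mx 0 i) x = x 0 i.
Proof.
rewrite /dot (bigD1 i)//= mxE !eqxx mul1r big1 ?addr0// => j /negbTE ji.
by rewrite mxE ji andbF mul0r.
Qed.

Lemma flat0_le1 (t : R) : flat 0 t <= 1.
Proof. by rewrite /flat; case: ifP => // t0; rewrite expr0 mul1r expR_le1 oppr_le0 invr_ge0 ltW. Qed.

Lemma flat_gt0 n (t : R) : (0 < flat n t) = (0 < t).
Proof.
rewrite /flat; case: ifP => [t0|]; last by rewrite ltxx.
by rewrite mulr_gt0 ?exprn_gt0 ?invr_gt0 ?expR_gt0.
Qed.

Definition box_bump a b x : R := \prod_(i < d)
  (flat 0 (affine (delta_mx 0 i) (- a 0 i) x) * flat 0 (affine (- delta_mx 0 i) (b 0 i) x)).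

Lemma smooth_box_bump a b : smooth (box_bump a b).
Proof. by apply: smooth_prod => i; apply: smoothM; exact: smooth_flat. Qed.

Lemma box_bump01 a b x : 0 <= box_bump a b x <= 1.
Proof.
rewrite /box_bump; apply/andP; split.
  by apply: prodr_ge0 => i _; rewrite mulr_ge0 ?flat_ge0.
apply: prodr_ile1 => i _; rewrite mulr_ge0 ?flat_ge0//=.
by rewrite -[leRHS]mulr1 ler_pM ?flat_ge0 ?flat0_le1.
Qed.

Lemma box_bump_gt0 a b x : 0 < box_bump a b x <-> box a b x.
Proof.
have E i : (0 < flat 0 (affine (delta_mx 0 i) (- a 0 i) x) * flat 0 (affine (- delta_mx 0 i) (b 0 i) x))
    = (a 0 i < x 0 i < b 0 i).
  have -> : affine (delta_mx 0 i) (- a 0 i) x = x 0 i - a 0 i by rewrite /affine dot_delta.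
  have -> : affine (- delta_mx 0 i) (b 0 i) x = b 0 i - x 0 i.
    rewrite /affine addrC; congr (_ + _); rewrite -[in RHS](dot_delta i) /dot -sumrN.
    by apply: eq_bigr => j _; rewrite !mxE mulNr.
  rewrite -[a 0 i < _]subr_gt0 -[x 0 i < _]subr_gt0.
  have [h|h] := ltP 0 (x 0 i - a 0 i) => /=.
    by rewrite pmulr_rgt0 ?flat_gt0.
  by rewrite [X in X * _]/flat ifF ?mul0r ?ltxx//; apply/negbTE; rewrite -leNgt.
split=> [H i|H].
  rewrite -E lt_neqAle eq_sym mulr_ge0 ?flat_ge0// andbT; apply/eqP => Z.
  by move: H; rewrite /box_bump (bigD1 i)//= Z mul0r ltxx.
by apply: prodr_gt0 => i _; rewrite E; exact: H.
Qed.

Lemma box_ball x r : 0 < r -> box (\row_i (x 0 i - r)) (\row_i (x 0 i + r)) = ball x r.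
Proof.
move=> r0; apply/seteqP; split=> y.
  move=> H; rewrite -ball_normE /= [ltLHS]/Num.norm /= mx_normrE.
  apply/bigmax_ltP; split=> // -[i0 i] _ /=; rewrite !mxE ord1.
  by have := H i; rewrite !mxE ltr_norml => /andP[]; lra.
rewrite -ball_normE /= [ltLHS]/Num.norm /= mx_normrE => /bigmax_ltP[_ H] i.
by have := H (ord0, i) isT; rewrite !mxE ltr_norml => /andP[]; lra.
Qed.

Lemma closed_ball_compact x r : compact (closed_ball x r : set 'rV[R]_d).
Proof.
apply: bounded_closed_compact; last exact: closed_ball_closed.
have [r0|r0] := leP r 0.
  rewrite (_ : closed_ball x r = set0); first by exists 0; split; rewrite ?num_real// => M _ y [].
  by apply/seteqP; split=> // y; rewrite closed_ball0.
exists (`|x| + r); split; first by rewrite num_real.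
move=> M xM y; rewrite closed_ballE// /closed_ball_ /= => xy.
apply: le_trans (ltW xM); rewrite -lerBlDl; apply: le_trans xy.
by rewrite distrC; apply: lerB_dist.
Qed.

Lemma compact_bump K W : compact K -> open W -> K `<=` W ->
  exists theta, [/\ test_function W theta, forall x, 0 <= theta x <= 1 &
    forall x, K x -> 0 < theta x].
Proof.
move=> cK oW KW.
have Hr x : exists r : R, 0 < r /\ (K x -> closed_ball x r `<=` W).
  have [Kx|Kx] := pselect (K x); last by exists 1.
  have := oW; rewrite openE => /(_ x (KW x Kx)); rewrite /interior /= => /nbhs_closedballP[r].
  by exists r%:num.
have {Hr}[r Hr] := choice Hr.
have r0 x : 0 < r x by have [] := Hr x.
have rW x : K x -> closed_ball x (r x) `<=` W by have [] := Hr x.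
have := cK; rewrite compact_cover => /(_ _ K (fun x => ball x (r x))).
case=> [x _|x Kx|D DK Kcov]; first exact: ball_open.
  by exists x => //; exact: ballxx.
pose s := finmap.enum_fset D.
pose beta x := box_bump (\row_i (x 0 i - r x)) (\row_i (x 0 i + r x)).
have b0 x y : 0 <= beta x y by have /andP[] := box_bump01 (\row_i (x 0 i - r x)) (\row_i (x 0 i + r x)) y.
have b1 x y : beta x y <= 1 by have /andP[] := box_bump01 (\row_i (x 0 i - r x)) (\row_i (x 0 i + r x)) y.
have sD x : x \in s -> K x by move=> xs; apply/set_mem; apply: DK.
have tb x : K x -> test_function W (beta x).
  move=> Kx; split; first exact: smooth_box_bump.
  exists (closed_ball x (r x)); split; [exact: closed_ball_compact|exact: rW|].
  move=> y ny; apply/eqP; rewrite eq_le b0 andbT leNgt; apply/negP => /box_bump_gt0.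
  by rewrite box_ball// => /subset_closed_ball.
pose theta y := (size s).+1%:R^-1 * \sum_(x <- s) (if x \in s then beta x y else 0).
exists theta; split.
- apply: test_functionZ; apply: test_function_sum => x.
  case: (boolP (x \in s)) => [xs|_]; last exact: test_function0.
  exact/tb/sD.
- move=> y; rewrite /theta mulr_ge0 ?invr_ge0//=; last first.
    by apply: sumr_ge0 => x _; case: ifP.
  rewrite ler_pdivrMl// mulr1.
  apply: (@le_trans _ _ (\sum_(x <- s) 1)).
    by apply: ler_sum => x _; case: ifP.
  by rewrite big_const_seq count_predT iter_addr_0 ler_nat.
- move=> y Ky; rewrite mulr_gt0 ?invr_gt0//.
  have [x /= xD xy] := Kcov y Ky.
  have xs : x \in s by [].
  rewrite (big_rem x)//= xs ltr_wpDr//; last first.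
    by apply/box_bump_gt0; rewrite box_ball.
  by apply: sumr_ge0 => z _; case: ifP.
Qed.

(** As [m] grows, the first factor tends to the indicator of the union of the sets [0 < beta k], the
    second to that of [0 < theta]: powers send every positive value to 1 in the limit. The factor
    with [theta] supplies the compact support. *)
Definition saturate (theta : 'rV[R]_d -> R) (beta : nat -> 'rV[R]_d -> R) m x : R :=
  (1 - \prod_(k < m) (1 - beta k x) ^+ m) * (1 - (1 - theta x) ^+ m).

Lemma saturate_test W theta beta m : test_function W theta -> (forall k, smooth (beta k)) ->
  test_function W (saturate theta beta m).
Proof.
move=> [st [K [cK KW K0]]] sb.
have sm : smooth (fun x => 1 - \prod_(k < m) (1 - beta k x) ^+ m).
  apply: smoothB; first exact: smooth_cst.
  apply: smooth_prod => k; apply: smoothX; apply: smoothB => //; exact: smooth_cst.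
split.
  apply: smoothM => //; apply: smoothB; first exact: smooth_cst.
  by apply: smoothX; apply: smoothB => //; exact: smooth_cst.
by exists K; split=> // x Kx; rewrite /saturate K0// subr0 expr1n subrr mulr0.
Qed.

Lemma saturate01 theta beta m x : 0 <= theta x <= 1 -> (forall k, 0 <= beta k x <= 1) ->
  0 <= saturate theta beta m x <= 1.
Proof.
move=> /andP[t0 t1] b01.
have p01 : 0 <= \prod_(k < m) (1 - beta k x) ^+ m <= 1.
  rewrite prodr_ge0/=; last first.
    by move=> k _; rewrite exprn_ge0// subr_ge0; have /andP[] := b01 k.
  apply: prodr_ile1 => k _; have /andP[h0 h1] := b01 k.
  by rewrite exprn_ge0 ?subr_ge0//= exprn_ile1 ?subr_ge0// gerBl.
have q01 : 0 <= (1 - theta x) ^+ m <= 1.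
  by rewrite exprn_ge0 ?subr_ge0//= exprn_ile1 ?subr_ge0// gerBl.
move: p01 q01; rewrite /saturate; move: (\prod_(k < m) _) (_ ^+ m) => p q.
move=> /andP[p0 p1] /andP[q0 q1]; rewrite mulr_ge0 ?subr_ge0//=.
by rewrite -[leRHS]mulr1 ler_pM ?subr_ge0// gerBl.
Qed.

Lemma saturate_cvg theta beta x : 0 <= theta x <= 1 -> (forall k, 0 <= beta k x <= 1) ->
  saturate theta beta m x @[m --> \oo] -->
    (\1_[set y | 0 < theta y /\ exists k, 0 < beta k y] x : R).
Proof.
move=> /andP[t0 t1] b01; rewrite indicE.
have expcvg (y : R) : 0 < y <= 1 -> (1 - y) ^+ m @[m --> \oo] --> (0 : R).
  move=> /andP[y0 y1]; apply: cvg_expr; rewrite ger0_norm ?subr_ge0//.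
  by rewrite gtrBl.
have [tx|tx] := ltP 0 (theta x); last first.
  have {}tx : theta x = 0 by apply/eqP; rewrite eq_le t0 andbT.
  rewrite memNset => [|[]]; last by rewrite tx ltxx.
  rewrite (_ : (fun _ => _) = fun=> 0); first exact: cvg_cst.
  by apply/funext => m; rewrite /saturate tx subr0 expr1n subrr mulr0.
have ct : 1 - (1 - theta x) ^+ m @[m --> \oo] --> (1 : R).
  by rewrite -[X in _ --> X]subr0; apply: cvgB; [exact: cvg_cst|apply: expcvg; rewrite tx].
have [[k bk]|nb] := pselect (exists k, 0 < beta k x); last first.
  rewrite memNset => [|[_]//].
  rewrite (_ : (fun _ => _) = fun=> 0); first exact: cvg_cst.
  apply/funext => m; rewrite /saturate big1 ?subrr ?mul0r// => k _.
  rewrite (_ : beta k x = 0) ?subr0 ?expr1n//.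
  apply/eqP; rewrite eq_le; have /andP[-> _] := b01 k; rewrite andbT leNgt.
  by apply/negP => bk; apply: nb; exists k.
rewrite mem_set; last by split=> //; exists k.
rewrite -[X in _ --> X]mulr1; apply: cvgM => //.
rewrite -[X in _ --> X]subr0; apply: cvgB; first exact: cvg_cst.
have bk1 : beta k x <= 1 by have /andP[] := b01 k.
apply: (@squeeze_cvgr _ _ _ _ (cst 0) (fun m => (1 - beta k x) ^+ m)).
- near=> m; apply/andP; split.
    by apply: prodr_ge0 => j _; rewrite exprn_ge0// subr_ge0; have /andP[] := b01 j.
  have km : (k < m)%N by near: m; exact: nbhs_infty_gt.
  rewrite (bigD1 (Ordinal km))//= -[leRHS]mulr1 ler_wpM2l ?exprn_ge0 ?subr_ge0//.
  apply: prodr_ile1 => j _; have /andP[h0 h1] := b01 j.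
  by rewrite exprn_ge0 ?subr_ge0//= exprn_ile1 ?subr_ge0// gerBl.
- exact: cvg_cst.
- by apply: expcvg; rewrite bk.
Unshelve. all: by end_near. Qed.

End Bump.

Section RIndic.
Context {dsp : measure_display} {T : measurableType dsp} {R : realType}.
Variable mu : {measure set T -> \bar R}.

Lemma rint_indic (D E : set T) : measurable D -> measurable E -> (mu E < +oo)%E ->
  rint mu D (\1_E : T -> R).
Proof.
move=> mD mE fE; apply/integrableP; split; first exact/measurable_EFinP.
rewrite (eq_integral (EFin \o \1_E)); last first.
  by move=> x _ /=; rewrite ger0_norm// indicE.
by rewrite integral_indic// (le_lt_trans _ fE)// le_measure ?inE//; exact: measurableI.
Qed.

Lemma rint_support (D E : set T) (f : T -> R) : measurable D -> measurable E -> E `<=` D ->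
  (forall x, ~ E x -> f x = 0) -> rint mu E f <-> rint mu D f.
Proof.
move=> mD mE ED f0.
have HE := integrable_mkcond (mu := mu) (EFin \o f) mE.
have HD := integrable_mkcond (mu := mu) (EFin \o f) mD.
suff E0 : (EFin \o f) \_ E = (EFin \o f) \_ D.
  by rewrite E0 in HE; split=> [/HE/HD|/HD/HE].
apply/funext => x; rewrite /patch.
case: (boolP (x \in E)) => [/set_mem/ED/mem_set ->//|/negP xE].
by case: ifP => // _ /=; rewrite f0// => Ex; apply: xE; exact/mem_set.
Qed.

Lemma Rintegral_support (D E : set T) (f : T -> R) : E `<=` D ->
  (forall x, D x -> ~ E x -> f x = 0) -> \int[mu]_(x in E) f x = \int[mu]_(x in D) f x.
Proof.
move=> ED f0; rewrite Rintegral_mkcond [RHS]Rintegral_mkcond.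
congr (Rintegral mu setT _); apply/funext => x; rewrite /patch.
case: (boolP (x \in E)) => [/set_mem/ED/mem_set ->//|/negP xE].
by case: ifP => // /set_mem xD; rewrite f0// => Ex; apply: xE; exact/mem_set.
Qed.

End RIndic.

Section Density.
Context {R : realType} {d : nat}.
Implicit Types (psi f g : 'rV[R]_d -> R) (x z a b : 'rV[R]_d) (K W U E : set 'rV[R]_d).
Local Notation mu := (leb R d).
Local Notation lmeas A := (measurable (A : set (leb_space R d))).
Local Notation lmfun W f := (measurable_fun (W : set (leb_space R d)) (f : leb_space R d -> _)).

Lemma open_exhaust W : open W -> exists K : nat -> set 'rV[R]_d,
  [/\ forall n, compact (K n), forall n, K n `<=` W &
      forall x, W x -> \forall n \near \oo, K n x].
Proof.
move=> oW.
pose K (n : nat) := [set x : 'rV[R]_d | `|x| <= n%:R /\ forall y, ~ W y -> n.+1%:R^-1 <= `|x - y|].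
have ctsn y : continuous (fun x : 'rV[R]_d => `|x - y|).
  move=> x; apply: (@continuous_comp _ _ _ (fun x : 'rV[R]_d => x - y) (fun x => `|x|)).
    by apply: differentiable_continuous.
  exact: norm_continuous.
exists K; split=> [n|n x [_ H]|x Wx].
- apply: bounded_closed_compact.
    by exists n%:R; split=> [|M nM x [xn _]]; rewrite ?num_real//; apply: le_trans xn (ltW nM).
  rewrite (_ : K n = (fun x => `|x - 0|) @^-1` [set r | r <= n%:R] `&`
      \bigcap_(y in ~` W) ((fun x => `|x - y|) @^-1` [set r | n.+1%:R^-1 <= r])).
    apply: closedI.
      by apply: closed_comp => [x _|]; [exact: ctsn|exact: closed_le].
    apply: closed_bigI => y _.
    by apply: closed_comp => [x _|]; [exact: ctsn|exact: closed_ge].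
  by apply/seteqP; split=> x [] /=; rewrite ?subr0.
- apply: contrapT => nWx; have := H x nWx.
  by rewrite subrr normr0 leNgt invr_gt0 ltr0n.
- move: oW; rewrite openE => /(_ x Wx); rewrite /interior /= nbhs_ballP => -[e /= e0 be].
  near=> n; split.
    near: n; exists (Num.truncn `|x|).+1 => // m /= xm.
    by apply: le_trans (ltW (truncnS_gt _)) _; rewrite ler_nat.
  move=> y nWy; rewrite leNgt; apply/negP => h; apply: nWy; apply: be.
  rewrite -ball_normE /=; apply: lt_trans h _.
  near: n; exact: near_infty_natSinv_lt (PosNum e0).
Unshelve. all: by end_near. Qed.

Lemma leb_compact_fin K : compact K -> (mu K < +oo)%E.
Proof. by move=> cK; apply: leb_bounded; exact: compact_bounded. Qed.

Lemma test_function_sqint W psi : lmeas W -> test_function W psi -> sqint mu W psi.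
Proof.
move=> mW tp; have [M M0 HM] := test_function_bounded tp.
have [sp [K [cK KW K0]]] := tp.
have mp D : lmfun D psi by apply: leb_continuous; exact: smooth_continuous.
apply: Sqint; first exact: mp.
apply/(rint_support mu mW (leb_compact cK) KW); first by move=> x /K0 ->; rewrite expr0n.
apply: (@rint_bounded _ _ _ mu K _ (M ^+ 2)); [exact: leb_compact| |exact: leb_compact_fin|].
  exact: measurable_sqr (mp K).
by move=> x _; rewrite normrX lerXn2r ?nnegrE.
Qed.

Lemma open_betas U : open U -> exists beta : nat -> 'rV[R]_d -> R,
  [/\ forall k, smooth (beta k), forall k x, 0 <= beta k x <= 1 &
      forall x, U x <-> exists k, 0 < beta k x].
Proof.
move=> oU.
pose q2r (a : 'rV[rat]_d) : 'rV[R]_d := \row_i ratr (a 0 i).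
pose beta k x := if (unpickle k : option ('rV[rat]_d * 'rV[rat]_d)) is Some ab then
  if `[< box (q2r ab.1) (q2r ab.2) `<=` U >] then box_bump (q2r ab.1) (q2r ab.2) x else 0
  else 0.
exists beta; split.
- move=> k; rewrite /beta; case: (unpickle k) => [ab|]; last exact: smooth_cst.
  by case: (`[< _ >]); [exact: smooth_box_bump|exact: smooth_cst].
- move=> k x; rewrite /beta; case: (unpickle k) => [ab|]; last by rewrite lexx ler01.
  by case: ifP => _; [exact: box_bump01|rewrite lexx ler01].
move=> x; split=> [Ux|[k]]; last first.
  rewrite /beta; case: (unpickle k) => [ab|]; last by rewrite ltxx.
  by case: ifPn => [/asboolP H /box_bump_gt0/H//|]; rewrite ltxx.
move: oU; rewrite openE => /(_ x Ux); rewrite /interior /= nbhs_ballP => -[e /= e0 be].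
have Q (i : 'I_d) : exists ab : rat * rat,
    x 0 i - e < ratr ab.1 < x 0 i /\ x 0 i < ratr ab.2 < x 0 i + e.
  have [a /andP[a1 a2]] : exists a : rat, x 0 i - e < ratr a < x 0 i.
    have /rat_in_itvoo[q] : x 0 i - e < x 0 i by rewrite ltrBlDr ltrDl.
    by rewrite in_itv /= => ?; exists q.
  have [b /andP[b1 b2]] : exists a : rat, x 0 i < ratr a < x 0 i + e.
    have /rat_in_itvoo[q] : x 0 i < x 0 i + e by rewrite ltrDl.
    by rewrite in_itv /= => ?; exists q.
  by exists (a, b); rewrite a1 a2 b1 b2.
have {Q}[f Hf] := choice Q.
pose a := \row_i (f i).1; pose b := \row_i (f i).2.
exists (pickle (a, b)); rewrite /beta pickleK /= ifT.
  by apply/box_bump_gt0 => i; rewrite !mxE; have [/andP[_ ->] /andP[->]] := Hf i.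
apply/asboolP => y By; apply: be; rewrite -(box_ball _ e0) => i.
rewrite !mxE; have := By i; rewrite !mxE => /andP[y1 y2].
have [/andP[a1 a2] /andP[b1 b2]] := Hf i.
by apply/andP; split; lra.
Qed.

Lemma open_box a b : open (box a b).
Proof.
rewrite (_ : box a b = box_bump a b @^-1` [set r | 0 < r]).
  apply: open_comp => [x _|]; last exact: open_gt.
  exact: smooth_continuous (smooth_box_bump a b) x.
by apply/seteqP; split=> x; apply box_bump_gt0.
Qed.

Lemma leb_outer_box_vol E : (leb_outer E <= box_vol E)%E.
Proof.
apply: le_ereal_inf_tmp => _ [[-> ->]|[a [b [ab -> ->]]]]; first by rewrite outer_measure0.
exact: leb_box_le.
Qed.

(** A covering set of finite [box_vol] is empty or an open box, so a nearly optimal cover already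
    has an open union. *)
Lemma leb_outer_regular E (e : R) : (leb_outer E < +oo)%E -> 0 < e ->
  exists U, [/\ open U, E `<=` U & (leb_outer U <= leb_outer E + e%:E)%E].
Proof.
move=> fE e0.
have Efin : leb_outer E \is a fin_num by rewrite ge0_fin_numE// outer_measure_ge0.
have [_ [F [_ EF] <-] Fe0] := lb_ereal_inf_adherent e0 Efin.
have Fe : (\sum_(0 <= k <oo) box_vol (F k) < leb_outer E + e%:E)%E := Fe0.
have oF k : open (F k) /\ (leb_outer (F k) <= box_vol (F k))%E.
  have : (box_vol (F k) < +oo)%E.
    apply: le_lt_trans (lt_trans Fe _); last first.
      by rewrite -(fineK Efin) -EFinD ltry.
    rewrite (@nneseriesD1 R (fun k => box_vol (F k)) k xpredT (fun k _ => box_vol_ge0 _) isT).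
    by rewrite leeDl// nneseries_ge0// => *; exact: box_vol_ge0.
  rewrite /box_vol => /ereal_inf_lt[v [[F0 _]|[a [b [ab Fk _]]]] _]; rewrite -/(box_vol (F k)).
    by split; [rewrite F0; exact: open0|exact: leb_outer_box_vol].
  split.
    by rewrite Fk; exact: open_box.
  exact: leb_outer_box_vol.
exists (\bigcup_k F k); split => //; first by apply: bigcup_open => k _; have [] := oF k.
apply: le_trans (outer_measure_sigma_subadditive (@leb_outer R d) F) _.
apply: le_trans (ltW Fe); apply: lee_nneseries => [k _ _|k _]; first exact: outer_measure_ge0.
by have [] := oF k.
Qed.

Lemma L1loc_measurable W g : open W -> L1loc W g -> lmfun W g.
Proof.
move=> oW lg; have [K [cK KW WK]] := open_exhaust oW.
have -> : W = \bigcup_n K n.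
  apply/seteqP; split=> [x /WK [n _ H]|x [n _ /KW]//].
  by exists n => //; exact: H (leqnn n).
apply/measurable_fun_bigcup => n; first by apply: leb_compact.
exact: rint_measurable (lg _ (cK n) (KW n)).
Qed.

Lemma L1loc_mul W K g (h : 'rV[R]_d -> R) (M : R) : open W -> L1loc W g -> compact K -> K `<=` W ->
  lmfun W h -> (forall x, `|h x| <= M) -> (forall x, ~ K x -> h x = 0) ->
  rint mu W (fun x => h x * g x).
Proof.
move=> oW lg cK KW mh hM h0.
apply/(rint_support mu (leb_open oW) (leb_compact cK) KW).
  by move=> x /h0 ->; rewrite mul0r.
apply: (rint_mul_bounded (M := M)); [exact: leb_compact|exact: lg| |by move=> x _].
by apply: measurable_funS mh; [exact: leb_open|].
Qed.

Lemma measurable_bump_set U theta : open U -> smooth theta ->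
  lmeas [set y | 0 < theta y /\ U y].
Proof.
move=> oU st; apply: leb_open; rewrite (_ : [set _ | _] = (theta @^-1` [set r | 0 < r]) `&` U)//.
apply: openI => //; apply: open_comp => [x _|]; first exact: smooth_continuous.
exact: open_gt.
Qed.

Lemma Rintegral_test_open W U g theta : open W -> open U -> L1loc W g ->
  test_function W theta -> (forall x, 0 <= theta x <= 1) ->
  (forall psi, test_function W psi -> \int[mu]_(x in W) (psi x * g x) = 0) ->
  \int[mu]_(x in W) (\1_[set y | 0 < theta y /\ U y] x * g x) = 0.
Proof.
move=> oW oU lg tt t01 H.
have [beta [sb b01 Ub]] := open_betas oU.
have [st [K [cK KW K0]]] := tt.
have mW := leb_open oW; have mg := L1loc_measurable oW lg.
have sat m : test_function W (saturate theta beta m) by exact: saturate_test.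
have s01 m x : 0 <= saturate theta beta m x <= 1 by apply: saturate01.
have mV := measurable_bump_set oU st.
have dom : rint mu W (fun x => \1_K x * `|g x|).
  have : rint mu W (fun x => \1_K x * g x).
    apply: (L1loc_mul (K := K) (M := 1)) => //.
    - by apply: measurable_indic; exact: leb_compact.
    - by move=> x; rewrite indicE; case: (_ \in _); rewrite ?normr1 ?normr0.
    - by move=> x Kx; rewrite indicE memNset.
  move=> /integrable_norm; apply: eq_integrable => // x _ /=.
  by rewrite normrM (ger0_norm (x := \1_K x))// indicE.
pose V := [set y | 0 < theta y /\ U y].
have c1 x : W x -> saturate theta beta m x * g x @[m --> \oo] --> \1_V x * g x.
  move=> Wx; apply: cvgM; last exact: cvg_cst.
  have := @saturate_cvg _ _ theta beta x (t01 x) (fun k => b01 k x).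
  rewrite (_ : [set y | _] = V)//.
  by apply/seteqP; split=> y /= [ty /Ub].
have b1 m x : W x -> `|saturate theta beta m x * g x| <= \1_K x * `|g x|.
  move=> Wx; rewrite normrM ler_wpM2r//; have /andP[h0 h1] := s01 m x.
  rewrite ger0_norm// indicE; have [Kx|Kx] := pselect (K x); first by rewrite mem_set.
  by rewrite memNset// /saturate K0// subr0 expr1n subrr mulr0.
have m1 m : lmfun W (fun x => saturate theta beta m x * g x).
  apply: measurableM => //; apply: leb_continuous.
  exact: smooth_continuous (sat m).1.
have m2 : lmfun W (fun x => \1_V x * g x).
  by apply: measurableM => //; exact: measurable_indic.
have [_ cv] := Rintegral_dominated mW m1 m2 c1 dom b1.
apply: cvg_unique cv _; first exact: Rhausdorff.
rewrite (_ : (fun _ => _) = fun=> 0); first exact: cvg_cst.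
by apply/funext => m; exact: H.
Qed.

Lemma outer_G_delta E : lmeas E -> (mu E < +oo)%E -> exists U : nat -> set 'rV[R]_d,
  [/\ forall n, open (U n), forall n, E `<=` U n,
    forall n, U n.+1 `<=` U n & forall n, (mu (U n `\` E) <= (n.+1%:R^-1)%:E)%E].
Proof.
move=> mE fE.
have H n := @leb_outer_regular E n.+1%:R^-1 fE (ltac:(by rewrite invr_gt0)).
have [V HV] := choice H.
pose U n := \bigcap_(k in [set k | (k <= n)%N]) V k.
exists U; split.
- move=> n; rewrite /U; elim: n => [|n IH].
    rewrite (_ : \bigcap_(k in _) _ = V 0%N); first by have [] := HV 0%N.
    by apply/seteqP; split=> [x /(_ 0%N) /=|x Vx [|k]//]; exact.
  rewrite (_ : \bigcap_(k in _) _ = V n.+1 `&` \bigcap_(k in [set k | (k <= n)%N]) V k).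
    by apply: openI => //; have [] := HV n.+1.
  apply/seteqP; split=> [x H1|x [V1 H1] k /=].
    by split=> [|k /= kn]; apply: H1 => /=; [|exact: leqW].
  by rewrite leq_eqVlt => /orP[/eqP->//|]; exact: H1.
- by move=> n x Ex k _; have [_ + _] := HV k; exact.
- by move=> n x H1 k /= kn; apply: H1 => /=; exact: leqW.
- move=> n; have [oV EV VE] := HV n.
  have mV := leb_open oV.
  have le1 : (mu (U n `\` E) <= mu (V n `\` E))%E.
    by apply: le_outer_measure => x [/(_ n) Vx nE]; split=> //; apply: Vx => /=.
  apply: le_trans le1 _.
  have : (mu (V n) = mu (V n `&` E) + mu (V n `\` E))%E.
    by rewrite addeC; exact: measureDI.
  rewrite (_ : V n `&` E = E); last by apply/setIidr.
  move=> EQ; move: VE; rewrite -[leb_outer (V n)]/(mu (V n)) EQ.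
  rewrite leeD2lE//; rewrite ge0_fin_numE//; exact: outer_measure_ge0.
Qed.

(** Orthogonality passes from test functions to open sets by dominated convergence of [saturate],
    from there to the countable intersection [G] of open sets, and from [G] to [E], because [G]
    minus [E] is null. *)
Lemma Rintegral_test_set W K E g : open W -> compact K -> K `<=` W -> lmeas E -> E `<=` K ->
  L1loc W g ->
  (forall psi, test_function W psi -> \int[mu]_(x in W) (psi x * g x) = 0) ->
  \int[mu]_(x in E) g x = 0.
Proof.
move=> oW cK KW mE EK lg H.
have [theta [tt t01 tK]] := compact_bump cK oW KW.
have fE : (mu E < +oo)%E.
  by apply: le_lt_trans (leb_compact_fin cK); exact: le_outer_measure.
have [U [oU EU dU UE]] := outer_G_delta mE fE.
have [st [K' [cK' K'W K'0]]] := tt.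
have mW := leb_open oW; have mg := L1loc_measurable oW lg.
pose V n := [set y | 0 < theta y /\ U n y].
have mV n : lmeas (V n) := measurable_bump_set (oU n) st.
pose G := \bigcap_n V n.
have mG : lmeas G by exact: bigcap_measurable.
have VK' n : V n `<=` K'.
  by move=> x [tx _]; apply: contrapT => /K'0 t0; move: tx; rewrite t0 ltxx.
have dom : rint mu W (fun x => \1_K' x * `|g x|).
  have : rint mu W (fun x => \1_K' x * g x).
    apply: (L1loc_mul (K := K') (M := 1)) => //.
    - by apply: measurable_indic; exact: leb_compact.
    - by move=> x; rewrite indicE; case: (_ \in _); rewrite ?normr1 ?normr0.
    - by move=> x Kx; rewrite indicE memNset.
  move=> /integrable_norm; apply: eq_integrable => // x _ /=.
  by rewrite normrM (ger0_norm (x := \1_K' x))// indicE.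
have c1 x : W x -> \1_(V n) x * g x @[n --> \oo] --> \1_G x * g x.
  move=> Wx; apply: cvgM; last exact: cvg_cst.
  rewrite [X in _ --> X]indicE; have [Gx|Gx] := pselect (G x).
    rewrite mem_set// (_ : (fun _ => _) = fun=> 1); first exact: cvg_cst.
    by apply/funext => n; rewrite indicE mem_set//; exact: Gx.
  rewrite memNset//.
  have [n nV] : exists n, ~ V n x.
    by apply/existsNP => h; apply: Gx => k _; exact: h.
  apply: cvg_near_cst; near=> m; rewrite indicE memNset//.
  have nm : (n <= m)%N by near: m; exact: nbhs_infty_ge.
  move=> [tx Ux]; apply: nV; split=> //; move: Ux.
  by move: nm => /subnK <-; elim: (m - n)%N => // k IH; rewrite addSn => /dU.
have b1 n x : W x -> `|\1_(V n) x * g x| <= \1_K' x * `|g x|.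
  move=> Wx; rewrite normrM ler_wpM2r// !indicE; have [Vx|Vx] := pselect (V n x).
    by rewrite mem_set// mem_set ?normr1//; exact: VK' Vx.
  by rewrite memNset// normr0.
have m1 n : lmfun W (fun x => \1_(V n) x * g x).
  by apply: measurableM => //; exact: measurable_indic.
have m2 : lmfun W (fun x => \1_G x * g x).
  by apply: measurableM => //; exact: measurable_indic.
have [_ cv] := Rintegral_dominated mW m1 m2 c1 dom b1.
have G0 : \int[mu]_(x in W) (\1_G x * g x) = 0.
  apply: cvg_unique cv _; first exact: Rhausdorff.
  rewrite (_ : (fun _ => _) = fun=> 0); first exact: cvg_cst.
  by apply/funext => m; exact: Rintegral_test_open.
have EG : E `<=` G.
  by move=> x Ex n _; split; [exact/tK/EK|exact: EU].
rewrite -(setIidr (subset_trans EK KW)) -Rintegral_indic// -G0.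
have m3 : lmfun W (fun x => \1_E x * g x).
  by apply: measurableM => //; exact: measurable_indic.
apply: (ae_eq_Rintegral mW m3 m2).
exists (G `\` E); split; first exact: measurableD.
  apply/eqP; rewrite eq_le measure_ge0 andbT; apply/lee_addgt0Pr => e e0.
  rewrite add0e.
  have [n ne] : exists n : nat, n.+1%:R^-1 < e.
    by exists (Num.truncn e^-1); rewrite invf_plt ?posrE// truncnS_gt.
  apply: (@le_trans _ _ (mu (U n `\` E))).
    by apply: le_outer_measure => x [Gx nE]; split=> //; have [] := Gx n I.
  by apply: le_trans (UE n) _; rewrite lee_fin ltW.
move=> x /=; apply: contra_notP => nGE Wx; rewrite !indicE.
have [Ex|Ex] := pselect (E x); first by rewrite !mem_set//; exact: EG.
rewrite !memNset// => Gx; exact: nGE.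
Unshelve. all: by end_near. Qed.

(** On each compact set of an exhaustion, [g] has integral 0 over the measurable sets where it is
    positive and where it is negative; both are therefore null. *)
Lemma du_Bois_Reymond W g : open W -> L1loc W g ->
  (forall psi, test_function W psi -> \int[mu]_(x in W) (psi x * g x) = 0) ->
  {ae mu, forall x, W x -> g x = 0}.
Proof.
move=> oW lg H.
have [K [cK KW WK]] := open_exhaust oW.
have mg := L1loc_measurable oW lg.
have mK n : lmeas (K n) by exact: leb_compact.
have mgK n : lmfun (K n) g by apply: measurable_funS mg => //; exact: leb_open.
have key (h : 'rV[R]_d -> R) n : L1loc W h -> lmfun (K n) h ->
    (forall psi, test_function W psi -> \int[mu]_(x in W) (psi x * h x) = 0) ->
    mu.-negligible (K n `&` [set x | 0 < h x]).
  move=> lh mh Hh; set E := K n `&` _.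
  have mE : lmeas E by rewrite /E -[[set _ | _]]/(h @^-1` [set r | 0 < r]) -set_itvoy; exact: mh.
  have EK : E `<=` K n by move=> x [].
  have E0 := Rintegral_test_set oW (cK n) (KW n) mE EK lh Hh.
  have rE : rint mu E h by apply: rintS (lh _ (cK n) (KW n)).
  have := @Rintegral_ae0 _ _ _ mu E h mE rE _ _.
  have E1 x : E x -> 0 <= h x by move=> [_ /= /ltW].
  rewrite E0 => /(_ E1 (lexx _)); apply: negligibleS => x Ex /= /(_ Ex) h0.
  by case: Ex => _ /=; rewrite h0 ltxx.
have N1 n : mu.-negligible (K n `&` [set x | 0 < g x]) by exact: key.
have N2 n : mu.-negligible (K n `&` [set x | 0 < - g x]).
  apply: (key (fun x => - g x)).
  - move=> C cC CW; have := rintZ (-1) (leb_compact cC) (lg C cC CW).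
    apply: eq_integrable => [|x _ /=]; first exact: leb_compact.
    by rewrite mulN1r.
  - exact: measurable_funN.
  - move=> psi tp; have := H _ (test_functionZ (-1) tp).
    by under eq_Rintegral do rewrite mulN1r mulNr -mulrN.
have := negligible_bigcup (fun n => negligibleU (N1 n) (N2 n)).
apply: negligibleS => x /= /not_implyP[Wx /eqP gx].
have [n _ Kn] := WK x Wx; exists n => //.
by move: gx; rewrite neq_lt => /orP[gx|gx]; [right|left]; split; rewrite /= ?oppr_gt0//; apply: Kn => /=.
Qed.

Definition test_appr W f := forall e : R, 0 < e ->
  exists2 psi, test_function W psi & \int[mu]_(x in W) ((f x - psi x) ^+ 2) <= e.

Lemma sq_triangle W f g h : lmeas W -> sqint mu W (fun x => f x - g x) ->
  sqint mu W (fun x => g x - h x) ->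
  \int[mu]_(x in W) ((f x - h x) ^+ 2) <=
  2 * \int[mu]_(x in W) ((f x - g x) ^+ 2) + 2 * \int[mu]_(x in W) ((g x - h x) ^+ 2).
Proof.
move=> mW s1 s2; have [_ r1] := sqintE s1; have [_ r2] := sqintE s2.
have /sqintE[_ r3] : sqint mu W (fun x => f x - h x).
  rewrite (_ : (fun _ => _) = fun x => (f x - g x) + (g x - h x)); first exact: sqintD.
  by apply/funext => x; ring.
rewrite -!RintegralZl// -RintegralD//; [|exact: rintZ..].
apply: le_Rintegral => //; first by apply: rintD => //; exact: rintZ.
move=> x _; rewrite (_ : f x - h x = (f x - g x) + (g x - h x)); first exact: sqrD_le.
by ring.
Qed.

Lemma test_appr_limit W f (F : nat -> 'rV[R]_d -> R) : open W -> sqint mu W f ->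
  (forall n, sqint mu W (F n)) -> (forall n, test_appr W (F n)) ->
  \int[mu]_(x in W) ((f x - F n x) ^+ 2) @[n --> \oo] --> (0 : R) -> test_appr W f.
Proof.
move=> oW sf sF aF cv e e0; have mW := leb_open oW.
have e4 : 0 < e / 4 by lra.
have [n Hn] : exists n, \int[mu]_(x in W) ((f x - F n x) ^+ 2) <= e / 4.
  move/cvgr0Pnorm_le : cv => /(_ _ e4) [n _ /(_ n (leqnn n)) Hn].
  by exists n; apply: le_trans Hn; exact: ler_norm.
have [psi tp Hp] := aF n _ e4; exists psi => //.
have sp := test_function_sqint mW tp.
apply: le_trans (sq_triangle mW (sqintB mW sf (sF n)) (sqintB mW (sF n) sp)) _.
lra.
Qed.

Lemma test_apprD W f g : open W -> sqint mu W f -> sqint mu W g ->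
  test_appr W f -> test_appr W g -> test_appr W (fun x => f x + g x).
Proof.
move=> oW sf sg af ag e e0; have mW := leb_open oW.
have e4 : 0 < e / 4 by lra.
have [p tp Hp] := af _ e4; have [q tq Hq] := ag _ e4.
have sp := test_function_sqint mW tp; have sq := test_function_sqint mW tq.
exists (fun x => p x + q x); first exact: test_functionD.
have [_ r1] := sqintE (sqintB mW sf sp); have [_ r2] := sqintE (sqintB mW sg sq).
apply: (@le_trans _ _ (2 * \int[mu]_(x in W) ((f x - p x) ^+ 2) +
  2 * \int[mu]_(x in W) ((g x - q x) ^+ 2))); last by lra.
rewrite -!RintegralZl// -RintegralD//; [|exact: rintZ..].
apply: le_Rintegral => //.
- exact: sqint_sq (sqintB mW (sqintD mW sf sg) (sqintD mW sp sq)).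
- by apply: rintD => //; exact: rintZ.
- move=> x _; rewrite (_ : f x + g x - _ = (f x - p x) + (g x - q x)); first exact: sqrD_le.
  by ring.
Qed.

Lemma test_apprZ W (c : R) f : open W -> sqint mu W f -> test_appr W f ->
  test_appr W (fun x => c * f x).
Proof.
move=> oW sf af e e0; have mW := leb_open oW.
have c0 : 0 < c ^+ 2 + 1 by rewrite ltr_wpDl// sqr_ge0.
have [p tp Hp] := af (e / (c ^+ 2 + 1)) (divr_gt0 e0 c0).
have sp := test_function_sqint mW tp.
exists (fun x => c * p x); first exact: test_functionZ.
have [_ r1] := sqintE (sqintB mW sf sp).
rewrite (_ : (fun x => _) = fun x => c ^+ 2 * (f x - p x) ^+ 2); last first.
  by apply/funext => x; rewrite -mulrBr exprMn.
rewrite RintegralZl//; apply: (@le_trans _ _ ((c ^+ 2 + 1) * (e / (c ^+ 2 + 1)))).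
  apply: ler_pM => //; [exact: sqr_ge0| |by rewrite lerDl].
  by apply: Rintegral_ge0 => x _; exact: sqr_ge0.
by rewrite mulrC divfK// gt_eqF.
Qed.

Lemma test_appr_sum W I (s : seq I) (F : I -> 'rV[R]_d -> R) : open W ->
  (forall i, sqint mu W (F i)) -> (forall i, test_appr W (F i)) ->
  test_appr W (fun x => \sum_(i <- s) F i x).
Proof.
move=> oW sF aF; have mW := leb_open oW; elim: s => [|i s IH].
  move=> e e0; exists (fun=> 0); first exact: test_function0.
  rewrite (_ : (fun x => _) = fun=> 0); first by rewrite Rintegral_cst// mul0r ltW.
  by apply/funext => x; rewrite big_nil subrr expr0n.
rewrite (_ : (fun x => _) = fun x => F i x + \sum_(i <- s) F i x).
  by apply: test_apprD => //; exact: sqint_sum.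
by apply/funext => x; rewrite big_cons.
Qed.

Lemma sqint_indic W E : lmeas W -> lmeas E -> (mu E < +oo)%E -> sqint mu W (\1_E).
Proof.
move=> mW mE fE; apply: Sqint; first exact: measurable_indic.
rewrite (_ : (fun x => _) = \1_E); first exact: rint_indic.
by apply/funext => x; rewrite indicE; case: (_ \in _); rewrite ?expr1n ?expr0n.
Qed.

Lemma test_appr_indic W K E : open W -> compact K -> K `<=` W -> lmeas E -> E `<=` K ->
  test_appr W (\1_E).
Proof.
move=> oW cK KW mE EK e e0.
have [theta [tt t01 tK]] := compact_bump cK oW KW.
have fE : (mu E < +oo)%E.
  by apply: le_lt_trans (leb_compact_fin cK); exact: le_outer_measure.
have [U [oU EU _ UE]] := outer_G_delta mE fE.
have [n ne] : exists n : nat, n.+1%:R^-1 < e.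
  by exists (Num.truncn e^-1); rewrite invf_plt ?posrE// truncnS_gt.
have [st [K' [cK' K'W K'0]]] := tt.
have mW := leb_open oW; have mK' := leb_compact cK'.
have [beta [sb b01 Ub]] := open_betas (oU n).
pose psi m := saturate theta beta m.
have tpsi m : test_function W (psi m) by exact: saturate_test.
have p01 m x : 0 <= psi m x <= 1 by exact: saturate01.
pose V := [set y | 0 < theta y /\ U n y].
have mV : lmeas V := measurable_bump_set (oU n) st.
have EV : E `<=` V by move=> x Ex; split; [exact/tK/EK|exact: EU].
have VK' : V `<=` K'.
  by move=> x [tx _]; apply: contrapT => /K'0 t0; move: tx; rewrite t0 ltxx.
have c1 x : W x -> (\1_E x - psi m x) ^+ 2 @[m --> \oo] --> ((\1_E x - \1_V x) ^+ 2 : R).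
  move=> Wx.
  have c0 : psi m x @[m --> \oo] --> (\1_V x : R).
    have := @saturate_cvg _ _ theta beta x (t01 x) (fun k => b01 k x).
    rewrite (_ : [set y | _] = V)//.
    by apply/seteqP; split=> y /= [ty /Ub].
  have c2 : \1_E x - psi m x @[m --> \oo] --> (\1_E x - \1_V x : R).
    by apply: cvgB => //; exact: cvg_cst.
  exact: (cvgM c2 c2).
have b1 m x : W x -> `|(\1_E x - psi m x) ^+ 2| <= \1_K' x.
  move=> Wx; rewrite normrX indicE [leRHS]indicE; have /andP[h0 h1] := p01 m x.
  have [Kx|Kx] := pselect (K' x).
    rewrite (mem_set Kx) exprn_ile1//.
    by case: (x \in E) => /=; rewrite ler_norml; apply/andP; split; lra.
  have nE : ~ E x by move=> /EV /VK'.
  by rewrite !memNset// /psi /saturate K'0// subr0 expr1n subrr mulr0 subrr normr0 expr0n.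
have mpsi m : lmfun W (psi m) by apply: leb_continuous; exact: smooth_continuous (tpsi m).1.
have m1 m : lmfun W (fun x => (\1_E x - psi m x) ^+ 2).
  by apply: measurable_sqr; apply: measurable_funB => //; exact: measurable_indic.
have m2 : lmfun W (fun x => (\1_E x - \1_V x) ^+ 2 : R).
  by apply: measurable_sqr; apply: measurable_funB; exact: measurable_indic.
have dom : rint mu W (\1_K' : 'rV[R]_d -> R).
  by apply: rint_indic => //; exact: leb_compact_fin.
have [_ cv] := Rintegral_dominated mW m1 m2 c1 dom b1.
have lim_lt : \int[mu]_(x in W) ((\1_E x - \1_V x) ^+ 2) < e.
  apply: le_lt_trans ne; rewrite -lee_fin /Rintegral.
  rewrite (@eq_integral _ (leb_space R d) R mu W (fun x => (\1_(V `\` E) (x : leb_space R d))%:E : \bar R)); last first.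
    move=> x _; rewrite !indicE; congr EFin.
    have [Ex|Ex] := pselect (E x).
      by rewrite (mem_set Ex) (mem_set (EV _ Ex)) memNset ?subrr ?expr0n// => -[].
    have [Vx|Vx] := pselect (V x).
      by rewrite (memNset Ex) (mem_set Vx) mem_set//= sub0r sqrrN expr1n.
    by rewrite (memNset Ex) (memNset Vx) memNset ?subrr ?expr0n// => -[].
  rewrite integral_indic//; last exact: measurableD.
  have le1 : (mu ((V `\` E) `&` W) <= n.+1%:R^-1%:E)%E.
    by apply: le_trans (UE n); apply: le_outer_measure => x [[[_ Ux] nE] _].
  rewrite fineK//; rewrite ge0_fin_numE; first by apply: le_lt_trans le1 (ltry _).
  exact: measure_ge0.
have [N _ HN] := cvgr_lt _ cv _ lim_lt.
by exists (psi N) => //; apply: ltW; exact: HN (leqnn N).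
Qed.

Lemma cvg_sqr0 {K : realType} (a : nat -> K) : a n @[n --> \oo] --> 0 -> a n ^+ 2 @[n --> \oo] --> 0.
Proof.
move=> a0; rewrite (_ : (fun n => a n ^+ 2) = a \* a); last by apply/funext => n; rewrite expr2.
by rewrite -[X in _ --> X](mulr0 (0 : K)); exact: cvgM.
Qed.

Lemma count_ltn M t : (\sum_(k < M) (k < t)%N)%N = minn M t.
Proof.
elim: M => [|M IH]; first by rewrite big_ord0 min0n.
rewrite big_ord_recr /= IH; case: (ltnP M t) => h; lia.
Qed.

(** With $n = N+1$, [S] is $\lfloor ny \rfloor / n$ cut off at $n$. As a sum of indicators of
    superlevel sets it reduces the approximation of functions to that of sets. *)
Lemma levels_approx (N : nat) (y : R) : 0 <= y ->
  let S := \sum_(k < N.+1 * N.+1) N.+1%:R^-1 * ((k.+1%:R <= N.+1%:R * y)%R)%:R in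
  0 <= S <= y /\ (y <= N.+1%:R -> y - N.+1%:R^-1 <= S).
Proof.
move=> y0 S.
have N0 : 0 < N.+1%:R :> R by rewrite ltr0n.
have Ny : 0 <= N.+1%:R * y by rewrite mulr_ge0.
pose t := Num.truncn (N.+1%:R * y).
have ES : N.+1%:R * S = (minn (N.+1 * N.+1) t)%:R.
  rewrite /S -mulr_sumr mulrA mulfV ?gt_eqF// mul1r -count_ltn natr_sum.
  by apply: eq_bigr => k _; rewrite -truncn_gt_nat.
have /andP[tl tu] := truncn_itv Ny; rewrite -/t in tl tu.
have S0 : 0 <= S by rewrite -(pmulr_rge0 _ N0) ES.
split.
  rewrite S0 -(ler_pM2l N0) ES; apply: le_trans tl; rewrite ler_nat geq_minr//.
move=> yN; rewrite -(ler_pM2l N0) ES mulrBr mulfV ?gt_eqF//.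
have -> : minn (N.+1 * N.+1) t = t.
  apply/minn_idPr; rewrite -(ler_nat R); apply: le_trans tl _.
  by rewrite natrM ler_wpM2l.
by rewrite lerBlDr natr1 ltW.
Qed.

Let test_appr_ge0 W f : open W -> sqint mu W f -> (forall x, 0 <= f x) -> test_appr W f.
Proof.
move=> oW sf f0; have [mf rf] := sqintE sf; have mW := leb_open oW.
have [K [cK KW WK]] := open_exhaust oW.
pose E n k := K n `&` [set x | k.+1%:R <= n.+1%:R * f x].
have mE n k : lmeas (E n k).
  have mK : lmeas (K n) := leb_compact (cK n).
  have mfK : lmfun (K n) (fun x => n.+1%:R * f x).
    by apply: measurable_funM => //; apply: measurable_funS mf.
  rewrite /E -[[set _ | _]]/((fun x => n.+1%:R * f x) @^-1` [set r | k.+1%:R <= r]) -set_itvcy.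
  exact: mfK.
have EK n k : E n k `<=` K n by move=> x [].
have fE n k : (mu (E n k) < +oo)%E.
  by apply: le_lt_trans (leb_compact_fin (cK n)); exact: le_outer_measure.
pose F n (x : 'rV[R]_d) : R := \sum_(k < n.+1 * n.+1) n.+1%:R^-1 * \1_(E n k) x.
have FE n x : F n x = if x \in K n then \sum_(k < n.+1 * n.+1) n.+1%:R^-1 * ((k.+1%:R <= n.+1%:R * f x)%R)%:R else 0.
  rewrite /F; case: ifPn => [xK|xK].
    by apply: eq_bigr => k _; rewrite indicE in_setI xK /=; congr (_ * (_ : bool)%:R); exact: asboolb.
  by rewrite big1// => k _; rewrite indicE in_setI (negbTE xK) mulr0.
have Fb n x : 0 <= F n x <= f x.
  rewrite FE; case: ifP => _; last by rewrite lexx f0.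
  by have [] := levels_approx n (f0 x).
have sF n : sqint mu W (F n).
  by apply: sqint_sum => // k; apply: sqintZ => //; exact: sqint_indic.
have c1 x : W x -> (f x - F n x) ^+ 2 @[n --> \oo] --> (0 : R).
  move=> Wx.
  have c0 : f x - F n x @[n --> \oo] --> (0 : R).
    apply: (@squeeze_cvgr _ _ _ _ (cst 0) (fun n => n.+1%:R^-1)).
    - near=> n; have /andP[_ h1] := Fb n x; rewrite subr_ge0 h1 /= FE mem_set.
        have [_ /(_ _)] := levels_approx n (f0 x).
        rewrite lerBlDr lerBlDl => -> //.
        apply: (@le_trans _ _ (n%:R)); last by rewrite ler_nat.
        near: n; exists (Num.truncn (f x)).+1 => // m /= xm.
        by apply: le_trans (ltW (truncnS_gt _)) _; rewrite ler_nat.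
      by near: n; exact: WK.
    - exact: cvg_cst.
    - exact: cvg_harmonic.
    exact: (@cvg_sqr0 R (fun n => f x - F n x)).
apply: (test_appr_limit oW sf sF).
  move=> n; apply: test_appr_sum => // k; first by apply: sqintZ => //; exact: sqint_indic.
  apply: test_apprZ => //; first exact: sqint_indic.
  exact: (test_appr_indic oW (cK n) (KW n)).
have m1 n : lmfun W (fun x => (f x - F n x) ^+ 2).
  by apply: measurable_sqr; apply: measurable_funB mf _; exact: sqint_measurable (sF n).
have b1 n x : W x -> `|(f x - F n x) ^+ 2| <= f x ^+ 2.
  move=> _; have /andP[h0 h1] := Fb n x.
  by rewrite ger0_norm ?sqr_ge0// lerXn2r ?nnegrE ?subr_ge0// gerBl.
have m2 : lmfun W (fun _ : 'rV[R]_d => 0 : R) by exact: measurable_cst.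
have [_ cv] := Rintegral_dominated mW m1 m2 c1 rf b1.
by move: cv; rewrite Rintegral_cst// mul0r.
Unshelve. all: by end_near. Qed.

Theorem test_function_dense W f : open W -> sqint mu W f -> test_appr W f.
Proof.
move=> oW sf; have [mf rf] := sqintE sf; have mW := leb_open oW.
pose p x := Num.max (f x) 0; pose q x := Num.max (- f x) 0.
have mp : lmfun W p by apply: measurable_maxr => //; exact: measurable_cst.
have mq : lmfun W q.
  by apply: measurable_maxr; [exact: measurable_funN|exact: measurable_cst].
have sp : sqint mu W p.
  apply: (sqint_le mW mp _ sf) => x _; rewrite /p.
  by have [h|h] := leP (f x) 0; rewrite ?normr0.
have sq : sqint mu W q.
  apply: (sqint_le mW mq _ sf) => x _; rewrite /q.
  by have [h|h] := leP (- f x) 0; rewrite ?normr0 ?normrN.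
rewrite (_ : f = fun x => p x + -1 * q x); last first.
  by apply/funext => x; rewrite /p /q; case: leP => h1; case: leP => h2; lra.
apply: test_apprD => //; first exact: sqintZ.
  by apply: test_appr_ge0 => // x; rewrite le_max lexx orbT.
by apply: test_apprZ => //; apply: test_appr_ge0 => // x; rewrite le_max lexx orbT.
Qed.

(** $\|g\|^2 = 2\langle g,\psi\rangle - \|\psi\|^2 + \|g-\psi\|^2$ for every $\psi$, and the last
    term can be made small. An $L^2$ bound thus follows from knowledge of the pairings with test
    functions alone. *)
Lemma sqint_test_bound W g (k : R) : open W -> sqint mu W g ->
  (forall psi, test_function W psi ->
    2 * \int[mu]_(x in W) (g x * psi x) <= k + \int[mu]_(x in W) (psi x ^+ 2)) ->
  \int[mu]_(x in W) (g x ^+ 2) <= k.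
Proof.
move=> oW sg H; have mW := leb_open oW.
apply/ler_addgt0Pr => e e0.
have [psi tp Hp] := test_function_dense oW sg e0.
have sp := test_function_sqint mW tp.
have rg := sqint_sq sg; have rp := sqint_sq sp; have rgp := sqint_rint mW sg sp.
have rd := sqint_sq (sqintB mW sg sp).
have -> : \int[mu]_(x in W) (g x ^+ 2) = 2 * \int[mu]_(x in W) (g x * psi x)
    - \int[mu]_(x in W) (psi x ^+ 2) + \int[mu]_(x in W) ((g x - psi x) ^+ 2).
  rewrite -RintegralZl// -RintegralB//; last exact: rintZ.
  rewrite -RintegralD//; last by apply: rintB => //; exact: rintZ.
  by apply: eq_Rintegral => x _; ring.
by have := H _ tp; lra.
Qed.

End Density.

(** * Weak gradients *)

Section Quadratic.
Context {dsp : measure_display} {T : measurableType dsp} {R : realType}.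
Variable mu : {measure set T -> \bar R}.

Lemma rint_norm (D : set T) (f : T -> R) : rint mu D f -> rint mu D (fun x => `|f x|).
Proof. exact: integrable_abse. Qed.

Lemma aeS (P Q : T -> Prop) : (forall x, P x -> Q x) ->
  {ae mu, forall x, P x} -> {ae mu, forall x, Q x}.
Proof. by move=> PQ; apply: filterS. Qed.

Lemma aeI (P Q : T -> Prop) : {ae mu, forall x, P x} -> {ae mu, forall x, Q x} ->
  {ae mu, forall x, P x /\ Q x}.
Proof. by apply: filterI. Qed.

Lemma ae_forall (I : finType) (P : I -> T -> Prop) : (forall i, {ae mu, forall x, P i x}) ->
  {ae mu, forall x, forall i, P i x}.
Proof. by move=> H; apply: filter_forall. Qed.

Lemma Rintegral_CS (D : set T) (f g : T -> R) : measurable D -> sqint mu D f -> sqint mu D g ->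
  (\int[mu]_(x in D) (f x * g x)) ^+ 2 <=
  \int[mu]_(x in D) (f x ^+ 2) * \int[mu]_(x in D) (g x ^+ 2).
Proof.
move=> mD sf sg.
have rf := sqint_sq sf; have rg := sqint_sq sg; have rfg := sqint_rint mD sf sg.
set a := \int[mu]_(x in D) (f x * g x); set b := \int[mu]_(x in D) (f x ^+ 2).
set c := \int[mu]_(x in D) (g x ^+ 2).
have b0 : 0 <= b by apply: Rintegral_ge0 => x _; exact: sqr_ge0.
have c0 : 0 <= c by apply: Rintegral_ge0 => x _; exact: sqr_ge0.
have Q t : 0 <= b - 2 * t * a + t ^+ 2 * c.
  have -> : b - 2 * t * a + t ^+ 2 * c = \int[mu]_(x in D) ((f x - t * g x) ^+ 2).
    rewrite -!RintegralZl// -RintegralB//; last exact: rintZ.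
    rewrite -RintegralD//; [|by apply: rintB => //; exact: rintZ|exact: rintZ].
    by apply: eq_Rintegral => x _; ring.
  by apply: Rintegral_ge0 => x _; exact: sqr_ge0.
have [c1|c1] := eqVneq c 0.
  rewrite c1 mulr0 (_ : a = 0) ?expr0n//.
  apply/eqP/negPn/negP => an0; have := Q ((b + 1) / (2 * a)).
  rewrite c1 mulr0 addr0 (_ : 2 * _ * a = b + 1); last by field.
  by rewrite opprD addrA subrr sub0r oppr_ge0 ler10.
have cp : 0 < c by rewrite lt_neqAle eq_sym c1.
have := Q (a / c); rewrite (_ : _ - _ + _ = (b * c - a ^+ 2) / c); last by field.
by rewrite pmulr_lge0 ?invr_gt0// subr_ge0.
Qed.

Lemma Rintegral_CS_le (D : set T) (f g : T -> R) (A B : R) : measurable D ->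
  sqint mu D f -> sqint mu D g -> 0 <= A -> 0 <= B ->
  \int[mu]_(x in D) (f x ^+ 2) <= A ^+ 2 -> \int[mu]_(x in D) (g x ^+ 2) <= B ^+ 2 ->
  `|\int[mu]_(x in D) (f x * g x)| <= A * B.
Proof.
move=> mD sf sg A0 B0 fA gB; rewrite -ler_sqr ?nnegrE ?mulr_ge0//.
rewrite real_normK ?num_real// exprMn (le_trans (Rintegral_CS mD sf sg))//.
by apply: ler_pM => //; apply: Rintegral_ge0 => x _; exact: sqr_ge0.
Qed.

Lemma Rintegral_AMGM (D : set T) (f g : T -> R) (s : R) : measurable D ->
  sqint mu D f -> sqint mu D g -> 0 < s ->
  2 * \int[mu]_(x in D) (f x * g x) <=
  s * \int[mu]_(x in D) (f x ^+ 2) + s^-1 * \int[mu]_(x in D) (g x ^+ 2).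
Proof.
move=> mD sf sg s0.
have rf := sqint_sq sf; have rg := sqint_sq sg; have rfg := sqint_rint mD sf sg.
rewrite -!RintegralZl// -RintegralD//; [|exact: rintZ|exact: rintZ].
apply: le_Rintegral => //; [exact: rintZ|by apply: rintD => //; exact: rintZ|].
move=> x _; have := sqr_ge0 (s * f x - g x); rewrite -(@ler_pM2l _ s^-1) ?invr_gt0// mulr0.
rewrite (_ : s^-1 * _ = s * f x ^+ 2 + s^-1 * g x ^+ 2 - 2 * (f x * g x)); last by field; rewrite gt_eqF.
by rewrite subr_ge0.
Qed.

End Quadratic.

(** A quadratic remainder bound takes the place of differentiation under the integral sign. *)
Lemma is_derive_quad {R : realType} (F : R -> R) (t D C : R) :
  (forall h, `|F (t + h) - F t - h * D| <= C * h ^+ 2) -> is_derive t 1 F D.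
Proof.
move=> H.
have C0 : 0 <= C by have := H 1; rewrite expr1n mulr1; apply: le_trans.
suff cv : h^-1 *: (F (h *: 1 + t) - F t) @[h --> 0^'] --> D.
  by apply: DeriveDef; [apply/cvg_ex; exists D|exact: cvg_lim cv].
apply/cvgrPdist_le => e e0; near=> h.
have h0 : h != 0 by near: h; exact: nbhs_dnbhs_neq.
have hC : `|h| * (C + 1) <= e.
  rewrite -ler_pdivlMr ?ltr_wpDl//; near: h.
  by apply: dnbhs0_le; rewrite divr_gt0// ltr_wpDl.
have := H h; rewrite [h *: 1]mulr1 [h + t]addrC => Hh.
have -> : D - h^-1 *: (F (t + h) - F t) = - (h^-1 * (F (t + h) - F t - h * D)).
  by rewrite /GRing.scale /=; field.
rewrite normrN normrM normfV ler_pdivrMl ?normr_gt0//.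
apply: le_trans Hh _; rewrite -[h ^+ 2]real_normK ?num_real//.
rewrite expr2 mulrA [leRHS]mulrC; apply: ler_pM => //; first by rewrite mulr_ge0.
by apply: le_trans hC; rewrite mulrC ler_wpM2l// lerDl.
Unshelve. all: by end_near. Qed.

Section WeakGradient.
Context {R : realType} {d : nat}.
Implicit Types (W G : set 'rV[R]_d) (u v psi : 'rV[R]_d -> R) (z : 'rV[R]_d)
  (g : 'rV[R]_d -> 'rV[R]_d).
Local Notation mu := (leb R d).
Local Notation lmeas A := (measurable (A : set (leb_space R d))).
Local Notation lmfun W f := (measurable_fun (W : set (leb_space R d)) (f : leb_space R d -> _)).

Lemma L2P W u : lmeas W -> L2 W u <-> sqint mu W u.
Proof.
move=> mW; split=> [[mu_ fu]|su].
  apply: Sqint => //; apply/integrableP; split; first exact/measurable_EFinP/measurable_sqr.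
  by apply: le_lt_trans fu; under eq_integral do rewrite /= ger0_norm ?sqr_ge0//.
have [mu_ /integrableP[_ fu]] := sqintE su; split=> //; apply: le_lt_trans fu.
by under [leRHS]eq_integral do rewrite /= ger0_norm ?sqr_ge0//.
Qed.

Lemma sqint_L1loc W u : lmeas W -> sqint mu W u -> L1loc W u.
Proof.
move=> mW su K cK KW; have mK := leb_compact cK.
apply: (sqint_rint_finite mK (leb_compact_fin cK)).
exact: sqintS mK mW KW su.
Qed.

Lemma weak_grad_ae W u g g' i : open W -> is_weak_grad W u g -> is_weak_grad W u g' ->
  {ae mu, forall x, W x -> g x 0 i = g' x 0 i}.
Proof.
move=> oW /(_ i)[lg Hg] /(_ i)[lg' Hg'].
have lB : L1loc W (fun x => g x 0 i - g' x 0 i).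
  move=> K cK KW; have mK := leb_compact cK.
  by apply: (rintB mK); [exact: lg|exact: lg'].
have := du_Bois_Reymond oW lB; move=> H.
suff /H : forall psi, test_function W psi ->
    \int[mu]_(x in W) (psi x * (g x 0 i - g' x 0 i)) = 0.
  by apply: aeS => x Hx Wx; apply/eqP; rewrite -subr_eq0; apply/eqP; exact: Hx.
move=> psi tp; have mW := leb_open oW.
have [sp [K [cK KW K0]]] := tp.
have mK := leb_compact cK.
have [M M0 HM] := test_function_bounded tp.
have r1 h : L1loc W h -> rint mu W (fun x => psi x * h x).
  move=> lh; apply/(rint_support mu mW mK KW); first by move=> x /K0 ->; rewrite mul0r.
  apply: (@rint_mul_bounded _ _ _ mu _ _ _ M) => //; first exact: lh.
  by apply: leb_continuous; exact: smooth_continuous.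
have -> : \int[mu]_(x in W) (psi x * (g x 0 i - g' x 0 i)) =
    \int[mu]_(x in W) (psi x * g x 0 i) - \int[mu]_(x in W) (psi x * g' x 0 i).
  rewrite -RintegralB//; [|exact: r1|exact: r1].
  by apply: eq_Rintegral => x _; rewrite mulrBr.
have E h : \int[mu]_(x in W) (psi x * h x) = \int[mu]_(x in W) (h x * psi x).
  by apply: eq_Rintegral => x _; rewrite mulrC.
by rewrite !E -[X in X - _]opprK -[X in _ - X]opprK -Hg// -Hg'// subrr.
Qed.

(** [H1] with an explicit gradient. The chosen [grad W u] is linear in [u] only up to null sets,
    whereas the pairs [(u, g)] can be added, scaled and restricted pointwise. *)
Definition sobolev W u g := [/\ sqint mu W u, forall i, sqint mu W (fun x => g x 0 i)
  & forall i psi, test_function W psi ->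
    \int[mu]_(x in W) (u x * partial i psi x) = - \int[mu]_(x in W) (g x 0 i * psi x)].

Lemma sobolev_weak W u g : open W -> sobolev W u g -> is_weak_grad W u g.
Proof.
move=> oW [su sg H] i; split; last exact: H.
by apply: sqint_L1loc => //; exact: leb_open.
Qed.

Lemma sobolev_H1 W u g : open W -> sobolev W u g -> H1 W u.
Proof.
move=> oW S; have [su sg H] := S; have mW := leb_open oW; split; first exact/L2P.
by exists g; split=> [|i]; [exact: sobolev_weak|apply/L2P].
Qed.

Lemma weak_grad_grad W u g : is_weak_grad W u g -> is_weak_grad W u (grad W u).
Proof. by move=> H; apply: (xgetPex (fun=> 0 : 'rV[R]_d) (ex_intro _ g H)). Qed.

Lemma weak_grad_measurable W u g i : open W -> is_weak_grad W u g -> lmfun W (fun x => g x 0 i).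
Proof. by move=> oW /(_ i)[lg _]; exact: L1loc_measurable. Qed.

Lemma H1_sobolev W u : open W -> H1 W u -> sobolev W u (grad W u).
Proof.
move=> oW [/(L2P _ (leb_open oW)) su [g [wg lg]]]; have mW := leb_open oW.
have wgr := weak_grad_grad wg; split=> // i; last by have [] := wgr i.
apply: (ae_eq_sqint mW (weak_grad_measurable i oW wgr) (weak_grad_ae i oW wg wgr)).
exact/(L2P _ mW).
Qed.

Lemma sobolev_grad W u g : open W -> sobolev W u g ->
  {ae mu, forall x, W x -> grad W u x = g x}.
Proof.
move=> oW S; have wg := sobolev_weak oW S; have wgr := weak_grad_grad wg.
have H : {ae mu, forall x i, W x -> grad W u x 0 i = g x 0 i}.
  by apply: ae_forall => i; exact: weak_grad_ae wgr wg.
by apply: aeS H => x H Wx; apply/rowP => i; exact: H.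
Qed.

Lemma sobolevD W u v g h : lmeas W -> sobolev W u g -> sobolev W v h ->
  sobolev W (fun x => u x + v x) (fun x => g x + h x).
Proof.
move=> mW [su sg Hg] [sv sh Hh]; split; first exact: sqintD.
  move=> i; under eq_fun do rewrite mxE; exact: sqintD.
move=> i psi tp.
have sp := test_function_sqint mW tp; have sdp := test_function_sqint mW (test_function_partial i tp).
have := Hg i _ tp; have := Hh i _ tp => E1 E2.
transitivity (\int[mu]_(x in W) (u x * partial i psi x) + \int[mu]_(x in W) (v x * partial i psi x)).
  rewrite -RintegralD//; [|exact: sqint_rint|exact: sqint_rint].
  by apply: eq_Rintegral => x _; rewrite mulrDl.
rewrite E1 E2 -opprD -RintegralD//; [|exact: sqint_rint|exact: sqint_rint].
by congr (- _); apply: eq_Rintegral => x _; rewrite mxE mulrDl.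
Qed.

Lemma sobolevZ W c u g : lmeas W -> sobolev W u g ->
  sobolev W (fun x => c * u x) (fun x => c *: g x).
Proof.
move=> mW [su sg Hg]; split; first exact: sqintZ.
  move=> i; under eq_fun do rewrite mxE; exact: sqintZ.
move=> i psi tp.
have sp := test_function_sqint mW tp; have sdp := test_function_sqint mW (test_function_partial i tp).
transitivity (c * \int[mu]_(x in W) (u x * partial i psi x)).
  rewrite -RintegralZl//; last exact: sqint_rint.
  by apply: eq_Rintegral => x _; rewrite mulrA.
rewrite Hg// mulrN -RintegralZl//; last exact: sqint_rint.
by congr (- _); apply: eq_Rintegral => x _; rewrite mxE mulrA.
Qed.

Lemma sobolev0 W : lmeas W -> sobolev W (fun=> 0) (fun=> 0).
Proof.
move=> mW; split; first exact: sqint0.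
  by move=> i; under eq_fun do rewrite mxE; exact: sqint0.
move=> i psi _; under eq_Rintegral do rewrite mul0r.
by under [in RHS]eq_Rintegral do rewrite mxE mul0r; rewrite Rintegral_cst// mul0r oppr0.
Qed.

Lemma sobolev_sum W (I : eqType) (s : seq I) (c : I -> R) (u : I -> 'rV[R]_d -> R)
    (g : I -> 'rV[R]_d -> 'rV[R]_d) :
  lmeas W -> (forall i, i \in s -> sobolev W (u i) (g i)) ->
  sobolev W (fun x => \sum_(i <- s) c i * u i x) (fun x => \sum_(i <- s) c i *: g i x).
Proof.
move=> mW; elim: s => [|i s IH] H.
  under eq_fun do rewrite big_nil; rewrite (_ : (fun x => _ : 'rV[R]_d) = fun=> 0); first exact: sobolev0.
  by apply/funext => x; rewrite big_nil.
rewrite (_ : (fun x => _ : R) = fun x => c i * u i x + \sum_(i <- s) c i * u i x); last first.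
  by apply/funext => x; rewrite big_cons.
rewrite (_ : (fun x => _ : 'rV[R]_d) = fun x => c i *: g i x + \sum_(i <- s) c i *: g i x); last first.
  by apply/funext => x; rewrite big_cons.
apply: sobolevD => //; first by apply: sobolevZ => //; apply: H; rewrite mem_head.
by apply: IH => j js; apply: H; rewrite inE js orbT.
Qed.

Lemma sobolevS W G u g : open G -> lmeas W -> G `<=` W -> sobolev W u g -> sobolev G u g.
Proof.
move=> oG mW GW [su sg Hg]; have mG := leb_open oG.
split; first exact: sqintS su.
  by move=> i; apply: sqintS (sg i).
move=> i psi tp; have tpW := test_functionS GW tp.
have z h : test_function G h -> forall x, ~ G x -> h x = 0.
  by move=> [_ [K [_ KG K0]]] x Gx; apply: K0 => /KG.
have z1 := z _ tp; have z2 := z _ (test_function_partial i tp).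
rewrite (Rintegral_support mu GW); last by move=> x _ /z2 ->; rewrite mulr0.
rewrite (Rintegral_support mu GW); last by move=> x _ /z1 ->; rewrite mulr0.
exact: Hg.
Qed.

Lemma sobolev_smooth W u g eta (M : R) : open W -> sobolev W u g -> smooth eta ->
  (forall x, W x -> `|eta x| <= M) -> (forall i x, W x -> `|partial i eta x| <= M) ->
  sobolev W (fun x => eta x * u x)
    (fun x => eta x *: g x + u x *: (\row_i partial i eta x)).
Proof.
move=> oW [su sg Hg] se bE bdE; have mW := leb_open oW.
have me : lmfun W eta by apply: leb_continuous; exact: smooth_continuous.
have mde i : lmfun W (partial i eta).
  by apply: leb_continuous; apply: smooth_continuous; exact: smooth_partial.
have s1 i : sqint mu W (fun x => eta x * g x 0 i) by exact: (sqint_mul_bounded mW (sg i) me bE).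
have s2 i : sqint mu W (fun x => u x * partial i eta x).
  under eq_fun do rewrite mulrC.
  exact: (sqint_mul_bounded mW su (mde i) (bdE i)).
have sS i : sqint mu W (fun x => (eta x *: g x + u x *: (\row_i partial i eta x)) 0 i).
  by under eq_fun do rewrite !mxE; exact: sqintD.
split=> //; first exact: (sqint_mul_bounded mW su me bE).
move=> i psi tp.
have sp := test_function_sqint mW tp; have sdp := test_function_sqint mW (test_function_partial i tp).
have tep := test_functionM se tp.
have st := test_function_sqint mW tep; have sdt := test_function_sqint mW (test_function_partial i tep).
have s3 : sqint mu W (fun x => partial i eta x * psi x).
  exact: (sqint_mul_bounded mW sp (mde i) (bdE i)).
transitivity (\int[mu]_(x in W) (u x * partial i (fun x => eta x * psi x) x) -
    \int[mu]_(x in W) (u x * (partial i eta x * psi x))).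
  rewrite -RintegralB//; [|exact: sqint_rint|exact: sqint_rint].
  apply: eq_Rintegral => x _; rewrite partialM; [ring| |].
    by move=> y; exact: smooth_differentiable.
  by move=> y; apply: smooth_differentiable; case: tp.
rewrite Hg// -opprD -RintegralD//; [|exact: sqint_rint|exact: sqint_rint].
by congr (- _); apply: eq_Rintegral => x _; rewrite !mxE; ring.
Qed.

Lemma sqint_dot W z g : lmeas W -> (forall i, sqint mu W (fun x => g x 0 i)) ->
  sqint mu W (fun x => dot z (g x)).
Proof. by move=> mW sg; apply: sqint_sum => // i; exact: sqintZ. Qed.

Lemma Rintegral_shift z W (f : 'rV[R]_d -> R) : lmeas W -> lmfun W f ->
  \int[mu]_(x in W) f x = \int[mu]_(x in [set x | W (x + z)]) f (x + z).
Proof.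
move=> mW mf; rewrite /Rintegral (@leb_integral_shift R d z W (EFin \o f))//.
exact/measurable_EFinP.
Qed.

Lemma rint_shift z W (f : 'rV[R]_d -> R) : lmeas W -> rint mu W f ->
  rint mu [set x | W (x + z)] (fun x => f (x + z)).
Proof.
move=> mW rf; have mf := rint_measurable rf; have /integrableP[_ fi] := rf.
apply/integrableP; split; first by apply/measurable_EFinP; exact: measurable_fun_shift.
apply: le_lt_trans fi; rewrite [leRHS](@leb_integral_shift R d z W (abse \o (EFin \o f)))//.
exact/measurableT_comp/measurable_EFinP.
Qed.

Lemma sqint_shift z W (f : 'rV[R]_d -> R) : lmeas W -> sqint mu W f ->
  sqint mu [set x | W (x + z)] (fun x => f (x + z)).
Proof.
move=> mW /sqintE[mf rf]; apply: Sqint; first exact: measurable_fun_shift.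
exact: (@rint_shift z W (fun x => f x ^+ 2)).
Qed.

End WeakGradient.

(** * Translations and products *)

Section Translation.
Context {R : realType} {d : nat}.
Implicit Types (W G : set 'rV[R]_d) (u v psi f : 'rV[R]_d -> R) (z : 'rV[R]_d)
  (g : 'rV[R]_d -> 'rV[R]_d).
Local Notation mu := (leb R d).
Local Notation lmeas A := (measurable (A : set (leb_space R d))).
Local Notation lmfun W f := (measurable_fun (W : set (leb_space R d)) (f : leb_space R d -> _)).

Lemma test_function_measurable W G psi : test_function G psi -> lmfun W psi.
Proof. by move=> [sp _]; apply: leb_continuous; exact: smooth_continuous. Qed.

Lemma test_function_rint W G psi u : lmeas W -> rint mu W u -> test_function G psi ->
  rint mu W (fun x => u x * psi x).
Proof.
move=> mW ru tp; have [M M0 HM] := test_function_bounded tp.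
under eq_fun do rewrite mulrC.
by apply: (rint_mul_bounded mW ru (test_function_measurable tp)) => x _; exact: HM.
Qed.

Lemma test_function_translate G psi z : test_function G psi ->
  test_function [set y | G (y - z)] (fun y => psi (y - z)).
Proof. exact: test_function_shift. Qed.

Lemma dirder_translate psi z z' :
  dirder z (fun y => psi (y - z')) = fun x => dirder z psi (x - z').
Proof. by apply/funext => x; apply: eq_bigr => i _; rewrite (partial_shift i psi (- z')). Qed.

Lemma test_function_out G psi x : test_function G psi -> ~ G x -> psi x = 0.
Proof. by move=> [_ [K [_ KG K0]]] Gx; apply: K0 => /KG. Qed.

(** The shift sits on the test function, so the pairing is differentiable in the shift although [u]
    is merely integrable. *)
Lemma test_pairing_diff W G u psi z t : lmeas W -> rint mu W u -> test_function G psi ->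
  exists2 C : R, 0 <= C & forall h : R,
   `|\int[mu]_(y in W) (u y * psi (y - (t + h) *: z)) - \int[mu]_(y in W) (u y * psi (y - t *: z))
    + h * \int[mu]_(y in W) (u y * dirder z psi (y - t *: z))| <= C * h ^+ 2.
Proof.
move=> mW ru tp; have [C C0 HC] := test_function_taylor z tp.
have ra := rint_norm ru.
exists (C * \int[mu]_(y in W) `|u y|) => [|h].
  by apply: mulr_ge0 => //; apply: Rintegral_ge0.
have r1 := test_function_rint mW ru (test_function_translate ((t + h) *: z) tp).
have r2 := test_function_rint mW ru (test_function_translate (t *: z) tp).
have r3 := test_function_rint mW ru (test_function_translate (t *: z) (test_function_dirder z tp)).
have r12 := rintB mW r1 r2; have r3' := rintZ h mW r3.
have -> : \int[mu]_(y in W) (u y * psi (y - (t + h) *: z)) - \int[mu]_(y in W) (u y * psi (y - t *: z))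
    + h * \int[mu]_(y in W) (u y * dirder z psi (y - t *: z)) =
  \int[mu]_(y in W) (u y * psi (y - (t + h) *: z) - u y * psi (y - t *: z)
    + h * (u y * dirder z psi (y - t *: z))).
  by rewrite RintegralD// RintegralB// RintegralZl.
have r4 := rintD mW r12 r3'.
have r5 : rint mu W (fun x => C * h ^+ 2 * `|u x|) by exact: rintZ.
apply: le_trans (le_normr_Rintegral mW r4) _.
rewrite mulrAC -RintegralZl//; apply: le_Rintegral => //; first exact: rint_norm r4.
move=> y _; rewrite -mulrBr mulrCA -mulrDr normrM mulrC ler_wpM2r//.
have := HC (y - t *: z) (- h); rewrite sqrrN mulNr opprK; apply: le_trans.
by rewrite scaleNr scalerDl opprD addrA.
Qed.

Lemma sobolev_dirder W u g psi z : lmeas W -> sobolev W u g -> test_function W psi ->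
  \int[mu]_(x in W) (u x * dirder z psi x) = - \int[mu]_(x in W) (dot z (g x) * psi x).
Proof.
move=> mW [su sg H] tp; have sp := test_function_sqint mW tp.
have sdp i := test_function_sqint mW (test_function_partial i tp).
have r1 i : rint mu W (fun x => u x * partial i psi x) by exact: sqint_rint.
have r2 i : rint mu W (fun x => g x 0 i * psi x) by exact: sqint_rint.
transitivity (\sum_(i < d) \int[mu]_(x in W) (z 0 i * (u x * partial i psi x))).
  rewrite -Rintegral_sum; [|exact: mW|by move=> i; exact: rintZ].
  by apply: eq_Rintegral => x _; rewrite /dirder mulr_sumr; apply: eq_bigr => i _; rewrite mulrCA.
transitivity (\sum_(i < d) - \int[mu]_(x in W) (z 0 i * (g x 0 i * psi x))).
  apply: eq_bigr => i _; have Hi := H i _ tp.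
  by rewrite (RintegralZl _ mW (r1 i)) (RintegralZl _ mW (r2 i)) /= Hi mulrN.
rewrite sumrN -Rintegral_sum; [|exact: mW|by move=> i; exact: rintZ].
by congr (- _); apply: eq_Rintegral => x _; rewrite /dot mulr_suml; apply: eq_bigr => i _; rewrite mulrA.
Qed.

Lemma pairing_translate W G f psi z : lmeas W -> G `<=` [set y | W (y + z)] ->
  lmfun W f -> test_function G psi ->
  \int[mu]_(y in W) (f y * psi (y - z)) = \int[mu]_(y in G) (f (y + z) * psi y).
Proof.
move=> mW GW mf tp.
have mp := test_function_measurable (W := W) (test_function_translate z tp).
rewrite (@Rintegral_shift R d z W (fun y => f y * psi (y - z)) mW (measurableM mf mp)).
under eq_Rintegral do rewrite addrK.
by apply/esym/Rintegral_support => // x _ Gx; rewrite (test_function_out tp Gx) mulr0.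
Qed.

Lemma sqint_translate W G f z : lmeas W -> lmeas G -> G `<=` [set y | W (y + z)] ->
  sqint mu W f -> sqint mu G (fun x => f (x + z)).
Proof.
move=> mW mG GW sf; apply: (sqintS mG _ GW); first exact: measurable_shift_set.
exact: sqint_shift.
Qed.

(** By [sqint_test_bound] it is enough to pair the difference with a test function on [G]. This
    pairing is [Phi 1 - Phi 0], which by the mean value theorem is the pairing of $z\cdot g$ with
    one translate of the test function; $2ab \le a^2 + b^2$ finishes, as translates keep their norm.
    The segments from [x] to [x + z] must stay in [W] for the translate to be a test function
    there. *)
Lemma sobolev_translation W G u g z : open W -> (mu W < +oo)%E -> open G ->
  (forall x (t : R), G x -> 0 <= t <= 1 -> W (x + t *: z)) -> sobolev W u g ->
  sqint mu G (fun x => u (x + z) - u x) /\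
  \int[mu]_(x in G) ((u (x + z) - u x) ^+ 2) <= \int[mu]_(x in W) (dot z (g x) ^+ 2).
Proof.
move=> oW fW oG GW S; have [su sg _] := S.
have mW := leb_open oW; have mG := leb_open oG.
have GtW (t : R) : 0 <= t <= 1 -> G `<=` [set y | W (y + t *: z)] by move=> ht x Gx; exact: GW.
have GzW : G `<=` [set y | W (y + z)].
  by have := @GtW 1; rewrite scale1r ler01 lexx; apply.
have GW0 : G `<=` W.
  by have := @GtW 0; rewrite scale0r ler01 lexx => /(_ isT); under eq_fun do rewrite addr0.
have sz := sqint_translate mW mG GzW su; have suG := sqintS mG mW GW0 su.
have sd := sqintB mG sz suG; split=> //.
apply: (sqint_test_bound oG sd) => psi tp.
have ru := sqint_rint_finite mW fW su.
pose Phi (t : R) := \int[mu]_(y in W) (u y * psi (y - t *: z)).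
pose Phi' (t : R) := - \int[mu]_(y in W) (u y * dirder z psi (y - t *: z)).
have dPhi (t : R) : is_derive t (1 : R) Phi (Phi' t).
  have [C _ HC] := test_pairing_diff z t mW ru tp.
  apply: (is_derive_quad (C := C)) => h; have := HC h; rewrite /Phi /Phi'.
  by rewrite mulrN opprK.
have [c c01 Hc] : exists2 c : R, c \in `]0%R, 1%R[ & Phi 1 - Phi 0 = Phi' c * (1 - 0).
  apply: MVT => //; apply: continuous_subspaceT => t.
  by apply: differentiable_continuous; apply/derivable1_diffP; have [] := dPhi t.
have {}c01 : 0 <= c <= 1 by move: c01; rewrite in_itv /= => /andP[/ltW -> /ltW ->].
have Gc : [set y | G (y - c *: z)] `<=` W.
  by move=> y /= Gy; rewrite -(subrK (c *: z) y); exact: GtW.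
have tc : test_function W (fun y => psi (y - c *: z)).
  by apply: test_functionS Gc _; exact: test_function_translate.
have E1 : Phi 1 - Phi 0 = \int[mu]_(x in G) ((u (x + z) - u x) * psi x).
  rewrite /Phi (pairing_translate mW (GtW 1 _))//; last 2 first.
  - by rewrite ler01 lexx.
  - by case/sqintE: su.
  rewrite (pairing_translate mW (GtW 0 _))//; last 2 first.
  - by rewrite ler01 lexx.
  - by case/sqintE: su.
  under eq_Rintegral do rewrite scale1r.
  under [X in _ - X]eq_Rintegral do rewrite scale0r addr0.
  have sp := test_function_sqint mG tp.
  rewrite -RintegralB//; [|exact: sqint_rint|exact: sqint_rint].
  by apply: eq_Rintegral => x _; rewrite mulrBl.
have E2 : Phi' c = \int[mu]_(x in W) (dot z (g x) * psi (x - c *: z)).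
  have := sobolev_dirder z mW S tc; rewrite dirder_translate => E.
  by rewrite /Phi' E opprK.
have sdz := sqint_dot z mW sg; have stc := test_function_sqint mW tc.
rewrite -E1 Hc subr0 mulr1 E2.
have := Rintegral_AMGM mW sdz stc ltr01; rewrite invr1 !mul1r => /le_trans; apply.
rewrite lerD2l le_eqVlt; apply/orP; left; apply/eqP.
have tp2 : test_function G (fun x => psi x * psi x).
  by apply: test_functionM => //; case: tp.
have m1 : lmfun W (fun _ : 'rV[R]_d => 1 : R) by exact: measurable_cst.
have := pairing_translate mW (GtW c c01) m1 tp2.
under eq_Rintegral do rewrite mul1r -expr2.
by move=> ->; apply: eq_Rintegral => x _; rewrite mul1r expr2.
Qed.

Lemma compact_margin K W : compact K -> open W -> K `<=` W ->
  exists2 r : R, 0 < r & forall x y, K x -> `|y - x| < r -> W y.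
Proof.
move=> cK oW KW.
have := cK; rewrite compact_near_coveringP => /(_ R 0^'+ (fun r x => forall y, `|y - x| < r -> W y) _).
case=> [x Kx|r /= r0 H].
  have /nbhs_ballP[e /= e0 He] : nbhs x W by move: oW; rewrite openE; apply; exact: KW.
  exists (ball x (e / 2), [set r : R | r < e / 2]) => /=.
    split; first by apply: nbhsx_ballx; rewrite divr_gt0.
    by apply: nbhs_right_lt; rewrite divr_gt0.
  move=> [x' r] [/= xx' re] y yx'; apply: He; rewrite -ball_normE /=.
  rewrite (_ : x - y = (x - x') - (y - x')); last by rewrite opprB addrA subrK.
  apply: le_lt_trans (ler_normB _ _) _; rewrite [ltRHS]splitr ltrD//.
    by move: xx'; rewrite -ball_normE.
  exact: lt_trans re.
exists (r / 2); first by rewrite divr_gt0.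
move=> x y Kx yx; apply: (H (r / 2) _ _ x Kx y yx); last by rewrite divr_gt0.
by rewrite /= sub0r normrN gtr0_norm ?divr_gt0// ltr_pdivrMr// mulr2n mulrDr mulr1 ltrDl.
Qed.

Lemma dotZl c (x y : 'rV[R]_d) : dot (c *: x) y = c * dot x y.
Proof. by rewrite /dot mulr_sumr; apply: eq_bigr => i _; rewrite mxE mulrA. Qed.

(** Weak convergence in $L^2$ of the difference quotients to $z\cdot g$, written without division by
    [h]. It is clear against test functions; density extends it to [f], since [sobolev_translation]
    bounds the quotients uniformly. *)
Lemma weak_difference W G u g f z (h0 e : R) : open W -> (mu W < +oo)%E -> open G -> 0 < h0 ->
  (forall x (t : R), G x -> 0 <= t <= h0 -> W (x + t *: z)) -> sobolev W u g ->
  sqint mu G f -> 0 < e -> exists2 k : R, 0 < k <= h0 & forall h, 0 < h <= k ->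
  `|\int[mu]_(x in G) (f x * (u (x + h *: z) - u x)) - h * \int[mu]_(x in G) (f x * dot z (g x))|
    <= e * h.
Proof.
move=> oW fW oG h00 GW S sf e0; have [su sg _] := S.
have mW := leb_open oW; have mG := leb_open oG.
have GtW (t : R) : 0 <= t <= h0 -> G `<=` [set y | W (y + t *: z)] by move=> ht x Gx; exact: GW.
have GW0 : G `<=` W.
  have := @GtW 0; rewrite scale0r lexx (ltW h00) => /(_ isT) H x Gx.
  by have := H x Gx; rewrite /= addr0.
have sdW := sqint_dot z mW sg; have sdG := sqintS mG mW GW0 sdW.
pose B := Num.sqrt (\int[mu]_(x in W) (dot z (g x) ^+ 2)).
have B0 : 0 <= B by exact: sqrtr_ge0.
have BE : B ^+ 2 = \int[mu]_(x in W) (dot z (g x) ^+ 2).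
  by rewrite sqr_sqrtr//; apply: Rintegral_ge0 => x _; exact: sqr_ge0.
pose n := e / (4 * (B + 1)).
have n0 : 0 < n by rewrite divr_gt0// mulr_gt0// ltr_wpDl.
have [psi tp Hp] := test_function_dense oG sf (exprn_gt0 2 n0).
have ru := sqint_rint_finite mW fW su.
have [C C0 HC] := test_pairing_diff z 0 mW ru tp.
have sp := test_function_sqint mG tp; have sfp := sqintB mG sf sp.
exists (Num.min h0 (e / (2 * (C + 1)))).
  rewrite lt_min h00 divr_gt0 ?mulr_gt0 ?ltr_wpDl//=.
  by rewrite ge_min lexx.
move=> h /andP[hp]; rewrite le_min => /andP[hh0 hC].
have hin : 0 <= h <= h0 by rewrite ltW.
have [sb bb] : sqint mu G (fun x => u (x + h *: z) - u x) /\
    \int[mu]_(x in G) ((u (x + h *: z) - u x) ^+ 2) <= (h * B) ^+ 2.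
  have [|? H] := @sobolev_translation W G u g (h *: z) oW fW oG _ S.
    move=> x t Gx /andP[t0 t1]; rewrite scalerA; apply: GW => //.
    by rewrite mulr_ge0//= ?(ltW hp)// (le_trans _ hh0)// ler_piMl// ltW.
  split=> //; apply: le_trans H _; rewrite exprMn BE -RintegralZl//; last exact: sqint_sq.
  by under eq_Rintegral do rewrite dotZl exprMn.
have dB : \int[mu]_(x in G) (dot z (g x) ^+ 2) <= B ^+ 2.
  rewrite BE; apply: subset_Rintegral => //; first exact: sqint_sq.
  by move=> x _; exact: sqr_ge0.
have E1 : \int[mu]_(x in W) (u x * psi (x - (0 + h) *: z)) - \int[mu]_(x in W) (u x * psi (x - 0 *: z))
    = \int[mu]_(x in G) (psi x * (u (x + h *: z) - u x)).
  have [muW _] := sqintE su.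
  rewrite add0r (pairing_translate mW (GtW _ hin) muW tp).
  have -> : \int[mu]_(x in W) (u x * psi (x - 0 *: z)) = \int[mu]_(x in G) (u x * psi x).
    rewrite -(Rintegral_support mu GW0); first by apply: eq_Rintegral => x _; rewrite scale0r subr0.
    by move=> x _ Gx; rewrite scale0r subr0 (test_function_out tp Gx) mulr0.
  rewrite -RintegralB//.
  - by apply: eq_Rintegral => x _; ring.
  - by apply: sqint_rint => //; exact: (sqint_translate mW mG (GtW _ hin) su).
  - by apply: sqint_rint => //; exact: sqintS su.
have E2 : \int[mu]_(x in W) (u x * dirder z psi (x - 0 *: z)) = - \int[mu]_(x in G) (psi x * dot z (g x)).
  have := sobolev_dirder z mW S (test_functionS GW0 tp).
  under eq_Rintegral do rewrite -[X in dirder z psi X]subr0 -(scale0r z).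
  move=> ->; congr (- _); rewrite -(Rintegral_support mu GW0).
    by apply: eq_Rintegral => x _; rewrite mulrC.
  by move=> x _ Gx; rewrite (test_function_out tp Gx) mulr0.
have := HC h; rewrite E1 E2 mulrN => H1.
have H2 : `|\int[mu]_(x in G) ((f x - psi x) * (u (x + h *: z) - u x))| <= n * (h * B).
  by apply: (Rintegral_CS_le mG sfp sb) => //; [exact: ltW|rewrite mulr_ge0// ltW].
have H3 : `|\int[mu]_(x in G) ((f x - psi x) * dot z (g x))| <= n * B.
  by apply: (Rintegral_CS_le mG sfp sdG) => //; exact: ltW.
have E3 k : sqint mu G k -> \int[mu]_(x in G) (f x * k x) =
    \int[mu]_(x in G) ((f x - psi x) * k x) + \int[mu]_(x in G) (psi x * k x).
  move=> sk; rewrite -RintegralD//; [|exact: sqint_rint|exact: sqint_rint].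
  by apply: eq_Rintegral => x _; ring.
rewrite E3// (E3 (fun x => dot z (g x)))//.
move: H1 H2 H3.
set i1 := \int[mu]_(x in G) (psi x * _); set i2 := \int[mu]_(x in G) ((f x - psi x) * _).
set i3 := \int[mu]_(x in G) (psi x * _); set i4 := \int[mu]_(x in G) ((f x - psi x) * _).
move=> H1 H2 H3.
have -> : i2 + i1 - h * (i4 + i3) = (i1 - h * i3) + i2 - h * i4 by ring.
apply: le_trans (ler_normB _ _) _; apply: (@le_trans _ _ (C * h ^+ 2 + n * (h * B) + h * (n * B))).
  apply: lerD; first by apply: le_trans (ler_normD _ _) _; apply: lerD.
  by rewrite normrM (gtr0_norm hp) ler_pM2l.
have nB : n * B <= e / 4.
  rewrite /n -mulrA invfM -[leRHS]mulr1 -!mulrA ler_pM2l// ler_pM2l ?invr_gt0//.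
  by rewrite mulrC ler_pdivrMr ?mul1r ?ltr_wpDl// lerDl.
have Ch : C * h <= e / 2.
  apply: (@le_trans _ _ ((C + 1) * h)); first by rewrite ler_pM2r// lerDl.
  rewrite -ler_pdivlMl ?ltr_wpDl//; apply: le_trans hC _.
  by rewrite invfM mulrA mulrC.
have : n * (h * B) <= e / 4 * h by rewrite mulrCA mulrC ler_pM2r.
have : h * (n * B) <= e / 4 * h by rewrite mulrC ler_pM2r.
have : C * h ^+ 2 <= e / 2 * h by rewrite expr2 mulrA ler_pM2r.
lra.
Qed.

Lemma open_dilate K (r : R) : open [set y : 'rV[R]_d | exists2 x, K x & `|y - x| < r].
Proof.
rewrite openE => y [x Kx yx]; apply/nbhs_ballP; exists (r - `|y - x|) => /=; first by rewrite subr_gt0.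
move=> y'; rewrite -ball_normE /= => yy'; exists x => //.
rewrite (_ : y' - x = (y' - y) + (y - x)); last by rewrite addrA subrK.
by apply: le_lt_trans (ler_normD _ _) _; rewrite -ltrBrDr distrC.
Qed.

(** The discrete product rule $\Delta(uv) = u\,\Delta v + v\,\Delta u + \Delta u\,\Delta v$ is
    paired with [psi]. Divided by [h], the first two terms converge by [weak_difference] with the
    weights $\psi u$ and $\psi v$; the last is of order $h^2$ by Cauchy-Schwarz and
    [sobolev_translation]. *)
Lemma sobolev_product W u v gu gv i psi : open W -> (mu W < +oo)%E ->
  sobolev W u gu -> sobolev W v gv -> test_function W psi ->
  \int[mu]_(x in W) (u x * v x * partial i psi x) =
  - \int[mu]_(x in W) ((u x * gv x 0 i + v x * gu x 0 i) * psi x).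
Proof.
move=> oW fW Su Sv tp; have [su sgu _] := Su; have [sv sgv _] := Sv.
have mW := leb_open oW; pose z : 'rV[R]_d := delta_mx 0 i.
have [sp [K [cK KW K0]]] := tp.
have [r r0 Hr] := compact_margin cK oW KW.
pose G := [set y : 'rV[R]_d | exists2 x, K x & `|y - x| < r / 2].
have oG : open G by exact: open_dilate.
have mG := leb_open oG.
pose h0 := r / 2 / (`|z| + 1).
have h00 : 0 < h0 by rewrite !divr_gt0// ltr_wpDl.
have GW x (t : R) : G x -> 0 <= t <= h0 -> W (x + t *: z).
  move=> [y Ky xy] /andP[t0 th]; apply: (Hr y) => //.
  rewrite addrAC [ltRHS]splitr; apply: le_lt_trans (ler_normD _ _) _; rewrite ltr_leD//.
  rewrite normrZ ger0_norm//; apply: (@le_trans _ _ (t * (`|z| + 1))).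
    by rewrite ler_wpM2l// lerDl.
  by rewrite -ler_pdivlMr// ltr_wpDl.
have GW0 : G `<=` W.
  move=> x Gx; have := @GW x 0 Gx; rewrite scale0r addr0; apply.
  by rewrite lexx ltW.
have tG : test_function G psi.
  split=> //; exists K; split=> // x Kx; exists x => //.
  by rewrite subrr normr0 divr_gt0.
have [M M0 HM] := test_function_bounded tp.
have mp : lmfun G psi by exact: test_function_measurable tp.
have bp x : G x -> `|psi x| <= M by [].
have suG := sqintS mG mW GW0 su; have svG := sqintS mG mW GW0 sv.
have sup := sqint_mul_bounded mG suG mp bp; have svp := sqint_mul_bounded mG svG mp bp.
have ruv := sqint_rint mW su sv.
have [C C0 HC] := test_pairing_diff z 0 mW ruv tG.
have sdu := sqint_dot z mW sgu; have sdv := sqint_dot z mW sgv.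
pose A := Num.sqrt (\int[mu]_(x in W) (dot z (gu x) ^+ 2)).
pose B := Num.sqrt (\int[mu]_(x in W) (dot z (gv x) ^+ 2)).
have A0 : 0 <= A by exact: sqrtr_ge0.
have B0 : 0 <= B by exact: sqrtr_ge0.
have AE : A ^+ 2 = \int[mu]_(x in W) (dot z (gu x) ^+ 2).
  by rewrite sqr_sqrtr//; apply: Rintegral_ge0 => x _; exact: sqr_ge0.
have BE : B ^+ 2 = \int[mu]_(x in W) (dot z (gv x) ^+ 2).
  by rewrite sqr_sqrtr//; apply: Rintegral_ge0 => x _; exact: sqr_ge0.
have tr w g D : sobolev W w g -> D ^+ 2 = \int[mu]_(x in W) (dot z (g x) ^+ 2) -> forall h, 0 < h <= h0 ->
    sqint mu G (fun x => w (x + h *: z) - w x) /\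
    \int[mu]_(x in G) ((w (x + h *: z) - w x) ^+ 2) <= (h * D) ^+ 2.
  move=> S DE h /andP[hp hh0]; have [sw sg _] := S.
  have [|? H] := @sobolev_translation W G w g (h *: z) oW fW oG _ S.
    move=> x t Gx /andP[t0 t1]; rewrite scalerA; apply: GW => //.
    by rewrite mulr_ge0//= ?(ltW hp)// (le_trans _ hh0)// ler_piMl// ltW.
  split=> //; apply: le_trans H _; rewrite exprMn DE -RintegralZl//; last first.
    by apply: sqint_sq; exact: sqint_dot.
  by under eq_Rintegral do rewrite dotZl exprMn.
set L := LHS; set S := \int[mu]_(x in W) _.
apply/eqP; rewrite -addr_eq0 -normr_le0; apply/ler_addgt0Pr => e e0; rewrite add0r.
have e20 : 0 < e / 4 by rewrite divr_gt0.
have [k1 /andP[k10 k1h] Hk1] := weak_difference oW fW oG h00 GW Sv sup e20.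
have [k2 /andP[k20 k2h] Hk2] := weak_difference oW fW oG h00 GW Su svp e20.
(* Four errors of size [h * (e / 4)]: two from the weak limits, one from the Taylor remainder
   ([k3]), one from the product of the two differences ([k4]). *)
pose k3 := e / (4 * (C + 1)); pose k4 := e / (4 * (M * A * B + 1)).
have M1 : 0 < M * A * B + 1 by rewrite ltr_wpDl// !mulr_ge0.
have k30 : 0 < k3 by rewrite divr_gt0// mulr_gt0// ltr_wpDl.
have k40 : 0 < k4 by rewrite divr_gt0// mulr_gt0.
pose h := Num.min (Num.min k1 k2) (Num.min k3 k4).
have hp : 0 < h by rewrite !lt_min k10 k20 k30.
have hk1 : h <= k1 by rewrite !ge_min lexx.
have hk2 : h <= k2 by rewrite !ge_min lexx orbT.
have hk3 : h <= k3 by rewrite !ge_min lexx !orbT.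
have hk4 : h <= k4 by rewrite !ge_min lexx !orbT.
have hh0 : 0 < h <= h0 by rewrite hp (le_trans hk1).
have [sa ba] := tr _ _ _ Su AE _ hh0; have [sb bb] := tr _ _ _ Sv BE _ hh0.
have := Hk1 h; rewrite hp hk1 => /(_ isT); have := Hk2 h; rewrite hp hk2 => /(_ isT).
have := HC h.
have GhW : G `<=` [set y | W (y + h *: z)].
  by move=> x Gx; apply: GW => //; case/andP: hh0 => /ltW -> ->.
have sap := sqint_mul_bounded mG sa mp bp.
have i1 : `|\int[mu]_(x in G) (psi x * (u (x + h *: z) - u x) * (v (x + h *: z) - v x))|
    <= M * (h * A) * (h * B).
  apply: (Rintegral_CS_le mG sap sb) => //; try by rewrite !mulr_ge0// ltW.
  rewrite exprMn; apply: (@le_trans _ _ (M ^+ 2 * \int[mu]_(x in G) ((u (x + h *: z) - u x) ^+ 2))).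
    rewrite -RintegralZl//; last exact: sqint_sq.
    apply: le_Rintegral => //; [exact: sqint_sq|by apply: rintZ => //; exact: sqint_sq|].
    move=> x _; rewrite exprMn ler_wpM2r ?sqr_ge0// -real_normK ?num_real//.
    by rewrite ler_sqr ?nnegrE.
  by rewrite ler_wpM2l ?sqr_ge0.
have mpv : lmfun W (fun x => u x * v x) by exact: rint_measurable ruv.
have E0 : \int[mu]_(x in W) (u x * v x * dirder z psi (x - 0 *: z)) = L.
  apply: eq_Rintegral => x _; rewrite scale0r subr0; congr (_ * _).
  rewrite /dirder (bigD1 i)//= mxE !eqxx mul1r big1 ?addr0// => j /negbTE ji.
  by rewrite mxE ji mul0r.
have E1 : \int[mu]_(x in W) (u x * v x * psi (x - (0 + h) *: z))
   - \int[mu]_(x in W) (u x * v x * psi (x - 0 *: z)) =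
   \int[mu]_(x in G) (psi x * u x * (v (x + h *: z) - v x)) +
   \int[mu]_(x in G) (psi x * v x * (u (x + h *: z) - u x)) +
   \int[mu]_(x in G) (psi x * (u (x + h *: z) - u x) * (v (x + h *: z) - v x)).
  rewrite add0r (pairing_translate mW GhW mpv tG).
  have -> : \int[mu]_(x in W) (u x * v x * psi (x - 0 *: z)) = \int[mu]_(x in G) (u x * v x * psi x).
    rewrite -(Rintegral_support mu GW0); first by apply: eq_Rintegral => x _; rewrite scale0r subr0.
    by move=> x _ Gx; rewrite scale0r subr0 (test_function_out tG Gx) mulr0.
  have q1 := sqint_rint mG sup sb; have q2 := sqint_rint mG svp sa.
  have q3 := sqint_rint mG sap sb.
  have q0 : rint mu G (fun x => u x * v x * psi x).
    by apply: test_function_rint tG => //; exact: rintS ruv.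
  have qh : rint mu G (fun x => u (x + h *: z) * v (x + h *: z) * psi x).
    apply: test_function_rint tG => //.
    by apply: sqint_rint => //; [exact: (sqint_translate mW mG GhW su)|exact: (sqint_translate mW mG GhW sv)].
  rewrite -RintegralB// -RintegralD// -RintegralD//; last exact: rintD.
  by apply: eq_Rintegral => x _; ring.
have E2 : S = \int[mu]_(x in G) (psi x * u x * dot z (gv x)) + \int[mu]_(x in G) (psi x * v x * dot z (gu x)).
  rewrite /S -(Rintegral_support mu GW0); last first.
    by move=> x _ Gx; rewrite (test_function_out tG Gx) mulr0.
  have sduG := sqintS mG mW GW0 sdu; have sdvG := sqintS mG mW GW0 sdv.
  rewrite -RintegralD//; [|exact: sqint_rint|exact: sqint_rint].
  by apply: eq_Rintegral => x _; rewrite !dot_delta; ring.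
rewrite E0 E1 E2.
move: i1; set j1 := \int[mu]_(x in G) (_ * (v (_ + _) - _)); set j2 := \int[mu]_(x in G) (_ * (u (_ + _) - _)).
set j3 := \int[mu]_(x in G) (_ * (v (_ + _) - _)).
set j4 := \int[mu]_(x in G) _; set j5 := \int[mu]_(x in G) _.
move=> b1 b2 b3 b4.
rewrite -(ler_pM2l hp) -[X in X * `|_|](gtr0_norm hp) -normrM.
have -> : h * (L + (j5 + j4)) = (j3 + j2 + j1 + h * L) - (j2 - h * j4) - (j3 - h * j5) - j1 by ring.
have c1 : C * h ^+ 2 <= h * (e / 4).
  rewrite expr2 mulrCA ler_pM2l//; apply: (@le_trans _ _ ((C + 1) * h)).
    by rewrite ler_pM2r// lerDl.
  by rewrite -ler_pdivlMl ?ltr_wpDl//; apply: le_trans hk3 _; rewrite /k3 invfM mulrA mulrC.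
have c2 : M * (h * A) * (h * B) <= h * (e / 4).
  have -> : M * (h * A) * (h * B) = h * ((M * A * B) * h) by ring.
  rewrite ler_pM2l//; apply: (@le_trans _ _ ((M * A * B + 1) * h)).
    by rewrite ler_pM2r// lerDl.
  by rewrite -ler_pdivlMl//; apply: le_trans hk4 _; rewrite /k4 invfM mulrA mulrC.
apply: le_trans (ler_normB _ _) _; apply: le_trans (lerD (ler_normB _ _) (lexx _)) _.
apply: le_trans (lerD (lerD (ler_normB _ _) (lexx _)) (lexx _)) _.
lra.
Qed.

Lemma sobolevM W u v gu gv : open W -> (mu W < +oo)%E ->
  sobolev W u gu -> sobolev W v gv -> sqint mu W (fun x => u x * v x) ->
  (forall i, sqint mu W (fun x => u x * gv x 0 i + v x * gu x 0 i)) ->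
  sobolev W (fun x => u x * v x) (fun x => u x *: gv x + v x *: gu x).
Proof.
move=> oW fW Su Sv suv sg; split=> // [i|i psi tp].
  by under eq_fun do rewrite !mxE; exact: sg.
rewrite (sobolev_product i oW fW Su Sv tp).
by congr (- _); apply: eq_Rintegral => x _; rewrite !mxE.
Qed.

End Translation.

(** * Poincare inequality on boxes *)

Section Variance.
Context {dsp : measure_display} {T : measurableType dsp} {R : realType}.
Variable mu : {measure set T -> \bar R}.
Implicit Types (A B D : set T) (f u : T -> R).

Lemma Rintegral_split A B D f : measurable A -> measurable B -> measurable D ->
  A `<=` D -> B `<=` D -> [disjoint A & B] -> mu (D `\` (A `|` B)) = 0%E -> rint mu D f ->
  \int[mu]_(x in D) f x = \int[mu]_(x in A) f x + \int[mu]_(x in B) f x.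
Proof.
move=> mA mB mD AD BD dAB N0 rf.
have mAB : measurable (A `|` B) by exact: measurableU.
have mN : measurable (D `\` (A `|` B)) by exact: measurableD.
have rAB : rint mu (A `|` B) f by apply: rintS rf => // x [/AD|/BD].
rewrite -Rintegral_setU//; congr fine.
rewrite (negligible_integral mN mD rf N0); congr (integral mu _ _).
apply/seteqP; split=> [x [Dx /not_andP[//|/contrapT //]]|x ABx]; split.
  by case: ABx => [/AD|/BD].
by case.
Qed.

(** The squared $L^2$ distance of [u] from its mean value over [D], in the form in which it splits
    exactly under a bisection. *)
Definition sqdev D u : R := \int[mu]_(x in D) (u x ^+ 2) - (\int[mu]_(x in D) u x) ^+ 2 / fine (mu D).

Lemma Rintegral_sqr_le D u : measurable D -> (mu D < +oo)%E -> sqint mu D u ->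
  (\int[mu]_(x in D) u x) ^+ 2 <= fine (mu D) * \int[mu]_(x in D) (u x ^+ 2).
Proof.
move=> mD fD su; have s1 : sqint mu D (cst 1).
  apply: Sqint; first exact: measurable_cst.
  by under eq_fun do rewrite expr1n; exact: rint_cst.
have := Rintegral_CS mD s1 su; under eq_Rintegral do rewrite mul1r.
by under [X in _ <= X * _ -> _]eq_Rintegral do rewrite expr1n; rewrite Rintegral_cst// mul1r.
Qed.

Lemma sqdev_le D u c : measurable D -> (mu D < +oo)%E -> sqint mu D u ->
  sqdev D u <= \int[mu]_(x in D) ((u x - c) ^+ 2).
Proof.
move=> mD fD su; have ru := sqint_rint_finite mD fD su; have rs := sqint_sq su.
have -> : \int[mu]_(x in D) ((u x - c) ^+ 2) =
    \int[mu]_(x in D) (u x ^+ 2) - 2 * c * \int[mu]_(x in D) u x + c ^+ 2 * fine (mu D).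
  have rc : rint mu D (cst (c ^+ 2)) by exact: rint_cst.
  rewrite -(Rintegral_cst mu mD) -RintegralZl// -RintegralB//; last exact: rintZ.
  rewrite -RintegralD//; last by apply: rintB => //; exact: rintZ.
  by apply: eq_Rintegral => x _; rewrite /cst; ring.
have := Rintegral_sqr_le mD fD su; rewrite /sqdev.
set I := \int[mu]_(x in D) u x; set J := \int[mu]_(x in D) _.
have [->|m0] := eqVneq (fine (mu D)) 0.
  rewrite mul0r invr0 !mulr0 subr0 addr0 => I0.
  have /eqP : I ^+ 2 == 0 by rewrite eq_le I0 sqr_ge0.
  by move/eqP; rewrite expf_eq0 => /andP[_ /eqP ->]; rewrite mulr0 subr0.
move=> _; have mp : 0 < fine (mu D) by rewrite lt_neqAle eq_sym m0 fine_ge0.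
rewrite -subr_ge0 (_ : _ - _ = (c * fine (mu D) - I) ^+ 2 / fine (mu D)); last by field.
by rewrite divr_ge0 ?sqr_ge0// ltW.
Qed.

Lemma sqdev_bisect A B D u : measurable A -> measurable B -> measurable D ->
  A `<=` D -> B `<=` D -> [disjoint A & B] -> mu (D `\` (A `|` B)) = 0%E -> (mu D < +oo)%E ->
  mu A = mu B -> sqint mu D u ->
  sqdev D u = sqdev A u + sqdev B u +
    (\int[mu]_(x in B) u x - \int[mu]_(x in A) u x) ^+ 2 / fine (mu A) / 2.
Proof.
move=> mA mB mD AD BD dAB N0 fD AB su; have ru := sqint_rint_finite mD fD su.
rewrite /sqdev (Rintegral_split mA mB mD AD BD dAB N0 (sqint_sq su)).
rewrite (Rintegral_split mA mB mD AD BD dAB N0 ru).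
have r1 : rint mu D (cst 1) by exact: rint_cst.
have := Rintegral_split mA mB mD AD BD dAB N0 r1; rewrite !Rintegral_cst// !mul1r => ->.
rewrite -AB; have [->|m0] := eqVneq (fine (mu A)) 0; first by rewrite addr0 invr0; ring.
have m20 : fine (mu A) + fine (mu A) != 0 by rewrite -mulr2n mulrn_eq0.
by field; rewrite m0.
Qed.

End Variance.

Lemma poincare_arith {R : realFieldType} (c s S : R) : 1 <= c -> 0 <= s ->
  c / 6 * (S - 3 / 4 * s) + s / 8 <= c / 6 * S.
Proof. by move=> c1 s0; have := ler_peMl s0 c1; lra. Qed.

Section BoxPoincare.
Context {R : realType} {d : nat}.
Implicit Types (a b x y z : 'rV[R]_d) (W : set 'rV[R]_d) (u psi f : 'rV[R]_d -> R)
  (g : 'rV[R]_d -> 'rV[R]_d).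
Local Notation mu := (leb R d).
Local Notation lmeas A := (measurable (A : set (leb_space R d))).
Local Notation lmfun W f := (measurable_fun (W : set (leb_space R d)) (f : leb_space R d -> _)).

Lemma rowD x y (j : 'I_d) : (x + y) 0 j = x 0 j + y 0 j.
Proof. by rewrite mxE. Qed.

Lemma rowB x y (j : 'I_d) : (x - y) 0 j = x 0 j - y 0 j.
Proof. by rewrite !mxE. Qed.

Lemma rowZ (c : R) x (j : 'I_d) : (c *: x) 0 j = c * x 0 j.
Proof. by rewrite mxE. Qed.

Lemma row_norm_le x (r : R) : 0 <= r -> (forall i, `|x 0 i| <= r) -> `|x| <= r.
Proof.
move=> r0 H; rewrite [leLHS]/Num.norm /= mx_normrE.
by apply/bigmax_leP; split=> // -[i0 i] _ /=; rewrite ord1.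
Qed.

Lemma row_norm_coord x i : `|x 0 i| <= `|x|.
Proof. by rewrite [leRHS]/Num.norm /= mx_normrE; exact: (le_bigmax _ (fun ij : 'I_1 * 'I_d => `|x ij.1 ij.2|) (ord0, i)). Qed.

Lemma test_function_lipschitz W psi : test_function W psi ->
  exists2 L : R, 0 <= L & forall x y, `|psi x - psi y| <= L * `|x - y|.
Proof.
move=> tp.
have Hi (i : 'I_d) : exists M : R, 0 <= M /\ forall x, `|partial i psi x| <= M.
  by have [M M0 HM] := test_function_bounded (test_function_partial i tp); exists M.
have [M HM] := choice Hi.
exists (\sum_i M i) => [|x y]; first by apply: sumr_ge0 => i _; case: (HM i).
have [sp _] := tp; pose z := x - y.
have [c [_ Hc]] := MVT_between 0 1 (fun t => is_derive_line y z t sp).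
have yz : y + z = x by rewrite /z addrC subrK.
move: Hc; rewrite scale1r scale0r addr0 subr0 mulr1 yz => ->.
apply: le_trans (ler_norm_sum _ _ _) _; rewrite mulr_suml; apply: ler_sum => i _.
rewrite normrM mulrC; apply: ler_pM => //; first by case: (HM i).
exact: row_norm_coord.
Qed.

Lemma bounded_box a b : bounded_set (box a b).
Proof.
suff H (x : 'rV[R]_d) : box a b x -> `|x| <= `|a| + `|b|.
  exists (`|a| + `|b|); split=> [|M abM x /= Hx]; first by rewrite num_real.
  by apply: le_trans (ltW abM); exact: H.
move=> Hx; apply: row_norm_le => [|i]; first by rewrite addr_ge0.
have /andP[ax xb] := Hx i.
have := row_norm_coord a i; have := row_norm_coord b i.
have := ler_norm (b 0 i); have := ler_norm (- a 0 i); rewrite normrN.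
have := normr_ge0 a; have := normr_ge0 b; have := normr_ge0 (a 0 i); have := normr_ge0 (b 0 i).
move=> *; rewrite ler_norml; apply/andP; split; lra.
Qed.

Lemma leb_box_fin a b : (mu (box a b) < +oo)%E.
Proof. exact: leb_bounded (@bounded_box a b). Qed.

Lemma test_function_sqint_finite W D psi : lmeas D -> (mu D < +oo)%E -> test_function W psi ->
  sqint mu D psi.
Proof.
move=> mD fD tp; have [M M0 HM] := test_function_bounded tp.
have mp : lmfun D psi by exact: test_function_measurable tp.
apply: Sqint => //; apply: (rint_bounded (M := M ^+ 2) mD (measurable_sqr mp) fD) => x _.
by rewrite ger0_norm ?sqr_ge0// -real_normK ?num_real// ler_sqr ?nnegrE.
Qed.

Definition sides a b : R := \sum_i (b 0 i - a 0 i) ^+ 2.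

Definition half_side a b i : 'rV[R]_d := ((b 0 i - a 0 i) / 2) *: delta_mx 0 i.

Lemma half_sideE a b i j : half_side a b i 0 j = ((b 0 i - a 0 i) / 2) *+ (j == i).
Proof. by rewrite !mxE eqxx /=; case: (j == i); rewrite ?mulr1 ?mulr0. Qed.

Lemma sides_half a b i : sides a (b - half_side a b i) = sides a b - 3 / 4 * (b 0 i - a 0 i) ^+ 2.
Proof.
rewrite /sides (bigD1 i)//= [in RHS](bigD1 i)//= (eq_bigr (fun j => (b 0 j - a 0 j) ^+ 2)).
  by rewrite rowB half_sideE eqxx mulr1n; field.
by move=> j /negbTE ji; rewrite rowB half_sideE ji mulr0n subr0.
Qed.

Lemma sides_half' a b i : sides (a + half_side a b i) b = sides a (b - half_side a b i).
Proof.
apply: eq_bigr => j _; rewrite rowB rowD.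
by rewrite opprD addrA addrAC.
Qed.

Lemma box_bisect a b i : (forall j, a 0 j < b 0 j) ->
  let z := half_side a b i in
  [/\ forall j, a 0 j < (b - z) 0 j, forall j, (a + z) 0 j < b 0 j,
    box a (b - z) `<=` box a b /\ box (a + z) b `<=` box a b,
    [disjoint box a (b - z) & box (a + z) b] &
    mu (box a b `\` (box a (b - z) `|` box (a + z) b)) = 0%E].
Proof.
move=> ab z.
have zj j : z 0 j = 0 \/ j = i /\ z 0 j = (b 0 i - a 0 i) / 2.
  by rewrite half_sideE; case: eqP => [->|_]; [right|left].
have zi : z 0 i = (b 0 i - a 0 i) / 2 by rewrite half_sideE eqxx.
have z0 j : 0 <= z 0 j /\ z 0 j <= (b 0 j - a 0 j) / 2.
  by have := ab j; case: (zj j) => [->|[-> ->]] ?; split; lra.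
split.
- by move=> j; rewrite mxE [(- z) 0 j]mxE; have := z0 j; have := ab j; lra.
- by move=> j; rewrite mxE; have := z0 j; have := ab j; lra.
- split=> x H j; have := H j; rewrite mxE ?[(- z) 0 j]mxE => /andP[]; have := z0 j; have := ab j; lra.
- rewrite disj_set2E; apply/eqP/seteqP; split=> // x [/(_ i)/andP[_ H1] /(_ i)/andP[H2 _]].
  by move: H1 H2; rewrite rowB rowD zi; have := ab i; lra.
pose r := `|a| + `|b| + 1.
apply/eqP; rewrite eq_le measure_ge0 andbT.
rewrite -(@leb_hyperplane R d i ((a 0 i + b 0 i) / 2) r); apply: le_outer_measure.
move=> x [Hx Hn]; split; last first.
  move=> j; have /andP[] := Hx j.
  have := row_norm_coord a j; have := row_norm_coord b j.
  have := ler_norm (b 0 j); have := ler_norm (- a 0 j); rewrite normrN.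
  have := normr_ge0 a; have := normr_ge0 b; have := normr_ge0 (a 0 j); have := normr_ge0 (b 0 j).
  rewrite ltr_norml /r; lra.
apply/eqP/negPn/negP => xi; apply: Hn; have [xl|xl] := ltP (x 0 i) ((a 0 i + b 0 i) / 2).
  left=> j; rewrite mxE [(- z) 0 j]mxE; have /andP[-> /=] := Hx j.
  by case: (zj j) => [->|[-> ->]]; [rewrite subr0|lra].
right=> j; rewrite mxE; have /andP[+ ->] := Hx j; rewrite andbT.
case: (zj j) => [->|[-> ->] _]; first by rewrite addr0.
have : (a 0 i + b 0 i) / 2 < x 0 i by rewrite lt_neqAle eq_sym xi.
lra.
Qed.

Lemma box_half_shift a b i : let z := half_side a b i in
  box a (b - z) = [set x | box (a + z) b (x + z)].
Proof.
move=> z; apply/seteqP; split=> x H j; have := H j; rewrite !mxE.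
  by move=> /andP[H1 H2]; rewrite ltrD2r H1 -ltrBrDr.
by rewrite ltrD2r -ltrBrDr.
Qed.

(** The two halves are translates of each other by half a side, so the difference of their integrals
    is the integral of [u (x + z) - u x], to which the translation estimate applies. The constant 8
    is 4 from $|z|^2$ times the 2 in [sqdev_bisect]. *)
Lemma sqdev_box_bisect a b i u g : (forall j, a 0 j < b 0 j) -> sobolev (box a b) u g ->
  sqdev mu (box a b) u <= sqdev mu (box a (b - half_side a b i)) u +
    sqdev mu (box (a + half_side a b i) b) u +
    (b 0 i - a 0 i) ^+ 2 / 8 * \int[mu]_(x in box a b) (dot (g x) (g x)).
Proof.
move=> ab S; set z := half_side a b i; have [ab1 ab2 [s1 s2] dj N0] := box_bisect i ab.
have [su sg _] := S.
have oB := @open_box R d; have mB a' b' := leb_open (oB a' b').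
have sh := box_half_shift a b i.
have EB : mu (box a (b - z)) = mu (box (a + z) b) by rewrite /z sh; exact: leb_outer_shift.
rewrite (sqdev_bisect (mB _ _) (mB _ _) (mB _ _) s1 s2 dj N0 (leb_box_fin a b) EB su) lerD2l.
set A := box a (b - z).
have Atz x (t : R) : A x -> 0 <= t <= 1 -> box a b (x + t *: z).
  move=> Ax /andP[t0 t1] j; have := Ax j; rewrite rowB rowD [(t *: z) 0 j]rowZ /z half_sideE.
  case: eqP => [->|_]; rewrite ?mulr1n ?mulr0n ?mulr0 ?subr0 ?addr0 ?oppr0 ?addr0//.
  have := ab i; set s := b 0 i - a 0 i => si.
  have : 0 <= t * (s / 2) <= s / 2 by rewrite mulr_ge0 ?divr_ge0 ?subr_ge0 ?(ltW si)//= ler_piMl// divr_ge0 ?subr_ge0 ?(ltW si).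
  by move=> /andP[p1 p2] /andP[q1 q2]; rewrite /s in p1 p2 q2 *; lra.
have [st bt] := sobolev_translation (oB a b) (leb_box_fin a b) (oB a (b - z)) Atz S.
have suA := sqintS (mB _ _) (mB _ _) s1 su.
have ruA := sqint_rint_finite (mB _ _) (leb_box_fin _ _) suA.
have rst := sqint_rint_finite (mB _ _) (leb_box_fin _ _) st.
have AzB : A `<=` [set x | box a b (x + z)].
  by move=> x Ax; have := Atz x 1 Ax; rewrite scale1r; apply; rewrite ler01 lexx.
have rz := sqint_rint_finite (mB _ _) (leb_box_fin _ _) (sqint_translate (mB a b) (mB a (b - z)) AzB su).
have -> : \int[mu]_(x in box (a + z) b) u x - \int[mu]_(x in A) u x = \int[mu]_(x in A) (u (x + z) - u x).
  have mu2 : lmfun (box (a + z) b) u.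
    by apply: sqint_measurable; exact: sqintS (mB _ _) (mB _ _) s2 su.
  rewrite (@Rintegral_shift R d z _ u (mB _ _) mu2) -sh -/A -RintegralB; [done|exact: mB|exact: rz|exact: ruA].
have := Rintegral_sqr_le (mB _ _) (leb_box_fin _ _) st.
have rdot i' : rint mu (box a b) (fun x => g x 0 i' ^+ 2) by exact: sqint_sq.
have rdd : rint mu (box a b) (fun x => dot (g x) (g x)).
  rewrite (_ : (fun x => _) = fun x => \sum_i' g x 0 i' ^+ 2); first exact: rint_sum.
  by apply/funext => x; apply: eq_bigr => i' _; rewrite expr2.
have bt' : \int[mu]_(x in A) ((u (x + z) - u x) ^+ 2) <=
    (b 0 i - a 0 i) ^+ 2 / 4 * \int[mu]_(x in box a b) (dot (g x) (g x)).
  apply: le_trans bt _; rewrite -RintegralZl//.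
  apply: le_Rintegral => //; [|exact: rintZ|].
    by apply: sqint_sq; exact: sqint_dot.
  move=> x _; rewrite dotZl dot_delta exprMn.
  rewrite (_ : (_ / 2) ^+ 2 = (b 0 i - a 0 i) ^+ 2 / 4); last by field.
  rewrite ler_wpM2l ?divr_ge0 ?sqr_ge0// /dot (bigD1 i)//= -expr2 lerDl.
  by apply: sumr_ge0 => k _; rewrite -expr2 sqr_ge0.
move: bt'; set I := \int[mu]_(x in A) _; set J := \int[mu]_(x in A) _; set D := \int[mu]_(x in _) _.
move=> bt' IJ.
have D0 : 0 <= D by apply: Rintegral_ge0 => x _; apply: sumr_ge0 => k _; rewrite -expr2 sqr_ge0.
have [m0|m0] := eqVneq (fine (mu A)) 0.
  by rewrite m0 invr0 mulr0 mul0r mulr_ge0// divr_ge0// sqr_ge0.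
have mp : 0 < fine (mu A) by rewrite lt_neqAle eq_sym m0 fine_ge0.
rewrite ler_pdivrMr// ler_pdivrMr//; apply: le_trans IJ _.
by rewrite [leRHS]mulrC; apply: ler_wpM2l; [exact: ltW|lra].
Qed.

(** Induction on the number [n] of bisections, always across the longest side [s]. Its square is at
    least the [d]-th part of [sides], which therefore shrinks by the factor $1 - 3/(4d)$. A
    bisection costs $s^2/8$ times the energy and lowers [sides] by $\frac34 s^2$; the coefficient
    [d / 6] makes the decrease pay for the cost. On the final small boxes, [u] is compared with the
    Lipschitz function [psi], which is nearly constant there. *)
Lemma box_poincare_step (n : nat) a b W u psi g (L : R) : (0 < d)%N ->
  (forall j, a 0 j < b 0 j) -> sobolev (box a b) u g -> test_function W psi -> 0 <= L ->
  (forall x y, `|psi x - psi y| <= L * `|x - y|) ->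
  sqdev mu (box a b) u <= 2 * \int[mu]_(x in box a b) ((u x - psi x) ^+ 2) +
    2 * fine (mu (box a b)) * L ^+ 2 * ((1 - 3 / (4 * d%:R)) ^+ n * sides a b) +
    d%:R / 6 * sides a b * \int[mu]_(x in box a b) (dot (g x) (g x)).
Proof.
move=> d0 ab S tp L0 HL; pose q : R := 1 - 3 / (4 * d%:R).
have dR : 0 < d%:R :> R by rewrite ltr0n.
have q0 : 0 <= q.
  rewrite subr_ge0 ler_pdivrMr ?mulr_gt0// mul1r.
  by apply: (@le_trans _ _ 4); [rewrite ler_nat|rewrite ler_peMr// ler1n].
elim: n a b ab S => [|n IH] a b ab S; have [su sg _] := S;
    have mB := leb_open (@open_box R d a b); have fB := leb_box_fin a b;
    have sp := test_function_sqint_finite mB fB tp.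
- pose c : 'rV[R]_d := 2^-1 *: (a + b).
  apply: le_trans (sqdev_le (psi c) mB fB su) _.
  have sup := sqintB mB su sp; have r1 := sqint_sq sup.
  have r2 : rint mu (box a b) (cst (L ^+ 2 * sides a b)) by exact: rint_cst.
  have sS : 0 <= sides a b by apply: sumr_ge0 => j _; exact: sqr_ge0.
  have D0 : 0 <= \int[mu]_(x in box a b) (dot (g x) (g x)).
    by apply: Rintegral_ge0 => x _; apply: sumr_ge0 => k _; rewrite -expr2 sqr_ge0.
  apply: (@le_trans _ _ (2 * \int[mu]_(x in box a b) ((u x - psi x) ^+ 2) +
     2 * \int[mu]_(x in box a b) (cst (L ^+ 2 * sides a b) x))); last first.
    rewrite expr0 mul1r Rintegral_cst//.
    rewrite (_ : 2 * (L ^+ 2 * sides a b * fine (mu (box a b))) = 2 * fine (mu (box a b)) * L ^+ 2 * sides a b); last by ring.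
    by rewrite lerDl !mulr_ge0// invr_ge0.
  rewrite -!RintegralZl// -RintegralD//; [|exact: rintZ|exact: rintZ].
  apply: le_Rintegral => //; last first.
  + move=> x Bx; rewrite /cst (_ : u x - psi c = (u x - psi x) + (psi x - psi c)); last by ring.
    apply: le_trans (sqrD_le _ _) _; rewrite lerD2l ler_pM2l//.
    rewrite -[_ ^+ 2]real_normK ?num_real//; apply: (@le_trans _ _ ((L * `|x - c|) ^+ 2)).
      by rewrite ler_sqr ?nnegrE ?mulr_ge0.
    rewrite exprMn ler_wpM2l ?sqr_ge0// -(sqr_sqrtr sS) ler_sqr ?nnegrE ?sqrtr_ge0//.
    apply: row_norm_le => [|i]; first exact: sqrtr_ge0.
    rewrite -sqrtr_sqr ler_wsqrtr// /sides (bigD1 i)//= -[leLHS]addr0 lerD//; last first.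
      by apply: sumr_ge0 => j _; exact: sqr_ge0.
    by rewrite !mxE; have /andP[] := Bx i; nra.
  + by apply: rintD => //; exact: rintZ.
  + apply: sqint_sq; apply: sqintB => //; apply: Sqint; first exact: measurable_cst.
    exact: (rint_cst (psi c ^+ 2)).
have [i _ Hi] := @arg_maxP _ _ _ (Ordinal d0) xpredT (fun i => b 0 i - a 0 i) isT.
pose z := half_side a b i.
have [ab1 ab2 [s1 s2] dj N0] := box_bisect i ab.
have oB := @open_box R d; have mB' a' b' := leb_open (oB a' b').
have S1 := sobolevS (oB _ _) mB s1 S; have S2 := sobolevS (oB _ _) mB s2 S.
have H1 := IH _ _ ab1 S1; have H2 := IH _ _ ab2 S2.
have rd : rint mu (box a b) (fun x => dot (g x) (g x)).
  rewrite (_ : (fun x => _) = fun x => \sum_i' g x 0 i' ^+ 2).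
    by apply: rint_sum => // k; exact: sqint_sq.
  by apply/funext => x; apply: eq_bigr => i' _; rewrite expr2.
have E := Rintegral_split (mB' _ _) (mB' _ _) mB s1 s2 dj N0.
have sup := sqintB mB su sp.
have rc : rint mu (box a b) (cst 1) by exact: rint_cst.
have E1 := E _ (sqint_sq sup); have E2 := E _ rd; have := E _ rc.
rewrite !Rintegral_cst// !mul1r => E3.
have := sqdev_box_bisect i ab S; rewrite -/z => Hv.
apply: le_trans Hv _; apply: le_trans (lerD (lerD H1 H2) (lexx _)) _.
rewrite -/z E1 E2 E3 sides_half' -/z sides_half.
have D1 : 0 <= \int[mu]_(x in box a (b - z)) (dot (g x) (g x)).
  by apply: Rintegral_ge0 => x _; apply: sumr_ge0 => k _; rewrite -expr2 sqr_ge0.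
have D2 : 0 <= \int[mu]_(x in box (a + z) b) (dot (g x) (g x)).
  by apply: Rintegral_ge0 => x _; apply: sumr_ge0 => k _; rewrite -expr2 sqr_ge0.
have m1 : 0 <= fine (mu (box a (b - z))) by rewrite fine_ge0.
have m2 : 0 <= fine (mu (box (a + z) b)) by rewrite fine_ge0.
have sd : sides a b <= d%:R * (b 0 i - a 0 i) ^+ 2.
  rewrite mulr_natl -[X in _ *+ X]card_ord -sumr_const; apply: ler_sum => j _.
  by rewrite ler_sqr ?nnegrE ?subr_ge0 ?(ltW (ab _))//; exact: Hi.
have sq : sides a b - 3 / 4 * (b 0 i - a 0 i) ^+ 2 <= q * sides a b.
  rewrite (_ : q * sides a b = sides a b - 3 / 4 * (sides a b / d%:R)); last by rewrite /q; field; rewrite gt_eqF.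
  by rewrite lerD2l lerN2 ler_pM2l ?divr_gt0// ler_pdivrMr// mulrC.
have sq6 : d%:R / 6 * (sides a b - 3 / 4 * (b 0 i - a 0 i) ^+ 2) + (b 0 i - a 0 i) ^+ 2 / 8 <=
    d%:R / 6 * sides a b.
  have d1 : 1 <= d%:R :> R by rewrite ler1n.
  exact: poincare_arith d1 (sqr_ge0 _).
move: sq sq6 D1 D2 m1 m2; set s := (b 0 i - a 0 i) ^+ 2; set I1 := \int[mu]_(x in _) dot _ _.
set I2 := \int[mu]_(x in _) dot _ _; set M1 := fine _; set M2 := fine _ => sq sq6 D1 D2 m1 m2.
set J1 := \int[mu]_(x in _) _; set J2 := \int[mu]_(x in _) _.
have qn : 0 <= q ^+ n by rewrite exprn_ge0.
have h1 : 2 * M1 * L ^+ 2 * (q ^+ n * (sides a b - 3 / 4 * s)) <=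
   2 * M1 * L ^+ 2 * (q ^+ n.+1 * sides a b).
  apply: ler_wpM2l; first by rewrite !mulr_ge0.
  by rewrite [q ^+ n.+1]exprSr -[leRHS]mulrA; apply: ler_wpM2l.
have h2 : 2 * M2 * L ^+ 2 * (q ^+ n * (sides a b - 3 / 4 * s)) <=
   2 * M2 * L ^+ 2 * (q ^+ n.+1 * sides a b).
  apply: ler_wpM2l; first by rewrite !mulr_ge0.
  by rewrite [q ^+ n.+1]exprSr -[leRHS]mulrA; apply: ler_wpM2l.
rewrite -/q.
have h3 : d%:R / 6 * (sides a b - 3 / 4 * s) * I1 + d%:R / 6 * (sides a b - 3 / 4 * s) * I2 + s / 8 * (I1 + I2)
    <= d%:R / 6 * sides a b * (I1 + I2).
  rewrite -!mulrDr -mulrDl; apply: ler_wpM2r => //; exact: addr_ge0.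
lra.
Qed.

(** The approximating [psi] is fixed before [n]: its Lipschitz constant may be huge, but the
    geometric factor [q ^+ n] beats it. *)
Lemma box_poincare a b u g : (0 < d)%N -> (forall j, a 0 j < b 0 j) -> sobolev (box a b) u g ->
  sqdev mu (box a b) u <= d%:R / 6 * sides a b * \int[mu]_(x in box a b) (dot (g x) (g x)).
Proof.
move=> d0 ab S; apply/ler_addgt0Pr => e e0.
have oB := @open_box R d a b; have mB := leb_open oB; have [su _ _] := S.
have e4 : 0 < e / 4 by rewrite divr_gt0.
have [psi tp Hp] := test_function_dense oB su e4.
have [L L0 HL] := test_function_lipschitz tp.
pose q : R := 1 - 3 / (4 * d%:R).
have dR : 0 < d%:R :> R by rewrite ltr0n.
have q01 : `|q| < 1.
  have d1 : 1 <= d%:R :> R by rewrite ler1n.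
  rewrite /q invfM; have := invr_gt0 (d%:R : R); rewrite dR => d2.
  have : d%:R^-1 <= 1 :> R by rewrite invf_le1.
  rewrite ltr_norml; lra.
pose K := 2 * fine (mu (box a b)) * L ^+ 2 * sides a b.
have K0 : 0 <= K.
  by rewrite !mulr_ge0 ?sqr_ge0 ?fine_ge0// sumr_ge0// => j _; exact: sqr_ge0.
have [n Hn] : exists n, q ^+ n * K <= e / 2.
  have /cvgrPdist_lt := cvg_expr q01.
  have eK : 0 < e / 2 / (K + 1) by rewrite !divr_gt0// ltr_wpDl.
  move=> /(_ _ eK)[n _ Hn]; exists n; have := Hn n (leqnn n); rewrite sub0r normrN => /ltW.
  rewrite ler_pdivlMr ?ltr_wpDl//; apply: le_trans.
  apply: (@le_trans _ _ (`|q ^+ n| * K)); first by rewrite ler_wpM2r// ler_norm.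
  by rewrite ler_wpM2l// lerDl.
have := @box_poincare_step n a b _ u psi g L d0 ab S tp L0 HL.
rewrite -/q (_ : _ * (q ^+ n * _) = q ^+ n * K); last by rewrite /K; ring.
lra.
Qed.

End BoxPoincare.

Lemma quad_discr {R : realFieldType} (a b c : R) : 0 <= c ->
  (forall t, 0 <= b - 2 * t * a + t ^+ 2 * c) -> a ^+ 2 <= b * c.
Proof.
move=> c0 Q; have [c1|c1] := eqVneq c 0.
  rewrite c1 mulr0 (_ : a = 0) ?expr0n//.
  apply/eqP/negPn/negP => an0; have := Q ((b + 1) / (2 * a)).
  rewrite c1 mulr0 addr0 (_ : 2 * _ * a = b + 1); last by field.
  by rewrite opprD addrA subrr sub0r oppr_ge0 ler10.
have cp : 0 < c by rewrite lt_neqAle eq_sym c1.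
have := Q (a / c); rewrite (_ : _ - _ + _ = (b * c - a ^+ 2) / c); last by field.
by rewrite pmulr_lge0 ?invr_gt0// subr_ge0.
Qed.

(** * Cones and grids in Lipschitz domains *)

Section EuclideanNorm.
Context {R : realType} {d : nat}.
Implicit Types (x y z : 'rV[R]_d) (c : R).

Lemma dotC x y : dot x y = dot y x.
Proof. by apply: eq_bigr => i _; rewrite mulrC. Qed.

Lemma dotDl x y z : dot (x + y) z = dot x z + dot y z.
Proof. by rewrite /dot -big_split; apply: eq_bigr => i _; rewrite mxE mulrDl. Qed.

Lemma dotDr x y z : dot z (x + y) = dot z x + dot z y.
Proof. by rewrite dotC dotDl !(dotC z). Qed.

Lemma dotZr c x y : dot x (c *: y) = c * dot x y.
Proof. by rewrite dotC dotZl dotC. Qed.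

Lemma dotNl x y : dot (- x) y = - dot x y.
Proof. by rewrite -scaleN1r dotZl mulN1r. Qed.

Lemma dot_ge0 x : 0 <= dot x x.
Proof. by apply: sumr_ge0 => i _; rewrite -expr2 sqr_ge0. Qed.

Lemma dot_CS x y : dot x y ^+ 2 <= dot x x * dot y y.
Proof.
apply: quad_discr => [|t]; first exact: dot_ge0.
have := dot_ge0 (x + (- t) *: y).
rewrite dotDl !dotDr !dotZr !dotZl (dotC y x) => /le_trans; apply.
by rewrite le_eqVlt; apply/orP; left; apply/eqP; ring.
Qed.

Lemma sqr_enorm x : enorm x ^+ 2 = dot x x.
Proof. by rewrite sqr_sqrtr// dot_ge0. Qed.

Lemma enorm_ge0 x : 0 <= enorm x.
Proof. exact: sqrtr_ge0. Qed.

Lemma dot_le_norm x : dot x x <= d%:R * `|x| ^+ 2.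
Proof.
rewrite mulr_natl -[X in _ *+ X]card_ord -sumr_const; apply: ler_sum => i _.
by rewrite -expr2 -real_normK ?num_real// ler_sqr ?nnegrE// row_norm_coord.
Qed.

Lemma enorm_le x : enorm x <= d%:R * `|x|.
Proof.
rewrite -ler_sqr ?nnegrE ?enorm_ge0 ?mulr_ge0// sqr_enorm exprMn.
apply: le_trans (dot_le_norm x) _; rewrite ler_wpM2r ?sqr_ge0//.
by rewrite -natrX ler_nat; case: (d) => // n; rewrite leq_pmulr.
Qed.

Lemma coord_enorm x i : `|x 0 i| <= enorm x.
Proof.
rewrite -ler_sqr ?nnegrE ?enorm_ge0// sqr_enorm real_normK ?num_real//.
by rewrite /dot (bigD1 i)//= -expr2 lerDl sumr_ge0// => j _; rewrite -expr2 sqr_ge0.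
Qed.

Lemma norm_enorm x : `|x| <= enorm x.
Proof. by apply: row_norm_le => [|i]; [exact: enorm_ge0|exact: coord_enorm]. Qed.

Lemma dot_unit x e : enorm e = 1 -> `|dot x e| <= d%:R * `|x|.
Proof.
move=> e1; apply: le_trans (enorm_le x); rewrite -ler_sqr ?nnegrE ?enorm_ge0//.
by rewrite real_normK ?num_real// (le_trans (dot_CS x e))// -!sqr_enorm e1 expr1n mulr1.
Qed.

End EuclideanNorm.

Section Cone.
Context {R : realType} {d : nat}.
Implicit Types (x y z p c : 'rV[R]_d) (Om V W : set 'rV[R]_d).

(** A cone condition at scale [rho]: one vector of length at most [rho / eps] moves the whole ball
    about [y] into [Om], and points of [Om] stay in [Om] on the way. A single vector per ball is
    what the translation estimate can use. *)
Definition cone_at Om (eps : R) y := forall rho, 0 < rho < eps ->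
  exists z, [/\ `|z| <= rho / eps, forall x, `|x - y| <= rho -> Om (x + z)
   & forall x, `|x - y| <= rho -> Om x -> forall t, 0 <= t <= 1 -> Om (x + t *: z)].

Lemma cone_interior Om x : Om^° x ->
  exists2 s : R, 0 < s & forall eps y, 0 < eps <= s -> `|y - x| < s -> cone_at Om eps y.
Proof.
move=> /nbhs_ballP[r /= r0 Hr]; exists (r / 2); first by rewrite divr_gt0.
move=> eps y /andP[e0 er] yx rho /andP[rho0 rhoe]; exists 0.
have H x' : `|x' - y| <= rho -> Om x'.
  move=> xy; apply: Hr; rewrite -ball_normE /= distrC.
  rewrite (_ : x' - x = (x' - y) + (y - x)); last by rewrite addrA subrK.
  apply: le_lt_trans (ler_normD _ _) _; rewrite [ltRHS]splitr; apply: ler_ltD => //.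
  exact: le_trans xy (le_trans (ltW rhoe) er).
split; first by rewrite normr0 divr_ge0// ltW.
  by move=> x'; rewrite addr0; exact: H.
by move=> x' /H Ox _ t _; rewrite scaler0 addr0.
Qed.

(** The vector is [T * rho] in the direction [e] of the chart. Since [y] lies above the graph, a
    point at distance [rho] is below it by at most $(1 + |L|)\,d\rho = T\rho$; and moving along [e]
    never crosses the graph downwards. *)
Lemma cone_boundary Om x : (0 < d)%N -> lipschitz_boundary Om -> bnd Om x ->
  exists2 s : R, 0 < s & forall eps y, 0 < eps <= s -> `|y - x| < s -> Om y -> cone_at Om eps y.
Proof.
move=> d0 lip bx; have [r [e [gam [r0 e1 [L HL] ge HO]]]] := lip x bx.
have d1 : 1 <= d%:R :> R by rewrite ler1n.
have dp : 0 < d%:R :> R by rewrite ltr0n.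
have HL' y y' : gam y <= gam y' + `|L| * (d%:R * `|y - y'|).
  rewrite -lerBlDl; apply: le_trans (ler_norm _) _; apply: le_trans (HL _ _) _.
  apply: (@le_trans _ _ (`|L| * enorm (y - y'))).
    by rewrite ler_wpM2r ?enorm_ge0// ler_norm.
  by rewrite ler_wpM2l// enorm_le.
pose T := (1 + `|L|) * d%:R.
have T1 : 1 <= T.
  by rewrite /T -[leLHS]mulr1 ler_pM// lerDl.
have T0 : 0 < T by exact: lt_le_trans T1.
have en : `|e| <= 1 by rewrite -e1 norm_enorm.
have ee : dot e e = 1 by rewrite -sqr_enorm e1 expr1n.
(* The first bound turns the length [T * rho] into [rho / eps]; the second keeps all points involved
   in the chart, the factor [d] comparing the Euclidean with the sup norm. *)
pose s := Num.min T^-1 (r / (d%:R * (3 + T))).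
have dT : 0 < d%:R * (3 + T) by rewrite mulr_gt0// addr_gt0.
have s0 : 0 < s by rewrite lt_min invr_gt0 T0 divr_gt0.
have sT : s <= T^-1 by rewrite ge_min lexx.
have sr : (3 + T) * s <= r / d%:R.
  rewrite mulrC -ler_pdivlMr ?addr_gt0// -mulrA -invfM.
  by rewrite ge_min lexx orbT.
exists s => // eps y /andP[e0 es] yx Oy rho /andP[rho0 rhoe].
have inball x' : `|x' - y| <= rho + T * rho -> eball x r x'.
  move=> xy; rewrite /eball /=; apply: le_lt_trans (enorm_le _) _.
  rewrite mulrC -ltr_pdivlMr//; apply: lt_le_trans sr.
  rewrite (_ : x' - x = (x' - y) + (y - x)); last by rewrite addrA subrK.
  apply: le_lt_trans (ler_normD _ _) _.
  apply: (@le_lt_trans _ _ (rho + T * rho + s)); first by rewrite lerD// ltW.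
  have : rho <= s by rewrite ltW// (lt_le_trans rhoe).
  by have : T * rho <= T * s; [rewrite ler_pM2l// ltW// (lt_le_trans rhoe)|nra].
have chart x' : `|x' - y| <= rho + T * rho -> Om x' <-> gam x' < dot x' e.
  by move=> /inball; exact: HO.
have zb : `|(T * rho) *: e| <= T * rho.
  by rewrite normrZ gtr0_norm ?mulr_gt0// ler_piMr// mulr_ge0// ltW.
have xz x' (t : R) : `|x' - y| <= rho -> 0 <= t <= 1 -> `|x' + t *: ((T * rho) *: e) - y| <= rho + T * rho.
  move=> xy /andP[t0 t1]; rewrite addrAC; apply: le_trans (ler_normD _ _) _; apply: lerD => //.
  by rewrite normrZ ger0_norm//; apply: le_trans zb; rewrite ler_piMl.
exists ((T * rho) *: e); split.
- apply: le_trans zb _; rewrite mulrC ler_pM2l//.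
  by rewrite -[leLHS]invrK lef_pV2 ?posrE ?invr_gt0// (le_trans es).
- move=> x' xy; have := xz x' 1 xy; rewrite scale1r ler01 lexx => /(_ isT) H1.
  apply/(chart _ H1); rewrite ge dotDl dotZl ee mulr1.
  apply: le_lt_trans (HL' x' y) _.
  have yy : `|y - y| <= rho + T * rho by rewrite subrr normr0 addr_ge0// ?mulr_ge0// ltW.
  have /(chart _ yy) gy := Oy.
  have : dot y e <= dot x' e + d%:R * `|x' - y|.
    rewrite -lerBlDl -[X in _ - X]opprK -[- dot x' e]dotNl opprK; apply: le_trans (ler_norm _) _.
    rewrite -dotDl; apply: le_trans (dot_unit _ e1) _; by rewrite distrC.
  have : (1 + `|L|) * (d%:R * `|x' - y|) <= T * rho by rewrite mulrA ler_pM2l.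
  rewrite mulrDl mul1r; lra.
- move=> x' xy Ox t t01; have H1 := xz x' t xy t01.
  have xy' : `|x' - y| <= rho + T * rho by apply: le_trans xy _; rewrite lerDl mulr_ge0// ltW.
  have /(chart _ xy') gx := Ox; apply/(chart _ H1); case/andP: t01 => t0 t1.
  rewrite scalerA ge dotDl dotZl ee mulr1; apply: lt_le_trans gx _.
  by rewrite lerDl !mulr_ge0// ltW.
Qed.

(** Interior points admit the vector 0, boundary points the chart direction; compactness of the
    closure makes [eps] uniform. *)
Lemma cone_property Om : (0 < d)%N -> open Om -> bounded_set Om -> lipschitz_boundary Om ->
  exists2 eps : R, 0 < eps & forall y, Om y -> cone_at Om eps y.
Proof.
move=> d0 oO bO lip.
have cK : compact (closure Om).
  have [M [_ HM]] := bO; pose r := `|M| + 1.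
  have r0 : 0 < r by rewrite ltr_wpDl.
  have sub : Om `<=` closed_ball 0 r.
    move=> x Ox; rewrite closed_ballE// /closed_ball_ /= sub0r normrN; apply: HM => //.
    by rewrite /r (le_lt_trans (ler_norm M))// ltrDl.
  have cB := @closed_ball_compact R d 0 r; apply: (subclosed_compact _ cB); first exact: closed_closure.
  rewrite [X in _ `<=` X](closure_id _).1; last exact: closed_ball_closed.
  exact: closureS.
have := cK; rewrite compact_near_coveringP => /(_ R 0^'+ (fun eps y => Om y -> cone_at Om eps y) _).
case=> [x Kx|r /= r0 H].
  have [s s0 Hs] : exists2 s : R, 0 < s & forall eps y, 0 < eps <= s -> `|y - x| < s ->
      Om y -> cone_at Om eps y.
    have [ix|nx] := pselect (Om^° x); last exact: cone_boundary.
    by have [s s0 Hs] := cone_interior ix; exists s => // eps y e yx _; exact: Hs.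
  exists (ball x s, [set r : R | 0 < r <= s]) => /=.
    split; first exact: nbhsx_ballx.
    near=> eps; apply/andP; split => //.
    by near: eps; exact: nbhs_right_le.
  move=> [y eps] [/= xy es] Oy; apply: Hs => //.
  by move: xy; rewrite -ball_normE /= distrC.
exists (r / 2); first by rewrite divr_gt0.
move=> y Oy; apply: (H (r / 2)) => //; last exact: subset_closure.
- by rewrite /= sub0r normrN gtr0_norm ?divr_gt0// ltr_pdivrMr// mulr2n mulrDr mulr1 ltrDl.
- by rewrite divr_gt0.
Unshelve. all: by end_near. Qed.

End Cone.

(** * Poincare estimate on a grid of shifted balls *)

Section Grid.
Context {R : realType} {d : nat}.
Implicit Types (x y z p c : 'rV[R]_d) (Om V W : set 'rV[R]_d) (u : 'rV[R]_d -> R)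
  (g : 'rV[R]_d -> 'rV[R]_d) (G : set 'rV[R]_d).
Local Notation mu := (leb R d).
Local Notation lmeas A := (measurable (A : set (leb_space R d))).
Local Notation lmfun W f := (measurable_fun (W : set (leb_space R d)) (f : leb_space R d -> _)).

Definition grid_index (n : nat) := {ffun 'I_d -> 'I_(n + n).+1}.

Definition grid_point (n : nat) c (rho : R) (k : grid_index n) : 'rV[R]_d :=
  \row_i (c 0 i + rho * ((k i)%:R - n%:R)).

Lemma row_norm_lt x (r : R) : 0 < r -> (forall i, `|x 0 i| < r) -> `|x| < r.
Proof.
move=> r0 H; rewrite [ltLHS]/Num.norm /= mx_normrE.
by apply/bigmax_ltP; split=> // -[i0 i] _ /=; rewrite ord1.
Qed.

Lemma grid_cover n c rho x : 0 < rho -> `|x - c| <= n%:R * rho ->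
  exists k, `|x - grid_point c rho (k : grid_index n)| < rho.
Proof.
move=> rho0 xc; pose t (i : 'I_d) := (x 0 i - c 0 i) / rho + n%:R.
have ti i : 0 <= t i <= (n + n)%:R.
  have := le_trans (row_norm_coord (x - c) i) xc.
  rewrite rowB -ler_pdivrMr// -[X in _ / X](gtr0_norm rho0) -normf_div ler_norml natrD /t.
  by move=> /andP[]; lra.
have tr i : (Num.truncn (t i) < (n + n).+1)%N.
  case/andP: (ti i) => t0 t1; rewrite ltnS -(ler_nat R); apply: le_trans t1.
  by rewrite truncn_le.
exists [ffun i => Ordinal (tr i)]; apply: row_norm_lt => // i.
rewrite rowB mxE ffunE /=; have /andP[t0 _] := ti i.
have /andP[] := truncn_itv t0; set m := Num.truncn _ => m1 m2.
rewrite (_ : x 0 i - _ = rho * (t i - m%:R)); last by rewrite /t; field; rewrite gt_eqF.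
rewrite normrM gtr0_norm// gtr_pMr// ger0_norm ?subr_ge0//.
by rewrite ltrBlDl natr1.
Qed.

Lemma count_near (m T : nat) (y : R) :
  \sum_(j < m) (`|y - j%:R| < T%:R)%R%:R <= (2 * T)%:R :> R.
Proof.
rewrite -natr_sum ler_nat -(big_mkord xpredT (fun j => (`|y - j%:R| < T%:R)%R : nat)).
pose P j := `|y - j%:R| < T%:R.
have -> : (\sum_(0 <= j < m) (P j : nat) = size [seq j <- index_iota 0 m | P j])%N.
  by rewrite size_filter -sum1_count [RHS]big_mkcond; apply: eq_bigr => j _; case: (P j).
have [[j jP]|nP] := pselect (exists j, P j); last first.
  by rewrite (@eq_filter _ _ pred0) ?filter_pred0// => j; apply/negP => jP; apply: nP; exists j.
have [j0 P0 Hm] := @ex_minnP P (ex_intro _ j jP).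
rewrite -[leqRHS](size_iota j0); apply: uniq_leq_size; first by rewrite filter_uniq// iota_uniq.
move=> i; rewrite mem_filter mem_iota => /andP[Pi _]; rewrite (Hm _ Pi) /=.
rewrite -(ltr_nat R) natrD natrM.
by move: Pi P0; rewrite /P !ltr_norml => /andP[p1 p2] /andP[p3 p4]; lra.
Qed.

(** Grid and sup-norm balls are products, so the count factors over the coordinates, with at most
    [2 * T] integers at distance less than [T] in each. *)
Lemma grid_overlap n T c rho x : 0 < rho ->
  \sum_k (`|x - grid_point c rho (k : grid_index n)| < T%:R * rho)%R%:R <= (2 * T)%:R ^+ d :> R.
Proof.
move=> rho0; pose y (i : 'I_d) := (x 0 i - c 0 i) / rho + n%:R.
apply: (@le_trans _ _ (\sum_(k : grid_index n) \prod_(i < d) (`|y i - (k i)%:R| < T%:R)%R%:R)).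
  apply: ler_sum => k _; case: ltP => [xk|_]; last by apply: prodr_ge0 => i _; rewrite ler0n.
  rewrite big1// => i _; rewrite (_ : (_ < _) = true)//.
  have := le_lt_trans (row_norm_coord _ i) xk; rewrite rowB mxE.
  rewrite (_ : x 0 i - _ = rho * (y i - (k i)%:R)); last by rewrite /y; field; rewrite gt_eqF.
  by rewrite normrM gtr0_norm// mulrC ltr_pM2r.
rewrite -(bigA_distr_bigA (fun i (j : 'I_(n + n).+1) => (`|y i - j%:R| < T%:R)%R%:R : R)).
rewrite -[X in _ <= _ ^+ X](card_ord d) -prodr_const; apply: ler_prod => i _.
by rewrite count_near andbT sumr_ge0// => j _; rewrite ler0n.
Qed.

Lemma sqint_dot_self W g : lmeas W -> (forall i, sqint mu W (fun x => g x 0 i)) ->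
  rint mu W (fun x => dot (g x) (g x)).
Proof.
move=> mW sg; rewrite (_ : (fun x => _) = fun x => \sum_i g x 0 i ^+ 2).
  by apply: rint_sum => // k; exact: sqint_sq.
by apply/funext => x; apply: eq_bigr => i' _; rewrite expr2.
Qed.

Definition grid_const (T : nat) : R :=
  (2 * (d%:R ^+ 2 * 2 / 3) + 2 * (d%:R * T%:R ^+ 2)) * (2 * T.+1)%:R ^+ d.

Lemma zero_mean_ball p rho u g : (0 < d)%N -> 0 < rho -> sobolev (ball p rho) u g ->
  \int[mu]_(x in ball p rho) u x = 0 ->
  \int[mu]_(x in ball p rho) (u x ^+ 2) <=
  d%:R ^+ 2 * 2 / 3 * rho ^+ 2 * \int[mu]_(x in ball p rho) (dot (g x) (g x)).
Proof.
move=> d0 rho0; rewrite -(box_ball p rho0) => S u0.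
have ab (j : 'I_d) : (\row_i (p 0 i - rho)) 0 j < (\row_i (p 0 i + rho)) 0 j.
  by rewrite !mxE; lra.
have := box_poincare d0 ab S; set B := box _ _.
have -> : sqdev mu B u = \int[mu]_(x in B) (u x ^+ 2).
  transitivity (\int[mu]_(x in B) (u x ^+ 2) - 0 ^+ 2 / fine (mu B)).
    by congr (_ - _ ^+ 2 / _); exact: u0.
  by rewrite expr0n mul0r subr0.
move=> /le_trans; apply.
rewrite (_ : sides _ _ = d%:R * (4 * rho ^+ 2)).
  by rewrite le_eqVlt; apply/orP; left; apply/eqP; field.
rewrite mulr_natl -[X in _ *+ X]card_ord -sumr_const; apply: eq_bigr => j _.
by rewrite !mxE; ring.
Qed.

(** $u(x)^2 \le 2u(x+z)^2 + 2(u(x+z)-u(x))^2$. The first term is integrated over a full ball inside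
    [V'] on which [u] has mean value 0, where the box inequality holds; the second is the
    translation estimate. The cell itself may stick out of the domain. *)
Lemma grid_cell V' p z rho (T : nat) u g G : (0 < d)%N -> 0 < rho -> open V' ->
  (mu V' < +oo)%E -> sobolev V' u g -> `|z| <= T%:R * rho -> open G -> G `<=` ball p rho ->
  (forall x : 'rV[R]_d, ball p rho x -> V' (x + z)) ->
  (forall (x : 'rV[R]_d) (t : R), G x -> 0 <= t <= 1 -> V' (x + t *: z)) ->
  \int[mu]_(x in ball (p + z) rho) u x = 0 ->
  \int[mu]_(x in G) (u x ^+ 2) <=
  (2 * (d%:R ^+ 2 * 2 / 3) + 2 * (d%:R * T%:R ^+ 2)) * rho ^+ 2 *
    \int[mu]_(x in V' `&` ball p (T.+1%:R * rho)) (dot (g x) (g x)).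
Proof.
move=> d0 rho0 oV fV S zT oG Gp HB HG u0; have [su sg _] := S.
pose W := V' `&` ball p (T.+1%:R * rho).
have oW : open W by apply: openI => //; apply: ball_open; rewrite mulr_gt0.
have mV := leb_open oV; have mW := leb_open oW; have mG := leb_open oG.
have fW : (mu W < +oo)%E.
  by apply: le_lt_trans fV; apply: le_measure; rewrite ?inE//; exact: subIsetl.
have SW := sobolevS oW mV (@subIsetl _ _ _) S; have [suW sgW _] := SW.
have GW (x : 'rV[R]_d) (t : R) : G x -> 0 <= t <= 1 -> W (x + t *: z).
  move=> Gx t01; split; first exact: HG.
  move: (Gp _ Gx); rewrite -!ball_normE /= => px; case/andP: t01 => t0 t1.
  rewrite opprD addrA; apply: le_lt_trans (ler_normB _ _) _.
  rewrite -natr1 mulrDl mul1r [ltRHS]addrC ltr_leD//.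
  by rewrite normrZ ger0_norm//; apply: le_trans zT; rewrite ler_piMl.
have [st bt] := sobolev_translation oW fW oG GW SW.
have BW : ball (p + z) rho `<=` W.
  move=> x; rewrite -!ball_normE /= => px.
  have bx : ball p rho (x - z).
    by rewrite -ball_normE /= opprB addrA.
  split; first by rewrite -(subrK z x); exact: HB.
  rewrite -ball_normE /= (_ : p - x = (p + z - x) - z); last by rewrite addrAC addrK.
  apply: le_lt_trans (ler_normB _ _) _.
  by rewrite -natr1 mulrDl mul1r addrC ler_ltD.
have oBz : open (ball (p + z) rho) by exact: ball_open.
have mBz := leb_open oBz.
have := zero_mean_ball d0 rho0 (sobolevS oBz mW BW SW) u0.
have rd := sqint_dot_self mW sgW.
have dd0 x : 0 <= dot (g x) (g x) by exact: dot_ge0.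
have ID : \int[mu]_(x in ball (p + z) rho) dot (g x) (g x) <= \int[mu]_(x in W) dot (g x) (g x).
  by apply: subset_Rintegral.
have IT : \int[mu]_(x in W) (dot z (g x) ^+ 2) <=
    d%:R * T%:R ^+ 2 * rho ^+ 2 * \int[mu]_(x in W) dot (g x) (g x).
  rewrite -RintegralZl//; apply: le_Rintegral => //; last 1 first.
  - move=> x _; apply: le_trans (dot_CS _ _) _; rewrite ler_wpM2r//.
    apply: le_trans (dot_le_norm z) _; rewrite -mulrA -exprMn ler_wpM2l//.
    by rewrite ler_sqr ?nnegrE// mulr_ge0// ltW.
  - by apply: sqint_sq; exact: sqint_dot.
  - exact: rintZ.
have GzW : G `<=` [set x | W (x + z)].
  by move=> x Gx; have := GW x 1 Gx; rewrite scale1r; apply; rewrite ler01 lexx.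
have GzB : G `<=` [set x | ball (p + z) rho (x + z)].
  by move=> x /Gp; rewrite -!ball_normE /= opprD addrACA subrr addr0.
have suz := sqint_translate mW mG GzW suW.
have GW0 : G `<=` W.
  by move=> x Gx; have := GW x 0 Gx; rewrite scale0r addr0; apply; rewrite lexx ler01.
have suG := sqintS mG mW GW0 suW.
have IU : \int[mu]_(x in G) (u (x + z) ^+ 2) <= \int[mu]_(x in ball (p + z) rho) (u x ^+ 2).
  have mu2 : lmfun (ball (p + z) rho) (fun x => u x ^+ 2).
    by apply: measurable_sqr; apply: sqint_measurable (sqintS mBz mW BW suW).
  rewrite (@Rintegral_shift R d z _ (fun x => u x ^+ 2) mBz mu2).
  apply: subset_Rintegral => //; first exact: measurable_shift_set.
    apply: sqint_sq; apply: sqint_shift => //; exact: sqintS mBz mW BW suW.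
  by move=> x _; exact: sqr_ge0.
have I2 : \int[mu]_(x in G) (u x ^+ 2) <= 2 * \int[mu]_(x in G) (u (x + z) ^+ 2) +
    2 * \int[mu]_(x in G) ((u (x + z) - u x) ^+ 2).
  rewrite -!RintegralZl//; [|exact: sqint_sq|exact: sqint_sq].
  rewrite -RintegralD//; [|by apply: rintZ => //; exact: sqint_sq|by apply: rintZ => //; exact: sqint_sq].
  apply: le_Rintegral => //; first exact: sqint_sq.
    by apply: rintD => //; apply: rintZ => //; exact: sqint_sq.
  move=> x _; have := sqrD_le (u (x + z)) (- (u (x + z) - u x)).
  by rewrite sqrrN opprB addrC subrK.
move: ID IT IU I2 bt; rewrite -/W.
set D := \int[mu]_(x in W) dot _ _; set D' := \int[mu]_(x in ball _ _) dot _ _.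
set a := \int[mu]_(x in G) (u x ^+ 2); set b := \int[mu]_(x in G) (u (x + z) ^+ 2).
set a' := \int[mu]_(x in ball _ _) _; set b' := \int[mu]_(x in G) _; set z' := \int[mu]_(x in W) _.
move=> ID IT IU I2 bt ua.
have : d%:R ^+ 2 * 2 / 3 * rho ^+ 2 * D' <= d%:R ^+ 2 * 2 / 3 * rho ^+ 2 * D.
  by rewrite ler_wpM2l// mulr_ge0 ?sqr_ge0// divr_ge0// mulr_ge0// sqr_ge0.
lra.
Qed.

(** The balls are chosen before [V], [V'] and [u], so the same functionals serve all layers. Summing
    the cell estimates costs only the bounded overlap of the enlarged cells. *)
Lemma grid_estimate Om eps (T : nat) n c rho : (0 < d)%N -> open Om -> (mu Om < +oo)%E ->
  0 < eps -> (forall y, Om y -> cone_at Om eps y) -> 2 / eps <= T%:R ->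
  0 < rho -> 2 * rho < eps ->
  exists B : grid_index n -> set 'rV[R]_d, (forall k, open (B k)) /\
   forall V V' u g, open V -> open V' -> V' `<=` Om -> V `<=` Om ->
   (forall x y, V x -> Om y -> `|y - x| < (T + 2)%:R * rho -> V' y) ->
   (forall x, V x -> `|x - c| <= n%:R * rho) ->
   sobolev V' u g -> (forall k, B k `<=` V' -> \int[mu]_(x in B k) u x = 0) ->
   \int[mu]_(x in V) (u x ^+ 2) <= grid_const T * rho ^+ 2 * \int[mu]_(x in V') dot (g x) (g x).
Proof.
move=> d0 oO fO e0 Hc eT rho0 rhoe.
pose p := grid_point c rho (n := n).
(* The cone condition is used at some point of [Om] in the cell, with radius [2 * rho] so that its
   ball contains the cell; this is the origin of [2 / eps] and of [2 * rho < eps]. Cells missing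
   [Om] get the vector 0. *)
have Hz k : exists z, ball (p k) rho `&` Om !=set0 -> [/\ `|z| <= T%:R * rho,
    forall x : 'rV[R]_d, ball (p k) rho x -> Om (x + z)
    & forall (x : 'rV[R]_d) (t : R), ball (p k) rho x -> Om x -> 0 <= t <= 1 -> Om (x + t *: z)].
  have [[y [py Oy]]|nG] := pselect (ball (p k) rho `&` Om !=set0); last by exists 0.
  have [|z [zb z1 z2]] := Hc y Oy (2 * rho); first by rewrite rhoe mulr_gt0.
  have pxy (x : 'rV[R]_d) : ball (p k) rho x -> `|x - y| <= 2 * rho.
    move: py; rewrite -!ball_normE /= => py px.
    rewrite (_ : x - y = (p k - y) - (p k - x)); last by rewrite opprB [RHS]addrC addrA subrK.
    by apply: ltW; apply: le_lt_trans (ler_normB _ _) _; rewrite mulr2n mulrDl mul1r ltrD.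
  exists z => _; split; first by apply: le_trans zb _; rewrite mulrAC ler_wpM2r// ltW.
    by move=> x /pxy; exact: z1.
  by move=> x t /pxy xy Ox t01; exact: z2.
have {Hz}[z Hz] := choice Hz.
exists (fun k => ball (p k + z k) rho); split; first by move=> k; exact: ball_open.
move=> V V' u g oV oV' V'O VO HV Vc S u0; have [su sg _] := S.
have fV' : (mu V' < +oo)%E.
  by apply: le_lt_trans fO; apply: le_measure; rewrite ?inE//; exact: leb_open.
pose G k : set 'rV[R]_d := ball (p k) rho `&` V.
have oG k : open (G k) by apply: openI => //; exact: ball_open.
have {}Hz k : G k !=set0 -> [/\ `|z k| <= T%:R * rho,
    forall x : 'rV[R]_d, ball (p k) rho x -> V' (x + z k)
    & forall (x : 'rV[R]_d) (t : R), G k x -> 0 <= t <= 1 -> V' (x + t *: z k)].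
  move=> [y [py Vy]]; have [|zT z1 z2] := Hz k; first by exists y; split=> //; exact: VO.
  have pxy (x : 'rV[R]_d) : ball (p k) rho x -> `|x - y| < 2 * rho.
    move: py; rewrite -!ball_normE /= => py px.
    rewrite (_ : x - y = (p k - y) - (p k - x)); last by rewrite opprB [RHS]addrC addrA subrK.
    by apply: le_lt_trans (ler_normB _ _) _; rewrite mulr2n mulrDl mul1r ltrD.
  have zt (x : 'rV[R]_d) (t : R) : ball (p k) rho x -> 0 <= t <= 1 -> `|x + t *: z k - y| < (T + 2)%:R * rho.
    move=> px /andP[t0 t1]; rewrite addrAC natrD mulrDl addrC; apply: le_lt_trans (ler_normD _ _) _.
    apply: ler_ltD; last exact: pxy.
    by rewrite normrZ ger0_norm//; apply: le_trans zT; rewrite ler_piMl.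
  split=> // x.
    move=> px; apply: (HV y) => //; first exact: z1.
    by have := zt x 1 px; rewrite scale1r; apply; rewrite ler01 lexx.
  move=> t [px Vx] t01; apply: (HV y) => //; last exact: zt.
  by apply: z2 => //; exact: VO.
have mV := leb_open oV; have mV' := leb_open oV'; have mG k := leb_open (oG k).
have VV' : V `<=` V'.
  by move=> x Vx; apply: (HV x) => //; [exact: VO|rewrite subrr normr0 mulr_gt0// ltr0n addn2].
have ruV := sqint_sq (sqintS mV mV' VV' su).
have mB k : lmeas (ball (p k) rho) by apply: leb_open; exact: ball_open.
have mN k : lmeas (ball (p k) (T.+1%:R * rho)) by apply: leb_open; apply: ball_open; rewrite mulr_gt0.
have rI k (A : set 'rV[R]_d) (h : 'rV[R]_d -> R) V0 : lmeas V0 -> lmeas A -> rint mu V0 h ->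
    rint mu V0 (fun x => \1_A x * h x).
  move=> m0 mA rh; apply: (@rint_mul_bounded _ _ _ mu _ _ _ 1) => //.
  by move=> x _; rewrite indicE; case: (_ \in _); rewrite ?normr1 ?normr0.
pose C := (2 * (d%:R ^+ 2 * 2 / 3) + 2 * (d%:R * T%:R ^+ 2)) * rho ^+ 2.
have C0 : 0 <= C.
  by rewrite /C mulr_ge0 ?sqr_ge0// addr_ge0// mulr_ge0// ?divr_ge0// mulr_ge0// sqr_ge0.
have rd := sqint_dot_self mV' sg.
apply: (@le_trans _ _ (\sum_k \int[mu]_(x in V) (\1_(ball (p k) rho) x * u x ^+ 2))).
  rewrite -Rintegral_sum; [|exact: mV|by move=> k; exact: rI].
  apply: le_Rintegral => //; first by apply: rint_sum => // k; exact: rI.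
  move=> x Vx; rewrite -mulr_suml ler_peMl ?sqr_ge0//.
  have [k xk] := grid_cover rho0 (Vc x Vx).
  rewrite (bigD1 k)//= indicE mem_set; last by rewrite -ball_normE /= distrC.
  by rewrite lerDl sumr_ge0// => j _; rewrite indicE ler0n.
apply: (@le_trans _ _ (\sum_k C * \int[mu]_(x in V') (\1_(ball (p k) (T.+1%:R * rho)) x * dot (g x) (g x)))).
  apply: ler_sum => k _; rewrite !Rintegral_indic// setIC -/(G k).
  have [Gk|nG] := pselect (G k !=set0); last first.
    rewrite (_ : G k = set0) ?Rintegral_set0; last by apply/seteqP; split=> // x Gx; apply: nG; exists x.
    by rewrite mulr_ge0// Rintegral_ge0// => x _; exact: dot_ge0.
  have [H1 H2 H3] := Hz k Gk.
  apply: (grid_cell d0 rho0 oV' fV' S H1 (oG k) _ H2 H3); first exact: subIsetl.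
  apply: u0 => x; rewrite -ball_normE /= => px; rewrite -(subrK (z k) x); apply: H2.
  by rewrite -ball_normE /= opprB addrA.
rewrite -mulr_sumr -Rintegral_sum; [|exact: mV'|by move=> k; exact: rI].
have -> : grid_const T * rho ^+ 2 = C * (2 * T.+1)%:R ^+ d by rewrite /grid_const mulrAC.
rewrite -[leRHS]mulrA; apply: ler_wpM2l => //.
rewrite -RintegralZl//; apply: le_Rintegral => //; [by apply: rint_sum => // k; exact: rI|exact: rintZ|].
move=> x _; rewrite -mulr_suml ler_wpM2r ?dot_ge0//; apply: le_trans (grid_overlap n T.+1 c x rho0).
by apply: ler_sum => k _; rewrite indicE -ball_normE /= distrC ler_nat; case: (boolP (_ \in _)) => // /set_mem ->.
Qed.

End Grid.

Lemma mem_In (T : eqType) (x : T) (s : seq T) : x \in s -> List.In x s.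
Proof. by elim: s => //= y s IH; rewrite inE => /orP[/eqP ->|/IH]; [left|right]. Qed.

Lemma dyadic_scale {R : realType} (r : R) (J : nat) : 0 < r <= 2^-1 ^+ J ->
  exists2 j : nat, (J <= j)%N & 2^-1 ^+ j.+1 < r <= 2^-1 ^+ j.
Proof.
move=> /andP[r0 rJ].
have h01 : 0 < (2^-1 : R) < 1 by rewrite invr_gt0 ltr0n invf_lt1 ?ltr1n// ltr0n.
have ex : exists j, 2^-1 ^+ j.+1 < r.
  have n1 : `|2^-1 : R| < 1 by rewrite gtr0_norm; case/andP: h01.
  have /cvgrPdist_lt/(_ _ r0)[n _ Hn] := cvg_expr n1; exists n.
  have := Hn n.+1 (leqnSn n); rewrite sub0r normrN; apply: le_lt_trans; exact: ler_norm.
have [j jr Hj] := ex_minnP ex.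
have anti a b : (a <= b)%N -> 2^-1 ^+ b <= 2^-1 ^+ a :> R.
  move=> ab; apply: ler_wiXn2l => //; case/andP: h01 => *; exact: ltW.
have rj : r <= 2^-1 ^+ j.
  case: j jr Hj => [|j] jr Hj.
    by apply: le_trans rJ (anti _ _ _).
  by rewrite leNgt; apply/negP => /Hj; rewrite ltnn.
exists j; last by rewrite jr.
rewrite leqNgt; apply/negP => jJ; have := anti _ _ jJ.
by rewrite leNgt => /negP; apply; exact: lt_le_trans rJ.
Qed.

(** * Hausdorff measure of density sets *)

Section Covers.
Context {R : realType}.
Local Open Scope ereal_scope.

Lemma cover_outer_le (T : pointedType) (w : set T -> \bar R) (F : nat -> set T) X :
  X `<=` \bigcup_k F k -> cover_outer w X <= \sum_(k <oo) w (F k).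
Proof. by move=> XF; apply: ereal_inf_lbound; exists F => //; split=> // k; exact: sub_sigma_algebra. Qed.

Lemma cover_outer_seq (T : pointedType) (w : set T -> \bar R) (m : R) (s : seq (set T)) X :
  (forall A, 0 <= w A) -> w set0 = 0 -> (0 <= m)%R -> (forall A, List.In A s -> w A <= m%:E) ->
  (forall x, X x -> exists2 A, List.In A s & A x) -> cover_outer w X <= ((size s)%:R * m)%:E.
Proof.
move=> w0 ws0 m0 wm Xs.
apply: (@le_trans _ _ (\sum_(k <oo) w (nth set0 s k))).
  apply: cover_outer_le => x /Xs[A As Ax].
  have [k _ E] : exists2 k, (k < size s)%N & nth set0 s k = A.
    elim: s As {wm Xs} => // B s IH /= [->|/IH[k ks E]]; first by exists 0%N.
    by exists k.+1.
  by exists k => //=; rewrite E.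
apply: lime_le; first by apply: is_cvg_nneseries => n _ _; exact: w0.
apply: nearW => N.
elim: s N wm {Xs} => [|A s IH] N wm.
  by rewrite mul0r big1// => k _; rewrite nth_nil.
case: N => [|N]; first by rewrite big_geq// lee_fin mulr_ge0.
rewrite big_nat_recl//= -natr1 mulrDl mul1r [X in _ <= X%:E]addrC EFinD leeD//; first by apply: wm; left.
by apply: IH => B Bs; apply: wm; right.
Qed.

End Covers.

Lemma leb_ball {R : realType} {d : nat} (x : 'rV[R]_d) (r : R) :
  measurable (ball x r : set (leb_space R d)).
Proof.
have [r0|r0] := ltP 0 r; first by apply: leb_open; exact: ball_open.
rewrite (_ : ball x r = set0) ?measurable0//; apply/seteqP; split=> // y.
by rewrite -ball_normE /= => /(le_lt_trans (normr_ge0 _)); rewrite ltNge r0.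
Qed.

Section HausdorffBound.
Context {R : realType} {d : nat} (s : nat).
Implicit Types (x y p c : 'rV[R]_d) (A W X : set 'rV[R]_d) (f u : 'rV[R]_d -> R).
Local Notation mu := (leb R d).
Local Notation lmeas A := (measurable (A : set (leb_space R d))).

Lemma hcst_fin : @hcst R s \is a fin_num.
Proof.
rewrite /hcst fin_numM// ge0_fin_numE; last exact: outer_measure_ge0.
apply: (@leb_bounded R s); exists 1; split=> // M M1 x; rewrite /eball /= subr0 => x1.
by apply: le_trans (norm_enorm x) (le_trans (ltW x1) (ltW M1)).
Qed.

Definition hcoef : R := fine (@hcst R s).

Lemma hcoef_ge0 : 0 <= hcoef.
Proof. by apply: fine_ge0; exact: hcst_ge0. Qed.

Lemma ediam_ge0 A : (0 <= ediam A)%E.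
Proof. by apply: ereal_sup_ubound; left. Qed.

Lemma hweight_le (delta : R) A : (ediam A <= delta%:E)%E ->
  (hweight s delta A <= (hcoef * delta ^+ s)%:E)%E.
Proof.
move=> Ad; have d0 : 0 <= delta by rewrite -lee_fin (le_trans (ediam_ge0 A)).
rewrite /hweight; case: ifP => _; first by rewrite lee_fin mulr_ge0 ?exprn_ge0 ?hcoef_ge0.
rewrite Ad EFinM /hcoef fineK ?hcst_fin//; apply: lee_wpmul2l; first exact: hcst_ge0.
have := ediam_ge0 A; case: (ediam A) Ad => [r| |]//; rewrite lee_fin => rd; rewrite lee_fin => r0.
by rewrite -EFin_expe lee_fin lerXn2r.
Qed.

Lemma hweight_anti (delta delta' : R) A : delta <= delta' ->
  (hweight s delta' A <= hweight s delta A)%E.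
Proof.
move=> dd; rewrite /hweight; case: ifP => // _.
have [Ad|_] := boolP (ediam A <= delta%:E)%E; last exact: leey.
by rewrite (le_trans Ad)// lee_fin.
Qed.

Lemma cover_hweight_anti (delta delta' : R) X : delta <= delta' ->
  (cover_outer (hweight s delta') X <= cover_outer (hweight s delta) X)%E.
Proof.
move=> dd; apply: le_ereal_inf_tmp => _ [F [mF XF] <-].
apply: le_trans (cover_outer_le _ XF) _; apply: lee_nneseries => k _; last exact: hweight_anti.
by move=> _; exact: hweight_ge0.
Qed.

Lemma ediam_ball p (rho : R) : 0 <= rho -> (ediam (ball p rho : set 'rV[R]_d) <= (d%:R * (2 * rho))%:E)%E.
Proof.
move=> rho0; apply: ge_ereal_sup => _ [->|[x px [y py <-]]]; first by rewrite lee_fin !mulr_ge0.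
rewrite lee_fin; apply: le_trans (enorm_le _) _; rewrite ler_wpM2l//.
move: px py; rewrite -!ball_normE /= => px py.
rewrite (_ : x - y = (p - y) - (p - x)); last by rewrite opprB [RHS]addrC addrA subrK.
by apply: le_trans (ler_normB _ _) _; rewrite mulr2n mulrDl mul1r lerD// ltW.
Qed.

(* A point of [A] where the density of [f] at scale [rho] is at least [a] lies
   in one of few cells of a grid, since each point of [W] is near boundedly
   many cells. *)
Lemma hausdorff_density n c (rho a : R) A W f : 0 < rho -> 0 < a -> lmeas W ->
  rint mu W f -> (forall x, W x -> 0 <= f x) ->
  (forall x, A x -> `|x - c| <= n%:R * rho) ->
  (forall x, A x -> a <= \int[mu]_(y in W `&` ball x rho) f y) ->
  (cover_outer (hweight s (d%:R * (2 * rho))) A <=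
    (4 ^+ d / a * \int[mu]_(y in W) f y * (hcoef * (d%:R * (2 * rho)) ^+ s))%:E)%E.
Proof.
move=> rho0 a0 mW rf f0 Ac Ad.
pose p := grid_point c rho (n := n).
pose bad k := `[< A `&` ball (p k) rho !=set0 >].
pose bs := [seq ball (p k) rho | k <- enum (grid_index n) & bad k].
have m0 : 0 <= hcoef * (d%:R * (2 * rho)) ^+ s.
  by rewrite mulr_ge0 ?hcoef_ge0// exprn_ge0// !mulr_ge0// ltW.
have wp A' : (0 <= hweight s (d%:R * (2 * rho)) A')%E by exact: hweight_ge0.
have ws0 : hweight s (d%:R * (2 * rho)) (set0 : set 'rV[R]_d) = 0%E by exact: hweight0.
apply: le_trans (@cover_outer_seq R 'rV[R]_d _ _ bs A wp ws0 m0 _ _) _.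
- move=> B /List.in_map_iff[k [<- _]]; apply: hweight_le; apply: ediam_ball; exact: ltW.
- move=> x Ax; have [k xk] := grid_cover rho0 (Ac x Ax).
  have pkx : ball (p k) rho x by rewrite -ball_normE /= distrC.
  exists (ball (p k) rho) => //; apply/List.in_map_iff; exists k; split=> //.
  apply: mem_In; rewrite mem_filter mem_enum andbT; apply/asboolP.
  by exists x.
rewrite lee_fin ler_wpM2r// mulrAC ler_pdivlMr// size_map size_filter.
have mB k : lmeas (ball (p k) (2%:R * rho)) by apply: leb_open; apply: ball_open; rewrite mulr_gt0.
have rI k : rint mu W (fun x => \1_(ball (p k) (2%:R * rho)) x * f x).
  apply: (@rint_mul_bounded _ _ _ mu _ _ _ 1) => //.
  by move=> x _; rewrite indicE; case: (_ \in _); rewrite ?normr1 ?normr0.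
apply: (@le_trans _ _ (\sum_k \int[mu]_(x in W) (\1_(ball (p k) (2%:R * rho)) x * f x))).
  rewrite -sum1_count natr_sum mulr_suml [leLHS]big_enum_cond /=.
  rewrite [leLHS]big_mkcond; apply: ler_sum => k _.
  have I0 : 0 <= \int[mu]_(x in W) (\1_(ball (p k) (2 * rho)) x * f x).
    by apply: Rintegral_ge0 => x Wx; rewrite mulr_ge0 ?indicE ?ler0n ?f0.
  rewrite /bad; case: asboolP => //= -[x [Ax pkx]]; rewrite mul1r; apply: le_trans (Ad x Ax) _.
  rewrite Rintegral_indic//; apply: subset_Rintegral => //.
  - by apply: measurableI => //; apply: leb_open; exact: ball_open.
  - exact: measurableI.
  - move=> y [Wy]; rewrite -!ball_normE /= => xy; split=> //.
    move: pkx; rewrite -!ball_normE /= => px.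
    rewrite (_ : p k - y = (p k - x) + (x - y)); last by rewrite addrA subrK.
    by apply: le_lt_trans (ler_normD _ _) _; rewrite mulr2n mulrDl mul1r ltrD.
  - by apply: rintS rf => //; exact: measurableI.
  - by move=> y [/f0].
rewrite -Rintegral_sum; [|exact: mW|exact: rI].
rewrite -RintegralZl//; apply: le_Rintegral => //; [by apply: rint_sum|exact: rintZ|].
move=> x Wx; rewrite -mulr_suml ler_wpM2r ?f0//.
apply: le_trans (grid_overlap n 2 c x rho0).
by apply: ler_sum => k _; rewrite indicE -ball_normE /= distrC ler_nat; case: (boolP (_ \in _)) => // /set_mem ->.
Qed.

Lemma hausdorff_limsup0 (A : nat -> set 'rV[R]_d) X (D K : R) : 0 <= K ->
  (forall m, X `<=` \bigcup_j A (m + j)%N) ->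
  (forall j, (cover_outer (hweight s (D * 2^-1 ^+ j)) (A j) <= (K * 2^-1 ^+ j)%:E)%E) ->
  @hausdorff_outer R d s X = 0%E.
Proof.
move=> K0 XA HA; apply/eqP; rewrite eq_le outer_measure_ge0 andbT.
apply: ge_ereal_sup => _ [delta /= d0 <-].
have n1 : `|2^-1 : R| < 1 by rewrite gtr0_norm ?invr_gt0// invf_lt1// ltr1n.
have small C e : 0 < e -> exists m, forall j, (m <= j)%N -> C * 2^-1 ^+ j <= e :> R.
  move=> e0; have e1 : 0 < e / (`|C| + 1) by rewrite divr_gt0// ltr_wpDl.
  have /cvgrPdist_lt/(_ _ e1)[m _ Hm] := cvg_expr n1; exists m => j mj.
  have := Hm j mj; rewrite sub0r normrN => /ltW; rewrite ler_pdivlMr ?ltr_wpDl//.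
  apply: le_trans; apply: (@le_trans _ _ (2^-1 ^+ j * `|C|)).
    by rewrite mulrC ler_wpM2l ?exprn_ge0 ?invr_ge0// ler_norm.
  by apply: ler_pM; rewrite ?exprn_ge0 ?invr_ge0 ?ler_norm ?lerDl.
apply/lee_addgt0Pr => e e0; rewrite add0e.
have [m1 H1] := small D delta d0; have [m2 H2] := small (2 * K) e e0.
pose m := maxn m1 m2.
apply: (@le_trans _ _ (\sum_(j <oo) cover_outer (hweight s delta) (A (m + j)%N))%E).
  apply: le_trans; first exact: (@le_mu_ext _ (all_subsets _) R (hweight s delta) _ _ (XA m)).
  exact: (@mu_ext_sigma_subadditive _ (all_subsets _) R _ (@hweight_ge0 R d s delta)).
have c0 j : (0 <= cover_outer (hweight s delta) (A (m + j)%N))%E.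
  exact: (@mu_ext_ge0 _ (all_subsets _) R _ (@hweight_ge0 R d s delta)).
apply: lime_le; first by apply: is_cvg_nneseries => j _ _; exact: c0.
apply: nearW => N.
have bj j : (cover_outer (hweight s delta) (A (m + j)%N) <= (K * 2^-1 ^+ (m + j))%:E)%E.
  apply: le_trans (HA _); apply: cover_hweight_anti; apply: H1.
  by rewrite (leq_trans (leq_maxl m1 m2))// leq_addr.
apply: (@le_trans _ _ (\sum_(0 <= j < N) (K * 2^-1 ^+ (m + j))%:E)%E); first by apply: lee_sum.
rewrite sumEFin lee_fin; apply: le_trans (H2 m (leq_maxr m1 m2)).
have -> : \sum_(0 <= j < N) K * 2^-1 ^+ (m + j) = 2 * K * 2^-1 ^+ m * (1 - 2^-1 ^+ N).
  elim: N => [|N IH]; first by rewrite big_geq// expr0 subrr mulr0.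
  by rewrite big_nat_recr//= IH exprD exprS; field.
by rewrite ler_piMr ?mulr_ge0 ?exprn_ge0 ?invr_ge0// gerBl exprn_ge0 ?invr_ge0.
Qed.

(** The averages of $u^2$ over balls about [x] are $o(r^{-2})$, which is just what lets a Lipschitz
    factor be pulled out of the mean values. *)
Definition thin W u x := forall e : R, 0 < e -> exists2 k : R, 0 < k &
  forall r, 0 < r <= k -> r ^+ 2 * \int[mu]_(y in W `&` ball x r) (u y ^+ 2) <= e * r ^+ d.

End HausdorffBound.

Section Thin.
Context {R : realType} {d : nat}.
Implicit Types (x y p c : 'rV[R]_d) (A W X : set 'rV[R]_d) (f u : 'rV[R]_d -> R).
Local Notation mu := (leb R d).
Local Notation lmeas A := (measurable (A : set (leb_space R d))).

(* With a square integrable [u] the exceptional set at scale [rho] has content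
   [O(rho)], which is summable over dyadic scales. *)
Lemma ae_thin (n : nat) W u : (1 < d)%N -> lmeas W -> sqint mu W u ->
  @hausdorff_outer R d d.-1 [set x | `|x| <= n%:R /\ ~ thin W u x] = 0%E.
Proof.
move=> d1 mW su.
pose Z (m : nat) := [set x : 'rV[R]_d | `|x| <= n%:R /\ forall k : R, 0 < k -> exists r : R, 0 < r <= k /\
   m.+1%:R^-1 * r ^+ d < r ^+ 2 * \int[mu]_(y in W `&` ball x r) (u y ^+ 2)].
suff Z0 m : @hausdorff_outer R d d.-1 (Z m) = 0%E.
  apply/eqP; rewrite eq_le outer_measure_ge0 andbT.
  apply: (@le_trans _ _ (hausdorff_outer d.-1 (\bigcup_m Z m))).
    apply: le_outer_measure => x [xn /existsNP[e /not_implyP[e0 ne]]].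
    have [m me] : exists m : nat, m.+1%:R^-1 <= e.
      exists (Num.truncn e^-1); rewrite -[leRHS]invrK lef_pV2 ?posrE ?invr_gt0//.
      exact: ltW (truncnS_gt _).
    exists m => //; split=> // k k0; apply: contrapT => nr; apply: ne; exists k => // r rk.
    rewrite leNgt; apply/negP => Hr; apply: nr; exists r; split=> //.
    by apply: le_lt_trans Hr; rewrite ler_wpM2r// exprn_ge0//; case/andP: rk => /ltW.
  apply: le_trans (outer_measure_sigma_subadditive _ _) _.
  by rewrite eseries0// => i _ _; exact: Z0.
have mu0 := Rintegral_ge0; pose U := \int[mu]_(y in W) (u y ^+ 2).
have U0 : 0 <= U by apply: Rintegral_ge0 => y _; exact: sqr_ge0.
pose e : R := m.+1%:R^-1; have e0 : 0 < e by rewrite invr_gt0.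
pose h j : R := 2^-1 ^+ j; have h0 j : 0 < h j by rewrite exprn_gt0// invr_gt0.
pose A j := [set x : 'rV[R]_d | `|x| <= n%:R /\ exists r : R, h j.+1 < r <= h j /\
   e * r ^+ d < r ^+ 2 * \int[mu]_(y in W `&` ball x r) (u y ^+ 2)].
have dE : d = d.-2.+2 by case: (d) d1 => [|[]].
(* [hausdorff_density] gives the bound [K * h j]: the covers contribute $h_j^{d-1}$ and the density
   threshold divides by $h_{j+1}^{d-2}$, where the halved radius produces $2^{d-2}$. *)
pose K := 4 ^+ d * 2 ^+ d.-2 / e * U * (@hcoef R d.-1 * (d%:R * 2) ^+ d.-1).
have hc0 := @hcoef_ge0 R d.-1.
have K0 : 0 <= K.
  rewrite /K mulr_ge0 ?mulr_ge0 ?exprn_ge0 ?invr_ge0 ?mulr_ge0//; exact: ltW.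
apply: (@hausdorff_limsup0 R d d.-1 A (Z m) (d%:R * 2) K K0).
  move=> J x [xn Hx]; have [r [rJ Hr]] := Hx (h J) (h0 J).
  have [j Jj rj] := dyadic_scale rJ.
  by exists (j - J)%N => //; rewrite subnKC//; split=> //; exists r.
move=> j; have a0 : 0 < e * (h j.+1) ^+ d.-2 by rewrite mulr_gt0// exprn_gt0.
have mB x r : lmeas (ball x r) by exact: leb_ball.
have rs := sqint_sq su.
have Ac x : A j x -> `|x - 0| <= (n * 2 ^ j)%:R * h j.
  by move=> [xn _]; rewrite subr0 natrM natrX /h exprVn mulfK// expf_neq0.
have Ad x : A j x -> e * (h j.+1) ^+ d.-2 <= \int[mu]_(y in W `&` ball x (h j)) (u y ^+ 2).
  move=> [_ [r [/andP[hr rh] Hr]]].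
  have r0 : 0 < r := lt_trans (h0 _) hr.
  apply: (@le_trans _ _ (\int[mu]_(y in W `&` ball x r) (u y ^+ 2))).
    rewrite -(ler_pM2l (exprn_gt0 2 r0)); apply: le_trans (ltW Hr).
    have -> : r ^+ d = r ^+ 2 * r ^+ d.-2 by rewrite -exprD add2n -dE.
    rewrite [leRHS]mulrCA ler_pM2l ?exprn_gt0// ler_pM2l//.
    by rewrite lerXn2r ?nnegrE ?ltW.
  apply: subset_Rintegral.
  - by apply: measurableI => //.
  - by apply: measurableI => //.
  - by move=> y [Wy xy]; split=> //; exact: le_ball xy.
  - by apply: rintS rs => //; exact: measurableI.
  - by move=> y _; exact: sqr_ge0.
have := @hausdorff_density R d d.-1 (n * 2 ^ j) 0 (h j) _ (A j) W _ (h0 j) a0 mW rs (fun y _ => sqr_ge0 _) Ac Ad.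
rewrite -/U mulrA => /le_trans; apply; rewrite lee_fin le_eqVlt; apply/orP; left; apply/eqP.
rewrite /K -/(h j) (_ : h j.+1 = 2^-1 * h j); last by rewrite /h exprS.
rewrite (_ : (d%:R * 2 * h j) ^+ d.-1 = (d%:R * 2) ^+ d.-1 * (h j ^+ d.-2 * h j)); last first.
  rewrite exprMn; congr (_ * _); rewrite -exprSr; congr (_ ^+ _).
  by rewrite [in LHS]dE.
rewrite exprMn exprVn.
have q1 := lt0r_neq0 (h0 j); have q2 := lt0r_neq0 e0.
by field; rewrite q2 /= !expf_neq0.
Qed.

End Thin.

(** * Mean values near the boundary *)

Section Means.
Context {R : realType} {d : nat}.
Implicit Types (x y z p c : 'rV[R]_d) (A W w Om U : set 'rV[R]_d) (f u theta : 'rV[R]_d -> R).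
Local Notation mu := (leb R d).
Local Notation lmeas A := (measurable (A : set (leb_space R d))).
Local Notation lmfun W f := (measurable_fun (W : set (leb_space R d)) (f : leb_space R d -> _)).

Lemma enormD x y : enorm (x + y) <= enorm x + enorm y.
Proof.
rewrite -ler_sqr ?nnegrE ?addr_ge0 ?enorm_ge0// sqr_enorm dotDl !dotDr (dotC y x) sqrrD !sqr_enorm.
have : dot x y <= enorm x * enorm y.
  apply: le_trans (ler_norm _) _; rewrite -ler_sqr ?nnegrE ?mulr_ge0 ?enorm_ge0//.
  by rewrite real_normK ?num_real// exprMn !sqr_enorm dot_CS.
by rewrite mulr2n; lra.
Qed.

Lemma open_eball x (r : R) : open (eball x r).
Proof.
rewrite openE => y; rewrite /eball /= => xy; apply/nbhs_ballP.
have d1 : 0 < d%:R + 1 :> R by rewrite ltr_wpDl.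
exists ((r - enorm (y - x)) / (d%:R + 1)) => /=; first by rewrite divr_gt0// subr_gt0.
move=> y'; rewrite -ball_normE /= distrC ltr_pdivlMr// => yy'.
rewrite (_ : y' - x = (y' - y) + (y - x)); last by rewrite addrA subrK.
apply: le_lt_trans (enormD _ _) _; rewrite -ltrBrDr; apply: le_lt_trans yy'.
apply: le_trans (enorm_le _) _; rewrite mulrDr mulr1 mulrC lerDl//.
Qed.

Lemma leb_eball x (r : R) : lmeas (eball x r).
Proof. exact: leb_open (@open_eball x r). Qed.

Lemma eball_ball x (r : R) : eball x r `<=` ball x r.
Proof. by move=> y; rewrite /eball -ball_normE /= distrC; apply: le_lt_trans; exact: norm_enorm. Qed.

(** The volume of the sup-norm unit ball. Its positivity is carried along as a hypothesis; the
    theorem settles the case of volume 0 by [unit_vol0]. *)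
Definition unit_vol : R := fine (mu (ball (0 : 'rV[R]_d) 1)).

Lemma ball_bounded x (r : R) : bounded_set (ball x r : set 'rV[R]_d).
Proof.
exists (`|x| + `|r|); split=> [|M xM y]; first by rewrite num_real.
rewrite -ball_normE /= => xy; apply: le_trans (ltW xM); rewrite -lerBlDl.
apply: le_trans (ler_norm r); apply: le_trans (ltW xy); rewrite distrC.
exact: lerB_dist.
Qed.

Lemma leb_ball_fin x (r : R) : (mu (ball x r) < +oo)%E.
Proof. by apply: leb_bounded; exact: ball_bounded. Qed.

Lemma leb_fineS A W : lmeas A -> lmeas W -> A `<=` W -> (mu W < +oo)%E -> fine (mu A) <= fine (mu W).
Proof.
move=> mA mW AW fW; have H : (mu A <= mu W)%E by apply: le_measure; rewrite ?inE.
by apply: fine_le => //; rewrite ge0_fin_numE//; exact: le_lt_trans fW.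
Qed.

Lemma leb_ball_ge p (rho : R) : 0 < rho -> rho ^+ d * unit_vol <= fine (mu (ball p rho)).
Proof.
move=> rho0; have := @leb_outer_affine R d rho p (ball p rho) rho0.
rewrite (_ : [set x | _] = ball (0 : 'rV[R]_d) 1); last first.
  apply/seteqP; split=> x /=; rewrite -!ball_normE /= sub0r normrN opprD addrCA subrr addr0 normrN normrZ gtr0_norm//.
    by rewrite gtr_pMr.
  by rewrite gtr_pMr.
have fB := leb_ball_fin p rho; have f1 := leb_ball_fin 0 1.
have n1 : mu (ball (0 : 'rV[R]_d) 1) \is a fin_num by rewrite ge0_fin_numE.
have n2 : mu (ball p rho) \is a fin_num by rewrite ge0_fin_numE.
change ((mu (ball (0%R : 'rV[R]_d) 1) <= (rho ^- d)%:E * mu (ball p rho))%E -> rho ^+ d * unit_vol <= fine (mu (ball p rho))).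
rewrite -(fineK n1) -(fineK n2) -EFinM lee_fin -/unit_vol => H.
by rewrite mulrC -ler_pdivlMr ?exprn_gt0// mulrC.
Qed.

(** A ball of radius [r / D] about a nearby point of [Om], moved by the cone vector, lies in [Om]
    and still within Euclidean distance [r] of [x]. In [D], the summands 2 and $1/\varepsilon$
    account for the distances in units of the radius, and [d] compares the norms. *)
Lemma density_closure Om eps x : (0 < d)%N -> open Om -> 0 < eps ->
  (forall y, Om y -> cone_at Om eps y) -> closure Om x ->
  let D := d%:R * (2 + eps^-1) in
  forall r, 0 < r < eps * D -> (r / D) ^+ d * unit_vol <= fine (mu (eball x r `&` Om)).
Proof.
move=> d0 oO e0 Hc cx D r /andP[r0 re].
have D0 : 0 < D by rewrite mulr_gt0 ?ltr0n// addr_gt0// invr_gt0.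
pose rho := r / D; have rho0 : 0 < rho by rewrite divr_gt0.
have [y [Oy xy]] := cx (ball x rho) (nbhsx_ballx x rho rho0).
have [|z [zb z1 _]] := Hc y Oy rho; first by rewrite rho0 ltr_pdivrMr.
apply: le_trans (leb_ball_ge (y + z) rho0) _; apply: leb_fineS.
- exact: leb_ball.
- by apply: measurableI; [exact: leb_eball|exact: leb_open].
- move=> x'; rewrite -ball_normE /= => yx; split; last first.
    rewrite -(subrK z x'); apply: z1; apply/ltW; apply: le_lt_trans yx.
    by rewrite (_ : x' - z - y = - (y + z - x')) ?normrN// opprB opprD addrA addrAC.
  rewrite /eball /=; apply: le_lt_trans (enorm_le _) _.
  have -> : r = d%:R * ((2 + eps^-1) * rho) by rewrite mulrA -/D /rho mulrCA divff ?mulr1// gt_eqF.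
  rewrite ltr_pM2l ?ltr0n//.
  rewrite (_ : x' - x = - (y + z - x') + (z - (x - y))); last first.
    by apply/rowP => i; rewrite !mxE; ring.
  apply: le_lt_trans (ler_normD _ _) _; rewrite normrN.
  move: xy; rewrite -ball_normE /= => xy.
  have : `|z - (x - y)| < rho / eps + rho.
    by apply: le_lt_trans (ler_normB _ _) _; rewrite ler_ltD.
  by rewrite mulrDl [eps^-1 * rho]mulrC; lra.
- by apply: le_lt_trans (leb_ball_fin x r); apply: le_measure; rewrite ?inE;
    [apply: measurableI; [exact: leb_eball|exact: leb_open]|exact: leb_ball|move=> x' [/eball_ball]].
Qed.

(** On the ball, [theta] differs from [theta x] by at most $Lr$, so by Cauchy-Schwarz the squared
    difference is at most $L^2 r^2$ times the average of $u^2$. The lower density bound turns that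
    average into the quantity controlled by [thin]. *)
Lemma mean_cutoff w u theta L M (c : R) x : (0 < d)%N -> lmeas w -> (mu w < +oo)%E -> sqint mu w u ->
  lmfun w theta -> 0 <= L -> (forall y, `|theta y| <= M) ->
  (forall y, `|theta y - theta x| <= L * `|y - x|) -> 0 < c ->
  (\forall r \near 0^'+, c * r ^+ d <= fine (mu (eball x r `&` w))) -> thin w u x ->
  mean w (fun y => theta y * u y) x r - theta x * mean w u x r @[r --> 0^'+] --> 0.
Proof.
move=> d0 mw fw su mth L0 thM thL c0 Hd tx.
apply/cvgrPdist_le => e e0; pose e' := e ^+ 2 * c / (L + 1) ^+ 2.
have L1 : 0 < L + 1 by rewrite ltr_wpDl.
have e'0 : 0 < e' by rewrite divr_gt0 ?mulr_gt0 ?exprn_gt0.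
have [k k0 Hk] := tx e' e'0.
near=> r; rewrite sub0r normrN.
have r0 : 0 < r by near: r; exact: nbhs_right_gt.
have rk : 0 < r <= k by rewrite r0/=; near: r; exact: nbhs_right_le.
have Hr : c * r ^+ d <= fine (mu (eball x r `&` w)) by near: r.
have rd : 0 < r ^+ d by rewrite exprn_gt0.
pose E := eball x r `&` w; pose V := fine (mu E).
have V0 : 0 < V by apply: lt_le_trans Hr; rewrite mulr_gt0.
have mE : lmeas E by apply: measurableI => //; exact: leb_eball.
have Ew : E `<=` w by move=> y [].
have fE : (mu E < +oo)%E by apply: le_lt_trans fw; apply: le_measure; rewrite ?inE.
have suE := sqintS mE mw Ew su; have ruE := sqint_rint_finite mE fE suE.
have mthE : lmfun E theta by exact: measurable_funS mth.
have rtu : rint mu E (fun y => theta y * u y) by apply: (rint_mul_bounded mE ruE mthE) => y _; exact: thM.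
have diffE : mean w (fun y => theta y * u y) x r - theta x * mean w u x r =
    (\int[mu]_(y in E) ((theta y - theta x) * u y)) / V.
  rewrite /mean -/E -/V mulrA -mulrBl; congr (_ / _).
  rewrite -RintegralZl// -RintegralB//; last exact: rintZ.
  by apply: eq_Rintegral => y _; rewrite mulrBl.
rewrite diffE -ler_sqr ?nnegrE// ?(ltW e0)// real_normK ?num_real// expr_div_n.
have mdE : lmfun E (fun y => theta y - theta x) by apply: measurable_funB => //; exact: measurable_cst.
have bd y : E y -> `|theta y - theta x| <= L * r.
  move=> [xy _]; apply: le_trans (thL y) _; rewrite ler_wpM2l//.
  by apply: le_trans (norm_enorm _) (ltW xy).
have sd := sqint_mul_bounded mE suE mdE bd.
have H1 := Rintegral_sqr_le mE fE sd; rewrite -/V in H1.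
rewrite ler_pdivrMr ?exprn_gt0//; apply: le_trans H1 _.
rewrite [V ^+ 2]expr2 mulrCA ler_pM2l//.
apply: (@le_trans _ _ (L ^+ 2 * (r ^+ 2 * \int[mu]_(y in w `&` ball x r) (u y ^+ 2)))).
  have mB : lmeas (w `&` ball x r) by apply: measurableI => //; exact: leb_ball.
  have sB : sqint mu (w `&` ball x r) u by apply: sqintS su => // y [].
  have sB2 := sqint_sq sB.
  rewrite mulrA -exprMn -RintegralZl//.
  apply: (@le_trans _ _ (\int[mu]_(y in E) ((L * r) ^+ 2 * u y ^+ 2))).
    apply: le_Rintegral => //; [exact: sqint_sq|by apply: rintZ => //; exact: sqint_sq|].
    move=> y Ey; rewrite exprMn ler_wpM2r ?sqr_ge0// -real_normK ?num_real//.
    by rewrite ler_sqr ?nnegrE ?mulr_ge0// ?(ltW r0)//; exact: bd.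
  apply: subset_Rintegral => //; [|exact: rintZ|].
    by move=> y [/eball_ball xy wy].
  by move=> y _; rewrite mulr_ge0 ?sqr_ge0.
have := Hk r rk => H2.
apply: (@le_trans _ _ (L ^+ 2 * (e' * r ^+ d))); first by rewrite ler_wpM2l ?sqr_ge0.
apply: (@le_trans _ _ ((L + 1) ^+ 2 * (e' * r ^+ d))).
  apply: ler_wpM2r; first by apply: mulr_ge0; exact: ltW.
  by rewrite ler_sqr ?nnegrE ?(ltW L1)// lerDl.
rewrite (_ : (L + 1) ^+ 2 * (e' * r ^+ d) = e ^+ 2 * (c * r ^+ d)); last by rewrite /e'; field; rewrite gt_eqF.
by rewrite ler_wpM2l ?sqr_ge0.
Unshelve. all: by end_near. Qed.

Lemma mean_out w K u theta x : closed K -> ~ K x -> (forall y, ~ K y -> theta y = 0) ->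
  \forall r \near 0^'+, mean w (fun y => theta y * u y) x r = 0.
Proof.
move=> cK Kx K0.
have /nbhs_ballP[s /= s0 Hs] : nbhs x (~` K) by apply: open_nbhs_nbhs; split=> //; exact: closed_openC.
near=> r; rewrite /mean (_ : \int[mu]_(y in _) _ = 0) ?mul0r//.
have E0 : {in eball x r `&` w, (fun y => theta y * u y) =1 fun=> 0}.
  move=> y /set_mem[/eball_ball xy _]; rewrite K0 ?mul0r//; apply: Hs; apply: le_ball xy.
  by near: r; exact: nbhs_right_le.
transitivity (\int[mu]_(y in eball x r `&` w) (0 : R)); first exact: eq_Rintegral.
by rewrite /Rintegral integral0.
Unshelve. all: by end_near. Qed.

Lemma trace_point0 w u x : ~ cvg (mean w u x @ 0^'+) -> trace w u x = 0.
Proof. by rewrite /trace => /dvgP ->. Qed.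

Lemma trace_cutoff w u theta x :
  mean w (fun y => theta y * u y) x r - theta x * mean w u x r @[r --> 0^'+] --> 0 ->
  trace w (fun y => theta y * u y) x = theta x * trace w u x.
Proof.
move=> H; have [cu|ncu] := pselect (cvg (mean w u x @ 0^'+)).
  apply: cvg_lim => //.
  have H1 : theta x * mean w u x r @[r --> 0^'+] --> theta x * trace w u x.
    by apply: cvgM; [exact: cvg_cst|exact: cu].
  exact: cvg_sub0 H H1.
rewrite (trace_point0 ncu) mulr0; have [t0|t0] := eqVneq (theta x) 0.
  apply: cvg_lim => //; apply: cvg_sub0 H _; rewrite t0.
  by under eq_fun do rewrite mul0r; exact: cvg_cst.
apply: trace_point0 => cf; apply: ncu.
have H2 := cvgM (cvg_cst (theta x)^-1) (cvgB cf H).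
apply/cvg_ex; eexists; move: H2; rewrite (_ : _ \* _ = mean w u x); first exact.
by apply/funext => r /=; rewrite opprB addrCA subrr addr0 mulKf.
Unshelve. all: by end_near. Qed.

Lemma bounded_setS A W : A `<=` W -> bounded_set W -> bounded_set A.
Proof. by move=> AW [M [Mr HM]]; exists M; split=> // N MN x /AW Wx; exact: HM. Qed.

Lemma outer_null_measurable (nu : {outer_measure set 'rV[R]_d -> \bar R}) A :
  nu A = 0%E -> nu.-cara.-measurable A.
Proof.
move=> A0; apply: le_caratheodory_measurable => X.
suff H : (nu (X `&` A) + nu (X `&` ~` A) <= nu X)%E by exact: H.
have -> : nu (X `&` A) = 0%E.
  apply/eqP; rewrite eq_le outer_measure_ge0 andbT -A0; apply: le_outer_measure.
  by move=> x [].
by rewrite add0e; apply: le_outer_measure => x [].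
Qed.

Lemma hausdorff_ae (s : nat) X (Q : 'rV[R]_d -> Prop) : @hausdorff_outer R d s X = 0%E ->
  (forall x, ~ X x -> Q x) -> \forall x \ae hausdorff R d s, Q x.
Proof.
move=> X0 HQ; exists X; split; [exact: outer_null_measurable|exact: X0|].
by move=> x nQ; apply: contrapT => /HQ.
Qed.

(** Nothing is known about the boundary of [U], but it is never seen: either [x] is off the support
    of [theta], and both terms vanish for small radii, or [x] is in [U], and small balls meet [U]
    and [Om] in the same set as [Om] alone. *)
Lemma cutoff_mean Om eps U theta u x : (1 < d)%N -> open Om -> bounded_set Om -> 0 < eps ->
  (forall y, Om y -> cone_at Om eps y) -> 0 < unit_vol -> open U -> test_function U theta ->
  sqint mu (U `&` Om) u -> closure (U `&` Om) x -> thin (U `&` Om) u x ->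
  mean (U `&` Om) (fun y => theta y * u y) x r - theta x * mean (U `&` Om) u x r @[r --> 0^'+] --> 0.
Proof.
move=> d1 oO bO e0 Hc v0 oU tU su cx tx; set w := U `&` Om.
have d0 : (0 < d)%N := ltnW d1.
have [sth [K [cK KU K0]]] := tU.
have clK := compact_closed_row cK.
have [Kx|nK] := pselect (K x); last first.
  rewrite (K0 x nK); apply/cvgrPdist_le => e e1; near=> r.
  rewrite mul0r subr0 sub0r normrN.
  have -> : mean w (fun y => theta y * u y) x r = 0 by near: r; exact: mean_out clK nK K0.
  by rewrite normr0 ltW.
have oW : open w by exact: openI.
have mw := leb_open oW; have mOm := leb_open oO.
have fw : (mu w < +oo)%E.
  apply: le_lt_trans (leb_bounded bO); apply: le_measure; rewrite ?inE//; exact: subIsetr.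
have [L L0 HL] := test_function_lipschitz tU.
have [M M0 HM] := test_function_bounded tU.
have mth : lmfun w theta by exact: test_function_measurable tU.
pose D := d%:R * (2 + eps^-1).
have D0 : 0 < D by rewrite mulr_gt0 ?ltr0n// addr_gt0// invr_gt0.
have c0 : 0 < D ^- d * unit_vol by rewrite mulr_gt0// invr_gt0 exprn_gt0.
apply: (mean_cutoff d0 mw fw su mth L0 HM (fun y => HL y x) c0) => //.
have cOm : closure Om x by apply: closureS cx; exact: subIsetr.
have /nbhs_ballP[s /= s0 Hs] : nbhs x U by apply: open_nbhs_nbhs; split=> //; exact: KU.
near=> r.
have r0 : 0 < r by near: r; exact: nbhs_right_gt.
rewrite (_ : eball x r `&` w = eball x r `&` Om).
  rewrite mulrAC [D ^- d * _]mulrC -expr_div_n; apply: (density_closure d0 oO e0 Hc cOm); rewrite r0 /=.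
  by near: r; apply: nbhs_right_lt; rewrite mulr_gt0.
apply/seteqP; split=> [y [xy [_ Oy]]//|y [xy Oy]]; split=> //; split=> //; apply: Hs.
by apply: le_ball (eball_ball xy); near: r; exact: nbhs_right_le.
Unshelve. all: by end_near. Qed.

Lemma hausdorff_bnd_thin w u : (1 < d)%N -> lmeas w -> bounded_set w -> sqint mu w u ->
  \forall x \ae hausdorff R d d.-1, closure w x -> thin w u x.
Proof.
move=> d1 mw [N [_ HN]] su.
pose n := (Num.truncn (`|N| + 2)).+1.
apply: (hausdorff_ae (ae_thin n d1 mw su)) => x nx cx; apply: contrapT => nt; apply: nx; split=> //.
have [y [wy]] := cx (ball x 1) (nbhsx_ballx x 1 ltr01); rewrite -ball_normE /= => xy.
have yN : `|y| <= `|N| + 1 by apply: HN => //; rewrite (le_lt_trans (ler_norm N))// ltrDl.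
rewrite -(subrK y x); apply: le_trans (ler_normD _ _) _.
apply: (@le_trans _ _ (`|N| + 2)); first by lra.
exact: ltW (truncnS_gt _).
Qed.

End Means.

(** * Cutoffs and the boundary conditions *)

Section Cutoff.
Context {R : realType} {d : nat} (P : pde_data R d).
Implicit Types (x y : 'rV[R]_d) (w U : set 'rV[R]_d) (u theta : 'rV[R]_d -> R).
Local Notation mu := (leb R d).
Local Notation Om := (Omega P).

Lemma bnd_not_in w x : open w -> bnd w x -> closure w x /\ ~ w x.
Proof. by move=> oW [cx ix]; split=> // wx; apply: ix; move: oW; rewrite openE; exact. Qed.

Lemma test_sobolev w U u g theta : open w -> test_function U theta -> sobolev w u g ->
  sobolev w (fun x => theta x * u x) (fun x => theta x *: g x + u x *: (\row_i partial i theta x)).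
Proof.
move=> oW tU S; have [M M0 HM] := test_function_bounded tU.
have Hi (i : 'I_d) : exists N : R, 0 <= N /\ forall x, `|partial i theta x| <= N.
  by have [N N0 HN] := test_function_bounded (test_function_partial i tU); exists N.
have [N HN] := choice Hi.
apply: (@sobolev_smooth _ _ _ _ _ _ (M + \sum_i N i)) => //; first by case: tU.
  by move=> x _; apply: le_trans (HM x) _; rewrite lerDl sumr_ge0// => i _; case: (HN i).
move=> i x _; have [Ni0 HNi] := HN i; apply: le_trans (HNi x) _.
rewrite (bigD1 i)//= addrCA lerDl addr_ge0// sumr_ge0// => j _; by case: (HN j).
Qed.

(** A boundary point of [U] in [Om] is outside [U], hence off the support of [theta]; on [GammaD]
    the trace of [u] is already 0. *)
Lemma cutoff_H1D0 eps U theta u : (1 < d)%N -> open Om -> bounded_set Om -> 0 < eps ->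
  (forall y, Om y -> cone_at Om eps y) -> 0 < @unit_vol R d -> open U -> test_function U theta ->
  H1D P (U `&` Om) u -> H1D0 P (U `&` Om) (fun x => theta x * u x).
Proof.
move=> d1 oO bO e0 Hc v0 oU tU [H1u vu]; set w := U `&` Om.
have oW : open w by exact: openI.
have S := H1_sobolev oW H1u; have [su _ _] := S.
split; first exact: sobolev_H1 oW (test_sobolev oW tU S).
have bw : bounded_set w by apply: bounded_setS bO; exact: subIsetr.
have := aeI vu (hausdorff_bnd_thin d1 (leb_open oW) bw su).
apply: aeS => x [vx tx] Hx.
have [clx nwx] : closure w x /\ ~ w x by apply: (bnd_not_in oW); case: Hx => -[].
have main := cutoff_mean d1 oO bO e0 Hc v0 oU tU su clx (tx clx).
have [sth [K [cK KU K0]]] := tU.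
case: Hx => [[bx Dx]|[bx Ox]].
  apply: cvg_sub0 main _; rewrite -[X in _ --> X](mulr0 (theta x)).
  by apply: cvgM; [exact: cvg_cst|exact: vx].
have nK : ~ K x by move=> /KU Ux; apply: nwx.
apply: cvg_sub0 main _; rewrite (K0 x nK).
by under eq_fun do rewrite mul0r; exact: cvg_cst.
Qed.

Lemma cutoff_trace eps U theta u : (1 < d)%N -> open Om -> bounded_set Om -> 0 < eps ->
  (forall y, Om y -> cone_at Om eps y) -> 0 < @unit_vol R d -> open U -> test_function U theta ->
  H1 (U `&` Om) u -> \forall x \ae hausdorff R d d.-1, bnd (U `&` Om) x ->
    trace (U `&` Om) (fun y => theta y * u y) x = theta x * trace (U `&` Om) u x.
Proof.
move=> d1 oO bO e0 Hc v0 oU tU H1u; set w := U `&` Om.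
have oW : open w by exact: openI.
have [su _ _] := H1_sobolev oW H1u.
have bw : bounded_set w by apply: bounded_setS bO; exact: subIsetr.
have := hausdorff_bnd_thin d1 (leb_open oW) bw su.
apply: aeS => x tx bx; have [clx _] := bnd_not_in oW bx.
by apply: trace_cutoff; exact: cutoff_mean d1 oO bO e0 Hc v0 oU tU su clx (tx clx).
Qed.

End Cutoff.

(** * Measurability of traces *)

Section HausdorffBorel.
Context {R : realType} {d : nat} (s : nat).
Implicit Types (x y : 'rV[R]_d) (A B X Y : set 'rV[R]_d).
Local Notation H := (@hausdorff_outer R d s).
Local Open Scope ereal_scope.

(** A set of diameter at most [delta] cannot meet both [A] and [B], so a cover of the union splits
    into two covers. *)
Lemma cover_hweight_add (i : 'I_d) (delta : R) A B :
  (forall x y, A x -> B y -> (delta < `|x 0%R i - y 0%R i|)%R) ->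
  cover_outer (hweight s delta) A + cover_outer (hweight s delta) B <=
  cover_outer (hweight s delta) (A `|` B).
Proof.
move=> AB; apply: le_ereal_inf_tmp => _ [F [_ ABF] <-].
pose G (X : set 'rV[R]_d) k := if `[< F k `&` X !=set0 >] then F k else set0.
have cG X : X `<=` A `|` B -> X `<=` \bigcup_k G X k.
  move=> XAB x Xx; have [k _ Fk] := ABF _ (XAB x Xx); exists k => //.
  by rewrite /G asboolT//; exists x.
apply: (@le_trans _ _ (\sum_(k <oo) hweight s delta (G A k) + \sum_(k <oo) hweight s delta (G B k))).
  by apply: leeD; apply: cover_outer_le; apply: cG => x; [left|right].
rewrite -nneseriesD; [|by move=> *; exact: hweight_ge0|by move=> *; exact: hweight_ge0].
apply: lee_nneseries => k _; first by move=> _; rewrite adde_ge0 ?hweight_ge0.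
rewrite /G; case: asboolP => [[x [Fx Ax]]|_]; case: asboolP => [[y [Fy By]]|_];
  rewrite ?hweight0 ?adde0 ?add0e ?hweight_ge0//.
rewrite {3}/hweight ifF; last by apply/negbTE/eqP => F0; move: Fx; rewrite F0.
case: ifPn => [|_]; last exact: leey.
move=> Fd; have := AB x y Ax By; rewrite ltNge => /negP[].
rewrite -lee_fin; apply: le_trans Fd; apply: (@le_trans _ _ (enorm (x - y))%:E).
  by rewrite lee_fin -rowB coord_enorm.
by apply: ereal_sup_ubound; right; exists x => //; exists y.
Qed.

Lemma hausdorff_add (i : 'I_d) (c1 c2 : R) A B : (c1 < c2)%R ->
  (forall x, A x -> (x 0%R i <= c1)%R) -> (forall y, B y -> (c2 <= y 0%R i)%R) ->
  H A + H B <= H (A `|` B).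
Proof.
move=> c12 Ac Bc.
have HM delta X : (0 < delta)%R -> cover_outer (hweight s delta) X <= H X.
  by move=> d0; apply: ereal_sup_ubound; exists delta.
have key d1 d2 : (0 < d1)%R -> (0 < d2)%R ->
    cover_outer (hweight s d1) A + cover_outer (hweight s d2) B <= H (A `|` B).
  move=> d10 d20; pose delta := Num.min (Num.min d1 d2) ((c2 - c1) / 2)%R.
  have d0 : (0 < delta)%R by rewrite !lt_min d10 d20 divr_gt0// subr_gt0.
  apply: le_trans (HM delta _ d0); apply: le_trans (@cover_hweight_add i delta A B _).
    by apply: leeD; apply: cover_hweight_anti; rewrite !ge_min lexx ?orbT.
  move=> x y /Ac x1 /Bc y2; apply: (@le_lt_trans _ _ ((c2 - c1) / 2)%R); first by rewrite !ge_min lexx !orbT.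
  by rewrite distrC; apply: lt_le_trans (ler_norm _); lra.
have [HAB|] := ltP (H (A `|` B)) +oo; last by rewrite leye_eq => /eqP ->; exact: leey.
have fAB : H (A `|` B) \is a fin_num by rewrite ge0_fin_numE// outer_measure_ge0.
have fA : H A \is a fin_num.
  rewrite ge0_fin_numE ?outer_measure_ge0//; apply: le_lt_trans HAB; apply: le_outer_measure.
  exact: subsetUl.
have c0 delta X : 0 <= cover_outer (hweight s delta) X.
  exact: (@mu_ext_ge0 _ (all_subsets _) R _ (@hweight_ge0 R d s delta)).
rewrite addeC -leeBrDr//; apply: ge_ereal_sup => _ [d2 /= d20 <-].
rewrite leeBrDr// addeC -leeBrDr; last first.
  rewrite ge0_fin_numE//; apply: le_lt_trans (HM d2 B d20) _.
  by apply: le_lt_trans HAB; apply: le_outer_measure; exact: subsetUr.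
apply: ge_ereal_sup => _ [d1 /= d10 <-]; rewrite leeBrDr; first exact: key.
rewrite ge0_fin_numE//; apply: le_lt_trans (HM d2 B d20) _.
by apply: le_lt_trans HAB; apply: le_outer_measure; exact: subsetUr.
Qed.

(** Caratheodory's criterion for metric outer measures. The strips [B m] accumulate at the
    hyperplane; those of equal parity are separated, so all of them sum to at most [H X + H X] and
    their tails vanish. Without a tail, the part below the hyperplane has a gap to the rest, and
    additivity holds. *)
Lemma hausdorff_halfspace (i : 'I_d) (c : R) :
  H.-cara.-measurable [set x : 'rV[R]_d | (x 0%R i < c)%R].
Proof.
apply: le_caratheodory_measurable => X; set E := [set x | _].
suff : H (X `&` E) + H (X `&` ~` E) <= H X by [].
have [HX|] := ltP (H X) +oo; last by rewrite leye_eq => /eqP ->; exact: leey.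
pose h (m : nat) : R := (m.+1%:R^-1)%R.
have h0 m : (0 < h m)%R by rewrite invr_gt0.
have hS m n : (m < n)%N -> (h n < h m)%R by move=> mn; rewrite ltf_pV2 ?posrE// ltr_nat ltnS.
pose Y m := X `&` [set x : 'rV[R]_d | (x 0%R i <= c - h m)%R].
pose B m := X `&` [set x : 'rV[R]_d | (c - h m < x 0%R i <= c - h m.+1)%R].
have YX m : Y m `<=` X by move=> x [].
have YS m n : (m <= n)%N -> Y m `<=` Y n.
  rewrite leq_eqVlt => /orP[/eqP -> //|mn] x [Xx /= xm]; split=> //=.
  by apply: le_trans xm _; rewrite lerD2l lerN2 ltW// hS.
have H0 Z : 0 <= H Z by exact: outer_measure_ge0.
have alt p N : \sum_(0 <= k < N) H (B (2 * k + p).+1) <= H (Y (2 * N + p)%N).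
  elim: N => [|N IH]; first by rewrite big_geq.
  rewrite big_nat_recr//=; apply: (@le_trans _ _ (H (Y (2 * N + p)%N) + H (B (2 * N + p).+1))).
    exact: leeD.
  apply: le_trans (@hausdorff_add i (c - h (2 * N + p)%N)%R (c - h (2 * N + p).+1)%R _ _ _ _ _) _.
  - by rewrite ltrD2l ltrN2 hS.
  - by move=> x [].
  - by move=> x [_ /andP[/ltW]].
  - apply: le_outer_measure => x [|[Xx /andP[_ xB]]]; first by apply: YS; lia.
    by split=> //=; apply: le_trans xB _; rewrite lerD2l lerN2 mulnSr addnAC addn2.
have tot N : \sum_(0 <= k < 2 * N) H (B k.+1) <= H X + H X.
  apply: (@le_trans _ _ (\sum_(0 <= k < N) H (B (2 * k + 0).+1) + \sum_(0 <= k < N) H (B (2 * k + 1).+1))).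
    elim: N => [|N IH]; first by rewrite muln0 !big_geq// adde0.
    rewrite mulnSr addn2 !big_nat_recr//= -addeA; apply: le_trans (leeD IH (lexx _)) _.
    by rewrite addn0 addn1 addeACA.
  by apply: leeD; apply: le_trans (alt _ _) _; apply: le_outer_measure.
have fsum : \sum_(0 <= k <oo) H (B k.+1) < +oo.
  apply: (@le_lt_trans _ _ (H X + H X)); last by rewrite lte_add_pinfty.
  apply: lime_le; first by apply: is_cvg_nneseries.
  apply: nearW => N; apply: le_trans (tot N).
  by apply: lee_sum_nneg_natr => //; lia.
have tail := nneseries_tail_cvg fsum (fun k _ => H0 _).
have split_ m : X `&` E `<=` Y m.+1 `|` \bigcup_(k in ~` `I_m) B k.+1.
  move=> x [Xx /= xc]; have [xm|xm] := leP (x 0%R i) (c - h m.+1)%R; first by left; split.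
  right; have ex : exists n, (x 0%R i <= c - h n)%R.
    exists (Num.truncn (c - x 0%R i)^-1%R); rewrite lerBrDr addrC -lerBrDr.
    rewrite -[leRHS]invrK lef_pV2 ?posrE ?invr_gt0 ?subr_gt0//.
    exact: ltW (truncnS_gt _).
  have [n xn Hn] := ex_minnP ex.
  have mn : (m.+1 < n)%N.
    rewrite ltnNge; apply/negP => nm; move: xm; rewrite ltNge => /negP; apply.
    by apply: le_trans xn _; rewrite lerD2l lerN2; case: ltngtP nm => // [/hS/ltW|->].
  exists n.-2; first by apply/negP; rewrite -leqNgt; lia.
  have nE : n = n.-2.+2 by lia.
  split=> //=; rewrite -nE xn andbT ltNge; apply/negP => xn1.
  by have := Hn _ xn1; lia.
apply/lee_addgt0Pr => e e0.
have [m Hm] : exists m, \sum_(m <= k <oo) H (B k.+1) < e%:E.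
  have : nbhs 0 [set y : \bar R | y < e%:E].
    by apply: lt_nbhsl; move: e0; rewrite -lte_fin.
  by move=> /tail[m _ Hm]; exists m; exact: Hm (leqnn m).
have HXE : H (X `&` E) <= H (Y m.+1) + e%:E.
  have s1 : H (X `&` E) <= H (Y m.+1 `|` \bigcup_(k in ~` `I_m) B k.+1).
    by apply: le_outer_measure; exact: split_.
  apply: le_trans s1 _; apply: le_trans (outer_measureU2 _ _ _) _; apply: leeD => //.
  apply: le_trans (ltW Hm).
  exact: (@outer_measure_sigma_subadditive_tail _ _ H m (fun k => B k.+1)).
apply: le_trans (leeD HXE (lexx _)) _; rewrite addeAC leeD//.
apply: le_trans (@hausdorff_add i (c - h m.+1)%R c _ _ _ _ _) _.
- by rewrite ltrBlDr ltrDl.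
- by move=> x [].
- by move=> x [_ /= /negP]; rewrite -leNgt.
- by apply: le_outer_measure => x [[]|[]].
Qed.

End HausdorffBorel.

Lemma measurable_norm {dsp : measure_display} {T : measurableType dsp} {R : realType} (D : set T)
  (f : T -> R) : measurable_fun D f -> measurable_fun D (fun x => `|f x|).
Proof. by move=> mf; apply: measurableT_comp. Qed.

Lemma measurable_limit {dsp : measure_display} {T : measurableType dsp} {R : realType}
  (h : nat -> T -> R) (f : T -> R) : (forall n, measurable_fun setT (h n)) ->
  (forall x, h n x @[n --> \oo] --> f x) -> measurable_fun setT f.
Proof. by move=> mh hf; apply: (measurable_fun_cvg mh) => x _; exact: hf. Qed.

Lemma measurable_inv {dsp : measure_display} {T : measurableType dsp} {R : realType} (f : T -> R) :
  measurable_fun setT f -> (forall x, 0 <= f x) -> measurable_fun setT (fun x => (f x)^-1).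
Proof.
move=> mf f0; apply: (measurability _ (RGenOInfty.measurableE R)) => _ [_ [a ->] <-].
rewrite setTI (_ : _ @^-1` _ = [set x | a < (f x)^-1]); last first.
  by apply/seteqP; split=> x /=; rewrite in_itv /= andbT.
have mlt (b : R) : measurable [set x | f x < b].
  rewrite -[X in measurable X]setTI; exact: (measurable_fun_ltr mf (measurable_cst b)).
have mgt (b : R) : measurable [set x | b < f x].
  rewrite -[X in measurable X]setTI; exact: (measurable_fun_ltr (measurable_cst b) mf).
have [a0|a0] := ltP a 0.
  rewrite (_ : [set x | _] = setT); first exact: measurableT.
  by apply/seteqP; split=> // x _ /=; rewrite (lt_le_trans a0)// invr_ge0.
have [->|an0] := eqVneq a 0.
  rewrite (_ : [set x | _] = [set x | 0 < f x]); first exact: mgt.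
  by apply/seteqP; split=> x /=; rewrite invr_gt0.
have ap : 0 < a by rewrite lt_neqAle eq_sym an0.
rewrite (_ : [set x | _] = [set x | 0 < f x] `&` [set x | f x < a^-1]); first exact: measurableI.
apply/seteqP; split=> x /=.
  move=> ax; have fp : 0 < f x by rewrite -invr_gt0 (lt_trans ap).
  by split=> //; rewrite -[ltLHS]invrK ltf_pV2 ?posrE ?invr_gt0.
by move=> [fp fa]; rewrite -[ltLHS]invrK ltf_pV2 ?posrE ?invr_gt0.
Qed.

Section TraceMeasurable.
Context {R : realType} {d : nat} (s : nat).
Implicit Types (x y : 'rV[R]_d) (w : set 'rV[R]_d) (u v f g : 'rV[R]_d -> R).
Local Notation mu := (leb R d).
Local Notation lmeas A := (measurable (A : set (leb_space R d))).
Local Notation hmeas A := (measurable (A : set (Defs.hausdorff_space R d s))).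
Local Notation hmfun f := (measurable_fun (setT : set (Defs.hausdorff_space R d s)) (f : Defs.hausdorff_space R d s -> R)).

Lemma hausdorff_open (U : set 'rV[R]_d) : open U -> hmeas U.
Proof. exact: (open_cara_measurable (@hausdorff_halfspace R d s)). Qed.

Lemma hausdorff_closed (A : set 'rV[R]_d) : closed A -> hmeas A.
Proof. by move=> cA; rewrite -(setCK A); apply: measurableC; apply: hausdorff_open; exact: closed_openC. Qed.

Lemma hausdorff_continuous f : continuous f -> hmfun f.
Proof. exact: (continuous_cara_measurable (@hausdorff_halfspace R d s)). Qed.

Definition ballint w v (r : R) x : R := \int[mu]_(y in eball x r `&` w) v y.

Lemma ballint_left w v r x (rn : nat -> R) : lmeas w -> rint mu w v -> (forall n, rn n < r) ->
  rn n @[n --> \oo] --> r -> ballint w v (rn n) x @[n --> \oo] --> ballint w v r x.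
Proof.
move=> mw rv rnr rnc.
have mE t : lmeas (eball x t) by exact: leb_eball.
have E t : ballint w v t x = \int[mu]_(y in w) (\1_(eball x t) y * v y).
  by rewrite Rintegral_indic// setIC.
rewrite E (_ : (fun n => _) = fun n => \int[mu]_(y in w) (\1_(eball x (rn n)) y * v y)); last first.
  by apply/funext => n; rewrite E.
have mv := rint_measurable rv.
have mi t : measurable_fun (w : set (leb_space R d)) (fun y : leb_space R d => \1_(eball x t) y * v y : R).
  by apply: measurableM => //; apply: measurable_indic; exact: mE.
have [//||] := Rintegral_dominated mw (fun n => mi (rn n)) (mi r) _ (rint_norm rv) _.
  move=> y wy; apply: cvgM; last exact: cvg_cst.
  have [xy|xy] := ltP (enorm (y - x)) r; last first.
    have i0 t : t <= r -> \1_(eball x t) y = 0 :> R.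
      move=> tr; rewrite indicE memNset// /eball /= => H.
      by have := lt_le_trans H tr; rewrite ltNge xy.
    by rewrite i0//; apply: cvg_near_cst; apply: nearW => n; rewrite i0// ltW.
  rewrite (_ : \1_(eball x r) y = 1); last by rewrite indicE mem_set.
  apply: cvg_near_cst.
  have [n0 _ Hn0] := cvgr_gt _ rnc _ xy; exists n0 => // n nn.
  by rewrite /= indicE mem_set//; exact: Hn0.
  by move=> n y wy; rewrite normrM indicE; case: (_ \in _); rewrite ?normr1 ?mul1r ?normr0 ?mul0r.
by move=> _; exact.
Qed.

(** A slightly smaller ball about [x] already has integral above [a], and it is contained in the
    balls of radius [r] about all points near [x]. *)
Lemma ballint_lsc w v r : lmeas w -> rint mu w v -> (forall y, w y -> 0 <= v y) ->
  forall a : R, open [set x | a < ballint w v r x].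
Proof.
move=> mw rv v0 a; rewrite openE => x /= ax.
pose rn (n : nat) := r - n.+1%:R^-1.
have rnr n : rn n < r by rewrite ltrBlDr ltrDl invr_gt0.
have rnc : rn n @[n --> \oo] --> r.
  rewrite -[X in _ --> X]subr0; apply: cvgB; [exact: cvg_cst|exact: cvg_harmonic].
have cx := ballint_left (x := x) mw rv rnr rnc.
have [n _ Hn] := cvgr_gt _ cx _ ax.
have {Hn} Hn := Hn n (leqnn n).
apply/nbhs_ballP; exists (n.+1%:R^-1 / (d%:R + 1)) => /=.
  by rewrite divr_gt0 ?invr_gt0// ltr_wpDl.
move=> x'; rewrite -ball_normE /= => xx'; apply: lt_le_trans Hn _.
apply: subset_Rintegral.
- by apply: measurableI => //; exact: leb_eball.
- by apply: measurableI => //; exact: leb_eball.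
- move=> y [xy wy]; split=> //; rewrite /eball /= in xy *.
  rewrite (_ : y - x' = (y - x) + (x - x')); last by rewrite addrA subrK.
  apply: le_lt_trans (enormD _ _) _; rewrite -(subrK n.+1%:R^-1 r) ltr_leD//.
  apply: le_trans (enorm_le _) _; apply: (@le_trans _ _ ((d%:R + 1) * `|x - x'|)).
    by rewrite ler_wpM2r// lerDl.
  by rewrite mulrC -ler_pdivlMr ?ltr_wpDl// ltW.
- by apply: rintS rv => //; apply: measurableI => //; exact: leb_eball.
- by move=> y [_ /v0].
Qed.

Lemma lsc_measurable f : (forall a : R, open [set x | a < f x]) -> hmfun f.
Proof.
move=> H; apply: (measurability _ (RGenOInfty.measurableE R)) => _ [_ [a ->] <-].
rewrite setTI; apply: hausdorff_open.
rewrite (_ : f @^-1` _ = [set x | a < f x])//.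
by apply/seteqP; split=> x /=; rewrite in_itv /= andbT.
Qed.

Lemma measurable_ballint w u r : lmeas w -> rint mu w u -> hmfun (ballint w u r).
Proof.
move=> mw ru.
have rp : rint mu w (fun y => `|u y| + u y) by apply: rintD => //; exact: rint_norm.
have rn : rint mu w (fun y => `|u y|) by exact: rint_norm.
have -> : ballint w u r = (fun x => ballint w (fun y => `|u y| + u y) r x - ballint w (fun y => `|u y|) r x).
  apply/funext => x; have mE : lmeas (eball x r `&` w) by apply: measurableI => //; exact: leb_eball.
  have sE : eball x r `&` w `<=` w by move=> y [].
  rewrite /ballint -RintegralB//; [|exact: rintS rp|exact: rintS rn].
  by apply: eq_Rintegral => y _; rewrite addrAC subrr add0r.
apply: measurable_funB; apply: lsc_measurable; apply: ballint_lsc => // y _.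
by rewrite -lerBlDr sub0r -normrN ler_norm.
Qed.

Lemma meanE w u x r : lmeas w -> mean w u x r = ballint w u r x * (ballint w (cst 1) r x)^-1.
Proof.
move=> mw; rewrite /mean /ballint Rintegral_cst ?mul1r//.
by apply: measurableI => //; exact: leb_eball.
Qed.

Lemma ballint1_ge0 w r x : 0 <= ballint w (cst 1) r x.
Proof. by apply: Rintegral_ge0 => y _; rewrite ler01. Qed.

Lemma measurable_mean w u r : lmeas w -> (mu w < +oo)%E -> rint mu w u -> hmfun (fun x => mean w u x r).
Proof.
move=> mw fw ru; under eq_fun do rewrite meanE//.
have r1 : rint mu w (cst 1) by exact: rint_cst.
apply: measurable_funM; first exact: measurable_ballint.
by apply: measurable_inv => [|x]; [exact: measurable_ballint|exact: ballint1_ge0].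
Qed.

Lemma mean_left w u x r (rn : nat -> R) : lmeas w -> (mu w < +oo)%E -> rint mu w u -> (forall n, rn n < r) ->
  rn n @[n --> \oo] --> r -> mean w u x (rn n) @[n --> \oo] --> mean w u x r.
Proof.
move=> mw fw ru rnr rnc; have r1 : rint mu w (cst 1) by exact: rint_cst.
rewrite meanE//; under eq_fun do rewrite meanE//.
have c1 := ballint_left (x := x) mw ru rnr rnc; have c2 := ballint_left (x := x) mw r1 rnr rnc.
have [z|nz] := eqVneq (ballint w (cst 1) r x) 0; last by apply: cvgM => //; exact: cvgV.
rewrite z invr0 mulr0; apply: cvg_near_cst; apply: nearW => n.
suff -> : ballint w (cst 1) (rn n) x = 0 by rewrite invr0 mulr0.
apply/eqP; rewrite eq_le ballint1_ge0 andbT -z; apply: subset_Rintegral => //.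
- by apply: measurableI => //; exact: leb_eball.
- by apply: measurableI => //; exact: leb_eball.
- by move=> y [xy wy]; split=> //; exact: lt_trans xy (rnr n).
- by apply: rintS r1 => //; apply: measurableI => //; exact: leb_eball.
Qed.

(** The positive rationals, indexed by pairs of naturals so that countable unions and intersections
    run over [nat]. *)
Definition fraction (a b : nat) : R := a.+1%:R / b.+1%:R.

Lemma fraction_dense (p q : R) : 0 <= p -> p < q -> exists a b, p < fraction a b < q.
Proof.
move=> p0 pq; pose b := Num.truncn (q - p)^-1.
have bq : b.+1%:R^-1 < q - p.
  by rewrite -[ltRHS]invrK ltf_pV2 ?posrE ?invr_gt0 ?subr_gt0//; exact: truncnS_gt.
have b0 : 0 < b.+1%:R :> R by [].
exists (Num.truncn (p * b.+1%:R)), b; rewrite /fraction ltr_pdivlMr//.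
rewrite truncnS_gt /= ltr_pdivrMr// -natr1.
have H : (Num.truncn (p * b.+1%:R))%:R <= p * b.+1%:R by rewrite truncn_le mulr_ge0.
apply: le_lt_trans (lerD H (lexx _)) _.
by move: bq; rewrite -(ltr_pM2r b0) mulVf ?gt_eqF// mulrBl; lra.
Qed.

(** The Cauchy criterion along rational radii only, which makes the set of points with a trace
    measurable. Rational radii suffice because the mean values are left continuous in the radius. *)
Definition mean_cauchy w u x := forall k : nat, exists j : nat, forall a b a' b' : nat,
  fraction a b < j.+1%:R^-1 -> fraction a' b' < j.+1%:R^-1 ->
  `|mean w u x (fraction a b) - mean w u x (fraction a' b')| <= k.+1%:R^-1.

Lemma fraction_left (r : R) : 0 < r -> exists2 c : nat -> nat * nat,
  forall n, fraction (c n).1 (c n).2 < r & fraction (c n).1 (c n).2 @[n --> \oo] --> r.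
Proof.
move=> r0; have Hn (n : nat) : exists ab : nat * nat, Num.max 0 (r - n.+1%:R^-1) < fraction ab.1 ab.2 < r.
  have [||a [b ab]] := @fraction_dense (Num.max 0 (r - n.+1%:R^-1)) r; last by exists (a, b).
    by rewrite le_max lexx.
  by rewrite gt_max r0 /= ltrBlDr ltrDl invr_gt0.
have [c Hc] := choice Hn; exists c => [n|]; first by case/andP: (Hc n).
apply: (@squeeze_cvgr _ _ _ _ (fun n : nat => r - n.+1%:R^-1) (fun=> r)).
- apply: nearW => n; have /andP[] := Hc n; rewrite gt_max => /andP[_ h1] /ltW h2.
  by rewrite (ltW h1).
- rewrite -[X in _ --> X]subr0; apply: cvgB; [exact: cvg_cst|exact: cvg_harmonic].
- exact: cvg_cst.
Qed.

Lemma cvg_mean_cauchy w u x : lmeas w -> (mu w < +oo)%E -> rint mu w u ->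
  cvg (mean w u x @ 0^'+) <-> mean_cauchy w u x.
Proof.
move=> mw fw ru; split=> [cu k|H].
  have e0 : 0 < k.+1%:R^-1 / 2 :> R by rewrite divr_gt0.
  have /cvgrPdist_le/(_ _ e0)[e /= ep He] := cu.
  exists (Num.truncn e^-1) => a b a' b' ha ha'.
  have je : (Num.truncn e^-1).+1%:R^-1 < e.
    by rewrite -[ltRHS]invrK ltf_pV2 ?posrE ?invr_gt0//; exact: truncnS_gt.
  have F0 c c' : 0 < fraction c c' by rewrite divr_gt0.
  have B c c' : fraction c c' < (Num.truncn e^-1).+1%:R^-1 -> `|lim (mean w u x @ 0^'+) - mean w u x (fraction c c')| <= k.+1%:R^-1 / 2.
    move=> hc; apply: He => //=; rewrite sub0r normrN gtr0_norm//; exact: lt_trans je.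
  rewrite (_ : _ - _ = (lim (mean w u x @ 0^'+) - mean w u x (fraction a' b')) - (lim (mean w u x @ 0^'+) - mean w u x (fraction a b))); last by ring.
  by apply: le_trans (ler_normB _ _) _; rewrite [leRHS]splitr; apply: lerD; exact: B.
apply/cauchy_cvgP; apply: cauchy_exP => e e0.
pose k := Num.truncn e^-1.
have ke : k.+1%:R^-1 < e.
  by rewrite -[ltRHS]invrK ltf_pV2 ?posrE ?invr_gt0//; exact: truncnS_gt.
have [j Hj] := H k; have q0 : fraction 0 j.+1 < j.+1%:R^-1.
  by rewrite /fraction mul1r ltf_pV2 ?posrE// ltr_nat.
exists (mean w u x (fraction 0 j.+1)).
suff : \forall r \near 0^'+, ball (mean w u x (fraction 0 j.+1)) e (mean w u x r) by [].
near=> r; rewrite -ball_normE /=.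
have r0 : 0 < r by near: r; exact: nbhs_right_gt.
have rj : r < j.+1%:R^-1 by near: r; apply: nbhs_right_lt; rewrite invr_gt0.
have [c cr cc] := fraction_left r0.
have ek : 0 < e - k.+1%:R^-1 by rewrite subr_gt0.
have /cvgrPdist_lt/(_ _ ek)[n _ Hn] := mean_left (x := x) mw fw ru cr cc.
have {}Hn := Hn n (leqnn n).
rewrite (_ : _ - _ = (mean w u x (fraction 0 j.+1) - mean w u x (fraction (c n).1 (c n).2)) -
   (mean w u x r - mean w u x (fraction (c n).1 (c n).2))); last by ring.
apply: le_lt_trans (ler_normB _ _) _; rewrite -[ltRHS](subrK k.+1%:R^-1) addrC ltr_leD//.
by apply: Hj => //; exact: lt_trans (cr n) rj.
Unshelve. all: by end_near. Qed.

Lemma measurable_mean_cauchy w u : lmeas w -> (mu w < +oo)%E -> rint mu w u ->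
  hmeas [set x | mean_cauchy w u x].
Proof.
move=> mw fw ru.
pose F k j a b a' b' := [set x : 'rV[R]_d | fraction a b < j.+1%:R^-1 -> fraction a' b' < j.+1%:R^-1 ->
  `|mean w u x (fraction a b) - mean w u x (fraction a' b')| <= k.+1%:R^-1].
rewrite (_ : [set x | _] = \bigcap_k \bigcup_j \bigcap_a \bigcap_b \bigcap_a' \bigcap_b' F k j a b a' b'); last first.
  apply/seteqP; split=> x H k; first by have [j Hj] := H k; exists j => // a _ b _ a' _ b' _; exact: Hj.
  by move=> /=; have [j _ Hj] := H k I; exists j => a b a' b'; exact: (Hj a I b I a' I b' I).
apply: bigcapT_measurable => k; apply: bigcup_measurable => j _.
apply: bigcapT_measurable => a; apply: bigcapT_measurable => b.
apply: bigcapT_measurable => a'; apply: bigcapT_measurable => b'.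
rewrite /F; have [h1|h1] := boolP (fraction _ _ < _); last first.
  by rewrite (_ : [set x | _] = setT); [exact: measurableT|apply/seteqP; split].
have [h2|h2] := boolP (fraction _ _ < _); last first.
  by rewrite (_ : [set x | _] = setT); [exact: measurableT|apply/seteqP; split].
rewrite (_ : [set x | _] = [set x | `|mean w u x (fraction a b) - mean w u x (fraction a' b')| <= k.+1%:R^-1]); last first.
  by apply/seteqP; split=> x //= H; exact: H.
have mf : hmfun (fun x => `|mean w u x (fraction a b) - mean w u x (fraction a' b')|).
  by apply: measurable_norm; apply: measurable_funB; exact: measurable_mean.
rewrite -[X in measurable X]setTI; exact: (measurable_fun_ler mf (measurable_cst _)).
Qed.

(** Multiplying by the indicator of the convergence set reproduces the default value 0, so the
    sequence along the radii $1/(n+1)$ converges everywhere. *)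
Lemma measurable_trace w u : lmeas w -> (mu w < +oo)%E -> rint mu w u -> hmfun (trace w u).
Proof.
move=> mw fw ru; have mC := measurable_mean_cauchy mw fw ru; set C := [set x | _] in mC.
pose f (n : nat) x : R := \1_C x * mean w u x n.+1%:R^-1.
apply: (@measurable_limit _ (Defs.hausdorff_space R d s) R f (trace w u)).
  by move=> n; apply: measurableM; [exact: measurable_indic|exact: measurable_mean].
move=> x; rewrite /f indicE; have [/set_mem Cx|/negP nC] := boolP (x \in C); last first.
  rewrite trace_point0; last by move=> /(cvg_mean_cauchy _ mw fw ru) Cx; apply: nC; exact/mem_set.
  by under eq_fun do rewrite mul0r; exact: cvg_cst.
under eq_fun do rewrite mul1r.
have /(cvg_mean_cauchy _ mw fw ru) cu : mean_cauchy w u x by [].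
have /cvg_at_rightP := cu : mean w u x r @[r --> 0^'+] --> trace w u x.
by apply; split=> [n|]; [rewrite invr_gt0|exact: cvg_harmonic].
Qed.

End TraceMeasurable.

(** * Integrals of nonmeasurable weights *)

Section LowerEnvelope.
Import HBNNSimple.
Context {dsp : measure_display} {T : measurableType dsp} {R : realType}.
Variable mu : {measure set T -> \bar R}.

Lemma ge0_integral_mono (f g : T -> \bar R) : (forall x, 0 <= f x)%E -> (forall x, f x <= g x)%E ->
  (\int[mu]_x f x <= \int[mu]_x g x)%E.
Proof.
move=> f0 fg; rewrite !ge0_integralTE//; last by move=> x; exact: le_trans (f0 x) (fg x).
by apply: le_ereal_sup => _ [h hf <-]; exists h => // x; apply: le_trans (fg x).
Qed.

Lemma ge0_integral_le_sup (f : T -> \bar R) b : (forall x, 0 <= f x)%E ->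
  (forall h : {nnsfun T >-> R}, (forall x, (h x)%:E <= f x)%E -> (\int[mu]_x (h x)%:E <= b)%E) ->
  (\int[mu]_x f x <= b)%E.
Proof.
move=> f0 H; rewrite ge0_integralTE//; apply: ge_ereal_sup => _ [h hf <-].
by rewrite -integralT_nnsfun; exact: H.
Qed.

Lemma rint_dominated_indic (A : set T) (b : R) (h : T -> R) : measurable A -> (mu A < +oo)%E ->
  measurable_fun setT h -> (forall x, 0 <= h x <= b * \1_A x) -> rint mu setT h.
Proof.
move=> mA fA mh hb; apply: (@rint_le _ _ _ mu _ h (fun x => b * \1_A x)) => //.
  by move=> x _; have /andP[h0 h1] := hb x; rewrite ger0_norm.
apply: rintZ => //; apply/integrableP; split; first exact/measurable_EFinP/measurable_indic.
rewrite (eq_integral (EFin \o \1_A)); last by move=> x _ /=; rewrite ger0_norm// indicE.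
by rewrite integral_indic// setIT.
Qed.

(** Maximize the integral among measurable minorants of [w]: running maxima of a maximizing sequence
    increase to a maximizer [ws]. For any other minorant [k], the integral of $\max(k, ws)$ cannot
    exceed that of [ws], so [k <= ws] almost everywhere. *)
Lemma lower_envelope (A : set T) (b : R) (w : T -> R) : measurable A -> (mu A < +oo)%E ->
  (forall x, 0 <= w x <= b * \1_A x) ->
  exists ws : T -> R, [/\ measurable_fun setT ws, forall x, 0 <= ws x <= w x &
    forall h : T -> R, measurable_fun setT h -> (forall x, 0 <= h x <= w x) ->
      {ae mu, forall x, h x <= ws x}].
Proof.
move=> mA fA wb.
have w0 x : 0 <= w x by case/andP: (wb x).
pose ok (h : T -> R) := measurable_fun setT h /\ forall x, 0 <= h x <= w x.
have okr h : ok h -> rint mu setT h.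
  move=> [mh hw]; apply: (rint_dominated_indic mA fA mh (b := b)) => x.
  by have /andP[-> h1] := hw x; have /andP[_] := wb x; exact: le_trans.
pose J h := \int[mu]_x h x.
pose E := [set J h | h in ok].
have ok0 : ok (fun=> 0) by split=> [|x]; [exact: measurable_cst|rewrite lexx w0].
have rA : rint mu setT (fun x => b * \1_A x).
  apply: rintZ => //; apply/integrableP; split; first exact/measurable_EFinP/measurable_indic.
  rewrite (eq_integral (EFin \o \1_A)); last by move=> x _ /=; rewrite ger0_norm// indicE.
  by rewrite integral_indic// setIT.
have supE : has_sup E.
  split; first by exists (J (fun=> 0)); exists (fun=> 0).
  exists (\int[mu]_x (b * \1_A x)) => _ [h oh <-]; apply: le_Rintegral => //; first exact: okr.
  by move=> x _; have /andP[_ h1] := oh.2 x; have /andP[_] := wb x; exact: le_trans.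
have Hn (n : nat) : exists h, ok h /\ sup E - n.+1%:R^-1 < J h.
  have [|_ [h oh <-] Hh] := @sup_adherent R E n.+1%:R^-1 _ supE; first by rewrite invr_gt0.
  by exists h.
have [h Hh] := choice Hn.
pose g := fix g n := match n with 0 => h 0%N | m.+1 => fun x => Num.max (g m x) (h m.+1 x) end.
have okmax f1 f2 : ok f1 -> ok f2 -> ok (fun x => Num.max (f1 x) (f2 x)).
  move=> [m1 b1] [m2 b2]; split; first exact: measurable_maxr.
  by move=> x; rewrite le_max ge_max; have /andP[-> ->] := b1 x; have /andP[_ ->] := b2 x.
have okg n : ok (g n).
  elim: n => [|n IH] /=; first by case: (Hh 0%N).
  by apply: okmax => //; case: (Hh n.+1).
have hg n x : h n x <= g n x by case: n => [|n] /=; rewrite ?le_max ?lexx ?orbT.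
have ndg x : nondecreasing_seq (g ^~ x).
  by apply/nondecreasing_seqP => n /=; rewrite le_max lexx.
have ubg x : has_ubound (range (g ^~ x)).
  by exists (w x) => _ [n _ <-]; have /andP[] := (okg n).2 x.
pose ws x := sup (range (g ^~ x)).
have cg x : g n x @[n --> \oo] --> ws x by exact: nondecreasing_cvgn.
have gws n x : g n x <= ws x by apply: ub_le_sup => //; exists n.
have okws : ok ws.
  split; first exact: (measurable_limit (fun n => (okg n).1) cg).
  move=> x; apply/andP; split.
    by apply: le_trans (gws 0%N x); have /andP[] := (okg 0%N).2 x.
  by apply: ge_sup; [exists (g 0%N x), 0%N|move=> _ [n _ <-]; have /andP[] := (okg n).2 x].
have Jws k : ok k -> J k <= J ws.
  move=> ok_; apply: (@le_trans _ _ (sup E)); first by apply: ub_le_sup; [case: supE|exists k].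
  apply/ler_addgt0Pr => e e0; pose n := Num.truncn e^-1.
  have ne : n.+1%:R^-1 < e.
    by rewrite -[ltRHS]invrK ltf_pV2 ?posrE ?invr_gt0//; exact: truncnS_gt.
  have [okn Hsn] := Hh n.
  have HJ : J (h n) <= J ws.
    apply: le_Rintegral => //; [exact: okr|exact: okr|].
    by move=> x _; exact: le_trans (hg n x) (gws n x).
  rewrite -lerBlDr; apply: le_trans HJ; apply: le_trans (ltW Hsn).
  by rewrite lerD2l lerN2 ltW.
exists ws; split; [by case: okws|by case: okws|].
move=> k mk kw; have okk : ok k by split.
have okm := okmax _ _ okk okws.
have rm := okr _ okm; have rws := okr _ okws.
have : {ae mu, forall x, setT x -> Num.max (k x) (ws x) - ws x = 0}.
  apply: Rintegral_ae0 => //; first exact: rintB.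
    by move=> x _; rewrite subr_ge0 le_max lexx orbT.
  by rewrite RintegralB// subr_le0; exact: Jws okm.
by apply: aeS => x /(_ I)/eqP; rewrite subr_eq0 => /eqP <-; rewrite le_max lexx.
Qed.

(** The integral of a nonnegative function, measurable or not, is the supremum over the simple
    functions below it. Such an [h] below [t * w] yields the measurable minorant [h / t] of [w],
    hence [h <= t * ws] almost everywhere. *)
Lemma envelope_integral (w ws t : T -> R) (F : T -> \bar R) :
  measurable_fun setT ws -> (forall x, 0 <= ws x <= w x) ->
  (forall h : T -> R, measurable_fun setT h -> (forall x, 0 <= h x <= w x) ->
      {ae mu, forall x, h x <= ws x}) ->
  measurable_fun setT t -> (forall x, 0 <= t x) -> (forall x, 0 <= F x)%E ->
  {ae mu, forall x, F x = (t x * w x)%:E} ->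
  (\int[mu]_x F x = \int[mu]_x (t x * ws x)%:E)%E.
Proof.
move=> mws wsw Hws mt t0 F0 [N [mN N0 HN]].
have FE x : ~ N x -> F x = (t x * w x)%:E by move=> nN; apply: contrapT => nF; apply: nN; exact: HN.
have w0 x : 0 <= w x by have /andP[a b] := wsw x; exact: le_trans b.
have mtw : measurable_fun setT (fun x => (t x * ws x)%:E) by apply/measurable_EFinP; exact: measurableM.
have tw0 x : (0 <= (t x * ws x)%:E)%E by rewrite lee_fin mulr_ge0//; have /andP[] := wsw x.
apply/eqP; rewrite eq_le; apply/andP; split.
- apply: ge0_integral_le_sup => // h hF.
  (* Where [t] vanishes, the quotient is 0 by convention, and [h] itself is 0 there off [N]. *)
  pose k x := if x \in N then 0 else h x / t x.
  have mnN : measurable (~` N) by exact: measurableC.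
  have mk : measurable_fun setT k.
    have -> : k = fun x => \1_(~` N) x * (h x / t x).
      apply/funext => x; rewrite /k indicE in_setC; case: (x \in N); rewrite ?mul0r ?mul1r//.
    apply: measurableM; first exact: measurable_indic.
    apply: measurableM; first exact: measurable_funPT.
    exact: measurable_inv.
  have kw x : 0 <= k x <= w x.
    rewrite /k; case: (boolP (x \in N)) => xN; first by rewrite lexx w0.
    have nN : ~ N x by move=> Nx; move/negP: xN; apply; exact/mem_set.
    have := hF x; rewrite FE// lee_fin => htw.
    have [t00|tn0] := eqVneq (t x) 0; first by rewrite t00 invr0 mulr0 lexx w0.
    have tp : 0 < t x by rewrite lt_neqAle eq_sym tn0 t0.
    by rewrite divr_ge0//= ler_pdivrMr// mulrC.
  apply: ae_ge0_le_integral => //.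
  + by move=> x _; rewrite lee_fin.
  + exact/measurable_EFinP/measurable_funPT.
  + have nN : {ae mu, forall x, ~ N x} by exists N; split=> // x /contrapT.
    have := aeI nN (Hws k mk kw); apply: aeS => x [nNx kx] _.
    have := hF x; rewrite FE// !lee_fin => htw.
    have [t00|tn0] := eqVneq (t x) 0; first by move: htw; rewrite t00 !mul0r.
    have tp : 0 < t x by rewrite lt_neqAle eq_sym tn0 t0.
    by move: kx; rewrite /k memNset// ler_pdivrMr// mulrC.
- pose g x := (\1_(~` N) x * (t x * ws x))%:E.
  have mg : measurable_fun setT g.
    apply/measurable_EFinP; apply: measurableM; last exact: measurableM.
    by apply: measurable_indic; exact: measurableC.
  have g0 x : (0 <= g x)%E by rewrite lee_fin mulr_ge0 ?indicE ?ler0n// -lee_fin.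
  have -> : (\int[mu]_x (t x * ws x)%:E = \int[mu]_x g x)%E.
    apply: ge0_ae_eq_integral => //.
    have nN : {ae mu, forall x, ~ N x} by exists N; split=> // x /contrapT.
    by apply: aeS nN => x nNx _; rewrite /g indicE mem_set// mul1r.
  apply: ge0_integral_mono => // x; rewrite /g indicE in_setC.
  case: (boolP (x \in N)) => xN; first by rewrite mul0r.
  have nN : ~ N x by move=> Nx; move/negP: xN; apply; exact/mem_set.
  rewrite mul1r FE// lee_fin ler_wpM2l//; by case/andP: (wsw x).
Qed.

(** Since [w] is nonnegative, the positive and negative parts of [t * w] are those of [t] times [w].
    The right side is linear in [t], which is not evident for the left one. *)
Lemma envelope_Rintegral (w ws t f : T -> R) (S : set T) :
  measurable_fun setT ws -> (forall x, 0 <= ws x <= w x) ->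
  (forall h : T -> R, measurable_fun setT h -> (forall x, 0 <= h x <= w x) ->
      {ae mu, forall x, h x <= ws x}) ->
  measurable_fun setT t -> {ae mu, forall x, (f \_ S) x = t x * w x} ->
  rint mu setT (fun x => t x * ws x) ->
  \int[mu]_(x in S) f x = \int[mu]_x (t x * ws x).
Proof.
move=> mws wsw Hws mt fE rt; rewrite Rintegral_mkcond /Rintegral; congr fine.
have w0 x : 0 <= w x by have /andP[a b] := wsw x; exact: le_trans b.
have ws0 x : 0 <= ws x by case/andP: (wsw x).
have mp : measurable_fun setT (fun x => Num.max (t x) 0) by apply: measurable_maxr.
have mn : measurable_fun setT (fun x => Num.max (- t x) 0).
  apply: measurable_maxr => //; rewrite (_ : (fun x => - t x) = fun x => 0 - t x).
    by apply: measurable_funB.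
  by apply/funext => x; rewrite sub0r.
rewrite integralE [RHS]integralE; congr (_ - _)%E.
- transitivity (\int[mu]_x (Num.max (t x) 0 * ws x)%:E)%E.
    apply: (envelope_integral mws wsw Hws mp) => //.
      by move=> x; rewrite le_max lexx orbT.
    apply: aeS fE => x; rewrite funeposE => ->.
    by rewrite -EFin_max maxr_pMl// mul0r.
  by apply: eq_integral => x _; rewrite funeposE -EFin_max maxr_pMl// mul0r.
- transitivity (\int[mu]_x (Num.max (- t x) 0 * ws x)%:E)%E.
    apply: (envelope_integral mws wsw Hws mn) => //.
      by move=> x; rewrite le_max lexx orbT.
    apply: aeS fE => x; rewrite funenegE => ->.
    by rewrite -EFinN -EFin_max maxr_pMl// mul0r mulNr.
  by apply: eq_integral => x _; rewrite funenegE -EFinN -EFin_max maxr_pMl// mul0r mulNr.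
Qed.

End LowerEnvelope.

(** * Square integrability of traces *)

Section Collar.
Context {R : realType} {d : nat}.
Implicit Types (x y e p : 'rV[R]_d) (w Om : set 'rV[R]_d) (u h : 'rV[R]_d -> R)
  (g : 'rV[R]_d -> 'rV[R]_d).
Local Notation mu := (leb R d).
Local Notation lmeas A := (measurable (A : set (leb_space R d))).
Local Notation lmfun W f := (measurable_fun (W : set (leb_space R d)) (f : leb_space R d -> _)).

(* [h] measures the height above the boundary graph. *)
Definition height e h (T : R) := [/\ enorm e = 1, 0 <= T,
  forall x y, `|h x - h y| <= T * `|x - y| & forall x (t : R), h (x + t *: e) = h x + t].

Lemma lipschitz_chart Om x0 : (0 < d)%N -> lipschitz_boundary Om -> bnd Om x0 ->
  exists (r : R) e h T, [/\ 0 < r, height e h T & forall y, ball x0 r y -> (Om y <-> 0 < h y)].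
Proof.
move=> d0 lip b0; have [r [e [gam [r0 e1 [L HL] ge HO]]]] := lip x0 b0.
have dp : 0 < d%:R :> R by rewrite ltr0n.
exists (r / d%:R), e, (fun y => dot y e - gam y), (d%:R * (1 + `|L|)); split.
- by rewrite divr_gt0.
- split=> //.
  + move=> x y; rewrite (_ : _ - _ = dot (x - y) e - (gam x - gam y)); last first.
      by rewrite dotDl dotNl; ring.
    apply: le_trans (ler_normB _ _) _; rewrite mulrDr mulr1 mulrDl; apply: lerD; first exact: dot_unit.
    apply: le_trans (HL _ _) _; apply: (@le_trans _ _ (`|L| * enorm (x - y))).
      by rewrite ler_wpM2r ?enorm_ge0// ler_norm.
    by rewrite [d%:R * _]mulrC -mulrA ler_wpM2l// enorm_le.
  + by move=> x t; rewrite dotDl dotZl ge -sqr_enorm e1 expr1n mulr1; ring.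
- move=> y; rewrite -ball_normE /= => xy; rewrite subr_gt0; apply: HO; rewrite /eball /=.
  by apply: le_lt_trans (enorm_le _) _; rewrite mulrC -ltr_pdivlMr// distrC.
Qed.

Section Height.
Variables (e : 'rV[R]_d) (h : 'rV[R]_d -> R) (T : R).
Hypothesis he : height e h T.

Lemma height_continuous : continuous h.
Proof.
have [_ T0 HT _] := he; move=> x A /nbhs_ballP[eps /= eps0 HA].
have T1 : 0 < T + 1 by rewrite ltr_wpDl.
have xe : \forall y \near x, ball x (eps / (T + 1)) y by apply: nbhsx_ballx; rewrite divr_gt0.
apply: filterS xe => y; rewrite -ball_normE /= => xy; apply: HA; rewrite -ball_normE /=.
apply: le_lt_trans (HT _ _) _.
apply: (@le_lt_trans _ _ ((T + 1) * `|x - y|)); first by rewrite ler_wpM2r// lerDl.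
by rewrite mulrC -ltr_pdivlMr.
Qed.

Lemma open_level (a b : R) : open [set y | a < h y < b].
Proof.
rewrite (_ : [set y | _] = [set y | a < h y] `&` [set y | h y < b]).
  apply: openI.
    by apply: (@open_comp _ _ h [set t : R | a < t]); [move=> y _; exact: height_continuous|exact: open_gt].
  by apply: (@open_comp _ _ h [set t : R | t < b]); [move=> y _; exact: height_continuous|exact: open_lt].
by apply/seteqP; split=> y /= => [/andP[]|[-> ->]].
Qed.

(** Layer [k] is the translate of layer 0 by [(k%:R * b) *: e]: the ball moves along with the
    height, so that layers are congruent. *)
Definition layer x0 (r b : R) (k : nat) :=
  [set y | ball x0 r (y - (k%:R * b) *: e)] `&` [set y | k%:R * b < h y < k.+1%:R * b].

Lemma open_layer x0 (r b : R) k : 0 < r -> open (layer x0 r b k).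
Proof.
move=> r0; apply: openI; last exact: open_level.
apply: (@open_comp _ _ (fun y => y - (k%:R * b) *: e) (ball x0 r)); last exact: ball_open.
by move=> y _; apply: (@continuousB _ _ _ id (fun=> _)); [exact: cvg_id|exact: cst_continuous].
Qed.

Let norm_e : `|e| <= 1.
Proof. by have [e1 _ _ _] := he; rewrite -e1 norm_enorm. Qed.

(* Shifting by [b *: e] maps a layer onto the next one. *)
Lemma collar_step (s b : R) x0 (i J : nat) w u g : (0 < J)%N -> (i < J)%N -> 0 < b -> J%:R * b <= s / 4 ->
  open w -> (mu w < +oo)%E -> (forall y, ball x0 s y -> 0 < h y -> w y) -> sobolev w u g ->
  \int[mu]_(y in layer x0 (s / 4) b i) (u y ^+ 2) <=
    (1 + J%:R^-1) * \int[mu]_(y in layer x0 (s / 4) b i.+1) (u y ^+ 2) +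
    (1 + J%:R) * b ^+ 2 * \int[mu]_(y in w `&` [set y | i%:R * b < h y < i.+2%:R * b]) (dot (g y) (g y)).
Proof.
move=> J0 iJ b0 Jb oW fw Hw S; pose N := layer x0 (s / 4) b; have [e1 T0 HT Ht] := he; have [su sg _] := S.
have mw := leb_open oW.
have JR : 0 < J%:R :> R by rewrite ltr0n.
have s4 : 0 < s / 4 by apply: lt_le_trans Jb; rewrite mulr_gt0.
have oN k : open (N k) by exact: open_layer.
have inb y k (t : R) : ball x0 (s / 4) (y - (k%:R * b) *: e) -> (k <= J)%N -> 0 <= t <= b ->
    ball x0 s (y + t *: e).
  rewrite -!ball_normE /= => yk kJ /andP[t0 tb].
  rewrite (_ : x0 - _ = (x0 - (y - (k%:R * b) *: e)) - (k%:R * b + t) *: e); last first.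
    by apply/rowP => j; rewrite !mxE; ring.
  apply: le_lt_trans (ler_normB _ _) _.
  have kb : k%:R * b <= s / 4 by apply: le_trans Jb; rewrite ler_pM2r// ler_nat.
  have bs : b <= s / 4 by apply: le_trans Jb; rewrite ler_peMl ?(ltW b0)// ler1n.
  have : `|(k%:R * b + t) *: e| <= k%:R * b + t.
    by rewrite normrZ ger0_norm ?addr_ge0 ?mulr_ge0 ?(ltW b0)// ler_piMr// addr_ge0// mulr_ge0// ltW.
  lra.
pose W := w `&` [set y | i%:R * b < h y < i.+2%:R * b].
have oWi : open W by apply: openI => //; exact: open_level.
have mW := leb_open oWi.
have fW : (mu W < +oo)%E.
  by apply: le_lt_trans fw; apply: le_measure; rewrite ?inE//; exact: subIsetl.
have SW := sobolevS oWi mw (@subIsetl _ _ _) S; have [suW sgW _] := SW.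
have NW k y : (k <= J)%N -> N k y -> w y.
  move=> kJ [yk /andP[hy _]]; apply: Hw.
    by have := inb y k 0 yk kJ; rewrite scale0r addr0; apply; rewrite lexx ltW.
  by apply: le_lt_trans hy; rewrite mulr_ge0// ltW.
have NWi x (t : R) : N i x -> 0 <= t <= 1 -> W (x + t *: (b *: e)).
  move=> [xi /andP[h1 h2]] /andP[t0 t1]; rewrite scalerA.
  have tb : 0 <= t * b <= b by rewrite mulr_ge0 ?(ltW b0)//= ler_piMl// ltW.
  have hh : h (x + (t * b) *: e) = h x + t * b by exact: Ht.
  have hin : i%:R * b < h (x + (t * b) *: e) < i.+2%:R * b.
    have i2 : i.+2%:R * b = i.+1%:R * b + b by rewrite -(natr1 i.+1) mulrDl mul1r.
    rewrite hh i2; case/andP: tb => tb0 tb1; apply/andP; split; lra.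
  split=> //; apply: Hw; first by apply: inb xi _ tb; exact: ltnW.
  by case/andP: hin => h3 _; apply: le_lt_trans h3; rewrite mulr_ge0// ltW.
have [st bt] := sobolev_translation oWi fW (oN i) NWi SW.
have mN k := leb_open (oN k).
have shift_N : N i = [set x | N i.+1 (x + b *: e)].
  have vE x : x + b *: e - (i.+1%:R * b) *: e = x - (i%:R * b) *: e.
    by apply/rowP => j; rewrite !mxE -(natr1 i); ring.
  have lE x : (i.+1%:R * b < h (x + b *: e) < i.+2%:R * b) = (i%:R * b < h x < i.+1%:R * b).
    by rewrite Ht -(natr1 i.+1) -(natr1 i) !mulrDl !mul1r !ltrD2r.
  by apply/seteqP; split=> x [] /=; rewrite ?vE ?lE => h1 h2; split; rewrite /= ?vE ?lE.
have NW1 : N i.+1 `<=` w by move=> y; exact: NW.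
have suN1 := sqintS (mN i.+1) mw NW1 su.
have NWi0 : N i `<=` w by move=> y; apply: NW; exact: ltnW.
have suN := sqintS (mN i) mw NWi0 su.
have sz : sqint mu (N i) (fun x => u (x + b *: e)) by rewrite shift_N; exact: sqint_shift.
have E1 : \int[mu]_(y in N i.+1) (u y ^+ 2) = \int[mu]_(x in N i) (u (x + b *: e) ^+ 2).
  have m2 : lmfun (N i.+1) (fun x => u x ^+ 2).
    by apply: measurable_sqr; exact: sqint_measurable suN1.
  by rewrite shift_N (@Rintegral_shift R d (b *: e) _ (fun x => u x ^+ 2) (mN i.+1) m2).
have rd := sqint_dot_self mW sgW.
have bt' : \int[mu]_(x in N i) ((u (x + b *: e) - u x) ^+ 2) <= b ^+ 2 * \int[mu]_(y in W) dot (g y) (g y).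
  apply: le_trans bt _; rewrite -RintegralZl//; apply: le_Rintegral => //; [|exact: rintZ|].
    by apply: sqint_sq; exact: sqint_dot.
  move=> x _; rewrite dotZl exprMn ler_wpM2l ?sqr_ge0//.
  by apply: le_trans (dot_CS _ _) _; rewrite -sqr_enorm e1 expr1n mul1r.
rewrite -/(N i) -/(N i.+1) E1; apply: (@le_trans _ _ ((1 + J%:R^-1) * \int[mu]_(x in N i) (u (x + b *: e) ^+ 2) +
   (1 + J%:R) * \int[mu]_(x in N i) ((u (x + b *: e) - u x) ^+ 2))); last first.
  by rewrite lerD2l -mulrA ler_wpM2l// addr_ge0// ltW.
rewrite -!RintegralZl//; [|exact: sqint_sq|exact: sqint_sq].
rewrite -RintegralD//; [|by apply: rintZ => //; exact: sqint_sq|by apply: rintZ => //; exact: sqint_sq].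
apply: le_Rintegral => //; first exact: sqint_sq.
  by apply: rintD => //; apply: rintZ => //; exact: sqint_sq.
(* Young's inequality with weight [J]: over at most [J] steps the factors $1 + 1/J$ multiply to no
   more than $e$. *)
move=> x _; set a := u x; set c := u (x + b *: e).
rewrite -subr_ge0 (_ : _ - _ = (c / J%:R - (a - c)) ^+ 2 * J%:R); last by field; rewrite gt_eqF.
by rewrite mulr_ge0 ?sqr_ge0// ltW.
Qed.

(** The lowest layer is bounded by any layer [k] plus the energy in between. Averaging over all
    [k < J] replaces the layer by $1/J$ of the whole integral, up to the overlap 2, and $1/J$ is
    proportional to the width [b]. *)
Lemma collar_bound (s : R) x0 w u g : 0 < s ->
  open w -> (mu w < +oo)%E -> (forall y, ball x0 s y -> 0 < h y -> w y) -> sobolev w u g ->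
  exists2 K : R, 0 <= K & forall J : nat, (0 < J)%N -> forall b, b = s / (4 * J%:R) ->
   \int[mu]_(y in ball x0 (s / 4) `&` [set y | 0 < h y < b]) (u y ^+ 2) <= K * b.
Proof.
move=> s0 oW fw Hw S; have [su sg _] := S; have mw := leb_open oW.
pose U := \int[mu]_(y in w) (u y ^+ 2); pose D := \int[mu]_(y in w) dot (g y) (g y).
have U0 : 0 <= U by apply: Rintegral_ge0 => y _; exact: sqr_ge0.
have D0 : 0 <= D by apply: Rintegral_ge0 => y _; exact: dot_ge0.
exists (expR 1 * (8 * U / s + s * D)).
  apply: mulr_ge0; first exact: expR_ge0.
  apply: addr_ge0; last by apply: mulr_ge0; [exact: ltW|].
  by apply: divr_ge0; [apply: mulr_ge0|exact: ltW].
move=> J J0 b bE; have JR : 0 < J%:R :> R by rewrite ltr0n.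
have b0 : 0 < b by rewrite bE divr_gt0// mulr_gt0.
have Jb : J%:R * b = s / 4 by rewrite bE; field; rewrite gt_eqF.
pose N := layer x0 (s / 4) b.
pose V k := \int[mu]_(y in N k) (u y ^+ 2).
pose B k := \int[mu]_(y in w `&` [set y | k%:R * b < h y < k.+2%:R * b]) (dot (g y) (g y)).
have step k : (k < J)%N -> V k <= (1 + J%:R^-1) * V k.+1 + (1 + J%:R) * b ^+ 2 * B k.
  by move=> kJ; apply: collar_step => //; rewrite Jb.
have B0 k : 0 <= B k by apply: Rintegral_ge0 => y _; exact: dot_ge0.
have V0 k : 0 <= V k by apply: Rintegral_ge0 => y _; exact: sqr_ge0.
pose q : R := 1 + J%:R^-1.
have q1 : 1 <= q by rewrite lerDl invr_ge0 ltW.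
have c0 : 0 <= (1 + J%:R) * b ^+ 2 by rewrite mulr_ge0 ?sqr_ge0// addr_ge0// ltW.
have iter k : (k <= J)%N -> V 0%N <= q ^+ k * (V k + (1 + J%:R) * b ^+ 2 * \sum_(j < k) B j).
  elim: k => [|k IH] kJ; first by rewrite expr0 mul1r big_ord0 mulr0 addr0.
  apply: le_trans (IH (ltnW kJ)) _; rewrite [q ^+ k.+1]exprSr -[leRHS]mulrA; apply: ler_wpM2l; first by rewrite exprn_ge0// (le_trans ler01).
  rewrite big_ord_recr /= !mulrDr addrCA [leRHS]addrCA.
  have := step k kJ; rewrite -/q => Hk.
  have p1 : (1 + J%:R) * b ^+ 2 * \sum_(j < k) B j <= q * ((1 + J%:R) * b ^+ 2 * \sum_(j < k) B j).
    by rewrite ler_peMl// mulr_ge0// sumr_ge0.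
  have p2 : (1 + J%:R) * b ^+ 2 * B k <= q * ((1 + J%:R) * b ^+ 2 * B k).
    by rewrite ler_peMl// mulr_ge0.
  lra.
have qJ k : (k <= J)%N -> q ^+ k <= expR 1.
  move=> kJ; apply: (@le_trans _ _ (q ^+ J)); first exact: ler_weXn2l.
  apply: (@le_trans _ _ (expR J%:R^-1 ^+ J)); first by apply: lerXn2r; rewrite ?nnegrE ?expR_ge0 ?expR_ge1Dx// (le_trans ler01).
  by rewrite -expRM_natl mulfV// gt_eqF.
have mlev a c : lmeas [set y | a < h y < c] by apply: leb_open; exact: open_level.
have rd := sqint_dot_self mw sg.
have rI (A : set 'rV[R]_d) (f : 'rV[R]_d -> R) : lmeas A -> rint mu w f -> rint mu w (fun x => \1_A x * f x).
  move=> mA rh; apply: (@rint_mul_bounded _ _ _ mu _ _ _ 1) => //.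
  by move=> x _; rewrite indicE; case: (_ \in _); rewrite ?normr1 ?normr0.
have overlap y : \sum_(j < J) \1_[set y | j%:R * b < h y < j.+2%:R * b] y <= 2 :> R.
  apply: le_trans (count_near J 1 (h y / b - 1)); apply: ler_sum => j _.
  rewrite indicE ler_nat; case: (boolP (_ \in _)) => // /set_mem /= /andP[h1 h2].
  rewrite (_ : (_ < _) = true)// ltr_norml.
  have j2 : j.+2%:R = j%:R + 2 :> R by rewrite -addn2 natrD.
  have e1 : j%:R < h y / b by rewrite ltr_pdivlMr.
  have e2 : h y / b < j%:R + 2 by rewrite ltr_pdivrMr// -j2.
  lra.
have sumB : \sum_(j < J) B j <= 2 * D.
  have -> : \sum_(j < J) B j = \int[mu]_(y in w) (\sum_(j < J) \1_[set y | j%:R * b < h y < j.+2%:R * b] y * dot (g y) (g y)).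
    rewrite Rintegral_sum; [|exact: mw|by move=> j; exact: rI].
    by apply: eq_bigr => j _; rewrite Rintegral_indic.
  rewrite -RintegralZl//; apply: le_Rintegral => //; [by apply: rint_sum => // j; exact: rI|exact: rintZ|].
  by move=> y _; rewrite -mulr_suml ler_wpM2r ?dot_ge0.
have NW k y : (k < J)%N -> N k y -> w y /\ k%:R * b < h y < k.+2%:R * b.
  move=> kJ [yk /andP[h1 h2]]; split; last first.
    by rewrite h1 (lt_trans h2)// ltr_pM2r// ltr_nat.
  apply: Hw; last by apply: le_lt_trans h1; rewrite mulr_ge0// ltW.
  move: yk; rewrite -!ball_normE /= => yk.
  rewrite (_ : x0 - y = (x0 - (y - (k%:R * b) *: e)) - (k%:R * b) *: e); last first.
    by apply/rowP => j; rewrite !mxE; ring.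
  apply: le_lt_trans (ler_normB _ _) _.
  have kb : k%:R * b <= s / 4 by rewrite -Jb ler_pM2r// ler_nat ltnW.
  have : `|(k%:R * b) *: e| <= k%:R * b.
    by rewrite normrZ ger0_norm ?mulr_ge0 ?(ltW b0)// ler_piMr// mulr_ge0// ltW.
  lra.
have oN k : open (N k) by apply: open_layer; rewrite divr_gt0.
have sumV : \sum_(j < J) V j <= 2 * U.
  have rs := sqint_sq su.
  apply: (@le_trans _ _ (\sum_(j < J) \int[mu]_(y in w) (\1_[set y | j%:R * b < h y < j.+2%:R * b] y * u y ^+ 2))).
    apply: ler_sum => j _; rewrite Rintegral_indic//; apply: subset_Rintegral.
    - exact: leb_open (oN j).
    - exact: measurableI.
    - by move=> y /(NW _ _ (ltn_ord j))[].
    - by apply: rintS rs => //; exact: measurableI.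
    - by move=> y _; exact: sqr_ge0.
  rewrite -Rintegral_sum; [|exact: mw|by move=> j; exact: rI].
  rewrite -RintegralZl//; apply: le_Rintegral => //; [by apply: rint_sum => // j; exact: rI|exact: rintZ|].
  by move=> y _; rewrite -mulr_suml ler_wpM2r ?sqr_ge0.
have bound k : (k < J)%N -> V 0%N <= expR 1 * (V k + (1 + J%:R) * b ^+ 2 * (2 * D)).
  move=> kJ; apply: le_trans (iter k (ltnW kJ)) _.
  apply: ler_pM; [by rewrite exprn_ge0// (le_trans ler01)| |exact: qJ (ltnW kJ)|].
    by rewrite addr_ge0// mulr_ge0// sumr_ge0.
  rewrite lerD2l ler_wpM2l//; apply: le_trans sumB.
  rewrite -(big_mkord xpredT B) -(big_mkord xpredT B) [leRHS](big_cat_nat (n := k))//=; last exact: ltnW.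
  by rewrite lerDl sumr_ge0.
have total : J%:R * V 0%N <= expR 1 * (2 * U + J%:R * ((1 + J%:R) * b ^+ 2 * (2 * D))).
  apply: (@le_trans _ _ (\sum_(k < J) expR 1 * (V k + (1 + J%:R) * b ^+ 2 * (2 * D)))).
    by rewrite mulr_natl -[X in _ *+ X]card_ord -sumr_const; apply: ler_sum => k _; exact: bound.
  rewrite -mulr_sumr big_split /=; apply: ler_wpM2l; first exact: expR_ge0.
  by apply: lerD => //; rewrite sumr_const card_ord [leRHS]mulr_natl.
have -> : ball x0 (s / 4) `&` [set y | 0 < h y < b] = N 0%N.
  by rewrite /N /layer; apply/seteqP; split=> y [] /=; rewrite mul0r mul1r scale0r subr0.
rewrite -/(V 0%N) -(ler_pM2l JR); apply: le_trans total _.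
have -> : J%:R * (expR 1 * (8 * U / s + s * D) * b) = expR 1 * (2 * U + s * D * (s / 4)).
  by rewrite -Jb bE; field; rewrite !gt_eqF.
rewrite ler_wpM2l ?expR_ge0// lerD2l.
have J1 : 1 <= J%:R :> R by rewrite ler1n.
have -> : J%:R * ((1 + J%:R) * b ^+ 2 * (2 * D)) = 2 * D * ((J%:R * b) * (b + J%:R * b)) by ring.
have bJ : b <= J%:R * b by rewrite ler_peMl// ltW.
rewrite Jb in bJ *.
have : D * ((s / 4) * (b + s / 4)) <= D * ((s / 4) * (s / 2)).
  by rewrite ler_wpM2l// ler_wpM2l ?divr_ge0 ?(ltW s0)//; lra.
lra.
Qed.

End Height.
End Collar.

Lemma fatou_bound {R : realType} {dsp : measure_display} {X : measurableType dsp} (m : {measure set X -> \bar R})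
  (D : set X) (f : nat -> X -> R) (f0 : X -> R) (B : \bar R) : measurable D ->
  (forall n, measurable_fun D (f n)) -> (forall n (y : X), 0 <= f n y) ->
  (forall y : X, f n y @[n --> \oo] --> f0 y) -> (forall n, \int[m]_(z in D) (f n z)%:E <= B)%E ->
  (\int[m]_(z in D) (f0 z)%:E <= B)%E.
Proof.
move=> mD mf fge cf fB.
have mE n : measurable_fun D (fun z => (f n z)%:E) by exact/measurable_EFinP.
have := fatou m mD mE (fun n (y : X) _ => fge n y : (0 <= (f n y)%:E)%E).
rewrite (_ : \int[m]_(z in D) limn_einf _ = \int[m]_(z in D) (f0 z)%:E)%E; last first.
  apply: eq_integral => x _.
  have cx : (f n x)%:E @[n --> \oo] --> (f0 x)%:E by apply: cvg_EFin; [exact: nearW|exact: cf].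
  by rewrite is_cvg_limn_einfE; [exact: cvg_lim|apply/cvg_ex; exists (f0 x)%:E].
move=> /le_trans; apply; rewrite limn_einf_lim.
apply: lime_le; first exact: is_cvg_einfs.
by apply: nearW => n; apply: le_trans (fB n); apply: ereal_inf_lbound; exists n => //=.
Qed.

Lemma sum_indic_ge {R : realType} {X : Type} {I : finType} (M : I -> R) (Q : I -> set X) k x :
  (forall i, 0 <= M i) -> Q k x -> M k <= \sum_i M i * \1_(Q i) x.
Proof.
move=> M0 Qx; rewrite (bigD1 k)//= indicE (mem_set Qx) mulr1 lerDl sumr_ge0// => j _.
by rewrite mulr_ge0// indicE ler0n.
Qed.

Lemma integral_finite_cover {R : realType} {dsp : measure_display} {X : measurableType dsp}
    (m : {measure set X -> \bar R}) (F : X -> \bar R) (I : eqType) (s : seq I) (A : I -> set X) (S : set X) :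
  measurable_fun setT F -> (forall z, 0 <= F z)%E -> (forall i, measurable (A i)) ->
  (forall z, S z -> exists2 i, i \in s & A i z) -> (forall i, i \in s -> \int[m]_(z in A i) F z < +oo)%E ->
  (\int[m]_(z in S) F z < +oo)%E.
Proof.
move=> mF F0 mA cov fin; rewrite integral_mkcond.
have F1 i z : (0 <= (F \_ (A i)) z)%E by rewrite patchE; case: ifP.
apply: (@le_lt_trans _ _ (\int[m]_z (\sum_(i <- s) (F \_ (A i)) z)%E)%E).
  apply: ge0_integral_mono => z; rewrite patchE; first by case: ifP.
  case: ifPn => [/set_mem Sz|_]; last first.
    by apply: sume_ge0 => i _; exact: F1.
  have [i si Az] := cov z Sz; rewrite (big_rem i)//= [(F \_ (A i)) z]patchE mem_set//.
  by rewrite leeDl// sume_ge0.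
rewrite ge0_integral_sum//=; last first.
  by move=> i; apply/(measurable_restrictT _ (mA i)); exact: measurable_funS mF.
rewrite big_seq; apply: lte_sum_pinfty => i si; rewrite -integral_mkcond; exact: fin.
Qed.

Lemma integral_step_le {R : realType} {dsp : measure_display} {X : measurableType dsp}
    (m : {measure set X -> \bar R}) (I : finType) (M : I -> R) (Q : I -> set X) (S : set X) (c : R) :
  measurable S -> (forall k, measurable (Q k)) -> (forall k, 0 <= M k) -> (forall k, m (Q k) <= c%:E)%E ->
  (\int[m]_(z in S) (\sum_k M k * \1_(Q k) z)%:E <= ((\sum_k M k) * c)%:E)%E.
Proof.
move=> mS mQ M0 Qc.
rewrite (eq_integral (fun z => (\sum_k (M k * \1_(Q k) z)%:E)%E)); last by move=> z _; rewrite sumEFin.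
rewrite ge0_integral_sum//=; last 2 first.
- by move=> k; apply/measurable_EFinP; apply: measurable_funM; [exact: measurable_cst|exact: measurable_indic].
- by move=> k z _; rewrite lee_fin mulr_ge0// indicE ler0n.
rewrite mulr_suml -sumEFin; apply: lee_sum => k _; under eq_integral do rewrite EFinM.
rewrite ge0_integralZl//=; last 2 first.
- exact/measurable_EFinP/measurable_indic.
- by rewrite lee_fin.
rewrite integral_indic// EFinM; apply: lee_wpmul2l; first by rewrite lee_fin.
apply: le_trans (Qc k); apply: le_measure; rewrite ?inE//; exact: measurableI.
Qed.

Lemma quarter {R : realType} (s : R) : 0 < s -> [/\ s / 16 < s, s / 16 + s / 16 < s / 4 & s / 4 < s].
Proof. by move=> s0; split; lra. Qed.

Section Trace.
Context {R : realType} {d : nat}.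
Implicit Types (x y e p : 'rV[R]_d) (w Om A K U : set 'rV[R]_d) (u h : 'rV[R]_d -> R)
  (g : 'rV[R]_d -> 'rV[R]_d).
Local Notation mu := (leb R d).
Local Notation nu := (hausdorff R d d.-1).
Local Notation lmeas A := (measurable (A : set (leb_space R d))).
Local Notation hmeas A := (measurable (A : set (Defs.hausdorff_space R d d.-1))).
Local Notation lmfun W f := (measurable_fun (W : set (leb_space R d)) (f : leb_space R d -> _)).
Local Notation hmfun f := (measurable_fun setT (f : Defs.hausdorff_space R d d.-1 -> R)).
Local Notation v := (@unit_vol R d).

Lemma ball_fine_le p (r : R) : 0 < r -> fine (mu (ball p r)) <= (2 * r) ^+ d.
Proof.
move=> r0; rewrite -lee_fin fineK; last by rewrite ge0_fin_numE//; exact: leb_ball_fin.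
rewrite -(box_ball p r0); apply: le_trans (@leb_box_le _ _ (\row_i (p 0 i - r)) (\row_i (p 0 i + r)) _ _ _) _.
- by move=> i; rewrite !mxE; lra.
- by [].
- rewrite lee_fin /vol (eq_bigr (fun=> 2 * r)); last by move=> i _; rewrite !mxE; ring.
  by rewrite prodr_const card_ord.
Qed.

Lemma Rintegral1 A : lmeas A -> \int[mu]_(y in A) (1 : R) = fine (mu A).
Proof. by move=> mA; rewrite Rintegral_cst// mul1r. Qed.

Lemma layer_volume e h (T : R) (J : nat) p (r b : R) : height e h T ->
  (0 < J)%N -> 0 < b -> 0 < r -> J%:R * b <= r ->
  J%:R * fine (mu (layer e h p r b 0)) <= (4 * r) ^+ d.
Proof.
move=> he J0 b0 r0 Jb; have [e1 _ _ Ht] := he.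
pose N := layer e h p r b.
have oN k : open (N k) by apply: open_layer he _ _ _ _ r0.
have mN k := leb_open (oN k).
have EN k : mu (N k) = mu (N 0%N).
  rewrite -[RHS](leb_outer_shift (- (k%:R * b) *: e)); congr (leb_outer _).
  apply/seteqP; split=> y; rewrite /N /layer /= Ht mul0r scale0r subr0 mul1r scaleNr -(natr1 k) mulrDl mul1r;
    by move=> [h1 /andP[h2 h3]]; split=> //; apply/andP; split; lra.
have B2 : 0 < 2 * r by rewrite mulr_gt0.
have oB : open (ball p (2 * r)) by exact: ball_open.
have mB := leb_open oB.
have NB k : (k < J)%N -> N k `<=` ball p (2 * r).
  move=> kJ y [yk _]; move: yk; rewrite -!ball_normE /= => yk.
  rewrite (_ : p - y = (p - (y - (k%:R * b) *: e)) - (k%:R * b) *: e); last first.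
    by apply/rowP => j; rewrite !mxE; ring.
  apply: le_lt_trans (ler_normB _ _) _.
  have kb : k%:R * b <= r by apply: le_trans Jb; rewrite ler_pM2r// ler_nat ltnW.
  have : `|(k%:R * b) *: e| <= k%:R * b.
    rewrite normrZ ger0_norm ?mulr_ge0 ?(ltW b0)// ler_piMr//; first by rewrite mulr_ge0// ltW.
    by rewrite -e1 norm_enorm.
  lra.
have r1 : rint mu (ball p (2 * r)) (fun=> 1 : R) by apply: rint_cst => //; exact: leb_ball_fin.
have rI k : rint mu (ball p (2 * r)) (fun x => \1_(N k) x * 1).
  apply: (@rint_mul_bounded _ _ _ mu _ _ _ 1) => //.
  by move=> x _; rewrite indicE; case: (_ \in _); rewrite ?normr1 ?normr0.
have tot : \sum_(k < J) fine (mu (N k)) <= fine (mu (ball p (2 * r))).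
  rewrite -(Rintegral1 mB) (eq_bigr (fun k : 'I_J => \int[mu]_(x in ball p (2 * r)) (\1_(N k) x * 1))); last first.
    move=> k _; rewrite Rintegral_indic// Rintegral1; last exact: measurableI.
    by congr (fine (mu _)); apply/esym/setIidPr; exact: NB (ltn_ord k).
  rewrite -Rintegral_sum; [|exact: mB|by move=> k; exact: rI].
  apply: le_Rintegral => //; first by apply: rint_sum => // k; exact: rI.
  move=> y _.
  have [[j yj]|nj] := pselect (exists j : 'I_J, N j y); last first.
    rewrite big1// => k _; rewrite indicE (_ : (y \in N k) = false) ?mul0r//.
    by apply/negbTE/negP => /set_mem yk; apply: nj; exists k.
  rewrite (bigD1 j)//= big1 ?addr0 ?mulr1 ?indicE ?(mem_set yj)// => k kj.
  rewrite indicE (_ : (y \in N k) = false) ?mul0r//; apply/negbTE/negP => /set_mem.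
  move: yj => [_ /andP[a1 a2]] [_ /andP[a3 a4]].
  have k1 : (j < k.+1)%N by rewrite -(ltr_nat R) -(ltr_pM2r b0); exact: lt_trans a1 a4.
  have k2 : (k < j.+1)%N by rewrite -(ltr_nat R) -(ltr_pM2r b0); exact: lt_trans a3 a2.
  by move/eqP: kj; apply; apply/val_inj/eqP; rewrite eqn_leq -ltnS k2 -ltnS k1.
move: tot; rewrite (eq_bigr (fun=> fine (mu (N 0%N)))); last by move=> k _; rewrite EN.
rewrite sumr_const card_ord => {}tot; rewrite mulr_natl; apply: le_trans tot _.
by apply: le_trans (ball_fine_le p B2) _; rewrite mulrA -natrM.
Qed.

(* The [J] disjoint shifts of a thin neighbourhood of the level set fit into one ball. *)
Lemma level_hausdorff e h (T : R) : (0 < d)%N -> 0 < v -> height e h T ->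
  exists2 C : R, 0 <= C & forall p (rho : R), 0 < rho ->
    (nu [set x | h x = 0%R /\ (`|x - p| < rho)%R] <= (C * rho ^+ d.-1)%:E)%E.
Proof.
move=> d0 v0 he; have [e1 T0 HT Ht] := he.
have T1 : 0 < T + 1 by rewrite ltr_wpDl.
have hc0 := @hcoef_ge0 R d.-1; set hc := hcoef d.-1 in hc0 *.
have Ed (t : R) : t ^+ d = t * t ^+ d.-1 by rewrite -exprS prednK.
exists (32 ^+ d * (2 * (T + 1)) / v * (hc * (d%:R * 2) ^+ d.-1)).
  apply: mulr_ge0; last by rewrite mulr_ge0// exprn_ge0// mulr_ge0.
  by rewrite divr_ge0 ?(ltW v0)// mulr_ge0 ?exprn_ge0// mulr_ge0// ltW.
move=> p rho rho0; apply: ge_ereal_sup => _ [delta0 /= del0 <-].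
set A := [set x | _].
(* [J] makes the covering sets smaller than [delta0], and [del] is such that [J] slabs of width
   [b = 2 * ((T + 1) * del)] have total width exactly [rho]. *)
pose J := (Num.truncn (d%:R * rho / ((T + 1) * delta0))).+1.
have JR : 0 < J%:R :> R by rewrite ltr0n.
pose del := rho / (2 * (T + 1) * J%:R).
have T2 : 0 < 2 * (T + 1) by rewrite mulr_gt0.
have d1 : 0 < del by rewrite divr_gt0// mulr_gt0.
have small : d%:R * (2 * del) <= delta0.
  rewrite (_ : d%:R * (2 * del) = d%:R * rho / (T + 1) / J%:R); last first.
    by rewrite /del; field; rewrite !gt_eqF.
  rewrite ler_pdivrMr// [leRHS]mulrC -ler_pdivrMr//.
  have E : d%:R * rho / (T + 1) / delta0 = d%:R * rho / ((T + 1) * delta0).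
    by field; rewrite !gt_eqF.
  by rewrite E; exact: ltW (truncnS_gt _).
apply: le_trans (cover_hweight_anti _ _ small) _.
(* Raising the height turns layer 0 into the slab $|h| < (T+1)\,del$, which contains the ball of
   radius [del] about every point of [A]. *)
pose h' := fun x => h x + (T + 1) * del.
have he' : height e h' T.
  split=> // [x y|x t]; rewrite /h'; last by rewrite Ht addrAC.
  by rewrite opprD addrACA subrr addr0; exact: HT.
pose b := 2 * ((T + 1) * del).
have b0 : 0 < b by apply: mulr_gt0 => //; exact: mulr_gt0.
have Jb : J%:R * b = rho by rewrite /b /del; field; rewrite !gt_eqF.
have r2 : 0 < 2 * rho by rewrite mulr_gt0.
pose W := layer e h' p (2 * rho) b 0.
have oW : open W by apply: open_layer he' _ _ _ _ r2.
have mW := leb_open oW.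
have J1 : 1 <= J%:R :> R by rewrite ler1n.
have T21 : 1 <= 2 * (T + 1) by lra.
have dr : del <= rho.
  rewrite /del ler_pdivrMr; last exact: mulr_gt0.
  rewrite ler_peMr ?(ltW rho0)//; apply: le_trans T21 _; rewrite ler_peMr//; exact: ltW.
have AW x : A x -> ball x del `<=` W.
  move=> [hx xp] y; rewrite -ball_normE /= => xy.
  have hy : `|h y| <= T * del.
    rewrite -[h y]subr0 -hx; apply: le_trans (HT _ _) _.
    by rewrite ler_wpM2l// distrC ltW.
  split.
    rewrite /= mul0r scale0r subr0 -ball_normE /= (_ : p - y = (x - y) - (x - p)); last by apply/rowP => j; rewrite !mxE; ring.
    by apply: le_lt_trans (ler_normB _ _) _; rewrite mulr2n mulrDl mul1r; exact: ler_ltD (le_trans (ltW xy) dr) xp.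
  rewrite /= mul0r mul1r /h' /b; move: hy; rewrite ler_norml => /andP[h1 h2]; apply/andP; split; lra.
have rW : rint mu W (fun=> 1 : R).
  apply: rint_cst => //; apply: le_lt_trans (leb_ball_fin p (2 * rho)); apply: le_measure; rewrite ?inE//.
    exact: leb_ball.
  by move=> y [] /=; rewrite mul0r scale0r subr0.
pose n := (Num.truncn (rho / del)).+1.
have nd x : A x -> `|x - p| <= n%:R * del.
  by move=> [_ xp]; apply: le_trans (ltW xp) _; rewrite -ler_pdivrMr//; exact: ltW (truncnS_gt _).
have a0 : 0 < del ^+ d * v by rewrite mulr_gt0// exprn_gt0.
have dens x : A x -> del ^+ d * v <= \int[mu]_(y in W `&` ball x del) (1 : R).
  move=> Ax; rewrite Rintegral1; last by apply: measurableI => //; exact: leb_ball.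
  by rewrite setIidr; [exact: leb_ball_ge|exact: AW].
apply: le_trans (hausdorff_density d.-1 d1 a0 mW rW (fun _ _ => ler01) nd dens) _.
rewrite lee_fin -/hc Rintegral1//.
have VW := layer_volume p he' (J := J) isT b0 r2.
have {}VW : J%:R * fine (mu W) <= (4 * (2 * rho)) ^+ d by apply: VW; rewrite Jb; lra.
have {}VW : fine (mu W) <= (8 * rho) ^+ d / J%:R.
  by rewrite ler_pdivlMr// mulrC; apply: le_trans VW _; rewrite mulrA -natrM.
have h0 : 0 <= hc * (d%:R * (2 * del)) ^+ d.-1.
  apply: mulr_ge0 => //; apply: exprn_ge0; apply: mulr_ge0 => //.
  by apply: mulr_ge0 => //; exact: ltW.
apply: (@le_trans _ _ (4 ^+ d / (del ^+ d * v) * ((8 * rho) ^+ d / J%:R) * (hc * (d%:R * (2 * del)) ^+ d.-1))).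
  by apply: ler_wpM2r => //; apply: ler_wpM2l => //; rewrite divr_ge0 ?exprn_ge0// ltW.
rewrite le_eqVlt; apply/orP; left; apply/eqP.
rewrite [d%:R * (2 * del)]mulrA [(d%:R * 2 * del) ^+ _]exprMn [(8 * rho) ^+ d]exprMn (Ed rho) (Ed del).
rewrite (_ : 32 ^+ d = 4 ^+ d * 8 ^+ d :> R); last by rewrite -exprMn -natrM.
have dd : del ^+ d.-1 != 0 by rewrite expf_neq0 ?gt_eqF.
have -> : rho = J%:R * b by rewrite Jb.
set X := (J%:R * b) ^+ d.-1.
by rewrite /b; field; rewrite dd !gt_eqF.
Qed.

Section LocalTrace.
Variables (Om w : set 'rV[R]_d) (e x0 : 'rV[R]_d) (h u : 'rV[R]_d -> R) (g : 'rV[R]_d -> 'rV[R]_d).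
Variables (eps T s : R).
Hypotheses (d0 : (0 < d)%N) (v0 : 0 < v) (oO : open Om) (e0 : 0 < eps)
  (Hc : forall y, Om y -> cone_at Om eps y) (he : height e h T) (s0 : 0 < s)
  (se : s <= eps * (d%:R * (2 + eps^-1))) (oW : open w) (fw : (mu w < +oo)%E) (wO : w `<=` Om)
  (Hs : forall y, ball x0 s y -> (Om y <-> 0 < h y)) (Hw : forall y, ball x0 s y -> Om y -> w y)
  (S : sobolev w u g).

Lemma bnd_level x : ball x0 s x -> bnd Om x -> h x = 0.
Proof.
move=> xs bx; have [cx nx] := bnd_not_in oO bx.
apply/eqP; rewrite eq_le; apply/andP; split; rewrite leNgt; apply/negP => hx.
  by apply: nx; apply/Hs.
have oL := @open_level _ _ e h T he (h x - 1) 0; have oB : open (ball x0 s) by exact: ball_open.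
have nb : nbhs x ([set y | h x - 1 < h y < 0] `&` ball x0 s).
  by apply: open_nbhs_nbhs; split; [exact: openI|split=> //=; rewrite hx andbT; lra].
have [y [Oy [/andP[_ hy] ys]]] := cx _ nb.
by have := (Hs ys).1 Oy; rewrite ltNge (ltW hy).
Qed.

Let A := bnd Om `&` ball x0 (s / 16).
Let D := d%:R * (2 + eps^-1).
Let kap := D ^- d * v.
Let rho (n : nat) : R := s / (4 * n.+1%:R) / (T + 4).

Let s16 : s / 16 < s.
Proof. by have [] := quarter s0. Qed.

Let s8 : s / 16 + s / 16 < s / 4.
Proof. by have [] := quarter s0. Qed.

Let s4 : s / 4 < s.
Proof. by have [] := quarter s0. Qed.

Let D0 : 0 < D.
Proof. by rewrite mulr_gt0 ?ltr0n// addr_gt0// invr_gt0. Qed.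

Let kap0 : 0 < kap.
Proof. by rewrite mulr_gt0// invr_gt0 exprn_gt0. Qed.

Let T4 : 0 < T + 4.
Proof. by have [_ T0 _ _] := he; rewrite ltr_wpDl. Qed.

Let rho0 n : 0 < rho n.
Proof. by rewrite /rho !divr_gt0// mulr_gt0. Qed.

Let rho_le n : rho n <= s / 16.
Proof.
have [_ T0 _ _] := he; have n1 : 1 <= n.+1%:R :> R by rewrite ler1n.
have n0 : 0 < n.+1%:R :> R by rewrite ltr0n.
rewrite /rho ler_pdivrMr// ler_pdivrMr ?mulr_gt0//.
have -> : s / 16 * (T + 4) * (4 * n.+1%:R) = s * (((T + 4) / 4) * n.+1%:R) by field.
rewrite ler_peMr ?(ltW s0)// -[1]mulr1; apply: ler_pM => //; lra.
Qed.

Let slab n := ball x0 (s / 4) `&` [set y | 0 < h y < s / (4 * n.+1%:R)].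

Let open_slab n : open (slab n).
Proof.
have oB : open (ball x0 (s / 4)) by apply: ball_open; rewrite divr_gt0.
have oL := @open_level R d e h T he 0 (s / (4 * n.+1%:R)).
exact: (@openI _ _ _ oB oL).
Qed.

Let eball_slab n x : A x -> eball x (rho n) `&` w `<=` slab n `&` w.
Proof.
move=> [bx xs] y [/eball_ball xy wy]; have [_ T0 HT _] := he.
have xs' : `|x0 - x| < s / 16 by move: xs; rewrite -ball_normE.
have xy' : `|x - y| < rho n by move: xy; rewrite -ball_normE.
have ys : `|x0 - y| < s / 4.
  rewrite (_ : x0 - y = (x0 - x) + (x - y)); last by rewrite addrA subrK.
  by apply: le_lt_trans (ler_normD _ _) _; apply: lt_trans (ltrD xs' (lt_le_trans xy' (rho_le n))) s8.
have hx : h x = 0 by apply: bnd_level => //; rewrite -ball_normE /=; exact: lt_trans xs' s16.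
have yb : ball x0 s y by rewrite -ball_normE /=; exact: lt_trans ys s4.
split=> //; split; first by rewrite -ball_normE.
rewrite /= (Hs yb).1 /=; last exact: wO.
apply: le_lt_trans (ler_norm _) _; rewrite -[h y]subr0 -hx; apply: le_lt_trans (HT _ _) _.
apply: (@le_lt_trans _ _ (T * rho n)); first by rewrite ler_wpM2l// distrC ltW.
apply: (@lt_le_trans _ _ ((T + 4) * rho n)); first by rewrite ltr_pM2r// ltrDl.
by rewrite /rho mulrC divfK// gt_eqF.
Qed.

Let mean_bound n x : A x ->
  mean w u x (rho n) ^+ 2 <= (kap * rho n ^+ d)^-1 * \int[mu]_(y in eball x (rho n) `&` w) (u y ^+ 2).
Proof.
move=> [bx xs]; have [su _ _] := S; have mw := leb_open oW.
have mE : lmeas (eball x (rho n) `&` w) by apply: measurableI => //; apply: leb_open; exact: open_eball.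
have fE : (mu (eball x (rho n) `&` w) < +oo)%E.
  by apply: le_lt_trans fw; apply: le_measure; rewrite ?inE//; exact: subIsetr.
have sE := sqintS mE mw (@subIsetr _ _ _) su.
have kE : kap * rho n ^+ d <= fine (mu (eball x (rho n) `&` w)).
  rewrite (_ : eball x (rho n) `&` w = eball x (rho n) `&` Om).
    rewrite /kap mulrAC [D ^- d * _]mulrC -expr_div_n; apply: (density_closure d0 oO e0 Hc); first by case: bx.
    by rewrite rho0 /=; apply: le_lt_trans (rho_le n) _; exact: lt_le_trans s16 se.
  apply/seteqP; split=> y [xy Oy]; split=> //; first exact: wO.
  apply: Hw Oy; have := eball_ball xy; move: xs; rewrite -!ball_normE /= => xs xy'.
  rewrite (_ : x0 - y = (x0 - x) + (x - y)); last by rewrite addrA subrK.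
  apply: le_lt_trans (ler_normD _ _) _; apply: lt_trans (ltrD xs (lt_le_trans xy' (rho_le n))) _; exact: lt_trans s8 s4.
have k0 : 0 < kap * rho n ^+ d by rewrite mulr_gt0// exprn_gt0.
have m0 := lt_le_trans k0 kE.
set I := \int[mu]_(y in _) _; have I0 : 0 <= I by apply: Rintegral_ge0 => y _; exact: sqr_ge0.
rewrite /mean expr_div_n ler_pdivrMr ?exprn_gt0//.
apply: le_trans (Rintegral_sqr_le mE fE sE) _; rewrite -/I expr2 mulrA mulrC ler_wpM2r ?(ltW m0)//.
apply: (@le_trans _ _ ((kap * rho n ^+ d)^-1 * (kap * rho n ^+ d) * I)); first by rewrite mulVf ?mul1r// gt_eqF.
rewrite mulrAC; apply: ler_wpM2l => //; by rewrite mulr_ge0// invr_ge0 ltW.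
Qed.

(** Fatou's lemma along the radii [rho n]. At radius $\rho$ a squared mean value costs
    $\rho^{-d}\int u^2$ over a ball, a grid cell carries surface measure $O(\rho^{d-1})$, and the
    collar holds $\int u^2 = O(\rho)$: the powers cancel. *)
Lemma trace_local : exists2 B : R, 0 <= B & (\int[nu]_(x in A) (trace w u x ^+ 2)%:E <= B%:E)%E.
Proof.
have [su _ _] := S; have mw := leb_open oW; have [_ T0 HT _] := he.
have [K K0 HK] := collar_bound he s0 oW fw (fun y ys hy => Hw ys ((Hs ys).2 hy)) S.
have [C C0 HC] := level_hausdorff d0 v0 he.
have ru : rint mu w u by exact: sqint_rint_finite.
have ru2 := sqint_sq su.
have cA : closed (bnd Om).
  rewrite /bnd setDE; apply: closedI; first exact: closed_closure.
  by apply: open_closedC; exact: open_interior.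
have mA : hmeas A by apply: measurableI; [exact: hausdorff_closed|apply: hausdorff_open; apply: ball_open; rewrite divr_gt0].
exists (C * kap^-1 * 4 ^+ d * K * (T + 4)).
  by rewrite !mulr_ge0 ?invr_ge0 ?exprn_ge0 ?(ltW kap0) ?(ltW T4).
have mC := measurable_mean_cauchy d.-1 mw fw ru; set E := [set x | _] in mC.
apply: (@fatou_bound R _ (Defs.hausdorff_space R d d.-1) nu A (fun n x => (\1_E x * mean w u x (rho n)) ^+ 2) (fun x => trace w u x ^+ 2)).
- exact: mA.
- move=> n; apply: measurable_sqr; apply: measurableM; first exact: measurable_indic.
  exact: (measurable_funS measurableT (@subsetT _ _) (measurable_mean _ mw fw ru)).
- by move=> n x; exact: sqr_ge0.
- move=> x; rewrite indicE; have [/set_mem Cx|/negP nC] := boolP (x \in E); last first.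
    rewrite trace_point0; last by move=> /(cvg_mean_cauchy _ mw fw ru) Cx; apply: nC; exact/mem_set.
    by under eq_fun do rewrite mul0r; exact: cvg_cst.
  under eq_fun do rewrite mul1r.
  have /(cvg_mean_cauchy _ mw fw ru) cu : mean_cauchy w u x by [].
  have /cvg_at_rightP cu' : mean w u x r @[r --> 0^'+] --> trace w u x by exact: cu.
  have cr : rho n @[n --> \oo] --> (0 : R).
    rewrite (_ : rho = fun n => s / 4 / (T + 4) * n.+1%:R^-1); last first.
      by apply/funext => n; rewrite /rho; field; rewrite !gt_eqF//= ltr0n.
    by rewrite -[X in _ --> X](mulr0 (s / 4 / (T + 4))); apply: cvgM; [exact: cvg_cst|exact: cvg_harmonic].
  have cm := cu' rho (conj rho0 cr).
  by rewrite expr2; under eq_fun do rewrite expr2; exact: cvgM.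
move=> n.
pose N := (Num.truncn (s / rho n)).+1.
pose p := grid_point x0 (rho n) (n := N).
have oS := openI (@open_slab n) oW.
have mS := leb_open oS.
have mB k : lmeas (ball (p k) (2 * rho n)) by exact: leb_ball.
have rS : rint mu (slab n `&` w) (fun y => u y ^+ 2) by apply: rintS ru2 => //; exact: subIsetr.
pose M k := (kap * rho n ^+ d)^-1 * \int[mu]_(y in slab n `&` w) (\1_(ball (p k) (2 * rho n)) y * u y ^+ 2).
have k0 : 0 < kap * rho n ^+ d by rewrite mulr_gt0// exprn_gt0.
have M0 k : 0 <= M k.
  rewrite mulr_ge0 ?invr_ge0 ?(ltW k0)//; apply: Rintegral_ge0 => y _.
  by rewrite mulr_ge0 ?sqr_ge0// indicE ler0n.
pose Q k := A `&` ball (p k) (rho n).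
have mQ k : hmeas (Q k) by apply: measurableI => //; apply: hausdorff_open; exact: ball_open.
have Qlev k : (nu (Q k) <= (C * rho n ^+ d.-1)%:E)%E.
  apply: le_trans (HC (p k) (rho n) (rho0 n)); apply: le_outer_measure => y [[by_ ys]].
  rewrite -ball_normE /= distrC => yp; split=> //; apply: bnd_level => //; apply: le_ball ys.
  exact: ltW.
have pt x : A x -> (\1_E x * mean w u x (rho n)) ^+ 2 <= \sum_k M k * \1_(Q k) x.
  move=> Ax; apply: (@le_trans _ _ (mean w u x (rho n) ^+ 2)).
    by rewrite exprMn ler_piMl ?sqr_ge0// indicE; case: (_ \in _); rewrite ?expr1n ?expr0n.
  have xN : `|x - x0| <= N%:R * rho n.
    rewrite -ler_pdivrMr//; apply: le_trans (ltW (truncnS_gt _)); rewrite ler_wpM2r ?invr_ge0 ?(ltW (rho0 n))//.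
    by have [_] := Ax; rewrite -ball_normE /= distrC => xs; apply: ltW; exact: lt_trans xs s16.
  have [k xk] := grid_cover (rho0 n) xN.
  have Qx : Q k x by split=> //; rewrite -ball_normE /= distrC.
  apply: le_trans (sum_indic_ge M0 Qx).
  apply: le_trans (mean_bound n Ax) _; rewrite /M ler_wpM2l ?invr_ge0 ?(ltW k0)// Rintegral_indic//.
  apply: subset_Rintegral.
  - by apply: measurableI => //; apply: leb_open; exact: open_eball.
  - exact: measurableI.
  - move=> y yE; split; first exact: eball_slab yE.
    have := eball_ball yE.1; rewrite -!ball_normE /= => xy.
    rewrite (_ : p k - y = (x - y) - (x - p k)); last by apply/rowP => j; rewrite !mxE; ring.
    by apply: le_lt_trans (ler_normB _ _) _; rewrite mulr2n mulrDl mul1r ltrD.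
  - by apply: rintS rS; [exact: measurableI|exact: mS|exact: subIsetl].
  - by move=> y _; exact: sqr_ge0.
have sumM : \sum_k M k <= (kap * rho n ^+ d)^-1 * (4 ^+ d * (K * (s / (4 * n.+1%:R)))).
  rewrite -mulr_sumr ler_wpM2l ?invr_ge0 ?(ltW k0)//.
  have rI k : rint mu (slab n `&` w) (fun y => \1_(ball (p k) (2 * rho n)) y * u y ^+ 2).
    apply: (@rint_mul_bounded _ _ _ mu _ _ _ 1) => //.
    by move=> x _; rewrite indicE; case: (_ \in _); rewrite ?normr1 ?normr0.
  rewrite -Rintegral_sum//; apply: (@le_trans _ _ (\int[mu]_(y in slab n `&` w) (4 ^+ d * u y ^+ 2))).
    apply: le_Rintegral => //; [by apply: rint_sum => // k; exact: rI|exact: rintZ|].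
    move=> y _; rewrite -mulr_suml ler_wpM2r ?sqr_ge0//.
    have := @grid_overlap R d N 2 x0 (rho n) y (rho0 n); apply: le_trans.
    apply: ler_sum => k _; rewrite indicE ler_nat; case: (boolP (_ \in _)) => // /set_mem.
    by rewrite -ball_normE /= distrC => ->.
  rewrite RintegralZl//; apply: ler_wpM2l; first exact: exprn_ge0.
  apply: le_trans (HK n.+1 isT _ erefl); apply: subset_Rintegral => //.
  - exact: leb_open (@open_slab n).
  - apply: rintS ru2 => //; first exact: leb_open (@open_slab n).
    move=> y [ys /andP[hy _]]; have ys' : ball x0 s y.
      by apply: le_ball ys; exact: ltW.
    by apply: Hw => //; apply/Hs.
  - by move=> y _; exact: sqr_ge0.
apply: (@le_trans _ _ (\int[nu]_(x in A) (\sum_k M k * \1_(Q k) x)%:E)%E).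
  rewrite integral_mkcond [leRHS]integral_mkcond; apply: ge0_integral_mono => x.
    by rewrite patchE; case: ifP => // _; rewrite lee_fin sqr_ge0.
  by rewrite !patchE; case: ifPn => // /set_mem /pt; rewrite lee_fin.
apply: le_trans (integral_step_le mA mQ M0 Qlev) _; rewrite lee_fin.
have r0 : 0 <= C * rho n ^+ d.-1 by rewrite mulr_ge0// exprn_ge0// ltW.
apply: le_trans (ler_wpM2r r0 sumM) _.
rewrite le_eqVlt; apply/orP; left; apply/eqP.
have Ed : rho n ^+ d = rho n * rho n ^+ d.-1 by rewrite -exprS prednK.
have -> : s / (4 * n.+1%:R) = rho n * (T + 4) by rewrite /rho divfK// gt_eqF.
rewrite Ed; field; rewrite !gt_eqF//= exprn_gt0//.
Qed.

Lemma bnd_local_finite : (nu A < +oo)%E.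
Proof.
have [C C0 HC] := level_hausdorff d0 v0 he.
have s160 : 0 < s / 16 by rewrite divr_gt0.
apply: (@le_lt_trans _ _ (C * (s / 16) ^+ d.-1)%:E); last exact: ltry.
apply: le_trans (HC x0 (s / 16) s160); apply: le_outer_measure => y [by_ ys]; split.
  by apply: bnd_level => //; apply: le_ball ys; exact: ltW.
by move: ys; rewrite -ball_normE /= distrC.
Qed.

End LocalTrace.

(** [U] may cut [Om] at a bad angle, but about a point of [K] a small ball lies in [U] and sees only
    the Lipschitz boundary of [Om]. Compactness leaves finitely many charts. *)
Lemma trace_compact Om eps U u g K : (0 < d)%N -> 0 < v -> open Om -> bounded_set Om -> 0 < eps ->
  (forall y, Om y -> cone_at Om eps y) -> lipschitz_boundary Om -> open U -> sobolev (U `&` Om) u g ->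
  compact K -> K `<=` U -> (nu (bnd Om `&` K) < +oo)%E /\
  (\int[nu]_(x in bnd Om `&` K) (trace (U `&` Om) u x ^+ 2)%:E < +oo)%E.
Proof.
move=> d0 v0 oO bO e0 Hc lip oU S cK KU; have oW := @openI _ _ _ oU oO.
have mw := leb_open oW; have [su _ _] := S.
have fw : (mu (U `&` Om) < +oo)%E.
  by apply: le_lt_trans (leb_bounded bO); apply: le_measure; rewrite ?inE//; [exact: leb_open].
have cA : closed (bnd Om).
  rewrite /bnd setDE; apply: closedI; first exact: closed_closure.
  by apply: open_closedC; exact: open_interior.
have ball_meas (x : 'rV[R]_d) (r : R) : hmeas (bnd Om `&` ball x r).
  apply: measurableI; [exact: hausdorff_closed|].
  have [r0|r0] := ltP 0 r; first by apply: hausdorff_open; exact: ball_open.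
  by rewrite (_ : ball x r = set0)//; apply/seteqP; split=> // y; rewrite -ball_normE /= ltNge (le_trans r0).
pose S0 := bnd Om `&` K.
have cS : compact S0 by rewrite /S0 setIC; exact: compact_closedI.
have loc x : exists s : R, 0 < s /\ (S0 x -> (nu (bnd Om `&` ball x s) < +oo)%E /\
    (\int[nu]_(y in bnd Om `&` ball x s) (trace (U `&` Om) u y ^+ 2)%:E < +oo)%E).
  have [[bx Kx]|nx] := pselect (S0 x); last by exists 1.
  have [r [e [h [T [r0 he Hr]]]]] := lipschitz_chart d0 lip bx.
  have /nbhs_ballP[t /= t0 Ht] : nbhs x U by apply: open_nbhs_nbhs; split=> //; exact: KU.
  have D0 : 0 < eps * (d%:R * (2 + eps^-1)).
    by rewrite mulr_gt0// mulr_gt0 ?ltr0n// addr_gt0// invr_gt0.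
  pose s := Num.min (eps * (d%:R * (2 + eps^-1))) (Num.min r t).
  have s0 : 0 < s by rewrite !lt_min D0 r0.
  have sr : s <= r by rewrite !ge_min lexx orbT.
  have st : s <= t by rewrite !ge_min lexx !orbT.
  have se : s <= eps * (d%:R * (2 + eps^-1)) by rewrite ge_min lexx.
  have Hs y : ball x s y -> (Om y <-> 0 < h y) by move=> xy; apply: Hr; exact: le_ball xy.
  have Hw y : ball x s y -> Om y -> (U `&` Om) y by move=> xy Oy; split=> //; apply: Ht; exact: le_ball xy.
  exists (s / 16); split; first by rewrite divr_gt0.
  move=> _; split; first exact: bnd_local_finite d0 v0 oO he s0 Hs.
  have [B B0 HB] := trace_local d0 v0 oO e0 Hc he s0 se oW fw (@subIsetr _ _ _) Hs Hw S.
  exact: le_lt_trans HB (ltry _).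
have [s Hs] := choice loc.
have := cS; rewrite compact_cover => /(_ _ S0 (fun x => ball x (s x))).
case=> [x _|x Kx|D DK Kcov]; first by apply: ball_open; case: (Hs x).
  by exists x => //; apply: ballxx; case: (Hs x).
have sD x : x \in finmap.enum_fset D -> S0 x by move=> xs; apply/set_mem; apply: DK.
have cov x : S0 x -> exists2 y, y \in finmap.enum_fset D & (bnd Om `&` ball y (s y)) x.
  by move=> Sx; have [y /= yD xy] := Kcov x Sx; exists y => //; split=> //; case: Sx.
have mS0 : hmeas S0 by apply: hausdorff_closed; exact: compact_closed_row.
split.
  have := @integral_finite_cover R _ (Defs.hausdorff_space R d d.-1) nu (fun=> 1%E) _ _
    (fun y => bnd Om `&` ball y (s y)) S0 (measurable_cst _) (fun=> lee01) (fun y => ball_meas y _) cov.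
  rewrite integral_cst// mul1e; apply => y /sD Sy; rewrite integral_cst// mul1e.
  by case: (Hs y) => _ /(_ Sy)[].
apply: (@integral_finite_cover R _ (Defs.hausdorff_space R d d.-1) nu _ _ _
  (fun y => bnd Om `&` ball y (s y)) S0 _ _ (fun y => ball_meas y _) cov).
- apply/measurable_EFinP; apply: measurable_sqr; apply: measurable_trace => //.
  exact: sqint_rint_finite.
- by move=> y; rewrite lee_fin sqr_ge0.
- by move=> y /sD Sy; case: (Hs y) => _ /(_ Sy)[].
Qed.

End Trace.

(** * Caccioppoli inequality *)

Section Coefficients.
Context {R : realType} {d : nat}.
Implicit Types (x y : 'rV[R]_d) (W w : set 'rV[R]_d) (f u : 'rV[R]_d -> R).
Local Notation mu := (leb R d).
Local Notation lmeas A := (measurable (A : set (leb_space R d))).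
Local Notation lmfun W f := (measurable_fun (W : set (leb_space R d)) (f : leb_space R d -> _)).

Lemma mul_le_sqrD (a b : R) : a * b <= a ^+ 2 + b ^+ 2.
Proof. by have := sqr_ge0 (a - b); have := sqr_ge0 (a + b); nra. Qed.

Lemma clamp_bound (M t : R) : 0 <= M -> `|Num.max (- M) (Num.min M t)| <= M.
Proof.
move=> M0; rewrite ler_norml le_max lexx /= ge_max ge_min lexx /= andbT.
by lra.
Qed.

Lemma clamp_id (M t : R) : `|t| <= M -> Num.max (- M) (Num.min M t) = t.
Proof. by rewrite ler_norml => /andP[t1 t2]; rewrite (min_idPr t2) (max_idPr t1). Qed.

Lemma Loo_clamp W f : Loo W f -> exists M, 0 <= M /\ exists f',
  [/\ lmfun W f', forall x, `|f' x| <= M & {ae mu, forall x, W x -> f x = f' x}].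
Proof.
move=> [mf [M HM]]; exists `|M|; split=> //.
exists (fun x => Num.max (- `|M|) (Num.min `|M| (f x))); split.
- apply: measurable_maxr; first exact: measurable_cst.
  by apply: measurable_minr => //; exact: measurable_cst.
- by move=> x; exact: clamp_bound.
- apply: aeS HM => x Hx Wx; rewrite clamp_id//; exact: le_trans (Hx Wx) (ler_norm M).
Qed.

Lemma mean_Loo w u (M : R) x (r : R) : open w -> (mu w < +oo)%E -> 0 <= M -> lmfun w u ->
  {ae mu, forall x, w x -> `|u x| <= M} -> `|mean w u x r| <= M.
Proof.
move=> oW fw M0 mu_ uM; pose E := eball x r `&` w.
have mE : lmeas E by apply: leb_open; apply: openI => //; exact: open_eball.
have fE : (mu E < +oo)%E.
  by apply: le_lt_trans fw; apply: le_measure; rewrite ?inE//; [exact: leb_open|exact: subIsetr].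
have rM : rint mu E (fun=> M) by exact: rint_cst.
have mE' : lmfun E u by apply: measurable_funS mu_; [exact: leb_open|exact: subIsetr].
have mb : {ae mu, forall x, E x -> u x = Num.max (- M) (Num.min M (u x))}.
  by apply: aeS uM => y Hy [_ wy]; rewrite clamp_id//; exact: Hy.
have mu' : lmfun E (fun y => Num.max (- M) (Num.min M (u y))).
  apply: measurable_maxr; first exact: measurable_cst.
  by apply: measurable_minr => //; exact: measurable_cst.
have ru' : rint mu E (fun y => Num.max (- M) (Num.min M (u y))).
  by apply: (rint_le mE mu' _ rM) => y _; exact: clamp_bound.
have IE : \int[mu]_(y in E) u y = \int[mu]_(y in E) Num.max (- M) (Num.min M (u y)).
  exact: (ae_eq_Rintegral mE mE' mu' mb).
have cM : \int[mu]_(y in E) M = M * fine (mu E) by rewrite Rintegral_cst.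
have m0 : 0 <= fine (mu E) by exact: fine_ge0.
have bd : `|\int[mu]_(y in E) u y| <= M * fine (mu E).
  rewrite IE -cM ler_norml; apply/andP; split.
    have -> : - (\int[mu]_(y in E) M) = \int[mu]_(y in E) (- M) by rewrite !Rintegral_cst// mulNr.
    apply: le_Rintegral => //; first exact: rint_cst.
    by move=> y _; have := clamp_bound (u y) M0; rewrite ler_norml => /andP[].
  by apply: le_Rintegral => // y _; have := clamp_bound (u y) M0; rewrite ler_norml => /andP[].
rewrite /mean -/E; have [->|n0] := eqVneq (fine (mu E)) 0; first by rewrite invr0 mulr0 normr0.
by rewrite normrM normfV (ger0_norm m0) ler_pdivrMr// lt_neqAle eq_sym n0.
Qed.

Lemma trace_Loo w u (M : R) x : open w -> (mu w < +oo)%E -> 0 <= M -> lmfun w u ->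
  {ae mu, forall x, w x -> `|u x| <= M} -> `|trace w u x| <= M.
Proof.
move=> oW fw M0 mu_ uM.
have [cu|nu] := pselect (cvg (mean w u x @ 0^'+)); last by rewrite trace_point0// normr0.
rewrite ler_norml; apply/andP; split.
  apply: limr_ge => //; apply: nearW => r.
  by have := mean_Loo x r oW fw M0 mu_ uM; rewrite ler_norml => /andP[].
apply: limr_le => //; apply: nearW => r.
by have := mean_Loo x r oW fw M0 mu_ uM; rewrite ler_norml => /andP[].
Qed.

Lemma outer_normal_le1 (Om : set 'rV[R]_d) x i : `|outer_normal Om x 0 i| <= 1.
Proof.
rewrite /outer_normal; case: xgetP => [nu _ [n1 _]|_]; last by rewrite mxE normr0.
by apply: le_trans (coord_enorm _ _) _; rewrite n1.
Qed.

Lemma app_sum (I : Type) (s : seq I) (c : I -> R) (A : 'M[R]_d) (g : I -> 'rV[R]_d) :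
  app A (\sum_(k <- s) c k *: g k) = \sum_(k <- s) c k *: app A (g k).
Proof. by rewrite /app mulmx_suml; apply: eq_bigr => k _; rewrite scalemxAl. Qed.

Lemma dot_suml (I : Type) (s : seq I) (c : I -> R) (x : I -> 'rV[R]_d) y :
  dot (\sum_(k <- s) c k *: x k) y = \sum_(k <- s) c k * dot (x k) y.
Proof.
elim/big_rec2: _ => [|k t z _ <-]; last by rewrite dotDl dotZl.
by rewrite /dot big1// => i _; rewrite mxE mul0r.
Qed.

Lemma dot_sumr (I : Type) (s : seq I) (c : I -> R) (x : I -> 'rV[R]_d) y :
  dot y (\sum_(k <- s) c k *: x k) = \sum_(k <- s) c k * dot y (x k).
Proof. by rewrite dotC dot_suml; apply: eq_bigr => k _; rewrite dotC. Qed.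

Lemma sqint_app W (A : 'rV[R]_d -> 'M[R]_d) (g : 'rV[R]_d -> 'rV[R]_d) (M : R) : lmeas W ->
  (forall i j, lmfun W (fun x => A x i j)) -> (forall x i j, `|A x i j| <= M) ->
  (forall i, sqint mu W (fun x => g x 0 i)) ->
  forall i, sqint mu W (fun x => app (A x) (g x) 0 i).
Proof.
move=> mW mA AM sg i.
have -> : (fun x => app (A x) (g x) 0 i) = fun x => \sum_j A x i j * g x 0 j.
  by apply/funext => x; rewrite /app mxE; apply: eq_bigr => j _; rewrite mxE mulrC.
apply: sqint_sum => // j; apply: (sqint_mul_bounded (M := M) mW (sg j) (mA i j)) => x _; exact: AM.
Qed.

Lemma measurable_dot W (f g : 'rV[R]_d -> 'rV[R]_d) : (forall i, lmfun W (fun x => f x 0 i)) ->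
  (forall i, lmfun W (fun x => g x 0 i)) -> lmfun W (fun x => dot (f x) (g x)).
Proof.
move=> mf mg; rewrite /dot.
by apply: (@measurable_sum _ (leb_space R d) R W _ (index_enum 'I_d)) => i; exact: measurable_funM.
Qed.

Lemma measurable_app W (A : 'rV[R]_d -> 'M[R]_d) (g : 'rV[R]_d -> 'rV[R]_d) :
  (forall i j, lmfun W (fun x => A x i j)) -> (forall i, lmfun W (fun x => g x 0 i)) ->
  forall i, lmfun W (fun x => app (A x) (g x) 0 i).
Proof.
move=> mA mg i.
have -> : (fun x => app (A x) (g x) 0 i) = fun x => \sum_j A x i j * g x 0 j.
  by apply/funext => x; rewrite /app mxE; apply: eq_bigr => j _; rewrite mxE mulrC.
by apply: (@measurable_sum _ (leb_space R d) R W _ (index_enum 'I_d)) => j; exact: measurable_funM.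
Qed.

Lemma rint_dot W (f g : 'rV[R]_d -> 'rV[R]_d) : lmeas W ->
  (forall i, sqint mu W (fun x => f x 0 i)) -> (forall i, sqint mu W (fun x => g x 0 i)) ->
  rint mu W (fun x => dot (f x) (g x)).
Proof. by move=> mW sf sg; apply: rint_sum => // i; exact: sqint_rint. Qed.

Lemma test_function_sqr U (th : 'rV[R]_d -> R) : test_function U th ->
  test_function U (fun x => th x ^+ 2) /\
  forall x, \row_i partial i (fun y => th y ^+ 2) x = (2 * th x) *: \row_i partial i th x.
Proof.
move=> tU; have [sth _] := tU; split.
  have -> : (fun x => th x ^+ 2) = fun x => th x * th x by apply/funext => x; rewrite expr2.
  exact: test_functionM.
move=> x; apply/rowP => i; rewrite !mxE /partial.
have dth : derivable th x (delta_mx 0 i) by apply: diff_derivable; have := sth [::] x.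
have -> : (fun y => th y ^+ 2) = th ^+ 2 by apply/funext => y; rewrite /GRing.exp /=.
by rewrite deriveX// expr1.
Qed.

End Coefficients.

Section Bilinear.
Context {dsp : measure_display} {T : measurableType dsp} {R : realType}.
Variable m : {measure set T -> \bar R}.

Lemma Rintegral_sum2 (I : finType) (D : set T) (c : I -> R) (F : I -> I -> T -> R) : measurable D ->
  (forall i j, rint m D (F i j)) ->
  rint m D (fun x => \sum_i \sum_j c i * c j * F i j x) /\
  \sum_i \sum_j c i * c j * \int[m]_(x in D) F i j x =
  \int[m]_(x in D) (\sum_i \sum_j c i * c j * F i j x).
Proof.
move=> mD rF.
have r1 i j : rint m D (fun x => c i * c j * F i j x) by exact: rintZ.
have r2 i : rint m D (fun x => \sum_j c i * c j * F i j x) by exact: rint_sum.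
split; first exact: rint_sum.
rewrite Rintegral_sum//; apply: eq_bigr => i _; rewrite Rintegral_sum//; apply: eq_bigr => j _.
by rewrite (RintegralZl _ mD (rF i j)).
Qed.

End Bilinear.

(** * The boundary term and the tested equation *)

Section Caccioppoli.
Context {R : realType} {d : nat} (P : pde_data R d).
Implicit Types (x y : 'rV[R]_d) (u theta : 'rV[R]_d -> R).
Local Notation mu := (leb R d).
Local Notation nu := (hausdorff R d d.-1).
Local Notation lmeas A := (measurable (A : set (leb_space R d))).
Local Notation hmeas A := (measurable (A : set (Defs.hausdorff_space R d d.-1))).
Local Notation lmfun W f := (measurable_fun (W : set (leb_space R d)) (f : leb_space R d -> _)).
Local Notation hmfun f := (measurable_fun setT (f : Defs.hausdorff_space R d d.-1 -> R)).
Local Notation v := (@unit_vol R d).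
Local Notation Om := (Omega P).

Variables (amin amax eps : R) (U : set 'rV[R]_d) (I : finType) (c : I -> R) (phi : I -> 'rV[R]_d -> R)
  (th : 'rV[R]_d -> R).
Hypotheses (d1 : (1 < d)%N) (v0 : 0 < v) (adm : admissible_data P amin amax) (e0 : 0 < eps)
  (Hc : forall y, Om y -> cone_at Om eps y) (oU : open U)
  (HBphi : forall k, HB P (U `&` Om) (phi k)) (tU : test_function U th) (th0 : forall x, 0 <= th x).
Local Notation ws := (U `&` Om).
Let g k := grad ws (phi k).
Let J k m := \int[nu]_(x in GammaO P `&` bnd ws)
   (trace ws (phi k) x * trace ws (fun y => th y * phi m y) x * b_dot_nu P x).

Let oO : open Om. Proof. by case: adm => -[]. Qed.
Let bO : bounded_set Om. Proof. by case: adm => -[]. Qed.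
Let oW : open ws. Proof. exact: (@openI _ _ _ oU oO). Qed.
Let d0 : (0 < d)%N. Proof. exact: ltnW. Qed.
Let fO : (mu Om < +oo)%E. Proof. exact: leb_bounded. Qed.
Let fw : (mu ws < +oo)%E.
Proof. by apply: le_lt_trans fO; apply: le_measure; rewrite ?inE//; exact: leb_open. Qed.
Let mW : lmeas ws. Proof. exact: leb_open. Qed.
Let H1phi k : H1 ws (phi k). Proof. by case: (HBphi k) => -[]. Qed.
Let S k : sobolev ws (phi k) (g k). Proof. exact: H1_sobolev. Qed.

(** [trace] and [outer_normal] are total with default value 0, so the bound holds at every point,
    also where no normal exists. *)
Lemma b_dot_nu_bounded : exists2 beta : R, 0 <= beta & forall x, `|b_dot_nu P x| <= beta.
Proof.
have [_ _ [Hb _] _] := adm.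
have HM i : exists M : R, 0 <= M /\ forall x, `|trace Om (fun y => bvec P y 0 i) x| <= M.
  have [[mb [M HM]] _] := Hb i; exists `|M|; split=> // x.
  by apply: trace_Loo => //; apply: aeS HM => y Hy Oy; exact: le_trans (Hy Oy) (ler_norm M).
have [M {}HM] := choice HM.
exists (\sum_i M i); first by apply: sumr_ge0 => i _; case: (HM i).
move=> x; apply: le_trans (ler_norm_sum _ _ _) _; apply: ler_sum => i _; have [M0 Mx] := HM i.
rewrite mxE normrM -[leRHS]mulr1; apply: ler_pM => //; exact: outer_normal_le1.
Qed.

(** Each [J k m] is rewritten with the same measurable minorant [q] of the weight; only then can the
    double sum be taken under the integral, where it is [th * q] times the square of $\sum_k c_k
    t_k$. *)
Lemma boundary_psd : 0 <= \sum_k \sum_m c k * c m * J k m.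
Proof.
have [[_ _ _ _ lip] [_ _ _ mGO] [_ bpos] _] := adm.
have [beta beta0 Hbeta] := b_dot_nu_bounded.
have [sth [K [cK KU Kout]]] := tU.
have [Mt Mt0 HMt] := test_function_bounded tU.
pose t k := trace ws (phi k).
have bndE : bnd ws `&` K `<=` bnd Om `&` K.
  move=> x [[cx ix] Kx]; split=> //; split; first by apply: closureS cx; exact: subIsetr.
  move=> iO; apply: ix; apply/filterI => //; apply: open_nbhs_nbhs; split=> //; exact: KU.
have clb (A : set 'rV[R]_d) : closed (bnd A).
  rewrite /bnd setDE; apply: closedI; first exact: closed_closure.
  by apply: open_closedC; exact: open_interior.
have cKc := compact_closed_row cK.
pose A := GammaO P `&` (bnd ws `&` K).
have mBK : hmeas (bnd ws `&` K) by apply: hausdorff_closed; exact: closedI.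
have mBO : hmeas (bnd Om `&` K) by apply: hausdorff_closed; exact: closedI.
have mA : hmeas A by exact: measurableI.
have AO : A `<=` bnd Om `&` K by move=> x [_ /bndE].
have fin k := trace_compact d0 v0 oO bO e0 Hc lip oU (S k) cK KU.
case: (pselect (exists k : I, True)) => [[k0 _]|nI]; last first.
  by rewrite big1// => k _; case: nI; exists k.
have fA : (nu A < +oo)%E.
  by apply: le_lt_trans (fin k0).1; apply: le_measure; rewrite ?inE.
(* The clipping changes nothing almost everywhere on [A], where the normal component is nonnegative,
   but bounds the weight at every point, as [lower_envelope] requires. *)
pose w x := \1_A x * Num.max 0 (Num.min beta (b_dot_nu P x)).
have wb x : 0 <= w x <= beta * \1_A x.
  rewrite /w mulrC ler_wpM2r ?indicE ?ler0n// ?mulr_ge0 ?ler0n ?le_max ?lexx//=.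
  by rewrite ge_max beta0 ge_min lexx.
have [q [mq qw qmax]] := lower_envelope mA fA wb.
have mt k : hmfun (t k).
  by apply: measurable_trace => //; apply: sqint_rint_finite => //; case: (S k).
have mth : hmfun th.
  by apply: hausdorff_continuous => x; apply: differentiable_continuous; exact: (sth [::]).
have mttt k m : hmfun (fun x => th x * t k x * t m x) by exact: measurable_funM (measurable_funM mth (mt k)) (mt m).
have rt k : rint nu setT (fun x => \1_(bnd Om `&` K) x * t k x ^+ 2).
  apply/integrableP; split.
    apply/measurable_EFinP; apply: measurable_funM; first exact: measurable_indic.
    exact: measurable_sqr.
  have [_ fk] := fin k; rewrite integral_mkcond in fk; apply: le_lt_trans fk.
  apply: ge0_integral_mono => x; first exact: abse_ge0.
  rewrite /= patchE indicE; case: ifP => _; last by rewrite mul0r normr0.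
  by rewrite mul1r ger0_norm ?sqr_ge0.
have rJ k m : rint nu setT (fun x => th x * t k x * t m x * q x).
  apply: (@rint_le _ _ _ nu _ _ (fun x => (Mt * beta) * (\1_(bnd Om `&` K) x * t k x ^+ 2 + \1_(bnd Om `&` K) x * t m x ^+ 2))).
  - exact: measurableT.
  - exact: measurable_funM (mttt k m) mq.
  - move=> x _; have /andP[q0 qx] := qw x; have /andP[_ wx] := wb x.
    have qb : q x <= beta * \1_(bnd Om `&` K) x.
      apply: le_trans (le_trans qx wx) _; rewrite ler_wpM2l// !indicE ler_nat.
      by case: (boolP (x \in A)) => // /set_mem /AO Ax; rewrite mem_set.
    rewrite normrM (ger0_norm q0) !normrM.
    have tt : `|t k x| * `|t m x| <= t k x ^+ 2 + t m x ^+ 2.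
      rewrite -[t k x ^+ 2]real_normK ?num_real// -[t m x ^+ 2]real_normK ?num_real//.
      exact: mul_le_sqrD.
    apply: (@le_trans _ _ (Mt * (t k x ^+ 2 + t m x ^+ 2) * (beta * \1_(bnd Om `&` K) x))).
      rewrite -[`|th x| * _ * _]mulrA; apply: ler_pM => //.
      by apply: ler_pM => //; exact: mulr_ge0.
    by rewrite le_eqVlt; apply/orP; left; apply/eqP; ring.
  - by apply: rintZ => //; apply: rintD.
have JE k m : J k m = \int[nu]_x (th x * t k x * t m x * q x).
  apply: (envelope_Rintegral mq qw qmax) => //.
  have := aeI bpos (cutoff_trace d1 oO bO e0 Hc v0 oU tU (H1phi m)).
  apply: aeS => x [bp tx]; rewrite patchE /w.
  have [/set_mem xS|/negP nS] := boolP (x \in _); last first.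
    rewrite indicE (_ : (x \in A) = false) ?mul0r ?mulr0//.
    by apply/negP => /set_mem [xG [xb _]]; apply: nS; apply/mem_set.
  case: xS => xG xb; rewrite tx// -/(t k) -/(t m) indicE.
  have [Kx|nK] := pselect (K x); last by rewrite Kout// !(mul0r, mulr0).
  rewrite mem_set// mul1r (min_idPr _); last by apply: le_trans (Hbeta x); exact: ler_norm.
  rewrite (max_idPr (bp xG)); ring.
have [_ E2] := Rintegral_sum2 c measurableT rJ.
rewrite (eq_bigr (fun k => \sum_m c k * c m * \int[nu]_x (th x * t k x * t m x * q x))); last first.
  by move=> k _; apply: eq_bigr => m _; rewrite JE.
rewrite E2; apply: Rintegral_ge0 => x _.
rewrite (_ : \sum_k _ = th x * q x * (\sum_k c k * t k x) ^+ 2).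
  by rewrite mulr_ge0 ?sqr_ge0// mulr_ge0//; case/andP: (qw x).
rewrite expr2 big_distrlr mulr_sumr; apply: eq_bigr => k _; rewrite mulr_sumr; apply: eq_bigr => m _ /=.
ring.
Qed.

Let phis x := \sum_k c k * phi k x.
Let gs x := \sum_k c k *: g k x.
Let dth x := \row_i partial i th x.

(* The form vanishes on [th * phi m]; what remains after moving the boundary terms to the
   right is the negative of the sum in [boundary_psd]. *)
Lemma form_nonpositive (A' : 'rV[R]_d -> 'M[R]_d) (b' : 'rV[R]_d -> 'rV[R]_d) (M : R) :
  (forall i j, lmfun ws (fun x => A' x i j)) -> (forall x i j, `|A' x i j| <= M) ->
  (forall i, lmfun ws (fun x => b' x 0 i)) -> (forall x i, `|b' x 0 i| <= M) ->
  {ae mu, forall x, ws x -> Amat P x = A' x /\ bvec P x = b' x} ->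
  let F x := dot (app (A' x) (gs x)) (th x *: gs x + phis x *: dth x) -
     phis x * dot (b' x) (th x *: gs x + phis x *: dth x) in
  rint mu ws F /\ \int[mu]_(x in ws) F x <= 0.
Proof.
move=> mA AM mb bM AE F; have [_ _ [Hb _] [_ _ HAl _ _]] := adm.
have mAP i j : lmfun ws (fun x => Amat P x i j).
  by have [H _] := HAl i j; apply: measurable_funS H; [exact: leb_open|exact: subIsetr].
have mbP i : lmfun ws (fun x => bvec P x 0 i).
  by have [[H _] _] := Hb i; apply: measurable_funS H; [exact: leb_open|exact: subIsetr].
pose psi m x := th x * phi m x.
pose G m x := th x *: g m x + phi m x *: dth x.
have SG m : sobolev ws (psi m) (G m) by exact: test_sobolev oW tU (S m).
have sphi k : sqint mu ws (phi k) by case: (S k).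
have sg k i : sqint mu ws (fun x => g k x 0 i) by case: (S k).
have sG k i : sqint mu ws (fun x => G k x 0 i) by case: (SG k).
have sA k i : sqint mu ws (fun x => app (A' x) (g k x) 0 i) by exact: sqint_app mW mA AM (sg k) i.
have sb k : sqint mu ws (fun x => dot (b' x) (G k x)).
  by apply: sqint_sum => // i; apply: (sqint_mul_bounded (M := M) mW (sG k i) (mb i)) => x _; exact: bM.
have rF k m : rint mu ws (fun x => dot (app (A' x) (g k x)) (G m x) - phi k x * dot (b' x) (G m x)).
  by apply: rintB => //; [exact: rint_dot|exact: sqint_rint].
have FE : F = fun x => \sum_k \sum_m c k * c m * (dot (app (A' x) (g k x)) (G m x) - phi k x * dot (b' x) (G m x)).
  apply/funext => x; rewrite /F.
  have -> : th x *: gs x + phis x *: dth x = \sum_m c m *: G m x.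
    rewrite /gs /phis scaler_sumr scaler_suml -big_split /=; apply: eq_bigr => m _.
    by rewrite /G scalerDr !scalerA mulrC.
  rewrite /gs app_sum dot_suml /phis mulr_suml -sumrB; apply: eq_bigr => k _.
  rewrite !dot_sumr !mulr_sumr -sumrB; apply: eq_bigr => m _; ring.
have [rs Es] := Rintegral_sum2 c mW rF.
rewrite FE; split; first exact: rs.
have gE m := sobolev_grad oW (SG m).
have BE k m : \int[mu]_(x in ws) (dot (app (A' x) (g k x)) (G m x) - phi k x * dot (b' x) (G m x)) = - J k m.
  have H0 := cutoff_H1D0 d1 oO bO e0 Hc v0 oU tU (HBphi m).1.
  have [_ HBk] := HBphi k; have := HBk (psi m) H0; rewrite /B_form /a_form.
  have gm i : lmfun ws (fun x => grad ws (psi m) x 0 i).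
    by case: (H1_sobolev oW H0.1) => _ sgm _; exact: sqint_measurable (sgm i).
  have mG i : lmfun ws (fun x => G m x 0 i) by exact: sqint_measurable (sG m i).
  have mgk i : lmfun ws (fun x => g k x 0 i) by exact: sqint_measurable (sg k i).
  have mp : lmfun ws (phi k) by exact: sqint_measurable (sphi k).
  have HA := aeI AE (gE m).
  have E1 : \int[mu]_(x in ws) dot (app (Amat P x) (grad ws (phi k) x)) (grad ws (psi m) x) =
      \int[mu]_(x in ws) dot (app (A' x) (g k x)) (G m x).
    apply: (ae_eq_Rintegral mW).
    - exact: measurable_dot (measurable_app mAP mgk) gm.
    - exact: measurable_dot (measurable_app mA mgk) mG.
    - by apply: aeS HA => x [H1 H2] wx; rewrite (H1 wx).1 (H2 wx).
  have E3 : \int[mu]_(x in ws) (phi k x * dot (bvec P x) (grad ws (psi m) x)) =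
      \int[mu]_(x in ws) (phi k x * dot (b' x) (G m x)).
    apply: (ae_eq_Rintegral mW).
    - exact: measurable_funM mp (measurable_dot mbP gm).
    - exact: measurable_funM mp (measurable_dot mb mG).
    - by apply: aeS HA => x [H1 H2] wx; rewrite (H1 wx).2 (H2 wx).
  rewrite E1 E3 -/(J k m).
  rewrite RintegralB//; [|exact: rint_dot|exact: sqint_rint].
  by move=> /eqP; rewrite addr_eq0 => /eqP.
rewrite -Es (eq_bigr (fun k => - \sum_m c k * c m * J k m)); last first.
  by move=> k _; rewrite -sumrN; apply: eq_bigr => m _; rewrite BE mulrN.
by rewrite sumrN oppr_le0; exact: boundary_psd.
Qed.

End Caccioppoli.

(** * The energy estimate *)

Section Energy.
Context {R : realType} {d : nat} (P : pde_data R d).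
Implicit Types (x y : 'rV[R]_d) (u theta : 'rV[R]_d -> R).
Local Notation mu := (leb R d).
Local Notation lmfun W f := (measurable_fun (W : set (leb_space R d)) (f : leb_space R d -> _)).
Local Notation Om := (Omega P).

(** Clamping turns essential bounds into pointwise ones, at the price of changing the coefficients
    on a null set; domination arguments then apply directly. *)
Lemma coefficients amin amax : admissible_data P amin amax ->
  exists (A' : 'rV[R]_d -> 'M[R]_d) (b' : 'rV[R]_d -> 'rV[R]_d) (M : R),
  [/\ 0 <= M, forall i j, lmfun Om (fun x => A' x i j), forall i, lmfun Om (fun x => b' x 0 i),
     (forall x i j, `|A' x i j| <= M) /\ (forall x i, `|b' x 0 i| <= M) &
     {ae mu, forall x, Om x -> Amat P x = A' x /\ bvec P x = b' x}].
Proof.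
move=> [_ _ [Hb _] [_ _ HA _ _]].
have [MA HMA] := choice (fun p : 'I_d * 'I_d => Loo_clamp (HA p.1 p.2)).
have [fA HfA] := choice (fun p => (HMA p).2).
have [Mb HMb] := choice (fun i => Loo_clamp (Hb i).1).
have [fb Hfb] := choice (fun i => (HMb i).2).
have MA0 p : 0 <= MA p by case: (HMA p).
have Mb0 i : 0 <= Mb i by case: (HMb i).
exists (fun x => \matrix_(i, j) fA (i, j) x), (fun x => \row_i fb i x), (\sum_p MA p + \sum_i Mb i); split.
- by rewrite addr_ge0// sumr_ge0.
- move=> i j; have [mf _ _] := HfA (i, j).
  by rewrite (_ : (fun x => _) = fA (i, j))//; apply/funext => x; rewrite mxE.
- move=> i; have [mf _ _] := Hfb i.
  by rewrite (_ : (fun x => _) = fb i)//; apply/funext => x; rewrite mxE.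
- split=> [x i j|x i]; rewrite mxE.
    have [_ bf _] := HfA (i, j); apply: le_trans (bf x) _; rewrite (bigD1 (i, j))//= -addrA lerDl.
    by rewrite addr_ge0// sumr_ge0.
  have [_ bf _] := Hfb i; apply: le_trans (bf x) _; rewrite [\sum_i Mb i](bigD1 i)//= addrCA lerDl.
  by rewrite addr_ge0// sumr_ge0.
- have H1 : {ae mu, forall x, forall p : 'I_d * 'I_d, Om x -> Amat P x p.1 p.2 = fA p x}.
    by apply: ae_forall => p; case: (HfA p).
  have H2 : {ae mu, forall x, forall i, Om x -> bvec P x 0 i = fb i x}.
    by apply: ae_forall => i; case: (Hfb i).
  apply: aeS (aeI H1 H2) => x [e1 e2] Ox; split.
    by apply/matrixP => i j; rewrite mxE; exact: (e1 (i, j)).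
  by apply/rowP => i; rewrite mxE; exact: e2.
Qed.

Lemma dot_sqrD_ge0 (X Y : 'rV[R]_d) (t : R) : 0 <= dot X X + 2 * t * dot X Y + t ^+ 2 * dot Y Y.
Proof.
have := dot_ge0 (X + t *: Y); rewrite dotDl !dotDr !dotZl !dotZr (dotC Y X) => H.
by rewrite (_ : _ + _ = dot X X + t * dot X Y + (t * dot X Y + t * (t * dot Y Y)))//; ring.
Qed.

(** Used with $X = \eta\nabla u$, $Y = u\nabla\eta$, $Z = \eta u$, where $\nabla(\eta^2 u) = \eta(X
    + 2Y)$. Nonnegativity of [A] at $X + 2Y$ gives $2AX\cdot Y \ge -\frac12 AX\cdot X - 2AY\cdot Y$,
    which leaves half of the ellipticity; the drift takes a further quarter of $a_{\min}|X|^2$. *)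
Lemma energy_pointwise (A : 'M[R]_d) (b X Y : 'rV[R]_d) (Z amin amax beta : R) : 0 < amin -> 0 <= amax ->
  A^T = A -> (forall xi, amin * dot xi xi <= dot (app A xi) xi <= amax * dot xi xi) -> dot b b <= beta ->
  amin / 4 * dot X X <= (dot (app A X) (X + 2 *: Y) - Z * dot b (X + 2 *: Y)) +
    (2 * amax + 1 + beta / amin + beta) * (dot Y Y + Z ^+ 2).
Proof.
move=> am0 ax0 As El bb.
have sym xi eta : dot (app A xi) eta = dot (app A eta) xi.
  have E (p q : 'rV[R]_d) : dot (app A p) q = (p *m A *m q^T) 0 0.
    rewrite /app As /dot [RHS]mxE; apply: eq_bigr => i _; by rewrite [q^T _ _]mxE.
  rewrite !E; transitivity ((xi *m A *m eta^T)^T 0 0); first by rewrite [RHS]mxE.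
  by rewrite !trmx_mul trmxK As mulmxA.
have appD xi eta : app A (xi + eta) = app A xi + app A eta by rewrite /app mulmxDl.
have appZ t xi : app A (t *: xi) = t *: app A xi by rewrite /app scalemxAl.
have /andP[X1 X2] := El X; have /andP[Y1 Y2] := El Y.
have /andP[Q1 _] := El (X + 2 *: Y).
have Q0 : 0 <= dot (app A (X + 2 *: Y)) (X + 2 *: Y).
  by apply: le_trans Q1; rewrite mulr_ge0 ?dot_ge0// ltW.
have := Q0; rewrite appD appZ !dotDl !dotDr !dotZl !dotZr (sym Y X) => {}Q0.
have B1 := dot_sqrD_ge0 X b (- (2 / amin) * Z).
have B2 := dot_sqrD_ge0 Y b (- Z).
have Z0 := sqr_ge0 Z.
have bbZ : Z ^+ 2 * dot b b <= Z ^+ 2 * beta by rewrite ler_wpM2l.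
have beta0 : 0 <= beta by apply: le_trans bb; exact: dot_ge0.
have Y0 := dot_ge0 Y.
have B1' : Z * dot b X <= amin / 4 * dot X X + beta / amin * Z ^+ 2.
  have : 0 <= amin / 4 * (dot X X + 2 * (- (2 / amin) * Z) * dot X b + (- (2 / amin) * Z) ^+ 2 * dot b b).
    by rewrite mulr_ge0// divr_ge0// ltW.
  rewrite (_ : amin / 4 * _ = amin / 4 * dot X X - Z * dot b X + Z ^+ 2 * dot b b / amin); last first.
    by rewrite (dotC X b); field; rewrite gt_eqF.
  have : Z ^+ 2 * dot b b / amin <= beta / amin * Z ^+ 2.
    by rewrite [beta / amin * _]mulrAC ler_wpM2r ?invr_ge0 ?(ltW am0)// [beta * _]mulrC.
  by move=> h1 h2; lra.
have B2' : 2 * (Z * dot b Y) <= dot Y Y + beta * Z ^+ 2.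
  by move: B2; rewrite sqrrN (dotC Y b) => B2; lra.
have p1 : 0 <= (2 * amax + 1) * Z ^+ 2 by rewrite mulr_ge0// addr_ge0// mulr_ge0.
have p2 : 0 <= (beta / amin + beta) * dot Y Y.
  by rewrite mulr_ge0// addr_ge0// divr_ge0// ltW.
lra.
Qed.

(** [form_nonpositive] with the nonnegative cutoff $\eta^2$, combined with [energy_pointwise]. The
    constant depends neither on [U] nor on the number of functions combined. *)
Lemma caccioppoli amin amax eps : (1 < d)%N -> 0 < @unit_vol R d -> admissible_data P amin amax -> 0 < eps ->
  (forall y, Om y -> cone_at Om eps y) ->
  exists2 C : R, 0 <= C & forall (U : set 'rV[R]_d) (I : finType) (c : I -> R) (phi : I -> 'rV[R]_d -> R)
    (eta : 'rV[R]_d -> R), open U -> (forall k, HB P (U `&` Om) (phi k)) -> test_function U eta ->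
  let u x := \sum_k c k * phi k x in let g x := \sum_k c k *: grad (U `&` Om) (phi k) x in
  let de x := \row_i partial i eta x in
  (\int[mu]_(x in U `&` Om) (eta x ^+ 2 * dot (g x) (g x)) <=
   C * \int[mu]_(x in U `&` Om) (u x ^+ 2 * (dot (de x) (de x) + eta x ^+ 2)) : Prop).
Proof.
move=> d1 v0 adm e0 Hc; have [A' [b' [M [M0 mA mb [AM bM] AE]]]] := coefficients adm.
have [[oO _ _ bO _] _ _ [am0 ax0 _ As El]] := adm.
pose beta := d%:R * M ^+ 2; pose K := 2 * amax + 1 + beta / amin + beta.
have beta0 : 0 <= beta by rewrite mulr_ge0// sqr_ge0.
have K0 : 0 <= K by rewrite !addr_ge0// ?mulr_ge0 ?divr_ge0 ?invr_ge0// ltW.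
exists (4 / amin * K); first by rewrite mulr_ge0// divr_ge0// ltW.
move=> U I c phi eta oU HBphi tU u g de.
have oW : open (U `&` Om) by exact: openI.
have mW := leb_open oW; set ws := U `&` Om in oW mW *.
have WO : ws `<=` Om by exact: subIsetr.
have mO := leb_open oO.
have [t2 dE] := test_function_sqr tU.
have S k : sobolev ws (phi k) (grad ws (phi k)) by apply: H1_sobolev => //; case: (HBphi k) => -[].
have su : sqint mu ws u by apply: sqint_sum => // k; apply: sqintZ => //; case: (S k).
have sg i : sqint mu ws (fun x => g x 0 i).
  have -> : (fun x => g x 0 i) = fun x => \sum_k c k * grad ws (phi k) x 0 i.
    by apply/funext => x; rewrite /g summxE; apply: eq_bigr => k _; rewrite mxE.
  by apply: sqint_sum => // k; apply: sqintZ => //; case: (S k).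
have [Me Me0 HMe] := test_function_bounded tU.
have meta : lmfun ws eta by exact: test_function_measurable tU.
have sX i : sqint mu ws (fun x => eta x * g x 0 i).
  by apply: (sqint_mul_bounded (M := Me) mW (sg i) meta) => x _; exact: HMe.
have sY i : sqint mu ws (fun x => partial i eta x * u x).
  have tp := test_function_partial i tU; have [N N0 HN] := test_function_bounded tp.
  by apply: (sqint_mul_bounded (M := N) mW su) => [|x _]; [exact: test_function_measurable tp|exact: HN].
have sZ : sqint mu ws (fun x => eta x * u x).
  by apply: (sqint_mul_bounded (M := Me) mW su meta) => x _; exact: HMe.
have sub i j : lmfun ws (fun x => A' x i j) by exact: measurable_funS mO WO (mA i j).
have subb i : lmfun ws (fun x => b' x 0 i) by exact: measurable_funS mO WO (mb i).
have AW : {ae mu, forall x, ws x -> Amat P x = A' x /\ bvec P x = b' x}.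
  by apply: aeS AE => x Hx wx; exact: Hx (WO _ wx).
have [rF F0] := @form_nonpositive R d P amin amax eps U I c phi (fun x => eta x ^+ 2) d1 v0 adm e0 Hc oU HBphi t2
  (fun x => sqr_ge0 (eta x)) A' b' M sub AM subb bM AW.
set F := (fun x => _ - _) in rF F0.
have rX : rint mu ws (fun x => eta x ^+ 2 * dot (g x) (g x)).
  have -> : (fun x => eta x ^+ 2 * dot (g x) (g x)) = fun x => \sum_i (eta x * g x 0 i) * (eta x * g x 0 i).
    by apply/funext => x; rewrite /dot mulr_sumr; apply: eq_bigr => i _; ring.
  by apply: rint_sum => // i; exact: sqint_rint.
have rY : rint mu ws (fun x => u x ^+ 2 * (dot (de x) (de x) + eta x ^+ 2)).
  have -> : (fun x => u x ^+ 2 * (dot (de x) (de x) + eta x ^+ 2)) =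
      fun x => \sum_i (partial i eta x * u x) * (partial i eta x * u x) + (eta x * u x) * (eta x * u x).
    apply/funext => x; rewrite mulrDr /dot mulr_sumr; congr (_ + _); last by ring.
    by apply: eq_bigr => i _; rewrite !mxE; ring.
  by apply: rintD => //; [apply: rint_sum => // i|]; exact: sqint_rint.
have pt : {ae mu, forall x, ws x -> amin / 4 * (eta x ^+ 2 * dot (g x) (g x)) <=
    F x + K * (u x ^+ 2 * (dot (de x) (de x) + eta x ^+ 2))}.
  apply: aeS AW => x Hx wx; have [EA Eb] := Hx wx; have Ox := WO _ wx.
  have El' xi : amin * dot xi xi <= dot (app (Amat P x) xi) xi <= amax * dot xi xi.
    by have := El x xi Ox; rewrite sqr_enorm.
  have bb : dot (bvec P x) (bvec P x) <= beta.
    rewrite Eb /beta mulr_natl -[X in _ *+ X]card_ord -sumr_const; apply: ler_sum => i _.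
    by rewrite -expr2 -real_normK ?num_real// ler_sqr ?nnegrE.
  have := energy_pointwise (eta x *: g x) (u x *: de x) (eta x * u x) am0 (ltW ax0) (As x Ox) El' bb.
  have -> : dot (eta x *: g x) (eta x *: g x) = eta x ^+ 2 * dot (g x) (g x).
    by rewrite dotZl dotZr mulrA expr2.
  move=> /le_trans; apply; rewrite -/K le_eqVlt; apply/orP; left; apply/eqP; congr (_ + _ * _).
    rewrite /F EA Eb (dE x) -/(de x) -/(u x) -/(g x).
    have -> : eta x ^+ 2 *: g x + u x *: ((2 * eta x) *: de x) = eta x *: (eta x *: g x + 2 *: (u x *: de x)).
      by apply/rowP => i; rewrite !mxE; ring.
    have -> : app (A' x) (eta x *: g x) = eta x *: app (A' x) (g x) by rewrite /app scalemxAl.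
    by rewrite !dotZl !dotZr; ring.
  by rewrite dotZl dotZr; ring.
have := ae_le_Rintegral mW (rintZ _ mW rX) (rintD mW rF (rintZ _ mW rY)) pt.
rewrite RintegralD//; last exact: rintZ.
rewrite (RintegralZl _ mW rX) (RintegralZl _ mW rY); set IX := Rintegral _ _ _; set IY := \int[mu]_(x in ws) (u x ^+ 2 * _) => H.
have {}H : amin / 4 * IX <= K * IY by apply: le_trans H _; rewrite gerDr.
have -> : 4 / amin * K * IY = (amin / 4)^-1 * (K * IY) by field; rewrite gt_eqF.
by rewrite ler_pdivlMl ?divr_gt0.
Qed.

End Energy.

(** * Cubes and decay across layers *)

Section Cutoffs.
Context {R : realType} {d : nat}.
Implicit Types (x y c : 'rV[R]_d) (W : set 'rV[R]_d).

Lemma flat0_lipschitz (s t : R) : `|flat 0 s - flat 0 t| <= 6 * `|s - t|.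
Proof.
have D (r : R) : is_derive r 1 (flat 0 : R -> R) (flat 2 r).
  by have := is_derive_flat 0 r; rewrite mul0r subr0.
(* The 6 is $3!$ from [flat_le] on the unit interval; beyond 1 both factors of [flat 2] are at most
   1. *)
have B (r : R) : `|flat 2 r| <= 6.
  rewrite ger0_norm ?flat_ge0//; have [r1|r1] := leP `|r| 1.
    by apply: le_trans (flat_le 2 0 r) _; rewrite expr1 -[leRHS]mulr1 ler_wpM2l.
  rewrite /flat; case: ifPn => // r0; rewrite gtr0_norm// in r1.
  apply: (@le_trans _ _ 1); last by rewrite ler1n.
  rewrite -[leRHS]mulr1; apply: ler_pM; rewrite ?expR_ge0 ?exprn_ge0 ?invr_ge0 ?(ltW r0)//.
    by apply: exprn_ile1; rewrite ?invr_ge0 ?(ltW r0)// invf_le1// ltW.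
  by rewrite expR_le1 oppr_le0 invr_ge0 ltW.
have [z [_ ->]] := MVT_between t s D.
by rewrite normrM ler_wpM2r.
Qed.

Lemma prod_lipschitz (I : Type) (r : seq I) (f g : I -> R) :
  (forall i, 0 <= f i <= 1) -> (forall i, 0 <= g i <= 1) ->
  `|\prod_(i <- r) f i - \prod_(i <- r) g i| <= \sum_(i <- r) `|f i - g i|.
Proof.
move=> f01 g01; elim: r => [|i r IH]; first by rewrite !big_nil subrr normr0.
rewrite !big_cons.
have p01 (h : I -> R) : (forall i, 0 <= h i <= 1) -> `|\prod_(i <- r) h i| <= 1.
  move=> h01; rewrite normr_prod; apply: prodr_ile1 => j _; rewrite normr_ge0/=.
  by case/andP: (h01 j) => h0 h1; rewrite ger0_norm.
set F := \prod_(_ <- _) _ in IH *; set G := \prod_(_ <- _) _ in IH *.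
rewrite (_ : f i * F - g i * G = (f i - g i) * F + g i * (F - G)); last by ring.
apply: le_trans (ler_normD _ _) _; rewrite !normrM; apply: lerD.
  by rewrite -[leRHS]mulr1 ler_wpM2l// p01.
apply: le_trans IH; rewrite ler_piMl//.
by case/andP: (g01 i) => g0 g1; rewrite ger0_norm.
Qed.

Lemma partial_lipschitz (f : 'rV[R]_d -> R) (L : R) i x : derivable f x (delta_mx 0 i) -> 0 <= L ->
  (forall x y, `|f x - f y| <= L * `|x - y|) -> `|partial i f x| <= L.
Proof.
move=> df L0 HL; rewrite /partial /derive.
have bd : \forall h \near (0 : R)^', `|h^-1 *: (f (h *: delta_mx 0 i + x) - f x)| <= L.
  near=> h; have h0 : h != 0 by near: h; exact: nbhs_dnbhs_neq.
  rewrite normrZ normfV ler_pdivrMl ?normr_gt0//; apply: le_trans (HL _ _) _.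
  rewrite addrK normrZ mulrC ler_wpM2r// -[leRHS]mulr1 ler_wpM2l//.
  by apply: row_norm_le => // j; rewrite mxE; case: (_ && _); rewrite ?normr1 ?normr0.
rewrite ler_norml; apply/andP; split.
  apply: limr_ge; first exact: df.
  by apply: filterS bd => h; rewrite ler_norml => /andP[].
apply: limr_le; first exact: df.
by apply: filterS bd => h; rewrite ler_norml => /andP[].
Unshelve. all: by end_near. Qed.

Section Cube.
Variables (Q : 'M[R]_d) (c : 'rV[R]_d).
Hypotheses (QQ : Q *m Q^T = 1%:M) (d0 : (0 < d)%N).
Let dp : 0 < d%:R :> R. Proof. by rewrite ltr0n. Qed.

Definition cube_coord x i : R := ((x - c) *m Q) 0 i.

Lemma enorm_rotate x : enorm (x *m Q) = enorm x.
Proof.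
have E (p : 'rV[R]_d) : dot p p = (p *m p^T) 0 0.
  by rewrite /dot mxE; apply: eq_bigr => i _; rewrite [p^T _ _]mxE.
by rewrite /enorm !E trmx_mul mulmxA -(mulmxA x) QQ mulmx1.
Qed.

Lemma coord_lipschitz x y i : `|cube_coord x i - cube_coord y i| <= d%:R * `|x - y|.
Proof.
rewrite /cube_coord (_ : _ - _ = ((x - y) *m Q) 0 i); last first.
  by rewrite -[LHS]mulr1 mulr1 (_ : x - y = (x - c) - (y - c)) ?mulmxBl ?mxE//; apply/rowP => j; rewrite !mxE; ring.
by apply: le_trans (coord_enorm _ _) _; rewrite enorm_rotate enorm_le.
Qed.

Lemma cube_near (s r : R) x y : d%:R * r <= s / 2 -> `|y - x| < r ->
  forall a, (forall i, `|cube_coord x i| < a / 2) -> cube Q c (a + s) y.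
Proof.
move=> drs xy a Hx i; rewrite -/(cube_coord y i) -(subrK (cube_coord x i) (cube_coord y i)).
apply: le_lt_trans (ler_normD _ _) _; rewrite addrC mulrDl; apply: ltr_leD; first exact: Hx.
by apply: le_trans (coord_lipschitz _ _ _) _; apply: le_trans drs; rewrite ler_wpM2l// ltW.
Qed.

Lemma coord_affine x i : cube_coord x i = affine (\row_j Q j i) (- (c *m Q) 0 i) x.
Proof.
rewrite /cube_coord mulmxBl [LHS]mxE [X in _ + X]mxE; congr (_ + _).
by rewrite /dot mxE; apply: eq_bigr => j _; rewrite mxE mulrC.
Qed.

Lemma coord_continuous i : continuous (fun x => cube_coord x i).
Proof.
move=> x; rewrite (_ : (fun x => _) = affine (\row_j Q j i) (- (c *m Q) 0 i)); last first.
  by apply/funext => y; exact: coord_affine.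
exact: differentiable_continuous (differentiable_affine _ _ _).
Qed.

Lemma open_cube (s : R) : open (cube Q c s).
Proof.
rewrite openE => x Hx; suff : \forall y \near x, forall i, `|cube_coord y i| < s / 2 by [].
apply: (@filter_forall _ _ (fun i => [set y | `|cube_coord y i| < s / 2]) (nbhs x)) => i.
have o : open [set y | `|cube_coord y i| < s / 2].
  apply: (@open_comp _ _ (fun y => `|cube_coord y i|) [set t : R | t < s / 2]); last exact: open_lt.
  by move=> y _; apply: continuous_comp; [exact: coord_continuous|exact: norm_continuous].
exact: open_nbhs_nbhs (conj o (Hx i : [set y | `|cube_coord y i| < s / 2] x)).
Qed.

Lemma closed_cube (s : R) : closed [set x | forall i, `|cube_coord x i| <= s / 2].
Proof.
rewrite (_ : [set x | _] = \bigcap_i [set x | `|cube_coord x i| <= s / 2]).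
  apply: closed_bigI => i _.
  apply: (@closed_comp _ _ (fun x => `|cube_coord x i|) [set t : R | t <= s / 2]); last exact: closed_le.
  by move=> y _; apply: continuous_comp; [exact: coord_continuous|exact: norm_continuous].
by apply/seteqP; split=> [x H i _|x H i]; [exact: H|exact: (H i I)].
Qed.

Lemma coord_norm x (s : R) : 0 <= s -> (forall i, `|cube_coord x i| <= s / 2) -> `|x - c| <= d%:R * (s / 2).
Proof.
move=> s0 H; apply: le_trans (norm_enorm _) _; rewrite -enorm_rotate; apply: le_trans (enorm_le _) _.
by rewrite ler_wpM2l//; apply: row_norm_le => //; rewrite divr_ge0.
Qed.

Lemma compact_cube (s : R) : 0 <= s -> compact [set x | forall i, `|cube_coord x i| <= s / 2].
Proof.
move=> s0; have r0 : 0 < d%:R * (s / 2) + 1 by rewrite ltr_wpDl// mulr_ge0// divr_ge0.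
have cb : compact (closed_ball c (d%:R * (s / 2) + 1)) by exact: closed_ball_compact.
apply: (@subclosed_compact _ _ _ (@closed_cube s) cb).
move=> x Hx; apply: subset_closed_ball; rewrite -ball_normE /= distrC.
by apply: le_lt_trans (coord_norm s0 Hx) _; rewrite ltrDl.
Qed.

(** Vanishes for [cube_coord] of modulus at least [a] and is at least $e^{-2}$ once the modulus is
    at most [a - e]. It never reaches 1, so the cutoff is bounded below by $e^{-2d}$ instead of
    being 1 on the inner cube. *)
Definition ramp (a e : R) x i : R := flat 0 ((a - cube_coord x i) / e) * flat 0 ((a + cube_coord x i) / e).

Lemma ramp01 a e x i : 0 <= ramp a e x i <= 1.
Proof.
by rewrite /ramp mulr_ge0 ?flat_ge0//= -[leRHS]mulr1 ler_pM ?flat_ge0 ?flat0_le1.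
Qed.

Lemma cube_cutoff (s e : R) U : 0 < e -> 2 * e <= s -> open U ->
  [set x | forall i, `|cube_coord x i| <= s / 2] `<=` U ->
  exists eta : 'rV[R]_d -> R, [/\ test_function U eta, forall x, 0 <= eta x <= 1,
   forall x, (exists i, s / 2 < `|cube_coord x i|) -> eta x = 0 /\ forall i, partial i eta x = 0,
   forall x, (forall i, `|cube_coord x i| <= s / 2 - e) -> expR (- (2 * d%:R)) <= eta x &
   forall x i, `|partial i eta x| <= 12 * d%:R ^+ 2 / e].
Proof.
move=> e0 es oU KU; pose a := s / 2; pose eta x := \prod_(i < d) ramp a e x i.
have smR i : smooth (fun x => ramp a e x i).
  apply: smoothM.
    rewrite (_ : (fun x => _) = fun x => flat 0 (affine (- e^-1 *: \row_j Q j i) ((a + (c *m Q) 0 i) / e) x)).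
      exact: smooth_flat.
    apply/funext => x; rewrite coord_affine /affine dotZl; congr (flat 0 _); field; exact: lt0r_neq0.
  rewrite (_ : (fun x => _) = fun x => flat 0 (affine (e^-1 *: \row_j Q j i) ((a - (c *m Q) 0 i) / e) x)).
    exact: smooth_flat.
  apply/funext => x; rewrite coord_affine /affine dotZl; congr (flat 0 _); field; exact: lt0r_neq0.
have sm : smooth eta by exact: smooth_prod.
have zero x i : a < `|cube_coord x i| -> eta x = 0.
  move=> Hx; rewrite /eta (bigD1 i)//= /ramp.
  have f0 t : t <= 0 -> flat 0 (t / e) = 0 by move=> t0; rewrite /flat ltNge mulr_le0_ge0// invr_ge0 ltW.
  have [c0|c0] := leP 0 (cube_coord x i).
    by rewrite f0 ?mul0r// subr_le0 ltW// -[cube_coord x i]ger0_norm.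
  rewrite (f0 (a + cube_coord x i)) ?mulr0 ?mul0r//.
  by move: Hx; rewrite ltr0_norm// => Hx; lra.
(* Each factor [flat 0] has Lipschitz constant $6d/e$ in [x], with two factors per coordinate and
   [d] coordinates. *)
have lip x y : `|eta x - eta y| <= 12 * d%:R ^+ 2 / e * `|x - y|.
  apply: le_trans (prod_lipschitz _ (ramp01 a e x) (ramp01 a e y)) _.
  apply: (@le_trans _ _ (\sum_(i < d) (12 * d%:R / e * `|x - y|))); last first.
    rewrite sumr_const card_ord -mulr_natl le_eqVlt; apply/orP; left; apply/eqP; ring.
  apply: ler_sum => i _; have Lc := coord_lipschitz x y i.
  have Le : `|cube_coord x i - cube_coord y i| / e <= d%:R / e * `|x - y|.
    by rewrite [d%:R / e * _]mulrAC ler_wpM2r ?invr_ge0 ?(ltW e0).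
  have step t1 t2 : `|t1 - t2| = `|cube_coord x i - cube_coord y i| -> `|flat 0 (t1 / e) - flat 0 (t2 / e)| <= 6 * (d%:R / e * `|x - y|).
    move=> tt; apply: le_trans (flat0_lipschitz _ _) _; rewrite ler_wpM2l// -mulrBl normrM tt normfV (gtr0_norm e0).
    exact: Le.
  have S1 := step (a - cube_coord x i) (a - cube_coord y i).
  have S2 := step (a + cube_coord x i) (a + cube_coord y i).
  rewrite /ramp; set p := flat 0 _ in S1 *; set q := flat 0 _ in S2 *.
  set p' := flat 0 _ in S1 *; set q' := flat 0 _ in S2 *.
  have {}S1 : `|p - p'| <= 6 * (d%:R / e * `|x - y|).
    by apply: S1; rewrite [RHS]distrC; congr (`|_|); ring.
  have {}S2 : `|q - q'| <= 6 * (d%:R / e * `|x - y|).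
    by apply: S2; congr (`|_|); ring.
  rewrite (_ : p * q - p' * q' = (p - p') * q + p' * (q - q')); last by ring.
  apply: le_trans (ler_normD _ _) _; rewrite !normrM.
  have q1 : `|q| <= 1 by rewrite ger0_norm ?flat_ge0 ?flat0_le1.
  have p1 : `|p'| <= 1 by rewrite ger0_norm ?flat_ge0 ?flat0_le1.
  have h1 : `|p - p'| * `|q| <= `|p - p'| by rewrite -[leRHS]mulr1 ler_wpM2l.
  have h2 : `|p'| * `|q - q'| <= `|q - q'| by rewrite ler_piMl.
  rewrite (_ : 12 * d%:R / e * `|x - y| = 6 * (d%:R / e * `|x - y|) + 6 * (d%:R / e * `|x - y|)); last by ring.
  exact: lerD (le_trans h1 S1) (le_trans h2 S2).
have s0 : 0 <= s by apply: le_trans es; rewrite mulr_ge0// ltW.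
exists eta; split.
- split=> //; exists [set x | forall i, `|cube_coord x i| <= s / 2]; split=> //; first exact: compact_cube.
  move=> x nx; have [i] : exists i, a < `|cube_coord x i|; last exact: zero.
  by apply: contrapT => H; apply: nx => i; rewrite leNgt; apply/negP => Hi; apply: H; exists i.
- move=> x; rewrite /eta prodr_ge0/=; last by move=> i _; case/andP: (ramp01 a e x i).
  by apply: prodr_ile1 => i _; exact: ramp01.
- move=> x [i Hi]; split; first exact: zero Hi.
  move=> j; rewrite /partial.
  have nx : \forall y \near x, eta y = 0.
    have o : open [set y | a < `|cube_coord y i|].
      apply: (@open_comp _ _ (fun x => `|cube_coord x i|) [set t : R | a < t]); last exact: open_gt.
      by move=> y _; apply: continuous_comp; [exact: coord_continuous|exact: norm_continuous].
    have := open_nbhs_nbhs (conj o (Hi : [set y | a < `|cube_coord y i|] x)).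
    by apply: filterS => y; exact: zero.
  by rewrite (near_eq_derive _ nx) derive_cst.
- move=> x Hx; rewrite (_ : expR _ = \prod_(i < d) expR (- 2)); last first.
    by rewrite prodr_const card_ord -expRM_natl mulrN mulrC.
  apply: ler_prod => i _; rewrite expR_ge0 /=.
  have f1 (t : R) : 1 <= t -> expR (- 1) <= flat 0 t :> R.
    move=> t1; rewrite /flat (lt_le_trans ltr01 t1) expr0 mul1r ler_expR lerN2 invf_le1//.
    exact: lt_le_trans t1.
  have := Hx i; rewrite ler_norml => /andP[h1 h2].
  rewrite (_ : - 2 = - 1 + - 1 :> R) ?expRD; last by ring.
  by apply: ler_pM; rewrite ?expR_ge0//; apply: f1; rewrite ler_pdivlMr// mul1r /a; lra.
- move=> x i; apply: partial_lipschitz lip => //.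
    by apply: smooth_derivable.
  by rewrite divr_ge0 ?(ltW e0)// mulr_ge0// sqr_ge0.
Qed.

End Cube.
End Cutoffs.

(** * Decay of the energy across the layers *)

Section Decay.
Context {R : realType} {d : nat} (P : pde_data R d).
Implicit Types (x y : 'rV[R]_d) (u : 'rV[R]_d -> R) (g : 'rV[R]_d -> 'rV[R]_d).
Local Notation mu := (leb R d).
Local Notation lmeas A := (measurable (A : set (leb_space R d))).
Local Notation lmfun W f := (measurable_fun (W : set (leb_space R d)) (f : leb_space R d -> _)).
Local Notation Om := (Omega P).

Lemma small_scale (X a b : R) : 0 <= X -> 0 < a -> 0 < b ->
  exists2 t : R, 0 < t & [/\ t <= a, t <= b & X * t ^+ 2 <= expR (- 2)].
Proof.
move=> X0 a0 b0; have e0 := expR_gt0 (- 1 : R).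
have X1 : 0 < 1 + X by rewrite ltr_pwDl.
pose t0 := expR (- 1) / (1 + X); have t00 : 0 < t0 by exact: divr_gt0.
exists (Num.min t0 (Num.min a b)); first by rewrite !lt_min t00 a0.
set t := Num.min _ _; have t1 : t <= t0 by rewrite ge_min lexx.
have tp : 0 < t by rewrite !lt_min t00 a0.
split; [by rewrite !ge_min lexx orbT|by rewrite !ge_min lexx !orbT|].
apply: (@le_trans _ _ (X * t0 ^+ 2)); first by rewrite ler_wpM2l// ler_sqr ?nnegrE ?(ltW tp) ?(ltW t00).
have -> : expR (- 2) = expR (- 1) ^+ 2 :> R by rewrite -expRM_natl; congr expR; ring.
rewrite /t0 expr_div_n mulrCA -[leRHS]mulr1 ler_wpM2l ?sqr_ge0//.
by rewrite ler_pdivrMr ?exprn_gt0// mul1r; nra.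
Qed.

Section Layers.
Variables (amin amax eps : R) (Q : 'M[R]_d) (c : 'rV[R]_d) (h hs : R).
Hypotheses (d1 : (1 < d)%N) (v0 : 0 < @unit_vol R d) (adm : admissible_data P amin amax) (e0 : 0 < eps)
  (Hc : forall y, Om y -> cone_at Om eps y) (QQ : Q *m Q^T = 1%:M) (h0 : 0 < h) (hhs : 0 < hs - h).
Local Notation V s := (cube Q c s `&` Om).
Let ws := V hs.

Let oO : open Om. Proof. by case: adm => -[]. Qed.
Let bO : bounded_set Om. Proof. by case: adm => -[]. Qed.
Let d0 : (0 < d)%N. Proof. exact: ltnW. Qed.
Let fO : (mu Om < +oo)%E. Proof. exact: leb_bounded. Qed.
Let dp : 0 < d%:R :> R. Proof. by rewrite ltr0n. Qed.
Let oV s : open (V s).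
Proof. by apply: openI => //; exact: open_cube. Qed.
Let hs0 : 0 < hs. Proof. by apply: lt_trans h0 _; rewrite -subr_gt0. Qed.

Lemma cube_le (s t : R) : s <= t -> cube Q c s `<=` cube Q c t.
Proof. by move=> st x Hx i; apply: lt_le_trans (Hx i) _; rewrite ler_pM2r. Qed.

Let VS s t : s <= t -> V s `<=` V t.
Proof. by move=> st x [/(cube_le st) xt Ox]. Qed.

Section Family.
Variables (I : finType) (a : I -> R) (phi : I -> 'rV[R]_d -> R).
Hypothesis HBphi : forall k, HB P ws (phi k).
Let u x := \sum_k a k * phi k x.
Let g x := \sum_k a k *: grad ws (phi k) x.
Let D s := \int[mu]_(x in V s) dot (g x) (g x).
Let E s := \int[mu]_(x in V s) (u x ^+ 2).

Lemma sobolev_family : sobolev ws u g.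
Proof.
apply: sobolev_sum => [|k _]; first exact: leb_open (@oV hs).
by apply: (H1_sobolev (@oV hs)); case: (HBphi k) => -[].
Qed.

Let SV s : s <= hs -> sobolev (V s) u g.
Proof. by move=> sh; exact: sobolevS (@oV s) (leb_open (@oV hs)) (VS sh) sobolev_family. Qed.

Let E_ge0 s : 0 <= E s. Proof. by apply: Rintegral_ge0 => x _; exact: sqr_ge0. Qed.

(** The cutoff lives on the cube of side [s - tau / 2] and has a transition of width [tau / 4] on
    each side, so it is bounded below on the cube of side [s - tau]. The right side stops at
    [s - tau / 4], which leaves room for the grid estimate inside the same layer. *)
Lemma caccioppoli_layer (C tau s : R) : 0 <= C -> 0 < tau -> tau <= s -> s <= hs ->
  (forall eta, test_function (cube Q c hs) eta ->
    \int[mu]_(x in ws) (eta x ^+ 2 * dot (g x) (g x)) <=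
     C * \int[mu]_(x in ws) (u x ^+ 2 * (dot (\row_i partial i eta x) (\row_i partial i eta x) + eta x ^+ 2))) ->
  D (s - tau) <= expR (4 * d%:R) * C * ((d%:R * (48 * d%:R ^+ 2) ^+ 2 + hs ^+ 2) / tau ^+ 2) * E (s - tau / 4).
Proof.
move=> C0 tau0 taus shs Hcacc.
have tau4 : 0 < tau / 4 by rewrite divr_gt0.
have mW := leb_open (@oV hs); have [su sg _] := sobolev_family.
have KU : [set x | forall i, `|cube_coord Q c x i| <= (s - tau / 2) / 2] `<=` cube Q c hs.
  by move=> x Hx i; apply: le_lt_trans (Hx i) _; rewrite ltr_pM2r//; lra.
have [|eta [tU eta01 eta_out eta_in deta]] := cube_cutoff QQ (s := s - tau / 2) tau4 _ (@open_cube R d Q c hs) KU.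
  by lra.
have rd : rint mu ws (fun x => dot (g x) (g x)) by exact: sqint_dot_self.
have meta : lmfun ws eta by exact: test_function_measurable tU.
have eta1 x : `|eta x ^+ 2| <= 1.
  by case/andP: (eta01 x) => n0 n1; rewrite ger0_norm ?sqr_ge0// exprn_ile1.
have meta2 : lmfun ws (fun x => eta x ^+ 2) by exact: measurable_sqr.
have reta : rint mu ws (fun x => eta x ^+ 2 * dot (g x) (g x)).
  by apply: (rint_mul_bounded (M := 1) mW rd meta2) => x _; exact: eta1.
have sub1 : s - tau <= hs by lra.
have mV1 := leb_open (@oV (s - tau)).
have L1 : expR (- (4 * d%:R)) * D (s - tau) <= \int[mu]_(x in ws) (eta x ^+ 2 * dot (g x) (g x)).
  have rd1 : rint mu (V (s - tau)) (fun x => dot (g x) (g x)).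
    by apply: rintS rd => //; exact: VS.
  rewrite /D -(RintegralZl _ mV1 rd1); apply: (@le_trans _ _ (\int[mu]_(x in V (s - tau)) (eta x ^+ 2 * dot (g x) (g x)))).
    apply: le_Rintegral => //; [exact: rintZ|by apply: rintS reta => //; exact: VS|].
    move=> x [Hx _]; rewrite ler_wpM2r ?dot_ge0//.
    have ex : expR (- (2 * d%:R)) <= eta x.
      apply: eta_in => i; apply: ltW; have := Hx i; rewrite -/(cube_coord Q c x i) => Hi; lra.
    have -> : expR (- (4 * d%:R)) = expR (- (2 * d%:R)) ^+ 2 :> R by rewrite -expRM_natl; congr expR; ring.
    by rewrite ler_sqr ?nnegrE ?expR_ge0//; case/andP: (eta01 x).
  apply: subset_Rintegral => //; first exact: VS.
  by move=> x _; rewrite mulr_ge0 ?sqr_ge0 ?dot_ge0.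
pose K := d%:R * (12 * d%:R ^+ 2 / (tau / 4)) ^+ 2 + 1.
have K0 : 0 <= K by rewrite addr_ge0// mulr_ge0// sqr_ge0.
have sub2 : s - tau / 4 <= hs by lra.
have mV2 := leb_open (@oV (s - tau / 4)).
have ru := sqint_sq su.
have ru2 : rint mu (V (s - tau / 4)) (fun x => u x ^+ 2) by apply: rintS ru => //; exact: VS.
pose q x := dot (\row_i partial i eta x) (\row_i partial i eta x) + eta x ^+ 2.
have q0 x : 0 <= q x by rewrite addr_ge0 ?dot_ge0 ?sqr_ge0.
have qK x : q x <= K.
  apply: lerD; last by have := eta1 x; rewrite ger0_norm ?sqr_ge0.
  rewrite mulr_natl -[X in _ *+ X]card_ord -sumr_const; apply: ler_sum => i _.
  rewrite mxE -expr2 -real_normK ?num_real// ler_sqr ?nnegrE//.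
  by apply: le_trans (normr_ge0 _) (deta x i).
have qout x : ~ V (s - tau / 4) x -> ws x -> q x = 0.
  move=> nV [_ Ox]; have [i Hi] : exists i, (s - tau / 2) / 2 < `|cube_coord Q c x i|.
    apply: contrapT => H; apply: nV; split=> // i; rewrite -/(cube_coord Q c x i).
    rewrite ltNge; apply/negP => Hi; apply: H; exists i; lra.
  have [z0 z1] := eta_out x (ex_intro _ i Hi).
  by rewrite /q z0 expr0n addr0 /dot big1// => j _; rewrite mxE z1 mul0r.
have mp i : lmfun ws (fun x => (\row_i partial i eta x) 0 i).
  rewrite (_ : (fun x => _) = partial i eta); last by apply/funext => x; rewrite mxE.
  exact: test_function_measurable (test_function_partial i tU).
have mq : lmfun ws q := measurable_funD (measurable_dot mp mp) meta2.
have rq : rint mu ws (fun x => u x ^+ 2 * q x).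
  rewrite (_ : (fun x => _) = fun x => q x * u x ^+ 2); last by apply/funext => x; rewrite mulrC.
  by apply: (rint_mul_bounded (M := K) mW ru mq) => x _; rewrite ger0_norm.
have L2 : \int[mu]_(x in ws) (u x ^+ 2 * q x) <= K * E (s - tau / 4).
  rewrite /E -(RintegralZl _ mV2 ru2).
  apply: (@le_trans _ _ (\int[mu]_(x in ws) (\1_(V (s - tau / 4)) x * (K * u x ^+ 2)))).
    apply: le_Rintegral => //.
      apply: (rint_mul_bounded (M := 1) mW (rintZ K mW ru)); first exact: measurable_indic.
      by move=> x _; rewrite indicE; case: (_ \in _); rewrite ?normr1 ?normr0.
    move=> x wx; rewrite indicE; have [xV|/negP nV] := boolP (x \in _).
      by rewrite mul1r mulrC ler_wpM2r ?sqr_ge0.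
    by rewrite mul0r qout ?mulr0// => H; apply: nV; exact/mem_set.
  by rewrite Rintegral_indic// (setIidr (VS sub2)).
(* The zero-order term 1 is at most [hs ^+ 2 / tau ^+ 2]; thus the whole constant carries the factor
   [tau ^- 2] that the square of [rho] has to cancel. The 48 is 12 divided by the quarter in the
   transition width. *)
have KE : K <= (d%:R * (48 * d%:R ^+ 2) ^+ 2 + hs ^+ 2) / tau ^+ 2.
  rewrite ler_pdivlMr ?exprn_gt0// /K mulrDl mul1r; apply: lerD.
    by rewrite le_eqVlt; apply/orP; left; apply/eqP; field; rewrite gt_eqF.
  by rewrite ler_sqr ?nnegrE ?(ltW tau0) ?(ltW hs0)//; exact: le_trans shs.
have := le_trans L1 (Hcacc eta tU).
rewrite -/(q _) => L3.
have {}L3 : D (s - tau) <= expR (4 * d%:R) * (C * \int[mu]_(x in ws) (u x ^+ 2 * q x)).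
  by rewrite -[expR (4 * d%:R)]invrK -expRN ler_pdivlMl ?expR_gt0.
apply: le_trans L3 _; rewrite -!mulrA ler_wpM2l ?expR_ge0// ler_wpM2l//.
by apply: le_trans L2 _; rewrite mulrA ler_wpM2r.
Qed.

End Family.

(** The ratio [t] of [rho] to [tau] does not depend on [m]: Caccioppoli and the grid estimate
    combine to the factor $X t^2$, and the number of grid points per direction grows linearly in
    [m.+1]. *)
Lemma layer_decay : exists (C2 : nat) (C : R), 0 < C /\ forall m : nat,
  exists B : @grid_index d (C2 * m.+1) -> set 'rV[R]_d, (forall k, open (B k)) /\
  forall (I : finType) (a : I -> R) (phi : I -> 'rV[R]_d -> R), (forall k, HB P ws (phi k)) ->
   (forall k, \int[mu]_(x in B k `&` ws) (\sum_j a j * phi j x) = 0) ->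
  let g x := \sum_k a k *: grad ws (phi k) x in
  exists2 s : R, h < s <= hs &
  (\int[mu]_(x in V s) ((\sum_k a k * phi k x) ^+ 2) + \int[mu]_(x in V s) dot (g x) (g x) <=
   C * expR (- 2) ^+ m * \int[mu]_(x in ws) dot (g x) (g x) : Prop).
Proof.
have [Cc Cc0 HCc] := caccioppoli d1 v0 adm e0 Hc.
pose T := (Num.truncn (2 / eps)).+1.
have eT : 2 / eps <= T%:R by exact: ltW (truncnS_gt _).
pose G := @grid_const R d T.
have G0 : 0 <= G.
  apply: mulr_ge0; last exact: exprn_ge0.
  have g1 : 0 <= d%:R ^+ 2 * 2 / 3 :> R by apply: divr_ge0 => //; apply: mulr_ge0 => //; exact: sqr_ge0.
  have g2 : 0 <= d%:R * T%:R ^+ 2 :> R by apply: mulr_ge0 => //; exact: sqr_ge0.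
  by apply: addr_ge0; exact: mulr_ge0.
pose K1 := d%:R * (48 * d%:R ^+ 2) ^+ 2 + hs ^+ 2.
have K10 : 0 <= K1 by apply: addr_ge0; [apply: mulr_ge0|]; rewrite ?ler0n ?sqr_ge0.
pose X := expR (4 * d%:R) * Cc * K1 * G.
have X0 : 0 <= X by rewrite !mulr_ge0// expR_ge0.
have T20 : 0 < (T + 2)%:R :> R by rewrite ltr0n addn2.
(* The first bound fits the reach [(T + 2) * rho] of the grid estimate, times [d] for the rotated
   coordinates, into the gap of [tau / 8] on each side; the second gives [2 * rho < eps]; the third
   is the gain per layer. *)
have [t t0 [t1 t2 tX]] : exists2 t : R, 0 < t & [/\ t <= (8 * (d%:R * (T + 2)%:R))^-1,
    t <= eps / (4 * hs) & X * t ^+ 2 <= expR (- 2)].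
  by apply: small_scale => //; [rewrite invr_gt0 !mulr_gt0|rewrite divr_gt0// mulr_gt0].
(* A grid of [C2 * m.+1] steps of size [rho] in each direction reaches across the large cube, since
   [m.+1 * tau = hs - h]. *)
pose C2 := (Num.truncn (d%:R * (hs / 2) / (t * (hs - h)))).+1.
have HC2 : d%:R * (hs / 2) <= C2%:R * (t * (hs - h)).
  by rewrite -ler_pdivrMr ?mulr_gt0//; exact: ltW (truncnS_gt _).
exists C2, (1 + G * (t * hs) ^+ 2); split.
  by rewrite ltr_pwDl// mulr_ge0// sqr_ge0.
move=> m; have mp : 0 < m.+1%:R :> R by rewrite ltr0n.
have [tau tau0 mtau] : exists2 tau : R, 0 < tau & m.+1%:R * tau = hs - h.
  by exists ((hs - h) / m.+1%:R); [exact: divr_gt0|rewrite mulrC divfK// gt_eqF].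
have tauh : tau <= hs - h by rewrite -mtau ler_peMl ?(ltW tau0)// ler1n.
have tauhs : tau <= hs by apply: le_trans tauh _; rewrite gerBl ltW.
pose rho := t * tau; have rho0 : 0 < rho by exact: mulr_gt0.
have rhoe : 2 * rho < eps.
  apply: (@le_lt_trans _ _ (2 * (eps / (4 * hs) * hs))).
    by rewrite ler_wpM2l// /rho; apply: ler_pM => //; exact: ltW.
  by rewrite (_ : 2 * _ = eps / 2); [have := e0; lra|field; rewrite gt_eqF].
have [B [oB HB_]] := grid_estimate (C2 * m.+1) c d0 oO fO e0 Hc eT rho0 rhoe.
exists B; split=> // I a phi HBphi u0 g; set u := (fun x => \sum_j a j * phi j x) in u0 *.
pose D s := \int[mu]_(x in V s) dot (g x) (g x).
have S : sobolev ws u g := sobolev_family a HBphi.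
have SV s : s <= hs -> sobolev (V s) u g.
  by move=> sh; exact: sobolevS (@oV s) (leb_open (@oV hs)) (VS sh) S.
have D0 s : 0 <= D s by apply: Rintegral_ge0 => x _; exact: dot_ge0.
have grid s : tau <= s -> s <= hs -> \int[mu]_(x in V (s - tau / 4)) (u x ^+ 2) <= G * rho ^+ 2 * D s.
  move=> taus shs.
  apply: (HB_ (V (s - tau / 4)) (V s) u g (@oV _) (@oV _) (@subIsetr _ _ _) (@subIsetr _ _ _) _ _ (SV _ shs)).
  - move=> x y [Hx _] Oy xy; split=> //; rewrite -(subrK (tau / 4) s).
    apply: (cube_near QQ _ xy) => [|i]; last exact: Hx.
    apply: (@le_trans _ _ (d%:R * ((T + 2)%:R * ((8 * (d%:R * (T + 2)%:R))^-1 * tau)))).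
      by rewrite !ler_wpM2l ?(ltW T20)// ler_wpM2r// ltW.
    rewrite le_eqVlt; apply/orP; left; apply/eqP; field.
    by rewrite !gt_eqF.
  - move=> x [Hx _].
    have xs (i : 'I_d) : `|cube_coord Q c x i| <= hs / 2.
      by apply: ltW; apply: lt_le_trans (Hx i) _; rewrite ler_pM2r//; lra.
    apply: le_trans (coord_norm QQ (ltW hs0) xs) _; apply: le_trans HC2 _.
    by rewrite -mtau /rho natrM le_eqVlt; apply/orP; left; apply/eqP; ring.
  - move=> k Bk; rewrite -[RHS](u0 k); congr (Rintegral _ _ _).
    by apply/esym/setIidl => x /Bk; exact: VS.
have step s : tau <= s -> s <= hs -> D (s - tau) <= expR (- 2) * D s.
  move=> taus shs.
  have cac : forall eta, test_function (cube Q c hs) eta ->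
    \int[mu]_(x in ws) (eta x ^+ 2 * dot (g x) (g x)) <=
     Cc * \int[mu]_(x in ws) (u x ^+ 2 * (dot (\row_i partial i eta x) (\row_i partial i eta x) + eta x ^+ 2)).
    by move=> eta tU; exact: HCc (@open_cube R d Q c hs) HBphi tU.
  apply: le_trans (caccioppoli_layer HBphi Cc0 tau0 taus shs cac) _.
  rewrite -/K1; apply: (@le_trans _ _ (expR (4 * d%:R) * Cc * (K1 / tau ^+ 2) * (G * rho ^+ 2 * D s))).
    by rewrite ler_wpM2l ?grid// !mulr_ge0 ?expR_ge0// invr_ge0 sqr_ge0.
  rewrite (_ : _ * (G * rho ^+ 2 * D s) = X * t ^+ 2 * D s); first by rewrite ler_wpM2r.
  by rewrite /X /rho; field; rewrite gt_eqF.
have iter l : (l <= m)%N -> D (hs - l%:R * tau) <= expR (- 2) ^+ l * D hs.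
  elim: l => [|l IH] lm; first by rewrite mul0r subr0 expr0 mul1r.
  have ltau : l%:R * tau + tau <= hs - h.
    by rewrite -mtau -[X in _ + X]mul1r -mulrDl natr1 ler_pM2r// ler_nat leqW.
  have lt0 : 0 <= l%:R * tau by rewrite mulr_ge0// ltW.
  rewrite -natr1 mulrDl mul1r opprD addrA exprS -mulrA.
  apply: le_trans (step _ _ _) _; [have := h0; lra|lra|].
  by rewrite ler_wpM2l ?expR_ge0// IH// ltnW.
(* The last of the [m.+1] layers is kept to bound the $L^2$ norm by the energy once more. *)
have hm : hs - m%:R * tau = h + tau.
  have := mtau; rewrite -natr1 mulrDl mul1r => E; lra.
have ht : h + tau <= hs by lra.
have Dm : D (h + tau) <= expR (- 2) ^+ m * D hs by rewrite -hm; exact: iter.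
exists (h + tau - tau / 4); first by apply/andP; split; lra.
have tt : tau <= h + tau by have := h0; lra.
have G1 := grid _ tt ht.
have G2 : D (h + tau - tau / 4) <= D (h + tau).
  apply: subset_Rintegral; [exact: leb_open (@oV _)|exact: leb_open (@oV _)|by apply: VS; lra| |].
    by apply: sqint_dot_self; [exact: leb_open (@oV _)|case: (SV _ ht)].
  by move=> x _; exact: dot_ge0.
rewrite -/(D hs) -/(D _) -mulrA; apply: (@le_trans _ _ ((1 + G * (t * hs) ^+ 2) * D (h + tau))).
  rewrite mulrDl mul1r addrC; apply: lerD => //; apply: le_trans G1 _.
  rewrite ler_wpM2r// ler_wpM2l// ler_sqr ?nnegrE ?(ltW rho0) ?mulr_ge0 ?(ltW t0) ?(ltW hs0)//.
  by rewrite ler_wpM2l// ltW.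
by rewrite ler_wpM2l// addr_ge0// mulr_ge0// sqr_ge0.
Qed.

End Layers.
End Decay.

(** * Eigenvalues *)

Section SpectralBound.
Context {R : rcfType} {I : finType}.

(* On the finite part the two forms are simultaneously diagonal along distinct eigenvalues, so
   [(lam k - r) a k m] factors through [sqrt (lam k - r) * sqrt (lam m - r)]. *)
Lemma spectral_bound (a b : I -> I -> R) (lam : I -> option R) (r : R) (c : I -> R) :
  (forall k m, a k m = a m k) -> (forall k m, b k m = b m k) ->
  (forall e : I -> R, 0 <= \sum_k \sum_m e k * e m * a k m) ->
  (forall e : I -> R, 0 <= \sum_k \sum_m e k * e m * b k m) ->
  (forall k, if lam k is Some s then r <= s /\ forall m, b k m = s * a k m else forall m, a k m = 0) ->
  r * (\sum_k \sum_m c k * c m * a k m) <= \sum_k \sum_m c k * c m * b k m.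
Proof.
move=> sa sb pa pb Hl.
(* [None] stands for an infinite eigenvalue. There the row of [a] is 0, and the coefficient enters
   only through [e']. *)
pose e k := if lam k is Some s then c k * Num.sqrt (s - r) else 0.
pose e' k := if lam k is Some s then 0 else c k.
have -> : \sum_k \sum_m c k * c m * b k m =
    \sum_k \sum_m e k * e m * a k m + r * (\sum_k \sum_m c k * c m * a k m) + \sum_k \sum_m e' k * e' m * b k m.
  rewrite mulr_sumr -!big_split; apply: eq_bigr => k _ /=.
  rewrite mulr_sumr -!big_split; apply: eq_bigr => m _ /=.
  have Hk := Hl k; have Hm := Hl m; rewrite /e /e'.
  case: (lam k) Hk => [s [rs bs]|ak]; case: (lam m) Hm => [s' [rs' bs']|am].
  - rewrite bs; have [->|a0] := eqVneq (a k m) 0; first by ring.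
    have ss : s = s' by apply: (mulIf a0); rewrite -bs sb bs' sa.
    rewrite -ss (_ : _ * (c m * _) = c k * c m * Num.sqrt (s - r) ^+ 2); last by ring.
    by rewrite sqr_sqrtr ?subr_ge0//; ring.
  - by rewrite bs sa am; ring.
  - by rewrite sb bs' (sa m) ak; ring.
  - by rewrite ak; ring.
by rewrite addrAC lerDr addr_ge0.
Qed.

Lemma left_kernel (N K : nat) (A : 'M[R]_(N, K)) : (K < N)%N -> exists2 v : 'rV[R]_N, v != 0 & v *m A = 0.
Proof.
move=> KN; have : kermx A != 0.
  by rewrite -mxrank_eq0 mxrank_ker subn_eq0 -ltnNge; apply: leq_ltn_trans (rank_leq_col A) KN.
by move=> /rowV0Pn[v /sub_kermxP vA v0]; exists v.
Qed.

End SpectralBound.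

(** * The energy form on finite combinations *)

Section Forms.
Context {R : realType} {d : nat} (P : pde_data R d).
Implicit Types (x y : 'rV[R]_d) (u v : 'rV[R]_d -> R) (g : 'rV[R]_d -> 'rV[R]_d).
Local Notation mu := (leb R d).
Local Notation lmeas A := (measurable (A : set (leb_space R d))).
Local Notation lmfun W f := (measurable_fun (W : set (leb_space R d)) (f : leb_space R d -> _)).
Local Notation Om := (Omega P).

Variables (amin amax : R) (ws : set 'rV[R]_d).
Hypotheses (adm : admissible_data P amin amax) (oW : open ws) (WO : ws `<=` Om).
Let oO : open Om. Proof. by case: adm => -[]. Qed.
Let mW : lmeas ws. Proof. exact: leb_open. Qed.

(** The quadratic form of the Gram matrix, compared with the Dirichlet integral of explicit
    gradients. One statement serves the eigenfunctions and their products with [chi]. *)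
Lemma a_form_gram (I : finType) (psi : I -> 'rV[R]_d -> R) (G : I -> 'rV[R]_d -> 'rV[R]_d) (e : I -> R) :
  (forall k, sobolev ws (psi k) (G k)) ->
  let g x := \sum_k e k *: G k x in
  let q := \sum_k \sum_m e k * e m * a_form P ws (psi k) (psi m) in
  amin * \int[mu]_(x in ws) dot (g x) (g x) <= q /\ (q <= amax * \int[mu]_(x in ws) dot (g x) (g x) : Prop).
Proof.
move=> S g q.
have [A' [b' [M [M0 mA mb [AM bM] AE]]]] := coefficients adm.
have [_ _ _ [_ _ HAl _ El]] := adm.
have mO := leb_open oO.
have mA' i j : lmfun ws (fun x => A' x i j) by exact: measurable_funS mO WO (mA i j).
have mP i j : lmfun ws (fun x => Amat P x i j).
  by have [H _] := HAl i j; exact: measurable_funS mO WO H.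
have sG k i : sqint mu ws (fun x => G k x 0 i) by case: (S k).
have sgr k i : sqint mu ws (fun x => grad ws (psi k) x 0 i).
  by case: (H1_sobolev oW (sobolev_H1 oW (S k))).
have rF k m : rint mu ws (fun x => dot (app (A' x) (G k x)) (G m x)).
  by apply: rint_dot => // i; exact: sqint_app mW mA' AM (sG k) i.
have aE k m : a_form P ws (psi k) (psi m) = \int[mu]_(x in ws) dot (app (A' x) (G k x)) (G m x).
  apply: (ae_eq_Rintegral mW).
  - exact: measurable_dot (measurable_app mP (fun i => sqint_measurable (sgr k i))) (fun i => sqint_measurable (sgr m i)).
  - exact: measurable_dot (measurable_app mA' (fun i => sqint_measurable (sG k i))) (fun i => sqint_measurable (sG m i)).
  - apply: aeS (aeI AE (aeI (sobolev_grad oW (S k)) (sobolev_grad oW (S m)))) => x [H1 [H2 H3]] wx.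
    by rewrite (H1 (WO wx)).1 H2// H3.
have [rs Es] := Rintegral_sum2 e mW rF.
have FE : (fun x => \sum_k \sum_m e k * e m * dot (app (A' x) (G k x)) (G m x)) = fun x => dot (app (A' x) (g x)) (g x).
  apply/funext => x; rewrite /g app_sum dot_suml; apply: eq_bigr => k _.
  by rewrite dot_sumr mulr_sumr; apply: eq_bigr => m _; rewrite mulrA.
have qE : q = \int[mu]_(x in ws) dot (app (A' x) (g x)) (g x).
  by rewrite -FE -Es; apply: eq_bigr => k _; apply: eq_bigr => m _; rewrite aE.
rewrite FE in rs.
have sg i : sqint mu ws (fun x => g x 0 i).
  have -> : (fun x => g x 0 i) = fun x => \sum_k e k * G k x 0 i.
    by apply/funext => x; rewrite /g summxE; apply: eq_bigr => k _; rewrite mxE.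
  by apply: sqint_sum => // k; exact: sqintZ.
have rg := sqint_dot_self mW sg.
rewrite qE -!(RintegralZl _ mW rg); split; apply: (ae_le_Rintegral mW).
- exact: rintZ.
- exact: rs.
- apply: aeS AE => x Hx wx; have [EA _] := Hx (WO wx).
  by have := El x (g x) (WO wx); rewrite sqr_enorm EA => /andP[].
- exact: rs.
- exact: rintZ.
- apply: aeS AE => x Hx wx; have [EA _] := Hx (WO wx).
  by have := El x (g x) (WO wx); rewrite sqr_enorm EA => /andP[].
Qed.

Lemma a_form_sym u v : a_form P ws u v = a_form P ws v u.
Proof.
have [_ _ _ [_ _ _ As _]] := adm.
apply: eq_Rintegral => x /set_mem wx; have Ax := As x (WO wx).
have E (p q : 'rV[R]_d) : dot (app (Amat P x) p) q = (p *m Amat P x *m q^T) 0 0.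
  by rewrite /app Ax /dot [RHS]mxE; apply: eq_bigr => i _; rewrite [q^T _ _]mxE.
rewrite !E; set p := grad _ _ _; set q := grad _ _ _.
transitivity ((p *m Amat P x *m q^T)^T 0 0); first by rewrite [RHS]mxE.
by rewrite !trmx_mul trmxK Ax mulmxA.
Qed.

Lemma a_form_null u g v gv : sobolev ws u g -> sobolev ws v gv ->
  \int[mu]_(x in ws) dot (g x) (g x) = 0 -> a_form P ws u v = 0.
Proof.
move=> S Sv g0; have [su sg _] := S; have [_ _ _ [_ _ HAl _ _]] := adm.
have mO := leb_open oO.
have mP i j : lmfun ws (fun x => Amat P x i j).
  by have [H _] := HAl i j; exact: measurable_funS mO WO H.
have gu i : lmfun ws (fun x => grad ws u x 0 i).
  by have [_ H _] := H1_sobolev oW (sobolev_H1 oW S); exact: sqint_measurable (H i).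
have gv' i : lmfun ws (fun x => grad ws v x 0 i).
  by have [_ H _] := H1_sobolev oW (sobolev_H1 oW Sv); exact: sqint_measurable (H i).
have z : {ae mu, forall x, ws x -> dot (g x) (g x) = 0}.
  apply: (Rintegral_ae0 mW); [exact: sqint_dot_self|by move=> x _; exact: dot_ge0|by rewrite g0].
transitivity (\int[mu]_(x in ws) (0 : R)); last by rewrite /Rintegral integral0.
apply: (ae_eq_Rintegral mW).
- exact: measurable_dot (measurable_app mP gu) gv'.
- exact: measurable_cst.
- apply: aeS (aeI z (sobolev_grad oW S)) => x [H1 H2] wx; rewrite H2//.
  have -> : g x = 0.
    apply/rowP => i; rewrite mxE; apply/eqP; rewrite -normr_le0.
    by apply: le_trans (coord_enorm _ _) _; rewrite /enorm H1// sqrtr0.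
  by rewrite /app mul0mx /dot big1// => i _; rewrite mxE mul0r.
Qed.

End Forms.

(** * Multiplication by the partition of unity *)

Section Cut.
Context {R : realType} {d : nat}.
Implicit Types (x y : 'rV[R]_d) (u chi : 'rV[R]_d -> R) (g gc : 'rV[R]_d -> 'rV[R]_d) (Om ws w : set 'rV[R]_d).
Local Notation mu := (leb R d).
Local Notation lmfun W f := (measurable_fun (W : set (leb_space R d)) (f : leb_space R d -> _)).

(** On the open set of points of [Om] off the closure of [w], [chi] is 0 and so has the weak
    gradient 0; by uniqueness [gc] vanishes there almost everywhere. Clamping makes [gc] bounded at
    every point. *)
Lemma cut_gradient Om w chi : open Om -> (mu Om < +oo)%E -> W1oo Om chi ->
  (forall x, Om x -> 0 <= chi x <= 1) -> closure [set x | Om x /\ chi x != 0] `<=` closure w ->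
  exists (gc : 'rV[R]_d -> 'rV[R]_d) (M : R), [/\ 0 <= M, forall x i, `|gc x 0 i| <= M,
   forall i, lmfun Om (fun x => gc x 0 i), sobolev Om chi gc &
   {ae mu, forall x, Om x -> ~ closure w x -> chi x = 0 /\ gc x = 0}].
Proof.
move=> oO fO [[mchi _] [g0 [wg Lg]]] c01 supp; have mO := leb_open oO.
have [M HM] := choice (fun i => Loo_clamp (Lg i)).
have [f Hf] := choice (fun i => (HM i).2).
have M0 i : 0 <= M i by case: (HM i).
pose gc x : 'rV[R]_d := \row_i f i x.
have gcE i : (fun x => gc x 0 i) = f i by apply/funext => x; rewrite mxE.
have mgc i : lmfun Om (fun x => gc x 0 i) by rewrite gcE; case: (Hf i).
have bgc x i : `|gc x 0 i| <= \sum_i M i.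
  rewrite mxE; case: (Hf i) => _ /(_ x) H _; apply: le_trans H _.
  by rewrite (bigD1 i)//= lerDl sumr_ge0.
have s1 : sqint mu Om (fun=> 1 : R).
  by apply: Sqint; [exact: measurable_cst|exact: rint_cst].
have sb (h : 'rV[R]_d -> R) (K : R) : lmfun Om h -> (forall x, Om x -> `|h x| <= K) -> sqint mu Om h.
  move=> mh hK; rewrite (_ : h = fun x => h x * 1); last by apply/funext => x; rewrite mulr1.
  exact: (sqint_mul_bounded (M := K) mO s1 mh).
have schi : sqint mu Om chi.
  by apply: (sb _ 1) => // x /c01/andP[c0 c1]; rewrite ger0_norm.
have sgc i : sqint mu Om (fun x => gc x 0 i) by apply: (sb _ (\sum_i M i)) => // x _; exact: bgc.
have S : sobolev Om chi gc.
  split=> // i psi tp; have [_ ->//] := wg i; congr (- _).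
  have mp : lmfun Om psi by exact: test_function_measurable tp.
  apply: (ae_eq_Rintegral mO).
  - exact: measurable_funM (weak_grad_measurable i oO wg) mp.
  - exact: measurable_funM (mgc i) mp.
  - by have [_ _ H] := Hf i; apply: aeS H => x Hx Ox; rewrite mxE Hx.
exists gc, (\sum_i M i); split=> //; first exact: sumr_ge0.
pose Z := Om `&` ~` closure w.
have oZ : open Z by apply: openI => //; exact/closed_openC/closed_closure.
have chi0 x : Z x -> chi x = 0.
  move=> [Ox nc]; apply/eqP/negPn/negP => cx; apply: nc; apply: supp; exact: subset_closure.
have SZ := sobolevS oZ mO (@subIsetl _ _ _) S.
have S0 : sobolev Z chi (fun=> 0).
  split.
  - by case: SZ.
  - move=> i; have -> : (fun _ : 'rV[R]_d => (0 : 'rV[R]_d) 0 i) = fun=> 0 by apply/funext => x; rewrite mxE.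
    exact: sqint0 (leb_open oZ).
  - move=> i psi tp.
    have I0 (F : 'rV[R]_d -> R) : (forall x, Z x -> F x = 0) -> \int[mu]_(x in Z) F x = 0.
      move=> f0; transitivity (\int[mu]_(x in Z) (0 : R)); last by rewrite /Rintegral integral0.
      by apply: eq_Rintegral => x /set_mem; exact: f0.
    rewrite !I0 ?oppr0// => x Zx; first by rewrite mxE mul0r.
    by rewrite chi0// mul0r.
apply: aeS (aeI (sobolev_grad oZ SZ) (sobolev_grad oZ S0)) => x [H1 H2] Ox nc.
by split; [exact: chi0|rewrite -H1// H2].
Qed.

Lemma cut_sobolev Om ws chi gc (M : R) u g : open Om -> open ws -> ws `<=` Om -> (mu Om < +oo)%E ->
  (forall x, Om x -> 0 <= chi x <= 1) -> (forall x i, `|gc x 0 i| <= M) ->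
  (forall i, lmfun Om (fun x => gc x 0 i)) -> sobolev Om chi gc -> sobolev ws u g ->
  sobolev ws (fun x => chi x * u x) (fun x => chi x *: g x + u x *: gc x).
Proof.
move=> oO oW WO fO c01 bgc mgc Sc S; have mO := leb_open oO; have mW := leb_open oW.
have fW : (mu ws < +oo)%E by apply: le_lt_trans fO; apply: le_measure; rewrite ?inE.
have Scw := sobolevS oW mO WO Sc; have [sc _ _] := Scw; have [su sg _] := S.
have mc := sqint_measurable sc.
have c1 x : ws x -> `|chi x| <= 1 by move=> /WO/c01/andP[c0 c1]; rewrite ger0_norm.
have mg i : lmfun ws (fun x => gc x 0 i) by exact: measurable_funS mO WO (mgc i).
apply: (sobolevM oW fW Scw S) => [|i]; first exact: sqint_mul_bounded su mc c1.
apply: sqintD => //; first exact: sqint_mul_bounded (sg i) mc c1.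
rewrite (_ : (fun x => _) = fun x => gc x 0 i * u x); last by apply/funext => x; rewrite mulrC.
by apply: (sqint_mul_bounded (M := M) mW su (mg i)) => x _; exact: bgc.
Qed.

Lemma cut_energy Om ws V w chi gc (M : R) u g : open Om -> open ws -> open V -> ws `<=` Om -> V `<=` ws ->
  (mu Om < +oo)%E -> 0 <= M ->
  (forall x, Om x -> 0 <= chi x <= 1) -> (forall x i, `|gc x 0 i| <= M) ->
  (forall i, lmfun Om (fun x => gc x 0 i)) -> sobolev Om chi gc -> sobolev ws u g ->
  {ae mu, forall x, Om x -> ~ closure w x -> chi x = 0 /\ gc x = 0} ->
  (forall x, ws x -> closure w x -> V x) ->
  \int[mu]_(x in ws) dot (chi x *: g x + u x *: gc x) (chi x *: g x + u x *: gc x) <=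
  (2 + 2 * (d%:R * M ^+ 2)) * (\int[mu]_(x in V) (u x ^+ 2) + \int[mu]_(x in V) dot (g x) (g x)).
Proof.
move=> oO oW oV WO VW fO M0 c01 bgc mgc Sc S zero HV; have mW := leb_open oW; have mV := leb_open oV.
have [su sg _] := S; have [_ sG _] := cut_sobolev oO oW WO fO c01 bgc mgc Sc S.
have rg := sqint_dot_self mW sg; have ru := sqint_sq su; have rG := sqint_dot_self mW sG.
pose C := 2 + 2 * (d%:R * M ^+ 2).
have C0 : 0 <= C by rewrite addr_ge0// mulr_ge0// mulr_ge0// sqr_ge0.
have rs : rint mu ws (fun x => C * (u x ^+ 2 + dot (g x) (g x))) by apply: rintZ => //; exact: rintD.
have rV1 : rint mu V (fun x => u x ^+ 2) by exact: rintS ru.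
have rV2 : rint mu V (fun x => dot (g x) (g x)) by exact: rintS rg.
have -> : C * (\int[mu]_(x in V) (u x ^+ 2) + \int[mu]_(x in V) dot (g x) (g x)) =
    \int[mu]_(x in ws) (\1_V x * (C * (u x ^+ 2 + dot (g x) (g x)))).
  rewrite Rintegral_indic// (setIidr VW) -(RintegralD mV rV1 rV2) -(RintegralZl _ mV)//.
  exact: rintD.
apply: (ae_le_Rintegral mW rG).
  apply: (rint_mul_bounded (M := 1) mW rs); first exact: measurable_indic.
  by move=> x _; rewrite indicE; case: (_ \in _); rewrite ?normr1 ?normr0.
apply: aeS zero => x Hx wx; rewrite indicE; have [xV|/negP nV] := boolP (x \in V); last first.
  have nc : ~ closure w x by move=> cx; apply: nV; apply/mem_set; exact: HV.
  have [-> ->] := Hx (WO _ wx) nc.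
  by rewrite scale0r scaler0 addr0 mul0r /dot big1// => i _; rewrite mxE mul0r.
rewrite mul1r; have /andP[c0 c1] := c01 x (WO _ wx).
have B := dot_sqrD_ge0 (chi x *: g x) (u x *: gc x) (- 1).
have dgc : dot (gc x) (gc x) <= d%:R * M ^+ 2.
  rewrite mulr_natl -[X in _ *+ X]card_ord -sumr_const; apply: ler_sum => i _.
  by rewrite -expr2 -real_normK ?num_real// ler_sqr ?nnegrE.
have g0 := dot_ge0 (g x); have gc0 := dot_ge0 (gc x); have u0 := sqr_ge0 (u x).
apply: (@le_trans _ _ (2 * dot (chi x *: g x) (chi x *: g x) + 2 * dot (u x *: gc x) (u x *: gc x))).
  move: B; rewrite sqrrN expr1n mul1r !dotDl !dotDr (dotC (u x *: gc x) (chi x *: g x)) => B; lra.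
rewrite !dotZl !dotZr !mulrA.
have e1 : chi x * chi x * dot (g x) (g x) <= dot (g x) (g x).
  by rewrite ler_piMl// mulr_ile1.
have e2 : u x * u x * dot (gc x) (gc x) <= u x ^+ 2 * (d%:R * M ^+ 2) by rewrite expr2 ler_wpM2l// -expr2.
have e3 : 0 <= 2 * (d%:R * M ^+ 2) * dot (g x) (g x) by rewrite !mulr_ge0// sqr_ge0.
rewrite /C -!mulrA in e1 e2 e3 *; lra.
Qed.

End Cut.

Lemma Rintegral_null {dsp : measure_display} {T : measurableType dsp} {R : realType}
    (m : {measure set T -> \bar R}) (D : set T) (f : T -> R) :
  measurable D -> rint m D f -> m D = 0%E -> \int[m]_(x in D) f x = 0.
Proof.
move=> mD rf D0; rewrite /Rintegral null_set_integral//.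
by apply/measurable_EFinP; exact: rint_measurable rf.
Qed.

Lemma card_grid_index_le (d C m : nat) : (#|@grid_index d (C * m.+1)| <= ((2 * C).+1 * m.+1) ^ d)%N.
Proof.
rewrite card_ffun !card_ord; case: d => [|d]; first by rewrite !expn0.
by rewrite leq_exp2r// mulSn -mulnA mul2n -addnn addSn ltnS leq_addl.
Qed.

Lemma le_chain {R : realFieldType} (r am ax K D Dc qa qb : R) : 0 <= r -> 0 <= ax -> am * D <= qa ->
  r * qa <= qb -> qb <= ax * Dc -> Dc <= K * D -> r * (am * D) <= ax * (K * D).
Proof.
move=> r0 ax0 h1 h2 h3 h4; apply: le_trans (ler_wpM2l r0 h1) _; apply: le_trans h2 _.
by apply: le_trans h3 _; rewrite ler_wpM2l.
Qed.

(** * From the decay to the eigenvalue bound *)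

Section Final.
Context {R : realType} {d : nat} (P : pde_data R d).
Implicit Types (x y : 'rV[R]_d) (u v chi : 'rV[R]_d -> R) (g gc : 'rV[R]_d -> 'rV[R]_d).
Local Notation mu := (leb R d).
Local Notation Om := (Omega P).

(** A dilation shrinks [A] into the unit ball and changes outer measure by at most a finite
    factor. *)
Lemma unit_vol0 (A : set 'rV[R]_d) : @unit_vol R d = 0 -> bounded_set A -> mu A = 0%E.
Proof.
move=> v0 [N [_ HN]]; pose l : R := (`|N| + 2)^-1.
have N2 : 0 < `|N| + 2 by rewrite ltr_wpDl.
have l0 : 0 < l by rewrite invr_gt0.
have b0 : mu (ball (0 : 'rV[R]_d) 1) = 0%E.
  by rewrite -[LHS]fineK ?ge0_fin_numE ?leb_ball_fin//; congr EFin.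
apply/eqP; rewrite eq_le measure_ge0 andbT.
apply: (@le_trans _ _ (leb_outer [set x | ball (0 : 'rV[R]_d) 1 (l *: x + 0)])).
  apply: le_outer_measure => x Ax; rewrite /= addr0 -ball_normE /= sub0r normrN normrZ gtr0_norm//.
  rewrite /l mulrC ltr_pdivrMr// mul1r; apply: (@le_lt_trans _ _ (`|N| + 1)); last by rewrite ltrD2l ltr1n.
  by apply: HN => //; rewrite (le_lt_trans (ler_norm N))// ltrDl.
by apply: le_trans (leb_outer_affine 0 _ l0) _; rewrite (b0 : leb_outer (ball 0 1) = 0%E) mule0.
Qed.

Section Local.
Variables (amin amax : R) (w ws : set 'rV[R]_d) (chi : 'rV[R]_d -> R) (gc : 'rV[R]_d -> 'rV[R]_d) (M : R).
Hypotheses (adm : admissible_data P amin amax) (oW : open ws) (WO : ws `<=` Om)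
  (c01 : forall x, Om x -> 0 <= chi x <= 1) (bgc : forall x i, `|gc x 0 i| <= M)
  (mgc : forall i, measurable_fun (Om : set (leb_space R d)) (fun x => gc x 0 i)) (Sc : sobolev Om chi gc).
Let cut u : 'rV[R]_d -> R := fun x => chi x * u x.
Let cg u g := fun x => chi x *: g x + u x *: gc x.

Let oO : open Om. Proof. by case: adm => -[]. Qed.
Let fO : (mu Om < +oo)%E. Proof. by apply: leb_bounded; case: adm => -[]. Qed.

Let S_HB u : HB P ws u -> sobolev ws u (grad ws u).
Proof. by move=> [[H _] _]; exact: H1_sobolev. Qed.

Let S_cut u g : sobolev ws u g -> sobolev ws (cut u) (cg u g).
Proof. exact: cut_sobolev oO oW WO fO c01 bgc mgc Sc. Qed.

Lemma null_degenerate u g : sobolev ws u g -> \int[mu]_(x in ws) dot (g x) (g x) = 0 ->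
  \int[mu]_(x in ws) dot (cg u g x) (cg u g x) = 0 -> degenerate P ws chi u.
Proof.
move=> S g0 c0 psi /S_HB Sp; split.
  have := @a_form_null R d P amin amax ws adm oW WO u g psi _ S Sp g0; exact.
have := @a_form_null R d P amin amax ws adm oW WO _ _ _ _ (S_cut S) (S_cut Sp) c0; exact.
Qed.

(** One combination with small energy after the cutoff bounds the [N]-th eigenvalue. Its own energy
    cannot be 0: then the energy after the cutoff would be 0 too, and the combination would be
    degenerate, against the independence in [eigen_numbering]. The quotient $a_{\max}/a_{\min}$
    comes from passing between the form and the Dirichlet integral. *)
Lemma eigenvalue_bound (I : set nat) (lam : nat -> \bar R) (phi : nat -> 'rV[R]_d -> R) (N : nat)
    (v : 'rV[R]_N) (K : R) :
  eigen_numbering P w ws chi I lam phi -> (0 < N)%N -> I N -> v != 0 -> 0 <= K ->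
  let u x := \sum_(i < N) v 0 i * phi i.+1 x in
  let g x := \sum_(i < N) v 0 i *: grad ws (phi i.+1) x in
  \int[mu]_(x in ws) dot (cg u g x) (cg u g x) <= K * \int[mu]_(x in ws) dot (g x) (g x) ->
  exists2 r : R, lam N = r%:E & 0 <= r <= amax / amin * K.
Proof.
move=> [I1 I2 I3 I4] N0 IN v0 K0 u g cK.
have [_ _ _ [am0 ax0 _ _ _]] := adm.
have Ik (i : 'I_N) : I i.+1 by apply: (I1 N IN).2; rewrite /= ltn_ord.
have HBk (i : 'I_N) : HB P ws (phi i.+1) by case: (I2 _ (Ik i)).
have Sk (i : 'I_N) := S_HB (HBk i).
have Su : sobolev ws u g by apply: sobolev_sum => [|i _]; [exact: leb_open oW|exact: Sk].
pose D := \int[mu]_(x in ws) dot (g x) (g x).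
pose Dc := \int[mu]_(x in ws) dot (cg u g x) (cg u g x).
have Dc0 : 0 <= Dc by apply: Rintegral_ge0 => x _; exact: dot_ge0.
have D0 : 0 <= D by apply: Rintegral_ge0 => x _; exact: dot_ge0.
have nd : ~ degenerate P ws chi u.
  (* The numbering starts at 1 and ordinals at 0; outside the range the coefficients are 0. *)
  move=> dg; pose cc k : R := if k is k'.+1 then (if insub k' is Some i then v 0 i else 0) else 0.
  have cE (i : 'I_N) : cc i.+1 = v 0 i by rewrite /cc valK.
  have H : degenerate P ws chi (fun x => \sum_(1 <= k < N.+1) cc k * phi k x).
    rewrite (_ : (fun x => _) = u)//; apply/funext => x.
    by rewrite big_add1 big_mkord; apply: eq_bigr => i _; rewrite cE.
  have Z := I4 N cc IN H; move/eqP: v0; apply; apply/rowP => i; rewrite mxE -cE.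
  by apply: Z; rewrite /= ltn_ord.
have Dpos : 0 < D.
  rewrite lt_neqAle eq_sym D0 andbT; apply/eqP => DE; apply: nd; apply: (null_degenerate Su DE).
  by apply/eqP; rewrite eq_le Dc0 andbT; apply: le_trans cK _; rewrite -/D DE mulr0.
pose a (k m : 'I_N) := a_form P ws (phi k.+1) (phi m.+1).
pose b (k m : 'I_N) := a_form P ws (cut (phi k.+1)) (cut (phi m.+1)).
have aG e := a_form_gram adm oW WO e Sk.
have bG e := a_form_gram adm oW WO e (fun k => S_cut (Sk k)).
have dint0 (h : 'rV[R]_d -> 'rV[R]_d) : 0 <= amin * \int[mu]_(x in ws) dot (h x) (h x).
  by rewrite mulr_ge0 ?(ltW am0)//; apply: Rintegral_ge0 => x _; exact: dot_ge0.
have psa e : 0 <= \sum_k \sum_m e k * e m * a k m by apply: le_trans (aG e).1; exact: dint0.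
have psb e : 0 <= \sum_k \sum_m e k * e m * b k m by apply: le_trans (bG e).1; exact: dint0.
have [a1 _] := aG (fun i => v 0 i); have [_ b2] := bG (fun i => v 0 i).
have cgE : (fun x => \sum_(i < N) v 0 i *: cg (phi i.+1) (grad ws (phi i.+1)) x) = cg u g.
  apply/funext => x; rewrite /cg /u /g scaler_sumr scaler_suml -big_split; apply: eq_bigr => i _ /=.
  by rewrite scalerDr !scalerA mulrC.
have {}b2 : \sum_k \sum_m v 0 k * v 0 m * b k m <= amax * Dc by rewrite /Dc -cgE.
have lamN (i : 'I_N) : (lam N <= lam i.+1)%E by apply: I3 => //; exact: ltn_ord.
have eig (i : 'I_N) := (I2 _ (Ik i)).2.
have lamNE : lam N != -oo%E.
  by have [_] := I2 _ IN; case: (lam N).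
(* If the [N]-th eigenvalue were infinite, so would be all before it, and the energy form would
   vanish on their combinations, against [Dpos]. *)
case LN: (lam N) lamNE => [r| |] // _; last first.
  have az k m : a k m = 0.
    have := eig k; have := lamN k; rewrite LN leye_eq => /eqP -> [H _]; exact: H.
  have : amin * D <= 0.
    apply: le_trans a1 _; rewrite big1// => k _; rewrite big1// => m _.
    by rewrite -/(a k m) az mulr0.
  by rewrite leNgt mulr_gt0.
exists r => //; have rp : 0 <= r.
  by have [_] := I2 _ IN; rewrite LN => -[].
rewrite rp /=.
pose lo (k : 'I_N) := if lam k.+1 is s%:E then Some s else None.
have SB := @spectral_bound R 'I_N a b lo r (fun i => v 0 i) (fun k m => a_form_sym adm WO _ _)
  (fun k m => a_form_sym adm WO _ _) psa psb.
have {SB} : r * (\sum_k \sum_m v 0 k * v 0 m * a k m) <= \sum_k \sum_m v 0 k * v 0 m * b k m.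
  apply: SB => k; rewrite /lo; have := eig k; have := lamN k; rewrite LN; case: (lam k.+1) => [s| |//].
    by rewrite lee_fin => rs [_ H]; split=> // m; exact: H.
  by move=> _ [H _] m; exact: H.
move=> rb; have rD : r * (amin * D) <= amax * (K * D) by exact: le_chain rp (ltW ax0) a1 rb b2 cK.
rewrite -(ler_pM2r (mulr_gt0 am0 Dpos)); apply: le_trans rD _.
by rewrite le_eqVlt; apply/orP; left; apply/eqP; field; rewrite gt_eqF.
Qed.

End Local.

(* With [q = N^(1/d)], [m + 1 = trunc (q / (2 C3))] is the largest number of layers whose
   [(C3 (m + 1))^d] functionals are fewer than [N]. *)
Lemma layer_count (C3 N : nat) : (0 < d)%N -> (0 < C3)%N -> ((2 * C3) ^ d < N)%N ->
  exists2 m : nat, ((C3 * m.+1) ^ d < N)%N & N%:R `^ (d%:R^-1) / (2 * C3%:R) <= m%:R + 2 :> R.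
Proof.
move=> d0 C30 HN; set q : R := N%:R `^ _.
have dn : d%:R != 0 :> R by rewrite pnatr_eq0 -lt0n.
have qd : q ^+ d = N%:R by rewrite -powR_mulrn ?powR_ge0// -powRrM mulVf// powRr1.
have q0 : 0 <= q by exact: powR_ge0.
have C0 : 0 < 2 * C3%:R :> R by rewrite mulr_gt0// ltr0n.
have q1 : 1 <= q / (2 * C3%:R).
  rewrite ler_pdivlMr// mul1r leNgt; apply/negP => qC.
  have : q ^+ d < (2 * C3%:R) ^+ d by rewrite ltrXn2r// -lt0n.
  by rewrite qd -natrM -natrX ltr_nat ltnNge (ltnW HN).
pose t := Num.truncn (q / (2 * C3%:R)).
have t1 : (0 < t)%N by rewrite truncn_gt0.
have tq : t%:R <= q / (2 * C3%:R) by rewrite truncn_le; exact: le_trans ler01 q1.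
exists t.-1; last first.
  rewrite -(_ : t.-1%:R + 1 + 1 = t.-1%:R + 2); last by ring.
  by rewrite natr1 prednK// natr1; exact: ltW (truncnS_gt _).
rewrite prednK// -(ltr_nat R) natrX natrM -qd ltrXn2r// -?lt0n//.
  apply: (@le_lt_trans _ _ (q / 2)).
    move: tq; rewrite ler_pdivlMr// => tq; rewrite ler_pdivlMr//.
    by rewrite (_ : C3%:R * t%:R * 2 = t%:R * (2 * C3%:R)) //; ring.
  have qp : 0 < q by apply: lt_le_trans (lt_le_trans ltr01 q1) _; rewrite ler_pdivrMr// ler_peMr// -natrM ler1n muln_gt0.
  by rewrite ltr_pdivrMr// ltr_pMr// ltr1n.
Qed.

End Final.

Theorem theorem3p5 (R : realType) (d : nat) (P : pde_data R d) (amin amax : R)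
    (M : nat) (w ws : 'I_M -> set 'rV[R]_d)
    (chi : 'I_M -> 'rV[R]_d -> R) (Cchi : R) (H Hs : 'I_M -> R)
    (hd : d = 2%N \/ d = 3%N)
    (hdata : admissible_data P amin amax)
    (hglobal : well_posed P (Omega P) [set v | H1D P (Omega P) v])
    (hdec : decomposition (Omega P) w ws)
    (hchi : partition_of_unity (Omega P) w chi Cchi)
    (hlocal : forall j, well_posed P (ws j) [set v | H1D0 P (ws j) v])
    (hcubes : forall j,
       truncated_concentric_cubes (Omega P) (w j) (ws j) (H j) (Hs j))
    (hside : forall j, 0 < H j)
    (hdelta : forall j, 0 < Hs j - H j) :
  forall j : 'I_M, exists (C c : R) (N0 : nat), 0 < C /\ 0 < c /\
    forall (I : set nat) (lam : nat -> \bar R) (phi : nat -> 'rV[R]_d -> R),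
      eigen_numbering P (w j) (ws j) (chi j) I lam phi ->
      forall N : nat, (N0 < N)%N -> I N ->
        (lam N `^ (2^-1) <= (C * expR (- c * N%:R `^ (d%:R^-1)))%:E)%E.
Proof.
move=> j; have d1 : (1 < d)%N by case: hd => ->.
have d0 : (0 < d)%N by exact: ltnW.
have [[oO _ _ bO lip] _ _ [am0 ax0 _ _ _]] := hdata.
have fO : (leb R d (Omega P) < +oo)%E by exact: leb_bounded.
have [Q [c [QQ wE wsE]]] := hcubes j.
have [_ [_ /(_ j)[supp c01 W1 _]]] := hchi.
have oW : open (ws j) by rewrite wsE; apply: openI => //; exact: open_cube.
have WO : ws j `<=` Omega P by rewrite wsE; exact: subIsetr.
have [gc [Mc [Mc0 bgc mgc Sc zero]]] := cut_gradient oO fO W1 c01 supp.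
have amr : 0 < amax / amin by exact: divr_gt0.
(* If the unit ball had volume 0, every bounded set would be null and all energies 0;
   [eigenvalue_bound] with [K = 0] then gives a zero eigenvalue, and any constants do. *)
have [v0|v0] := ltP 0 (@unit_vol R d); last first.
  have vz : @unit_vol R d = 0 by apply/eqP; rewrite eq_le v0 fine_ge0.
  have mz : leb R d (ws j) = 0%E by apply: unit_vol0 => //; exact: bounded_setS WO bO.
  have mW := leb_open oW.
  exists 1, 1, 0%N; split=> //; split=> // I lam phi num N N0 IN.
  have [I1 I2 _ _] := num.
  have Sk (i : 'I_N) : sobolev (ws j) (phi i.+1) (grad (ws j) (phi i.+1)).
    by apply: H1_sobolev => //; case: (I2 _ ((I1 N IN).2 i.+1 (ltn_ord i))) => -[[]].
  have vn0 : (const_mx 1 : 'rV[R]_N) != 0.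
    by apply/eqP => /rowP/(_ (Ordinal N0))/eqP; rewrite !mxE oner_eq0.
  have Su := sobolev_sum (fun i : 'I_N => (const_mx 1 : 'rV[R]_N) 0 i) mW (fun i (_ : i \in index_enum 'I_N) => Sk i).
  have [_ sG _] := cut_sobolev oO oW WO fO c01 bgc mgc Sc Su.
  have [|r -> /andP[r0 rK]] := eigenvalue_bound hdata oW WO c01 bgc mgc Sc num N0 IN vn0 (lexx 0) (gc := gc).
    by rewrite mul0r (Rintegral_null mW (sqint_dot_self mW sG) mz).
  have -> : r = 0 by apply/eqP; rewrite eq_le r0 andbT; move: rK; rewrite mulr0.
  by rewrite poweR_EFin powR0 ?invr_neq0// lee_fin mul1r expR_ge0.
have [eps e0 Hc] := cone_property d0 oO bO lip.
have [C2 [CD [CD0 decay]]] := layer_decay c d1 v0 hdata e0 Hc QQ (hside j) (hdelta j).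
(* A grid of half-width $n = C_2(m+1)$ has $2n + 1 \le (2C_2+1)(m+1)$ points in each direction. *)
pose C3 := (2 * C2).+1.
pose C1 := amax / amin * ((2 + 2 * (d%:R * Mc ^+ 2)) * CD).
have Cm0 : 0 <= 2 + 2 * (d%:R * Mc ^+ 2) by rewrite addr_ge0// mulr_ge0// mulr_ge0// sqr_ge0.
have C10 : 0 <= C1 by rewrite !mulr_ge0// ?invr_ge0 ltW.
have C3p : 0 < 2 * C3%:R :> R by rewrite mulr_gt0// ltr0n.
(* [layer_count] gives $N^{1/d}/(2C_3) \le m + 2$, and [expR 2] pays for the 2. The summand 1 makes
   positivity immediate, and the threshold on [N] allows at least one layer. *)
exists (Num.sqrt C1 * expR 2 + 1), (2 * C3%:R)^-1, ((2 * C3) ^ d)%N.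
split; first by rewrite ltr_wpDl// mulr_ge0 ?sqrtr_ge0 ?expR_ge0.
split; first by rewrite invr_gt0.
move=> I lam phi num N HN IN.
have N0 : (0 < N)%N by exact: leq_ltn_trans HN.
have [m Hm qm] := @layer_count R d C3 N d0 isT HN.
have [B [oB HB_]] := decay m; rewrite -wsE in HB_.
have [I1 I2 _ _] := num.
have HBk (i : 'I_N) : HB P (ws j) (phi i.+1) by case: (I2 _ ((I1 N IN).2 i.+1 (ltn_ord i))).
have mW := leb_open oW.
have fW : (leb R d (ws j) < +oo)%E by apply: le_lt_trans fO; apply: le_measure; rewrite ?inE//; exact: leb_open.
have rk (i : 'I_N) : rint (leb R d) (ws j) (phi i.+1).
  by apply: sqint_rint_finite => //; case: (H1_sobolev oW (HBk i).1.1).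
pose Kn := #|@grid_index d (C2 * m.+1)|.
have KN : (Kn < N)%N.
  by apply: leq_ltn_trans Hm; exact: card_grid_index_le.
(* Fewer functionals than functions: a nonzero vector in the left kernel is a combination whose mean
   values over all the grid balls vanish. *)
pose A : 'M[R]_(N, Kn) := \matrix_(i, k) \int[leb R d]_(x in B (enum_val k) `&` ws j) phi i.+1 x.
have [v vn0 vA] := left_kernel A KN.
have mB k : measurable ((B k `&` ws j) : set (leb_space R d)) by apply: leb_open; exact: openI.
have rB k (i : 'I_N) : rint (leb R d) (B k `&` ws j) (phi i.+1).
  by apply: rintS (rk i) => //; exact: subIsetr.
have zeroB k : \int[leb R d]_(x in B k `&` ws j) (\sum_i v 0 i * phi i.+1 x) = 0.
  rewrite Rintegral_sum//; last by move=> i; exact: rintZ.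
  have vk : \sum_i v 0 i * A i (enum_rank k) = 0.
    by have := congr1 (fun r : 'rV[R]_Kn => r 0 (enum_rank k)) vA; rewrite !mxE.
  rewrite -[RHS]vk.
  by apply: eq_bigr => i _; rewrite mxE enum_rankK (RintegralZl _ (mB k) (rB k i)).
have [s /andP[hs1 hs2] dec] := HB_ 'I_N (fun i => v 0 i) (fun i => phi i.+1) HBk zeroB.
pose u x := \sum_(i < N) v 0 i * phi i.+1 x.
pose g x := \sum_(i < N) v 0 i *: grad (ws j) (phi i.+1) x.
have Su : sobolev (ws j) u g.
  by apply: sobolev_sum => [|i _]; [exact: mW|exact: H1_sobolev oW (HBk i).1.1].
have oV : open (cube Q c s `&` Omega P) by apply: openI => //; exact: open_cube.
have VW : cube Q c s `&` Omega P `<=` ws j.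
  by rewrite wsE => x [xs Ox]; split=> //; exact: cube_le hs2 _ xs.
(* The support of the partition function is only known to lie in the closure of [w j]; the strict
   inequality [H j < s] absorbs its boundary. *)
have HV x : ws j x -> closure (w j) x -> (cube Q c s `&` Omega P) x.
  move=> /WO Ox cx; split=> // i; rewrite -/(cube_coord Q c x i).
  have wC : w j `<=` [set x | forall i, `|cube_coord Q c x i| <= H j / 2].
    by rewrite wE => y [Hy _] k; exact: ltW (Hy k).
  have := @closed_cube R d Q c (H j) x (closureS wC cx) i; move=> /le_lt_trans; apply.
  by rewrite ltr_pM2r.
have CE := cut_energy oO oW oV WO VW fO Mc0 c01 bgc mgc Sc Su zero HV.
pose Kc := (2 + 2 * (d%:R * Mc ^+ 2)) * CD * expR (- 2) ^+ m.
have Kc0 : 0 <= Kc by rewrite mulr_ge0 ?exprn_ge0 ?expR_ge0// mulr_ge0// ltW.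
have [|r lamN /andP[r0 rK]] := eigenvalue_bound hdata oW WO c01 bgc mgc Sc num N0 IN vn0 Kc0 (gc := gc).
  by apply: le_trans CE _; rewrite /Kc -!mulrA ler_wpM2l// mulrA; exact: dec.
rewrite lamN poweR_EFin lee_fin powR12_sqrt//.
have e2m : Num.sqrt (expR (- 2) ^+ m) = expR (- m%:R) :> R.
  rewrite (_ : expR (- 2) ^+ m = expR (- m%:R) ^+ 2); first by rewrite sqrtr_sqr ger0_norm ?expR_ge0.
  by rewrite -!expRM_natl; congr expR; ring.
apply: (@le_trans _ _ (Num.sqrt C1 * expR (- m%:R))).
  rewrite -e2m -sqrtrM// ler_sqrt; first by apply: le_trans rK _; rewrite /C1 /Kc !mulrA.
  by rewrite mulr_ge0// exprn_ge0// expR_ge0.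
apply: (@le_trans _ _ (Num.sqrt C1 * expR 2 * expR (- (2 * C3%:R)^-1 * N%:R `^ (d%:R^-1)))).
  rewrite -mulrA -expRD; apply: ler_wpM2l; first exact: sqrtr_ge0.
  rewrite ler_expR mulNr [_^-1 * _]mulrC; lra.
by rewrite ler_wpM2r ?expR_ge0// lerDl.
Qed.
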